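(* Let $\rho>-1/2$, let $b:(0,\infty)\to\mathbb R$ and $w:(0,\infty)\to\mathbb C$, and consider on $L^2(\mathbb R_+)$ the integral operator $$(Hf)(x)=\int_0^\infty w(x)b(x+y)\overline{w(y)}f(y)\,dy.$$ Define $a(t)=t^{1+2\rho}b(t)$ and $\omega(t)=t^{-\rho}w(t)$ for $t>0$. Assume that $a,\omega\in C^2(0,\infty)$, and that there are $a_0,a_\infty\in\mathbb R$ and $\omega_0,\omega_\infty\in\mathbb C$ such that $$a(t)\to a_0,\quad \omega(t)\to\omega_0\quad(t\to0),\qquad a(t)\to a_\infty,\quad\omega(t)\to\omega_\infty\quad(t\to\infty).$$ Assume in addition that there is a constant $C$ such that, for $f=a$ and $f=\omega$, $$|(D^2f)(t)|\le C\langle\log t\rangle^{-2},\qquad t>0,$$ where $D=t\,\frac{d}{dt}$ and $\langle s\rangle=1+|s|$. Set $$q_0=a_0|\omega_0|^2,\qquad q_\infty=a_\infty|\omega_\infty|^2,\qquad \pi_\rho=\frac{\Gamma(\rho+1/2)^2}{\Gamma(1+2\rho)}.$$ Then $H$ extends to a bounded self-adjoint operator and $$\sigma_{\mathrm{ess}}(H)=q_0[0,\pi_\rho]\cup q_\infty[0,\pi_\rho],$$ where $q[0,\pi_\rho]$ means $[q\pi_\rho,0]$ if $q<0$. Moreover, $\sigma_{\mathrm{sc}}(H)=\varnothing$. More precisely, define $q(0,\pi_\rho)$ to be $(0,q\pi_\rho)$ if $q>0$, $(q\pi_\rho,0)$ if $q<0$, and $\varnothing$ if $q=0$. If $\Delta$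 is a non-empty bounded open interval such that $$\overline\Delta\subset\bigl(q_0(0,\pi_\rho)\cup q_\infty(0,\pi_\rho)\bigr)\setminus\{q_0\pi_\rho,q_\infty\pi_\rho\},$$ then $H$ has no singular continuous spectrum in $\Delta$, and there are only finitely many eigenvalues of $H$ in $\Delta$, each of finite multiplicity.
   Context: $\mathbb R_+=(0,\infty)$. $\sigma_{\mathrm{ess}}$ and $\sigma_{\mathrm{sc}}$ denote the essential and singular continuous spectra of a bounded self-adjoint operator. *)

(* Defs.v *)
From HB Require Import structures.
From mathcomp Require Import all_boot all_order all_algebra.
From mathcomp Require Import generic_quotient ring_quotient sesquilinear complex.
From mathcomp Require Import all_classical all_reals all_analysis.
From mathcomp Require Import ring.

Set Implicit Arguments.
Unset Strict Implicit.
Unset Printing Implicit Defensive.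
Import Order.TTheory GRing.Theory Num.Theory.
Import numFieldNormedType.Exports.
Local Open Scope classical_set_scope.
Local Open Scope ring_scope.
Local Open Scope complex_scope.
Local Open Scope quotient_scope.

(* The real-valued projections of R[i], not the R[i]-valued ones of ssrnum. *)
Notation Re := (@complex.Re _).
Notation Im := (@complex.Im _).
Notation normc := ComplexField.Normc.normc.

Section ComplexFacts.
Variable R : realType.
Implicit Types a z w : R[i].

Lemma ReZD a z w : Re (a * z + w) = Re a * Re z - Im a * Im z + Re w.
Proof. by case: a z w => [? ?] [? ?] [? ?]. Qed.

Lemma ImZD a z w : Im (a * z + w) = Re a * Im z + Im a * Re z + Im w.
Proof. by case: a z w => [? ?] [? ?] [? ?]. Qed.

End ComplexFacts.

Section ComplexL2.
Context d (T : measurableType d) (R : realType).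
Variable mu : {measure set T -> \bar R}.
Local Notation C := R[i].

Definition cintegral (D : set T) (f : T -> C) : C :=
  (\int[mu]_(x in D) Re (f x)) +i* (\int[mu]_(x in D) Im (f x)).

(* For p < oo, membership in Lfun means measurable with finite p-norm, so f is
   complex square-integrable iff both its components are in Lfun mu 2. *)
Definition csqint : {pred T -> C} :=
  [pred f : T -> C | ((fun x => Re (f x)) \in Lfun mu 2%:E)
                  && ((fun x => Im (f x)) \in Lfun mu 2%:E)].

Let csqintP (f : T -> C) : reflect
  ((fun x => Re (f x)) \in Lfun mu 2%:E /\ (fun x => Im (f x)) \in Lfun mu 2%:E)
  (f \in csqint).
Proof. by rewrite inE; exact: andP. Qed.

Let LfunP2 (f g : T -> R) (a b : R) : f \in Lfun mu 2%:E -> g \in Lfun mu 2%:E ->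
  (fun x => a * f x + b * g x) \in Lfun mu 2%:E.
Proof.
move=> Lf Lg.
have [L0 ZD] := Lfun_submod_closed mu (lee1n 2 : (1 <= 2%:E :> \bar R)%E).
have Lbg : b \*: g \in Lfun mu 2%:E by have := ZD b _ _ Lg L0; rewrite addr0.
exact: ZD a _ _ Lf Lbg.
Qed.

Fact csqint_submod_closed : submod_closed csqint.
Proof.
split.
  have [L0 _] := Lfun_submod_closed mu (lee1n 2 : (1 <= 2%:E :> \bar R)%E).
  by rewrite inE /=; apply/andP; split; exact: L0.
move=> a f g /csqintP[fR fI] /csqintP[gR gI]; apply/csqintP; split.
- rewrite (_ : (fun x => Re _) = (fun x : T => 1 * (Re a * Re (f x) +
    (- Im a) * Im (f x)) + 1 * Re (g x))); first exact/LfunP2/gR/LfunP2.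
  by apply/funext => x; rewrite !mul1r mulNr ReZD.
- rewrite (_ : (fun x => Im _) = (fun x : T => 1 * (Re a * Im (f x) +
    Im a * Re (f x)) + 1 * Im (g x))); first exact/LfunP2/gI/LfunP2.
  by apply/funext => x; rewrite !mul1r ImZD.
Qed.

HB.instance Definition _ :=
  GRing.isSubmodClosed.Build _ _ csqint csqint_submod_closed.

Record cLfun := CLfun { cLfun_val :> T -> C; cLfun_valP : cLfun_val \in csqint }.

HB.instance Definition _ := [isSub for cLfun_val].
HB.instance Definition _ := [Choice of cLfun by <:].
HB.instance Definition _ := [SubChoice_isSubLmodule of cLfun by <:].

Definition aezero : {pred cLfun} :=
  [pred f : cLfun | `[< \forall x \ae mu, f x = 0 >]].

Fact aezero_zmod_closed : zmod_closed aezero.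
Proof.
split; first by apply/asboolP; apply: aeW.
move=> f g /asboolP f0 /asboolP g0; apply/asboolP.
by apply: filterS2 f0 g0 => x fx gx; rewrite -[LHS]/(f x - g x) fx gx subr0.
Qed.

HB.instance Definition _ := GRing.isZmodClosed.Build _ aezero aezero_zmod_closed.

(* L^2(T, mu; C): square-integrable functions modulo equality mu-a.e. *)
Definition cL2 := Quotient.quot aezero.
HB.instance Definition _ := GRing.Zmodule.on cL2.

HB.instance Definition _ := EqQuotient.on cL2.

Definition cL2_class (f : cLfun) : cL2 := \pi_cL2 f.

Lemma cL2_classP (f g : cLfun) :
  cL2_class f = cL2_class g <-> \forall x \ae mu, f x = g x.
Proof.
split.
  move=> /eqP; rewrite /cL2_class -Quotient.idealrBE => /asboolP.
  apply: filterS => x; rewrite -[LHS]/(f x - g x).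
  by move=> /eqP; rewrite subr_eq0 => /eqP.
move=> fg; apply/eqP; rewrite /cL2_class -Quotient.idealrBE; apply/asboolP.
by apply: filterS fg => x fgx; rewrite -[LHS]/(f x - g x) fgx subrr.
Qed.

Lemma cL2_repr (f : cLfun) : \forall x \ae mu, repr (cL2_class f) x = f x.
Proof. by apply/cL2_classP; exact: reprK. Qed.

Lemma cL2_classB (f g : cLfun) :
  cL2_class (f - g) = cL2_class f - cL2_class g.
Proof. by rewrite /cL2_class !piE. Qed.

Lemma cL2_classD (f g : cLfun) :
  cL2_class (f + g) = cL2_class f + cL2_class g.
Proof. by rewrite /cL2_class !piE. Qed.

Definition cL2_scale (a : C) (u : cL2) : cL2 := cL2_class (a *: repr u).

Let cL2_class_scale (a : C) (f : cLfun) :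
  cL2_class (a *: f) = cL2_scale a (cL2_class f).
Proof.
apply/cL2_classP; apply: filterS (cL2_repr f) => x fx.
by rewrite -[RHS]/(a * repr (cL2_class f) x) fx.
Qed.

Let cL2_scaleA a b u : cL2_scale a (cL2_scale b u) = cL2_scale (a * b) u.
Proof. by rewrite -cL2_class_scale scalerA. Qed.

Let cL2_scale1 : left_id 1 cL2_scale.
Proof. by move=> u; rewrite /cL2_scale scale1r; exact: reprK. Qed.

Let cL2_scaleDr : right_distributive cL2_scale +%R.
Proof.
move=> a u v; rewrite -[u]reprK -[v]reprK -!/(cL2_class _).
by rewrite -cL2_classD -!cL2_class_scale -cL2_classD scalerDr.
Qed.

Let cL2_scaleDl u : {morph cL2_scale^~ u : a b / a + b}.
Proof. by move=> a b; rewrite -cL2_classD -scalerDl. Qed.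

HB.instance Definition _ := GRing.Zmodule_isLmodule.Build C cL2
  cL2_scaleA cL2_scale1 cL2_scaleDr cL2_scaleDl.

Lemma cL2_classZ (a : C) (f : cLfun) : cL2_class (a *: f) = a *: cL2_class f.
Proof. exact: cL2_class_scale. Qed.

Let cdot (f g : cLfun) : C := cintegral setT (fun x => f x * (g x)^*).

Let prod_integrable (f g : T -> R) :
  f \in Lfun mu 2%:E -> g \in Lfun mu 2%:E ->
  mu.-integrable setT (EFin \o (fun x => f x * g x)).
Proof. by move=> Lf Lg; apply/Lfun1_integrable; exact: Lfun2_mul_Lfun1. Qed.

Let cdot_integrable (f g : cLfun) :
  mu.-integrable setT (EFin \o (fun x => Re (f x * (g x)^*))) /\
  mu.-integrable setT (EFin \o (fun x => Im (f x * (g x)^*))).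
Proof.
have /csqintP[fR fI] := cLfun_valP f; have /csqintP[gR gI] := cLfun_valP g.
split.
  rewrite (_ : EFin \o _ = (EFin \o (fun x => (Re (f x) * Re (g x))%R))
      \+ (EFin \o (fun x => (Im (f x) * Im (g x))%R)))%E.
    by apply: integrableD => //; exact: prod_integrable.
  apply/funext => x /=; rewrite -EFinD; congr EFin.
  by case: (f x) (g x) => [? ?] [? ?] /=; rewrite mulrN opprK.
rewrite (_ : EFin \o _ = (EFin \o (fun x => (Im (f x) * Re (g x))%R))
    \- (EFin \o (fun x => (Re (f x) * Im (g x))%R)))%E.
  by apply: integrableB => //; exact: prod_integrable.
apply/funext => x /=; rewrite -EFinB; congr EFin.
by case: (f x) (g x) => [? ?] [? ?] /=; rewrite mulrN addrC.
Qed.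

Let cdot_ae (f g h : cLfun) : (\forall x \ae mu, f x = g x) ->
  cdot f h = cdot g h.
Proof.
move=> fg; have [fR fI] := cdot_integrable f h.
have [gR gI] := cdot_integrable g h.
rewrite /cdot /cintegral /Rintegral; congr (fine _ +i* fine _).
- apply: ae_eq_integral => //; [exact: measurable_int fR|
    exact: measurable_int gR|by apply: filterS fg => x /= -> _].
- apply: ae_eq_integral => //; [exact: measurable_int fI|
    exact: measurable_int gI|by apply: filterS fg => x /= -> _].
Qed.

Let cdotC (f g : cLfun) : cdot f g = (cdot g f)^*.
Proof.
have [_ gfI] := cdot_integrable g f.
rewrite /cdot /cintegral /=; congr (_ +i* _).
  by apply: eq_Rintegral => x _; case: (f x) (g x) => [? ?] [? ?] /=; ring.
rewrite -mulN1r -RintegralZl//; apply: eq_Rintegral => x _.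
by case: (f x) (g x) => [? ?] [? ?] /=; ring.
Qed.

Let cdotDl a (f g h : cLfun) : cdot (a *: f + g) h = a * cdot f h + cdot g h.
Proof.
have [fR fI] := cdot_integrable f h.
have [gR gI] := cdot_integrable g h.
have iZ (c : R) F : mu.-integrable setT (EFin \o F) ->
    mu.-integrable setT (EFin \o (fun x => c * F x)).
  by move=> /(@integrableZl _ _ _ mu _ measurableT c).
rewrite [LHS]/cdot /cintegral [in RHS](_ : a * _ + _ =
  (Re a * Re (cdot f h) - Im a * Im (cdot f h) + Re (cdot g h)) +i*
  (Re a * Im (cdot f h) + Im a * Re (cdot f h) + Im (cdot g h))); last first.
  by rewrite -ReZD -ImZD; case: (_ + _).
rewrite /cdot /cintegral /=; congr (_ +i* _).
- rewrite -!RintegralZl// -RintegralB//; [|exact: iZ..].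
  rewrite -RintegralD//; last first.
    by have := integrableB measurableT (iZ (Re a) _ fR) (iZ (Im a) _ fI).
  apply: eq_Rintegral => x _.
  by rewrite -ReZD mulrA -mulrDl.
- rewrite -!RintegralZl// -RintegralD//; [|exact: iZ..].
  rewrite -RintegralD//; last first.
    by have := integrableD measurableT (iZ (Re a) _ fI) (iZ (Im a) _ fR).
  apply: eq_Rintegral => x _.
  by rewrite -ImZD mulrA -mulrDl.
Qed.

Let cdot_gt0 (f : cLfun) : ~ (\forall x \ae mu, f x = 0) -> 0 < cdot f f.
Proof.
move=> f0; have [fR fI] := cdot_integrable f f.
have I0 x : Im (f x * (f x)^*) = 0 by case: (f x) => ? ? /=; ring.
have R0 x : 0 <= Re (f x * (f x)^*).
  by case: (f x) => ? ? /=; rewrite mulrN opprK -!expr2 addr_ge0 ?sqr_ge0.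
rewrite ltcE /cdot /cintegral /=; apply/andP; split.
  by rewrite (@eq_Rintegral _ _ _ mu setT (cst 0)) ?Rintegral_cst ?mul0r// => x _.
rewrite lt_neqAle Rintegral_ge0 ?andbT//; apply/eqP => /esym i0; apply: f0.
have /(ae_eq_integral_abs mu measurableT (measurable_int mu fR)) :
    (\int[mu]_x `|(EFin \o (fun x => Re (f x * (f x)^*)%R)) x| = 0)%E.
  under eq_integral do rewrite gee0_abs ?lee_fin//.
  by rewrite -[LHS]fineK ?[fine _]i0// integrable_fin_num.
apply: filterS => x /(_ I) [] /eqP.
case: (f x) => u v /=; rewrite mulrN opprK -!expr2 paddr_eq0 ?sqr_ge0//.
by rewrite !sqrf_eq0 => /andP[/eqP -> /eqP ->].
Qed.

Definition cL2_dot (u v : cL2) : C :=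
  cintegral setT (fun x => repr u x * (repr v x)^*).

Lemma cL2_dotE (f g : cLfun) :
  cL2_dot (cL2_class f) (cL2_class g) = cintegral setT (fun x => f x * (g x)^*).
Proof.
rewrite -[RHS]/(cdot f g) -[LHS]/(cdot _ _) (cdot_ae _ (cL2_repr f)).
by rewrite cdotC (cdot_ae _ (cL2_repr g)) -cdotC.
Qed.

Let cL2_dotC u v : cL2_dot u v = (-1) ^+ false * Num.conj (cL2_dot v u).
Proof. by rewrite expr0 mul1r; exact: cdotC. Qed.

Let cL2_dot_linl v : GRing.linear_for *%R (cL2_dot^~ v).
Proof.
move=> a u w; rewrite -[u]reprK -[v]reprK -[w]reprK -!/(cL2_class _).
by rewrite -cL2_classZ -cL2_classD !cL2_dotE; exact: cdotDl.
Qed.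

Let cL2_dot_linr u : GRing.linear_for (@Num.conj C \; *%R) (cL2_dot u).
Proof.
move=> a v w; rewrite cL2_dotC cL2_dot_linl (cL2_dotC u v) (cL2_dotC u w).
by rewrite !expr0 !mul1r rmorphD rmorphM.
Qed.

HB.instance Definition _ := bilinear_isBilinear.Build C cL2 cL2 C
  *%R (@Num.conj C \; *%R) cL2_dot (cL2_dot_linl, cL2_dot_linr).
HB.instance Definition _ :=
  isHermitianSesquilinear.Build C cL2 false (@Num.conj C) cL2_dot cL2_dotC.

Let cL2_dot_gt0 u : u != 0 -> 0 < cL2_dot u u.
Proof.
move=> u0; apply: cdot_gt0 => ru0; move/eqP: u0; apply.
rewrite -[u]reprK -/(cL2_class _) -(subrr (cL2_class 0)) -cL2_classB subrr.
exact/cL2_classP.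
Qed.

HB.instance Definition _ := isDotProduct.Build C cL2 cL2_dot cL2_dot_gt0.

End ComplexL2.

Section SpectralTheory.
Variables (R : realType) (V : lmodType R[i]) (dot : {dot V for @Num.conj R[i]}).
Implicit Types (T : V -> V) (l : R) (u v : V).

Definition hnorm u : R := Num.sqrt (Re (dot u u)).

Definition bounded_operator T :=
  exists K : R, forall u, hnorm (T u) <= K * hnorm u.

Definition selfadjoint T := forall u v, dot (T u) v = dot u (T v).

(* Spectrum of the restriction of T to an invariant closed subspace M.  Only
   real points are recorded: T is meant to be bounded and self-adjoint. *)
Definition spectrum_on (M : set V) T : set R :=
  [set l | ~ exists S : V -> V,
    [/\ forall u, M u -> M (S u),
        exists K : R, forall u, M u -> hnorm (S u) <= K * hnorm u,
        forall u, M u -> S (T u - l%:C *: u) = u &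
        forall u, M u -> T (S u) - l%:C *: S u = u]].

Definition spectrum T : set R := spectrum_on setT T.

Definition is_eigenvalue T l := exists u, u != 0 /\ T u = l%:C *: u.

Definition finite_multiplicity T l :=
  exists (n : nat) (e : 'I_n -> V), forall u, T u = l%:C *: u ->
    exists c : 'I_n -> R[i], u = \sum_(i < n) c i *: e i.

Definition discrete_spectrum T : set R :=
  [set l | [/\ spectrum T l,
    exists2 r : R, 0 < r & forall m, spectrum T m -> `|m - l| < r -> m = l,
    is_eigenvalue T l & finite_multiplicity T l]].

Definition essential_spectrum T : set R := spectrum T `\` discrete_spectrum T.

Definition orthogonal_projection (P : V -> V) :=
  [/\ linear P, forall u, P (P u) = P u & selfadjoint P].

(* E is a projection-valued Borel measure on the line with T equal to the
   integral of x dE(x): for every u, A |-> <E(A) u, u> is a measure nu, and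
   <T u, u> is the integral of x dnu(x). *)
Definition is_spectral_measure T (E : set (measurableTypeR R) -> V -> V) :=
  [/\ forall A, measurable A -> orthogonal_projection (E A),
      forall u, E setT u = u &
      forall u, exists nu : {measure set (measurableTypeR R) -> \bar R},
        [/\ forall A, measurable A -> nu A = (Re (dot (E A u) u))%:E,
            nu.-integrable setT (fun x => x%:E) &
            dot (T u) u = (\int[nu]_x x)%:C]].

(* By the spectral theorem a bounded self-adjoint operator on a Hilbert space
   has a spectral measure, unique on Borel sets (the only ones used below); the
   zero map is a dummy default value. *)
Definition spectral_measure T : set (measurableTypeR R) -> V -> V :=
  xget (fun _ _ => 0) [set E | is_spectral_measure T E].

(* The vectors u whose measure A |-> <E(A) u, u> has no atom and is carried by
   a Lebesgue-null set. *)
Definition singular_continuous_subspace T : set V :=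
  [set u | (forall x : R, spectral_measure T [set x] u = 0) /\
    exists N : set (measurableTypeR R), [/\ measurable N,
      lebesgue_measure N = 0%E & spectral_measure T (~` N) u = 0]].

Definition singular_continuous_spectrum T : set R :=
  spectrum_on (singular_continuous_subspace T) T.

End SpectralTheory.

Section WeightedHankel.
Variable R : realType.
Implicit Types (f : R -> R) (g : R -> R[i]) (q p : R).

Definition lebesgue_halfline : {measure set (measurableTypeR R) -> \bar R} :=
  mrestr (@lebesgue_measure R) (measurable_itv `]0%R, +oo[).

Definition L2_halfline := cL2 lebesgue_halfline.

Definition L2_halfline_dot : {dot L2_halfline for @Num.conj R[i]} :=
  @cL2_dot _ _ _ lebesgue_halfline.

Definition weighted_hankel (w : R -> R[i]) (b : R -> R) g (x : R) : R[i] :=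
  cintegral (@lebesgue_measure R) `]0, +oo[
    (fun y => w x * (b (x + y))%:C * (w y)^* * g y).

(* H is initially defined on the dense set of square-integrable functions with
   compact support in (0, oo). *)
Definition extends_weighted_hankel (w : R -> R[i]) (b : R -> R)
    (T : L2_halfline -> L2_halfline) :=
  forall f : cLfun lebesgue_halfline,
    (exists r s : R, 0 < r /\ forall x, x \notin `[r, s] -> f x = 0) ->
    \forall x \ae lebesgue_halfline,
      repr (T (cL2_class f)) x = weighted_hankel w b f x.

Definition C2_halfline f := forall t, 0 < t ->
  [/\ derivable f t 1, derivable (derive1 f) t 1 &
      {for t, continuous (derive1 (derive1 f))}].

Definition cC2_halfline g :=
  C2_halfline (fun t => Re (g t)) /\ C2_halfline (fun t => Im (g t)).

(* The operator t d/dt. *)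
Definition eulerD f : R -> R := fun t => t * derive1 f t.

Definition ceulerD g : R -> R[i] := fun t =>
  eulerD (fun s => Re (g s)) t +i* eulerD (fun s => Im (g s)) t.

Definition bracket (s : R) : R := 1 + `|s|.

Definition Gamma (s : R) : R :=
  \int[@lebesgue_measure R]_(t in `]0, +oo[) (t `^ (s - 1) * expR (- t)).

Definition scaled_closed q p : set R :=
  if 0 <= q then `[0, q * p]%classic else `[q * p, 0]%classic.

Definition scaled_open q p : set R :=
  if 0 < q then `]0, q * p[%classic
  else if q < 0 then `]q * p, 0[%classic else set0.

End WeightedHankel.

(* Main.v *)
(* In the variable s = log x, H becomes the integral operator on L^2(R) with kernel
   om(s) a(e^s + e^s') k(s - s') conj(om(s')), where k(r) = (2 cosh (r/2))^(-1-2 rho). The symbol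
   phi of the convolution K by k is even and decreases from phi(0) = pi_rho to 0. Modulo compact
   operators H is q_0 K on s < 0 plus q_oo K on s > 0, and modulated tents pushed to infinity are
   Weyl sequences. The dilations in s serve as conjugate family: the bounds on D^2 a and D^2 omega
   make the dilated kernel twice differentiable, and the commutator of q K has the symbol
   - q xi phi'(xi), which gives a Mourre estimate with compact remainder away from 0, q_0 pi_rho and
   q_oo pi_rho. The virial identity then bounds the number of eigenvalues, and a differential
   inequality for the regularized resolvent, integrated by Gronwall's lemma, bounds <E(I) f, f>
   by C |I| for f in a dense set. *)

(* Three obstacles shape the proof. The generator of dilations is unbounded, so it is never formed:
   only the unitaries [U t] with [|t| <= 1/2] occur, and the commutator is the first Taylor
   coefficient [B] of [t |-> U t H U t^-1], with a quadratic remainder in norm. Compactness is used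
   only through inequalities: an operator is compact when its squared norm is at most [e |u|^2] plus
   finitely many squared inner products, and exactly such a sum is the remainder of the Mourre
   estimate, where a multiple of [|(H - l) u|^2] replaces the spectral cut-off. Finally, kernels and
   functions are real and are lifted to complex classes afterwards: the Hartley transform with a
   regularized Parseval identity does the work of the Fourier transform. The symbol [phi] is
   [|Gamma (b + i xi)|^2 / Gamma (2 b)] with [b = rho + 1/2]; its positivity and monotonicity come
   from its recurrence in [b], iterated until the kernel concentrates at the origin. The sign of the
   conjugate family follows the spectral interval: [B] serves above 0 and [- B] below. *)
Require Import Defs.
From HB Require Import structures.
From mathcomp Require Import all_boot all_order all_algebra.
From mathcomp Require Import generic_quotient ring_quotient sesquilinear complex.
From mathcomp Require Import all_classical all_reals all_analysis.
From mathcomp Require Import measurable_realfun.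
From mathcomp Require Import ring lra.
Import Order.TTheory GRing.Theory Num.Theory.
Import numFieldNormedType.Exports.
Local Open Scope classical_set_scope.
Local Open Scope ring_scope.
Local Open Scope complex_scope.
Set Implicit Arguments.
Unset Strict Implicit.
Unset Printing Implicit Defensive.
Local Notation Re := (@complex.Re _).
Local Notation Im := (@complex.Im _).
Local Notation measT := (measurable_fun setT).
Local Notation mset R := (set (measurableTypeR R)).

(* Nonnegativity and positivity goals are left to [done], by recursion on the shape of the expression. *)
Ltac sign_leaf := fail.
Ltac sign_auto := match goal with
  | |- is_true (0 <= ?x) => first [assumption | match x with
      | _ ^+ 2 => exact: sqr_ge0
      | `|_| => exact: normr_ge0
      | expR _ => exact: expR_ge0
      | Num.sqrt _ => exact: sqrtr_ge0
      | _%:R => exact: ler0n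
      | 1 => exact: ler01
      | _ * _ => apply: mulr_ge0; sign_auto
      | _ - _ => rewrite subr_ge0; assumption
      | _ + _ => apply: addr_ge0; sign_auto
      | _ ^-1 => rewrite invr_ge0; sign_auto
      | _ ^+ _ => apply: exprn_ge0; sign_auto
      end | sign_leaf | apply: ltW; assumption]
  | |- is_true (0 < ?x) => first [assumption | match x with
      | expR _ => exact: expR_gt0
      | _%:R => exact: ltr0Sn
      | 1 => exact: ltr01
      | _ * _ => apply: mulr_gt0; sign_auto
      | _ + _ => apply: addr_gt0; sign_auto
      | _ + _ => apply: ltr_wpDl; sign_auto
      | _ + _ => apply: ltr_pwDl; sign_auto
      | _ ^-1 => rewrite invr_gt0; sign_auto
      | _ ^+ _ => apply: exprn_gt0; sign_auto
      end | sign_leaf]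
  | |- is_true (?x != 0) => first [assumption | apply: lt0r_neq0; sign_auto]
  end.
#[global] Hint Extern 0 (is_true (0 <= _)) => sign_auto : core.
#[global] Hint Extern 0 (is_true (0 < _)) => sign_auto : core.
#[global] Hint Extern 0 (is_true (_ != 0)) => sign_auto : core.

Section ComplexParts.
Variable R : realType.
Implicit Types z w : R[i].
Lemma ReD z w : Re (z + w) = Re z + Re w.
Proof. by lra. Qed.
Lemma ImD z w : Im (z + w) = Im z + Im w.
Proof. by lra. Qed.
Lemma ReN z : Re (- z) = - Re z.
Proof. by lra. Qed.
Lemma ImN z : Im (- z) = - Im z.
Proof. by lra. Qed.
Lemma ReM z w : Re (z * w) = Re z * Re w - Im z * Im w.
Proof. by case: z w => [? ?] [? ?]. Qed.
Lemma ImM z w : Im (z * w) = Re z * Im w + Im z * Re w.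
Proof. by case: z w => [? ?] [? ?]. Qed.
Lemma Re_conj z : Re (z^*) = Re z.
Proof. by case: z. Qed.
Lemma Im_conj z : Im (z^*) = - Im z.
Proof. by case: z. Qed.
Lemma complex_eq z w : Re z = Re w -> Im z = Im w -> z = w.
Proof. by case: z w => [? ?] [? ?] /= -> ->. Qed.
Definition cpartsE := (ReD, ImD, ReN, ImN, ReM, ImM, Re_conj, Im_conj).
End ComplexParts.

(** * Hilbert space geometry: projections, inverses, monotone limits *)

Section Hilbert.
Variables (R : realType) (V : lmodType R[i]) (dot : {dot V for @Num.conj R[i]}).
Implicit Types (u v w : V) (T S P Q : V -> V) (M : set V).
Local Notation N := (hnorm dot).

(** The underlying real inner product. Since [Im (dot u v)] is [reform u (i v)], it determines the
    Hermitian form ([dotE]), so estimates can be made over the ordered reals, with multiplication by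
    [i] as an isometry. *)
Definition reform u v : R := Re (dot u v).
Local Notation rdot := reform.

Lemma rdotDl u v w : rdot (u + v) w = rdot u w + rdot v w.
Proof. by rewrite /reform linearDl ReD. Qed.
Lemma rdotNl u w : rdot (- u) w = - rdot u w.
Proof. by rewrite /reform linearNl ReN. Qed.
Lemma rdotBl u v w : rdot (u - v) w = rdot u w - rdot v w.
Proof. by rewrite rdotDl rdotNl. Qed.
Lemma dot_conj u v : dot u v = (dot v u)^*.
Proof. by rewrite (hermC dot u v) mul1r. Qed.
Lemma rdotC u v : rdot u v = rdot v u.
Proof. by rewrite /reform dot_conj Re_conj. Qed.
Lemma rdotDr u v w : rdot w (u + v) = rdot w u + rdot w v.
Proof. by lra. Qed.
Lemma rdotNr u w : rdot w (- u) = - rdot w u.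
Proof. by lra. Qed.
Lemma rdotBr u v w : rdot w (u - v) = rdot w u - rdot w v.
Proof. by lra. Qed.
Lemma dotZl (a : R[i]) u v : dot (a *: u) v = a * dot u v.
Proof. by rewrite linearZl_LR. Qed.
Lemma dotZr (a : R[i]) u v : dot v (a *: u) = a^* * dot v u.
Proof. by rewrite linearZr_LR. Qed.
Lemma rdotZl (a : R) u v : rdot (a%:C *: u) v = a * rdot u v.
Proof. by rewrite /reform dotZl ReM mul0r subr0. Qed.
Lemma rdotZr (a : R) u v : rdot v (a%:C *: u) = a * rdot v u.
Proof. by rewrite rdotC rdotZl rdotC. Qed.
Lemma rdot0l u : rdot 0 u = 0.
Proof. by rewrite -(subrr u) rdotBl subrr. Qed.
Lemma rdot0r u : rdot u 0 = 0.
Proof. by lra. Qed.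
Lemma rdot_suml I (r : seq I) (P : pred I) (F : I -> V) v :
  rdot (\sum_(i <- r | P i) F i) v = \sum_(i <- r | P i) rdot (F i) v.
Proof. by apply: (big_morph (rdot^~ v)) => [x y|]; rewrite ?rdotDl ?rdot0l. Qed.
Lemma Im_dotE u v : Im (dot u v) = rdot u ('i%C *: v).
Proof. by rewrite /reform dotZr; rewrite ReM /=; ring. Qed.
Lemma rdotIr u v : rdot ('i%C *: u) v = - rdot u ('i%C *: v).
Proof. by rewrite /reform dotZl dotZr !ReM /=; ring. Qed.
Lemma rdotII u v : rdot ('i%C *: u) ('i%C *: v) = rdot u v.
Proof. by rewrite /reform dotZl dotZr !cpartsE /=; ring. Qed.
Lemma dotE u v : dot u v = rdot u v +i* rdot u ('i%C *: v).
Proof. by apply: complex_eq; rewrite //= Im_dotE. Qed.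
Lemma rdot_ge0 u : 0 <= rdot u u.
Proof.
have [->|u0] := eqVneq u 0; first by lra.
have : 0 < dot u u by rewrite (@dnorm_gt0 _ _ dot).
by rewrite ltcE => /andP[_ /ltW].
Qed.
Lemma rdot_eq0 u : rdot u u = 0 -> u = 0.
Proof.
move=> u0; apply/eqP; apply: contraT => un0.
have : 0 < dot u u by rewrite (@dnorm_gt0 _ _ dot).
by rewrite ltcE -/(rdot u u) u0 ltxx andbF.
Qed.

Lemma hnorm_ge0 u : 0 <= N u.
Proof. exact: sqrtr_ge0. Qed.
Lemma hnorm_sqr u : N u ^+ 2 = rdot u u.
Proof. by rewrite sqr_sqrtr//; exact: rdot_ge0. Qed.
Lemma hnorm0 : N 0 = 0.
Proof. by rewrite /hnorm -/(rdot 0 0) rdot0l sqrtr0. Qed.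
Lemma hnorm_eq0 u : N u = 0 -> u = 0.
Proof. by move=> u0; apply: rdot_eq0; rewrite -hnorm_sqr u0 expr0n. Qed.
Lemma hnorm_sqr_le0 u : N u ^+ 2 <= 0 -> u = 0.
Proof. by move=> h; apply/hnorm_eq0/eqP; rewrite -sqrf_eq0 eq_le h sqr_ge0. Qed.
Lemma hnorm_le0 u : N u <= 0 -> u = 0.
Proof. by move=> h; apply/hnorm_eq0/le_anti; rewrite h sqrtr_ge0. Qed.
Lemma hnormNE u : N (- u) = N u.
Proof. by rewrite /hnorm -!/(rdot _ _) rdotNl rdotNr opprK. Qed.
Lemma hnorm_distC u v : N (u - v) = N (v - u).
Proof. by rewrite -opprB hnormNE. Qed.
Lemma hnorm_sqrD u v : N (u + v) ^+ 2 = N u ^+ 2 + 2 * rdot u v + N v ^+ 2.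
Proof. by rewrite !hnorm_sqr rdotDl !rdotDr (rdotC v u); ring. Qed.
Lemma hnorm_sqrB u v : N (u - v) ^+ 2 = N u ^+ 2 - 2 * rdot u v + N v ^+ 2.
Proof. by rewrite hnorm_sqrD hnormNE; ring. Qed.
Lemma hnorm_real (a : R) u : N (a%:C *: u) = `|a| * N u.
Proof.
by rewrite /hnorm -!/(rdot _ _) rdotZl rdotZr mulrA -expr2 sqrtrM// sqrtr_sqr.
Qed.
Lemma hnormI u : N ('i%C *: u) = N u.
Proof. by rewrite /hnorm -!/(rdot _ _) rdotII. Qed.

Lemma rdot_CS u v : `|rdot u v| <= N u * N v.
Proof.
have [v0|v0] := eqVneq (N v) 0.
  by rewrite (hnorm_eq0 v0) rdot0r normr0 hnorm0 mulr0.
have vp : 0 < N v by rewrite lt0r v0 hnorm_ge0.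
rewrite -ler_sqr ?nnegrE ?mulr_ge0 ?hnorm_ge0//.
have := sqr_ge0 (N (((N v)^+2)%:C *: u - (rdot u v)%:C *: v)).
rewrite hnorm_sqrB !hnorm_real rdotZl rdotZr !exprMn -!normrX !(ger0_norm (sqr_ge0 _)).
have -> : ((N v ^+ 2) ^+ 2 * N u ^+ 2 - 2 * (N v ^+ 2 * (rdot u v * rdot u v)) + rdot u v ^+ 2 * N v ^+ 2)
  = N v ^+ 2 * ((N u * N v) ^+ 2 - rdot u v ^+ 2) by lra.
by rewrite pmulr_rge0// subr_ge0 exprMn.
Qed.

(** Cauchy-Schwarz followed by division by [N u]. The test vector [w] may differ from [u] because
    the regularized resolvent is coercive only when tested against [i u] or [- i u]. *)
Lemma coercive_le (k : R) u x w : N w = N u -> k * N u ^+ 2 <= `|rdot x w| -> k * N u <= N x.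
Proof.
move=> wu h; have [u0|u0] := eqVneq (N u) 0; first by rewrite u0 mulr0 hnorm_ge0.
have up : 0 < N u by rewrite lt0r u0 hnorm_ge0.
by rewrite -(ler_pM2r up) -mulrA (le_trans h)// -wu rdot_CS.
Qed.

Lemma hnorm_triang u v : N (u + v) <= N u + N v.
Proof.
rewrite -ler_sqr ?nnegrE ?addr_ge0 ?hnorm_ge0// hnorm_sqrD.
have := rdot_CS u v; have := ler_norm (rdot u v).
lra.
Qed.

Lemma hnorm_triangB u v : N (u - v) <= N u + N v.
Proof. by rewrite -(hnormNE v) hnorm_triang. Qed.
Lemma hnorm_dist_triang w u v : N (u - v) <= N (u - w) + N (w - v).
Proof. by rewrite (_ : u - v = (u - w) + (w - v)) ?hnorm_triang// addrA subrK. Qed.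
Lemma hnorm_subrev u v : N u - N v <= N (u - v).
Proof. by rewrite lerBlDr -{1}(subrK v u) hnorm_triang. Qed.

Lemma hnormZ (a : R[i]) u : N (a *: u) = normc a * N u.
Proof.
rewrite /hnorm dotZl dotZr mulrA.
rewrite (_ : a * a^* = (normc a ^+ 2)%:C).
  by rewrite ReM /= mul0r subr0 sqrtrM// sqrtr_sqr ger0_norm//; case: (a) => x y; exact: sqrtr_ge0.
apply: complex_eq; rewrite !cpartsE /=; last by ring.
case: (a) => x y /=.
by rewrite sqr_sqrtr//; ring.
Qed.

Lemma hnorm_sum I (r : seq I) (P : pred I) (F : I -> V) :
  N (\sum_(i <- r | P i) F i) <= \sum_(i <- r | P i) N (F i).
Proof.
elim/big_ind2 : _ => [|x a y b h1 h2|//]; first by rewrite hnorm0.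
by rewrite (le_trans (hnorm_triang _ _))// lerD.
Qed.

Definition islin T := forall (a : R[i]) u v, T (a *: u + v) = a *: T u + T v.
Definition hbounded (K : R) T := forall u, N (T u) <= K * N u.
Definition rsym T := forall u v, rdot (T u) v = rdot u (T v).

Lemma lin0 T : islin T -> T 0 = 0.
Proof. by move=> lT; have := lT (-1) 0 0; rewrite scaleN1r addNr scaleN1r addNr. Qed.
Lemma linZ T : islin T -> forall a u, T (a *: u) = a *: T u.
Proof. by move=> lT a u; have := lT a u 0; rewrite !addr0 lin0// addr0. Qed.
Lemma linD T : islin T -> forall u v, T (u + v) = T u + T v.
Proof. by move=> lT u v; have := lT 1 u v; rewrite !scale1r. Qed.
Lemma linN T : islin T -> forall u, T (- u) = - T u.
Proof. by move=> lT u; rewrite -scaleN1r linZ// scaleN1r. Qed.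
Lemma linB T : islin T -> forall u v, T (u - v) = T u - T v.
Proof. by move=> lT u v; rewrite linD// linN. Qed.

Lemma rsym_selfadjoint T : islin T -> rsym T -> selfadjoint dot T.
Proof.
by move=> lT sT u v; rewrite (dotE (T u)) (dotE u) !sT linZ.
Qed.
Lemma selfadjoint_rsym T : selfadjoint dot T -> rsym T.
Proof. by move=> sT u v; rewrite /reform sT. Qed.

(** Polarization: the forms at [u + v] and [u - v] are subtracted, with [v] parallel to [T u] and as
    long as [u]. The set [M] makes the bound usable on the range of a spectral projection, where the
    form is controlled but not outside. *)
Lemma rsym_numrange (M : set V) T (c : R) : islin T -> rsym T -> 0 <= c ->
  (forall u v, M u -> M v -> M (u + v)) -> (forall (a : R) u, M u -> M (a%:C *: u)) ->
  (forall u, M u -> M (T u)) ->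
  (forall u, M u -> `|rdot (T u) u| <= c * N u ^+ 2) ->
  forall u, M u -> N (T u) <= c * N u.
Proof.
move=> lT sT c0 MD MZ MT qT u Mu.
have [Tu0|Tu0] := eqVneq (N (T u)) 0; first by rewrite Tu0 mulr_ge0 ?hnorm_ge0.
have [u0|u0] := eqVneq (N u) 0.
  by move: Tu0; rewrite (hnorm_eq0 u0) lin0// hnorm0 eqxx.
have up : 0 < N u by rewrite lt0r u0 hnorm_ge0.
have Tup : 0 < N (T u) by rewrite lt0r Tu0 hnorm_ge0.
pose a := N u / N (T u); pose v := a%:C *: T u.
have Mv : M v by apply/MZ/MT.
have Mnv : M (- v) by have := MZ (-1) _ Mv; rewrite rmorphN1 scaleN1r.
have Nv : N v = N u by rewrite hnorm_real ger0_norm ?divr_ge0// divfK.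
have e1 : rdot (T u) v = N u * N (T u).
  by rewrite rdotZr -hnorm_sqr mulrA divfK.
have h1 := ler_norm (rdot (T (u + v)) (u + v)).
have h2 := ler_norm (- rdot (T (u - v)) (u - v)).
have h3 := qT _ (MD _ _ Mu Mv).
have h4 := qT _ (MD _ _ Mu Mnv).
move: h1 h2 h3 h4; rewrite normrN hnorm_sqrD hnorm_sqrB Nv.
rewrite linB// linD// !(rdotDl, rdotDr, rdotNl, rdotNr) (rdotC (T v) u) -sT => h1 h2 h3 h4.
have : N u * N (T u) <= c * N u ^+ 2 by lra.
by rewrite mulrCA ler_pM2l.
Qed.

Ltac sign_leaf ::= exact: hnorm_ge0.

Lemma natinv_le (e : R) : 0 < e -> exists n, forall m, (n <= m)%N -> m.+1%:R^-1 <= e.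
Proof.
move=> e0; have [n _ h] := near_infty_natSinv_lt (PosNum e0).
by exists n => m /h /ltW.
Qed.

Lemma eps_cvg0 (a : nat -> R) : (forall n, 0 <= a n) ->
  (forall e, 0 < e -> exists K, forall n, (K <= n)%N -> a n <= e) ->
  a n @[n --> \oo] --> (0 : R).
Proof.
move=> a0 h; apply/cvgr0Pnorm_le => e e0; have [K hK] := h _ e0.
by exists K => // n  Kn; rewrite ger0_norm// hK.
Qed.

Lemma cvg0_eps (a : nat -> R) : a n @[n --> \oo] --> (0 : R) ->
  forall e, 0 < e -> exists K, forall n, (K <= n)%N -> `|a n| <= e.
Proof. by move/cvgr0Pnorm_le => h e e0; have [K _ hK] := h _ e0; exists K. Qed.

Definition hcvg (x : nat -> V) l := N (x n - l) @[n --> \oo] --> (0 : R).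
Definition hcauchy (x : nat -> V) := forall e : R, 0 < e -> exists K, forall m n,
  (K <= m)%N -> (K <= n)%N -> N (x m - x n) <= e.
Definition hcomplete := forall x, hcauchy x -> exists l, hcvg x l.

Lemma hnorm_dist u v : `|N u - N v| <= N (u - v).
Proof.
rewrite ler_norml; apply/andP; split; last exact: hnorm_subrev.
by rewrite lerNl opprB hnorm_distC hnorm_subrev.
Qed.

Lemma hcvg_rdot x l v : hcvg x l -> rdot (x n) v @[n --> \oo] --> rdot l v.
Proof.
move=> xl; apply/cvgrPdist_le => e e0.
have e0' : 0 < e / (N v + 1) by [].
have [K hK] := cvg0_eps xl e0'; exists K => // n  Kn.
rewrite -rdotBl (le_trans (rdot_CS _ _))// hnorm_distC.
have := hK _ Kn; rewrite ger0_norm// ler_pdivlMr//.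
by apply: le_trans; rewrite ler_wpM2l// lerDl.
Qed.

Lemma hcvg_hnorm x l : hcvg x l -> N (x n) @[n --> \oo] --> N l.
Proof.
move=> xl; apply/cvgrPdist_le => e e0; have [K hK] := cvg0_eps xl e0.
exists K => // n  Kn; apply: le_trans (hK _ Kn).
by rewrite (ger0_norm (hnorm_ge0 _)) hnorm_distC hnorm_dist.
Qed.

Lemma hcvg_unique x l l' : hcvg x l -> hcvg x l' -> l = l'.
Proof.
move=> h h'; apply/subr0_eq/hnorm_eq0.
apply/eqP; rewrite eq_le hnorm_ge0 andbT; apply/ler_addgt0Pl => e e0.
have e2 : 0 < e / 2 by [].
have [K hK] := cvg0_eps h e2; have [K' hK'] := cvg0_eps h' e2.
have := hK (maxn K K') (leq_maxl _ _); have := hK' (maxn K K') (leq_maxr _ _).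
rewrite !ger0_norm// => h1 h2.
by rewrite (le_trans (hnorm_dist_triang (x (maxn K K')) _ _))// (hnorm_distC l); lra.
Qed.

Lemma hcvgD x y l l' : hcvg x l -> hcvg y l' -> hcvg (fun n => x n + y n) (l + l').
Proof.
move=> h h'; apply: eps_cvg0 => [n|e e0]//.
have e2 : 0 < e / 2 by [].
have [K hK] := cvg0_eps h e2; have [K' hK'] := cvg0_eps h' e2.
exists (maxn K K') => n; rewrite geq_max => /andP[/hK h1 /hK' h2].
move: h1 h2; rewrite !ger0_norm// => h1 h2.
by rewrite opprD addrACA (le_trans (hnorm_triang _ _)); lra.
Qed.

Lemma hcvg_bounded T K x l : islin T -> hbounded K T -> hcvg x l ->
  hcvg (fun n => T (x n)) (T l).
Proof.
move=> lT bT h; apply: eps_cvg0 => [n|e e0]//.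
have Kp : 0 < `|K| + 1 by [].
have [K' hK'] := cvg0_eps h (divr_gt0 e0 Kp); exists K' => n /hK'.
rewrite ger0_norm// ler_pdivlMr// => h1.
rewrite -linB// (le_trans (bT _))// (le_trans _ h1)// mulrC ler_wpM2l//.
by rewrite (le_trans (ler_norm _))// lerDl.
Qed.

Lemma islin_scale (a : R[i]) : islin (fun u : V => a *: u).
Proof. by move=> b u v; rewrite scalerDr !scalerA mulrC. Qed.

Lemma hcvgZ (a : R[i]) x l : hcvg x l -> hcvg (fun n => a *: x n) (a *: l).
Proof.
by apply: hcvg_bounded (islin_scale a) _ => u; rewrite hnormZ.
Qed.

Lemma hcvg_cst u : hcvg (fun=> u) u.
Proof. by rewrite /hcvg subrr hnorm0; exact: cvg_cst. Qed.

Lemma hcvgB x y l l' : hcvg x l -> hcvg y l' -> hcvg (fun n => x n - y n) (l - l').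
Proof.
move=> h h'; have := hcvgD h (hcvgZ (-1) h'); rewrite scaleN1r.
by under eq_fun do rewrite scaleN1r.
Qed.

Lemma hcvg_le x l c : (forall n, N (x n) <= c) -> hcvg x l -> N l <= c.
Proof.
move=> h /hcvg_hnorm xl; rewrite -(cvg_lim _ xl)//; apply: limr_le; [by apply/cvg_ex; exists (N l)|exact: nearW].
Qed.

Definition subspace M := M 0 /\ forall (a : R[i]) u v, M u -> M v -> M (a *: u + v).
Definition hclosed M := forall x l, (forall n, M (x n)) -> hcvg x l -> M l.

Lemma subspaceD M u v : subspace M -> M u -> M v -> M (u + v).
Proof. by move=> [_ h] Mu Mv; have := h 1 _ _ Mu Mv; rewrite scale1r. Qed.
Lemma subspaceZ M a u : subspace M -> M u -> M (a *: u).
Proof. by move=> [h0 h] Mu; have := h a _ _ Mu h0; rewrite addr0. Qed.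
Lemma subspaceN M u : subspace M -> M u -> M (- u).
Proof. by rewrite -scaleN1r; apply: subspaceZ. Qed.
Lemma subspaceB M u v : subspace M -> M u -> M v -> M (u - v).
Proof. by move=> sM Mu Mv; apply: subspaceD => //; apply: subspaceN. Qed.

Lemma projection_exists M u : hcomplete -> subspace M -> hclosed M ->
  exists2 p, M p & forall m, M m -> rdot (u - p) m = 0.
Proof.
move=> cV sM clM.
pose D := [set N (u - m) | m in M].
have D0 : D !=set0 by exists (N (u - 0)), 0; case: sM.
have Dlb : has_lbound D by exists 0 => _ [m _ <-].
pose d := inf D.
have dle m : M m -> d <= N (u - m) by move=> Mm; apply: ge_inf => //; exists m.
have d0 : 0 <= d by apply: lb_le_inf => // _ [m _ <-].
have /choice[x hx] : forall n, exists m, M m /\ N (u - m) < d + n.+1%:R^-1.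
  move=> n; have [_ [m Mm <-] hm] := @inf_adherent _ D n.+1%:R^-1
    (ltac:(by rewrite invr_gt0)) (conj D0 Dlb).
  by exists m.
have Mx n : M (x n) := (hx n).1.
have par m n : N (x m - x n) ^+ 2 <=
    2 * N (u - x m) ^+ 2 + 2 * N (u - x n) ^+ 2 - 4 * d ^+ 2.
  have Mh : M ((2^-1)%:C *: (x m + x n)) by apply: subspaceZ => //; exact: subspaceD.
  have := dle _ Mh; rewrite -ler_sqr ?nnegrE//.
  have e1 : u - (2^-1)%:C *: (x m + x n) = (2^-1)%:C *: ((u - x m) + (u - x n)).
    rewrite addrACA -opprD scalerBr -mulr2n -(scaler_nat 2 u) scalerA.
    have -> : (2^-1)%:C * 2%:R = 1 :> R[i] by apply: complex_eq; rewrite /=; lra.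
    by rewrite scale1r.
  have -> : x m - x n = (u - x n) - (u - x m) by rewrite opprB [RHS]addrC addrA subrK.
  rewrite {}e1; move: (u - x m) (u - x n) => y z.
  rewrite hnorm_sqrB hnorm_real exprMn hnorm_sqrD (rdotC z).
  have -> : `|2^-1 : R| ^+ 2 = 4^-1 by rewrite ger0_norm; lra.
  by lra.
have [p xp] : exists l, hcvg x l.
  apply: cV => e e0.
  (* Since [(d + y)^2 <= d^2 + (2 d + 1) y] for [0 <= y <= 1], the parallelogram bound [par] makes
     [N (x m - x n) ^+ 2] at most [4 (2 d + 1) / (K + 1)]. *)
  have [K hK] : exists K : nat, 4 * (2 * d + 1) * K.+1%:R^-1 <= e ^+ 2.
    have c0 : 0 < e ^+ 2 / (4 * (2 * d + 1)) by [].
    have [K hK] := natinv_le c0; exists K; have := hK K (leqnn _).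
    by rewrite ler_pdivlMr mulrC.
  exists K => m n Km Kn.
  have b k : (K <= k)%N -> N (u - x k) ^+ 2 <= d ^+ 2 + (2 * d + 1) * K.+1%:R^-1.
    move=> Kk; have K0 : 0 < K.+1%:R^-1 :> R by [].
    have K1 : K.+1%:R^-1 <= 1 :> R by rewrite invf_le1 ?ler1n.
    have : N (u - x k) <= d + K.+1%:R^-1.
      by rewrite (le_trans (ltW (hx k).2))// lerD2l lef_pV2 ?posrE// ler_nat.
    rewrite -ler_sqr ?nnegrE//.
    move/le_trans; apply; move: (K.+1%:R^-1) K0 K1 => y y0 y1; nra.
  rewrite -ler_sqr ?nnegrE//.
  rewrite (le_trans (par m n))//; have := b _ Km; have := b _ Kn; move: hK.
  by move: (K.+1%:R^-1) => y; lra.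
have Mp : M p by apply: clM xp.
exists p => // m Mm.
have dp : N (u - p) <= d.
  apply/ler_addgt0Pl => e e0; have e2 : 0 < e / 2 by [].
  have [K hK] := cvg0_eps xp e2; have [K' hK'] := natinv_le e2.
  have := hK _ (leq_maxl K K'); have := hK' _ (leq_maxr K K').
  rewrite ger0_norm// => h1 h2.
  have := ltW (hx (maxn K K')).2 => h3.
  have {}h3 : N (u - x (maxn K K')) <= d + e / 2 by rewrite (le_trans h3)// lerD2l.
  by rewrite (le_trans (hnorm_dist_triang (x (maxn K K')) _ _)); lra.
have key t : 2 * t * rdot (u - p) m <= t ^+ 2 * N m ^+ 2.
  have : N (u - p) <= N (u - p - t%:C *: m).
    by rewrite (le_trans dp)// -addrA -opprD dle//; apply: subspaceD => //; exact: subspaceZ.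
  move: (u - p) => y.
  rewrite -ler_sqr ?nnegrE// hnorm_sqrB rdotZr hnorm_real exprMn -normrX.
  by rewrite (ger0_norm (sqr_ge0 t)); lra.
set c := rdot _ _ in key *.
(* With this [t] one has [c = t (|m|^2 + 1)], and [key] forces [t^2 (|m|^2 + 2) <= 0]. The added 1
   avoids a separate case [m = 0]. *)
have := key (c / (N m ^+ 2 + 1)).
set t := c / _; have -> : c = t * (N m ^+ 2 + 1) by rewrite divfK.
move: (N m ^+ 2) (sqr_ge0 (N m)) => y y0 h.
have : t ^+ 2 <= 0 by nra.
by rewrite real_exprn_even_le0 ?num_real// => /eqP ->; rewrite mul0r.
Qed.

Hypothesis cV : hcomplete.

Lemma rdot_adjC (a : R[i]) u v : rdot (a *: u) v = rdot u (a^* *: v).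
Proof. by rewrite /reform dotZl dotZr !cpartsE; ring. Qed.

Lemma rdot_ext u v : (forall w, rdot u w = rdot v w) -> u = v.
Proof.
move=> h; apply/subr0_eq/rdot_eq0.
by rewrite rdotBl h subrr.
Qed.

Definition hproj M u := xget 0 [set p | M p /\ forall m, M m -> rdot (u - p) m = 0].

Lemma hprojP M u : subspace M -> hclosed M ->
  M (hproj M u) /\ forall m, M m -> rdot (u - hproj M u) m = 0.
Proof.
move=> sM clM; apply: (@xgetPex _ 0 [set p | M p /\ _]).
by have [p Mp hp] := projection_exists u cV sM clM; exists p.
Qed.

Lemma hproj_unique M u p : subspace M -> hclosed M ->
  M p -> (forall m, M m -> rdot (u - p) m = 0) -> hproj M u = p.
Proof.
move=> sM clM Mp hp; have [M1 h1] := hprojP u sM clM.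
apply/subr0_eq/rdot_eq0.
have Md : M (hproj M u - p) by exact: subspaceB.
have := hp _ Md; rewrite -{1}(subrK (hproj M u) u) -addrA rdotDl h1// add0r.
by [].
Qed.

Lemma hproj_id M u : subspace M -> hclosed M -> M u -> hproj M u = u.
Proof.
by move=> sM clM Mu; apply: hproj_unique => // m Mm; rewrite subrr rdot0l.
Qed.

Lemma hproj_lin M : subspace M -> hclosed M -> islin (hproj M).
Proof.
move=> sM clM a u v; have [Mu hu] := hprojP u sM clM; have [Mv hv] := hprojP v sM clM.
apply: hproj_unique => //; first exact: sM.2.
move=> m Mm; rewrite opprD addrACA -scalerBr rdotDl hv// addr0 rdot_adjC hu//.
exact: subspaceZ.
Qed.

Lemma hproj_rsym M : subspace M -> hclosed M -> rsym (hproj M).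
Proof.
move=> sM clM u v; have [Mu hu] := hprojP u sM clM; have [Mv hv] := hprojP v sM clM.
have h1 := hu _ Mv; have h2 := hv _ Mu.
move: h1 h2; rewrite !rdotBl => /eqP; rewrite subr_eq0 => /eqP -> /eqP.
by rewrite subr_eq0 (rdotC (hproj M u) v) => /eqP ->; rewrite rdotC.
Qed.

Definition rproj (P : V -> V) := [/\ islin P, forall u, P (P u) = P u & rsym P].

Lemma rproj_orth P : rproj P -> orthogonal_projection dot P.
Proof. by move=> [h1 h2 h3]; split=> //; exact: rsym_selfadjoint. Qed.
Lemma orth_rproj P : orthogonal_projection dot P -> rproj P.
Proof. by move=> [h1 h2 h3]; split=> //; exact: selfadjoint_rsym. Qed.

Lemma hproj_rproj M : subspace M -> hclosed M -> rproj (hproj M).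
Proof.
move=> sM clM; split; [exact: hproj_lin| |exact: hproj_rsym].
by move=> u; apply: hproj_id; have [] := hprojP u sM clM.
Qed.

Lemma rproj_sqr P u : rproj P -> rdot (P u) u = N (P u) ^+ 2.
Proof. by move=> [_ h2 h3]; rewrite hnorm_sqr -h3 h2. Qed.
Lemma rproj_perp P u v : rproj P -> rdot (P u) (v - P v) = 0.
Proof. by move=> [lP h2 h3]; rewrite h3 linB// h2 subrr rdot0r. Qed.

Lemma rproj_pyth P u : rproj P -> N u ^+ 2 = N (P u) ^+ 2 + N (u - P u) ^+ 2.
Proof.
move=> pP; have := hnorm_sqrD (u - P u) (P u).
by rewrite subrK rdotC (rproj_perp _ _ pP) => ->; ring.
Qed.

Lemma rproj_le P u : rproj P -> N (P u) <= N u.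
Proof.
move=> pP; rewrite -ler_sqr ?nnegrE// (rproj_pyth u pP) lerDl.
by [].
Qed.

Lemma rproj_compl P : rproj P -> rproj (fun u => u - P u).
Proof.
move=> [lP h2 h3]; split.
- by move=> a u v; rewrite lP opprD addrACA scalerBr.
- by move=> u; rewrite linB// h2 subrr subr0.
- by move=> u v; rewrite rdotBl rdotBr h3.
Qed.

(** The lower bound makes [T] injective with closed range; [S] is its adjoint for the real form, and
    the trivial kernel of [S] leaves nothing orthogonal to the range. All resolvents below are
    obtained in this way. *)
Lemma invertible_of_bounded_below T S (K c : R) : islin T -> hbounded K T ->
  (forall u v, rdot (T u) v = rdot u (S v)) -> 0 < c ->
  (forall u, c * N u <= N (T u)) -> (forall u, S u = 0 -> u = 0) ->
  exists G : V -> V, [/\ islin G, forall u, T (G u) = u, forall u, G (T u) = u &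
    hbounded c^-1 G].
Proof.
move=> lT bT adj c0 bb ker.
have inj u v : T u = T v -> u = v.
  move=> e; apply/subr0_eq/hnorm_eq0.
  have := bb (u - v); rewrite linB// e subrr hnorm0 => h.
  by apply/eqP; rewrite eq_le hnorm_ge0 andbT -(pmulr_rle0 _ c0).
pose M := [set T u | u in setT].
have sM : subspace M.
  split; first by exists 0 => //; rewrite lin0.
  by move=> a _ _ [u _ <-] [v _ <-]; exists (a *: u + v).
have clM : hclosed M.
  move=> x l Mx xl; have /choice[y hy] : forall n, exists u, T u = x n.
    by move=> n; have [u _ <-] := Mx n; exists u.
  have [p yp] : exists p, hcvg y p.
    apply: cV => e e0; have ce : 0 < c * e / 2 by [].
    have [K' hK] := cvg0_eps xl ce; exists K' => m n /hK h1 /hK h2.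
    move: h1 h2; rewrite !ger0_norm// => h1 h2.
    rewrite -(ler_pM2l c0) (le_trans (bb _))// linB// !hy.
    by rewrite (le_trans (hnorm_dist_triang l _ _))// (hnorm_distC l); lra.
  exists p => //; apply: hcvg_unique (hcvg_bounded lT bT yp) _.
  by under eq_fun do rewrite hy.
have surj v : exists u, T u = v.
  have [[u _ eu] hp] := hprojP v sM clM.
  exists u; rewrite eu; apply/eqP; rewrite eq_sym -subr_eq0; apply/eqP/ker/rdot_ext => w.
  by rewrite rdotC -adj rdotC hp ?rdot0l//; exists w.
have /choice[G hG] := surj.
exists G; split => //.
- by move=> a u v; apply: inj; rewrite lT !hG.
- by move=> u; apply: inj.
- by move=> u; rewrite ler_pdivlMl// (le_trans (bb _))// hG.
Qed.

Lemma pos_op_norm D (c : R) u : islin D -> rsym D -> 0 <= c ->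
  (forall v, 0 <= rdot (D v) v <= c * N v ^+ 2) ->
  N (D u) ^+ 2 <= c * rdot (D u) u.
Proof.
move=> lD sD c0 h; have /andP[h1 h2] := h u; have /andP[h3 h4] := h (D u).
have key t : 0 <= rdot (D u) u - 2 * t * N (D u) ^+ 2 + t ^+ 2 * rdot (D (D u)) (D u).
  have /andP[+ _] := h (u - t%:C *: D u).
  rewrite linB// linZ// !(rdotBl, rdotBr) !rdotZl !rdotZr (sD (D u) u) hnorm_sqr.
  by lra.
have [cz|cz] := eqVneq c 0.
  move: h2 h4; rewrite cz.
  by have := key 1; lra.
have cp : 0 < c by lra.
have := key c^-1.
have : c^-1 ^+ 2 * rdot (D (D u)) (D u) <= c^-1 * N (D u) ^+ 2.
  by rewrite -mulrA ler_pM2l// ler_pdivrMl.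
move=> h5 h6; have : c^-1 * N (D u) ^+ 2 <= rdot (D u) u by lra.
by rewrite ler_pdivrMl.
Qed.

(** Vigier's theorem. The forms increase and are bounded, hence Cauchy, and [pos_op_norm] applied to
    [S n - S m] makes [S n u] Cauchy. *)
Lemma monotone_operator_limit (S : nat -> V -> V) (c : R) :
  (forall n, islin (S n)) -> (forall n, rsym (S n)) -> 0 <= c ->
  (forall n u, 0 <= rdot (S n u) u) ->
  (forall n u, rdot (S n u) u <= rdot (S n.+1 u) u) ->
  (forall n u, rdot (S n u) u <= c * N u ^+ 2) ->
  exists T, [/\ islin T, rsym T & forall u, hcvg (S ^~ u) (T u)].
Proof.
move=> lS sS c0 pS incS bS.
have incS2 m n u : (m <= n)%N -> rdot (S m u) u <= rdot (S n u) u.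
  by move=> /subnK <-; elim: (n - m)%N => // k ih; rewrite (le_trans ih).
have cau u : hcauchy (S ^~ u).
  have mono : nondecreasing_seq (fun n => rdot (S n u) u).
    by apply/nondecreasing_seqP => n.
  have ub : has_ubound (range (fun n => rdot (S n u) u)).
    by exists (c * N u ^+ 2) => _ [n _ <-].
  have cv := nondecreasing_cvgn mono ub; set l := sup _ in cv.
  move=> e e0.
  have ce : 0 < e ^+ 2 / (c + 1) by [].
  move/cvgrPdist_le : cv => /(_ _ ce) [K _ hK]; exists K.
  have main m n : (K <= m)%N -> (m <= n)%N -> N (S n u - S m u) <= e.
    move=> Km mn; pose D v := S n v - S m v.
    have := @pos_op_norm D c u; rewrite /D => pn.
    rewrite -ler_sqr ?nnegrE//.
    rewrite (le_trans (pn _ _ c0 _))//.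
    - by move=> a v w; rewrite !lS opprD addrACA scalerBr.
    - by move=> v w; rewrite rdotBl rdotBr !sS.
    - move=> v; rewrite rdotBl subr_ge0 incS2//=.
      by have := bS n v; have := pS m v; lra.
    have lub k : rdot (S k u) u <= l by apply: ub_le_sup.
    have := hK _ Km; rewrite ler_norml ler_pdivlMr//.
    rewrite rdotBl; have := lub n.
    by nra.
  move=> m n Km Kn; case: (leqP m n) => [mn|/ltnW nm]; first by rewrite hnorm_distC main.
  exact: main.
have /choice[T hT] : forall u, exists l, hcvg (S ^~ u) l by move=> u; exact: cV.
exists T; split=> //.
- move=> a u v; apply: (hcvg_unique (hT _)); under eq_fun do rewrite lS.
  by apply: hcvgD => //; exact: hcvgZ.
- move=> u v; have h1 := hcvg_rdot (v := v) (hT u); have := hcvg_rdot (v := u) (hT v).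
  under eq_fun do rewrite rdotC -sS; move=> h2.
  by rewrite [RHS]rdotC; apply: cvg_unique h1 _.
Qed.

Lemma islin_comp T S : islin T -> islin S -> islin (fun u => T (S u)).
Proof. by move=> lT lS a u v; rewrite lS. Qed.
Lemma islinD T S : islin T -> islin S -> islin (fun u => T u + S u).
Proof. by move=> lT lS a u v; rewrite lS lT scalerDr addrACA. Qed.
Lemma islinN T : islin T -> islin (fun u => - T u).
Proof. by move=> lT a u v; rewrite lT opprD scalerN. Qed.
Lemma islinB T S : islin T -> islin S -> islin (fun u => T u - S u).
Proof. by move=> lT lS; apply: islinD => //; exact: islinN. Qed.
Lemma islinZ a T : islin T -> islin (fun u => a *: T u).
Proof. exact: (islin_comp (@islin_scale a)). Qed.

(** * Square roots of positive operators and the spectral family *)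

Section SquareRootIteration.
Variable Z : V -> V.
Hypotheses (lZ : islin Z) (sZ : rsym Z) (bZ : hbounded 1 Z).
Hypothesis pZ : forall u, 0 <= rdot (Z u) u.

(** Polynomials in [Z] with nonnegative coefficients. They have nonnegative forms and commute with
    whatever commutes with [Z], so order relations between the iterates below need no functional
    calculus. *)
Inductive npoly : (V -> V) -> Prop :=
| npoly_iter c n : 0 <= c -> npoly (fun u => c%:C *: iter n Z u)
| npolyD X Y : npoly X -> npoly Y -> npoly (fun u => X u + Y u).

Lemma iter_lin n : islin (iter n Z).
Proof. by elim: n => // n ih a u v; rewrite !iterS ih. Qed.
Lemma iter_rsym n : rsym (iter n Z).
Proof. by elim: n => // n ih u v; rewrite sZ ih -iterSr. Qed.
Lemma npoly_lin X : npoly X -> islin X.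
Proof. by elim=> [c n _|X1 X2 _ ? _ ?]; [exact: islinZ (iter_lin n)|exact: islinD]. Qed.

Lemma npoly_rsym X : npoly X -> rsym X.
Proof.
elim=> [c n _|X1 X2 _ h1 _ h2] u v; last by rewrite rdotDl rdotDr h1 h2.
by rewrite rdotZl rdotZr iter_rsym.
Qed.

(** An even power [Z^(2 k)] has form [|Z^k u|^2], and an odd power has the form of [Z] at
    [Z^k u]. *)
Lemma npoly_ge0 X u : npoly X -> 0 <= rdot (X u) u.
Proof.
elim=> [c n c0|X1 X2 _ h1 _ h2]; last by rewrite rdotDl.
rewrite rdotZl mulr_ge0// -(odd_double_half n) -addnn; case: (odd n).
  by rewrite add1n -addnS iterD iter_rsym pZ.
by rewrite add0n iterD iter_rsym -hnorm_sqr.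
Qed.

Lemma npoly_comm X A : npoly X -> islin A -> (forall u, A (Z u) = Z (A u)) ->
  forall u, A (X u) = X (A u).
Proof.
move=> + lA AZ; elim=> [c n _|X1 X2 _ h1 _ h2] u; last by rewrite (linD lA) h1 h2.
by rewrite (linZ lA); congr (_ *: _); elim: n => //= n ih; rewrite AZ ih.
Qed.

Lemma npoly_comp X Y : npoly X -> npoly Y -> npoly (fun u => X (Y u)).
Proof.
elim=> [c n c0|X1 X2 _ h1 _ h2] hY; last exact: npolyD (h1 hY) (h2 hY).
elim: hY => [d m d0|Y1 Y2 _ h1 _ h2].
  rewrite (_ : (fun u => _) = fun u => (c * d)%:C *: iter (n + m) Z u); first exact: npoly_iter.
  by apply/funext => u; rewrite iterD (linZ (iter_lin n)) scalerA rmorphM.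
by under eq_fun do rewrite (linD (iter_lin n)) scalerDr; exact: npolyD.
Qed.

Lemma npolyZ c X : 0 <= c -> npoly X -> npoly (fun u => c%:C *: X u).
Proof. by move=> c0; exact: npoly_comp (npoly_iter 0 c0). Qed.

(** The iteration [W -> (Z + W^2) / 2] from 0. Its limit is [1 - sqrt (1 - Z)]. *)
Fixpoint sqrt_iter n u : V :=
  if n is m.+1 then (2^-1)%:C *: (Z u + sqrt_iter m (sqrt_iter m u)) else 0.
Local Notation W := sqrt_iter.

Lemma sqrt_iter_npoly n : npoly (W n).
Proof.
elim: n => [|n ih].
  by have := npoly_iter 0 (lexx 0); under eq_fun do rewrite scale0r.
apply: npolyZ => //; apply: npolyD (npoly_comp ih ih).
by have := npoly_iter 1 ler01; under eq_fun do rewrite scale1r.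
Qed.

(** The next increment is [(W' - W) (W' + W) / 2] for consecutive iterates [W], [W']: a product of
    polynomials with nonnegative coefficients. Hence the iterates increase. *)
Lemma sqrt_iterB_npoly n : npoly (fun u => W n.+1 u - W n u).
Proof.
elim: n => [|n ih]; first by under eq_fun do rewrite subr0; exact: sqrt_iter_npoly 1.
have h0 := sqrt_iter_npoly n; have h1 := sqrt_iter_npoly n.+1.
have l0 := npoly_lin h0; have l1 := npoly_lin h1.
have c u : W n.+1 (W n u) = W n (W n.+1 u).
  by apply: (npoly_comm h0 l1) => v; rewrite (npoly_comm h1 lZ).
have h2 : 0 <= 2^-1 :> R by [].
rewrite (_ : (fun u => _) = fun u => (2^-1)%:C *: (W n.+1 (W n.+1 u + W n u) - W n (W n.+1 u + W n u))).
  exact: (npolyZ h2 (npoly_comp ih (npolyD h1 h0))).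
apply/funext => u; rewrite (linD l1) (linD l0) c opprD addrA addrK.
by rewrite -scalerBr opprD addrACA subrr add0r.
Qed.

Lemma sqrt_iter_bound n : hbounded 1 (W n).
Proof.
elim: n => [|n ih] u ; first by rewrite hnorm0.
rewrite hnorm_real ger0_norm// ler_pdivrMl// (le_trans (hnorm_triang _ _))//.
by have := bZ u; have := ih u; have := ih (W n u); lra.
Qed.

End SquareRootIteration.

(** [Y] is the absolute value of [X]. With [Z = 1 - X^2] the limit satisfies [Y0 = (Z + Y0^2) / 2],
    so [(1 - Y0)^2 = 1 - Z = X^2]. Commutation passes from [X] to the iterates and then to the
    limit. *)
Lemma operator_sqrt X : islin X -> rsym X -> hbounded 1 X ->
  exists Y, [/\ islin Y, rsym Y, forall u, 0 <= rdot (Y u) u <= N u ^+ 2,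
    forall u, Y (Y u) = X (X u) &
    forall A K, islin A -> hbounded K A -> (forall u, A (X u) = X (A u)) ->
      forall u, A (Y u) = Y (A u)].
Proof.
move=> lX sX bX; pose Z u := u - X (X u).
have lZ : islin Z by move=> a u v; rewrite /Z !lX opprD addrACA scalerBr.
have sZ : rsym Z by move=> u v; rewrite rdotBl rdotBr !sX.
have X2 u : N (X u) ^+ 2 <= N u ^+ 2.
  by rewrite ler_sqr ?nnegrE// (le_trans (bX u))// mul1r.
have ZE u : rdot (Z u) u = N u ^+ 2 - N (X u) ^+ 2.
  by rewrite rdotBl sX -!hnorm_sqr.
have pZ u : 0 <= rdot (Z u) u by rewrite ZE subr_ge0.
have bZ : hbounded 1 Z.
  move=> u; apply: (@rsym_numrange setT) => // v _.
  by rewrite ger0_norm// mul1r ZE lerBlDr lerDl.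
pose W := sqrt_iter Z; have hW := sqrt_iter_npoly lZ.
have lW n : islin (W n) by exact: npoly_lin (hW n).
have sW n : rsym (W n) by exact: npoly_rsym (hW n).
have bW n u : N (W n u) <= N u by rewrite -[leRHS]mul1r; exact: sqrt_iter_bound.
have form_le T : (forall u, N (T u) <= N u) -> forall u, rdot (T u) u <= N u ^+ 2.
  by move=> bT u; rewrite (le_trans (ler_norm _))// (le_trans (rdot_CS _ _))// ler_wpM2r.
have W0 n u : 0 <= rdot (W n u) u by exact: (npoly_ge0 sZ pZ u (hW n)).
have Winc n u : rdot (W n u) u <= rdot (W n.+1 u) u.
  rewrite -subr_ge0 -rdotBl; exact: (npoly_ge0 sZ pZ u (sqrt_iterB_npoly lZ n)).
have W1 n u : rdot (W n u) u <= 1 * N u ^+ 2 by rewrite mul1r form_le.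
have [Y0 [lY0 sY0 cY0]] := monotone_operator_limit lW sW ler01 W0 Winc W1.
have bY0 u : N (Y0 u) <= N u by exact: hcvg_le (cY0 u).
have Y0E u : Y0 u = (2^-1)%:C *: (Z u + Y0 (Y0 u)).
  have h1 : hcvg (fun n => W n.+1 u) (Y0 u).
    apply: eps_cvg0 => [n|e e0]//.
    by have [K hK] := cvg0_eps (cY0 u) e0; exists K => n /leqW /hK; rewrite ger0_norm.
  apply: hcvg_unique h1 _.
  apply: hcvgZ; apply: hcvgD; first exact: hcvg_cst.
  have h2 : hcvg (fun n => W n (W n u) - W n (Y0 u)) 0.
    apply: eps_cvg0 => [n|e e0]//.
    have [K hK] := cvg0_eps (cY0 u) e0; exists K => n /hK.
    by rewrite ger0_norm// subr0 -linB//; apply: le_trans.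
  have := hcvgD h2 (cY0 (Y0 u)); rewrite add0r.
  by under eq_fun do rewrite subrK.
exists (fun u => u - Y0 u); split.
- by move=> a u v; rewrite lY0 opprD addrACA scalerBr.
- by move=> u v; rewrite rdotBl rdotBr sY0.
- move=> u; rewrite rdotBl -hnorm_sqr.
  have h0 : 0 <= rdot (Y0 u) u.
    have cv := hcvg_rdot (v := u) (cY0 u).
    rewrite -(cvg_lim _ cv)//; apply: limr_ge; first by apply/cvg_ex; eexists; exact: cv.
    exact: nearW => n.
  by have := form_le _ bY0 u; lra.
- move=> u; rewrite (linB lY0).
  have : (2%:R : R[i]) *: Y0 u = Z u + Y0 (Y0 u).
    rewrite {1}Y0E scalerA.
    have -> : 2%:R * (2^-1)%:C = 1 :> R[i] by apply: complex_eq; rewrite /=; lra.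
    by rewrite scale1r.
  rewrite scaler_nat mulr2n => e.
  have -> : X (X u) = u - (Y0 u + Y0 u - Y0 (Y0 u)) by rewrite e addrK subKr.
  by rewrite !opprD !addrA.
- move=> A K lA bA AX u; rewrite (linB lA); congr (_ - _).
  apply: hcvg_unique (hcvg_bounded lA bA (cY0 u)) _.
  have AW n : A (W n u) = W n (A u).
    by apply: (npoly_comm (hW n) lA) => v; rewrite (linB lA) !AX.
  by under eq_fun do rewrite AW; exact: cY0.
Qed.

(* E is the projection onto the kernel of |T - l| + (T - l). *)
Lemma spectral_family T (K l : R) : islin T -> rsym T -> hbounded K T ->
  exists E, [/\ rproj E, forall u, E u = u -> rdot (T u) u <= l * N u ^+ 2,
    forall u, E u = 0 -> l * N u ^+ 2 <= rdot (T u) u,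
    forall u, E u = 0 -> rdot (T u) u <= l * N u ^+ 2 -> u = 0 &
    forall A K', islin A -> hbounded K' A -> rsym A ->
      (forall u, A (T u) = T (A u)) -> forall u, A (E u) = E (A u)].
Proof.
move=> lT sT bT; pose c := `|K| + `|l| + 1.
have c0 : 0 < c by rewrite ltr_wpDl.
pose X u := (c^-1)%:C *: (T u - l%:C *: u).
have lX : islin X.
  by apply: islinZ; apply: islinB => //; apply: islinZ.
have sX : rsym X.
  by move=> u v; rewrite rdotZl rdotZr !(rdotBl, rdotBr) rdotZl rdotZr sT.
have bX : hbounded 1 X.
  move=> u; rewrite hnorm_real gtr0_norm// ler_pdivrMl//.
  rewrite (le_trans (hnorm_triangB _ _))// hnorm_real /c.
  have := bT u; have := ler_norm K; have := hnorm_ge0 u; nra.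
have TX u : rdot (T u) u = c * rdot (X u) u + l * N u ^+ 2.
  rewrite rdotZl mulrA divff// rdotBl rdotZl -hnorm_sqr; ring.
have hAX A : islin A -> (forall u, A (T u) = T (A u)) -> forall u, A (X u) = X (A u).
  by move=> lA AT u; rewrite (linZ lA) (linB lA) (linZ lA) AT.
have [Y [lY sY pY YX cY]] := operator_sqrt lX sX bX.
have bY : hbounded 1 Y.
  move=> u; apply: (@rsym_numrange setT) => // v _.
  by have /andP[h0 h1] := pY v; rewrite ger0_norm// mul1r.
have XY u : X (Y u) = Y (X u) by exact: (cY X 1).
pose D u := Y u + X u.
have lD : islin D by move=> a u v; rewrite /D lY lX scalerDr addrACA.
have bD : hbounded 2 D.
  move=> u; rewrite (le_trans (hnorm_triang _ _))//.
  by have := bX u; have := bY u; lra.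
pose M := [set u | D u = 0].
have sM : subspace M by split; [exact: lin0|move=> a u v; rewrite /M /= lD => -> ->; rewrite scaler0 addr0].
have clM : hclosed M.
  move=> x p Mx xp; apply: (@hcvg_unique (fun=> 0)); last exact: hcvg_cst.
  by have := hcvg_bounded lD bD xp; under eq_fun do rewrite Mx.
pose E := hproj M.
have pE : rproj E by exact: hproj_rproj.
have ker u : E u = u -> Y u = - X u.
  move=> Eu; have [] := hprojP u sM clM; rewrite -/(E u) Eu.
  by move/eqP; rewrite addr_eq0 => /eqP.
(* [(Y + X) (Y - X) = Y^2 - X^2 = 0], so [Y - X] maps into the kernel of [D], onto which [E]
   projects; for [u] in the complement this gives [Y u = X u]. *)
have perp u : E u = 0 -> Y u = X u.
  move=> Eu; have [_ h] := hprojP u sM clM; rewrite -/(E u) Eu subr0 in h.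
  apply/subr0_eq/rdot_eq0.
  have Mz z : M (Y z - X z).
    by rewrite /M /= /D (linB lY) (linB lX) YX XY addrA subrK subrr.
  by rewrite {1}rdotBl sY sX -rdotBr h.
exists E; split => //.
- move=> u Eu; have /andP[+ _] := pY u.
  by rewrite TX (ker u Eu) rdotNl; nra.
- by move=> u Eu; have /andP[+ _] := pY u; rewrite TX (perp u Eu); nra.
(* On the complement of [E] the operator [T - l] is strictly positive, because its kernel was put
   into the range of [E]. This choice makes the spectral family right continuous. *)
- move=> u Eu h; have /andP[h1 _] := pY u.
  have e0 : rdot (Y u) u = 0.
    by move: h h1; rewrite TX (perp u Eu); nra.
  have Yu : Y u = 0.
    apply: hnorm_sqr_le0.
    have := @pos_op_norm Y 1 u lY sY ler01; rewrite e0 mulr0; apply.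
    by move=> v; rewrite mul1r.
  have Mu : M u by rewrite /M /= /D -(perp u Eu) Yu addr0.
  by rewrite -Eu /E hproj_id.
- move=> A K' lA bA sA AT u.
  have AX := hAX A lA AT.
  have AD v : A (D v) = D (A v) by rewrite (linD lA) AX (cY A K').
  have [Mp hp] := hprojP u sM clM; symmetry.
  apply: hproj_unique => //; first by rewrite /M /= -AD Mp (lin0 lA).
  by move=> m Mm; rewrite -(linB lA) sA hp//= /M /= -AD Mm (lin0 lA).
Qed.

Lemma rsym_form0 T : islin T -> rsym T -> (forall u, rdot (T u) u = 0) ->
  forall u, T u = 0.
Proof.
move=> lT sT T0 u; apply: hnorm_eq0; apply/eqP.
rewrite eq_le hnorm_ge0 andbT -(mul0r (N u)).
by apply: (@rsym_numrange setT) => // v _; rewrite T0 normr0 mul0r.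
Qed.

Lemma rproj_of_form T : islin T -> rsym T ->
  (forall u, rdot (T u) u = N (T u) ^+ 2) -> rproj T.
Proof.
move=> lT sT h; split => // u; apply/subr0_eq.
have lD : islin (fun u => T (T u) - T u) by apply: islinB; exact: islin_comp.
apply: (rsym_form0 lD) => [v w|v]; first by rewrite rdotBl rdotBr !sT.
by rewrite rdotBl sT -hnorm_sqr -h subrr.
Qed.

Lemma rproj0 : rproj (fun=> 0).
Proof. by split => [a u v||u v]; rewrite ?scaler0 ?addr0 ?rdot0l ?rdot0r. Qed.
Lemma rproj_bounded P : rproj P -> hbounded 1 P.
Proof. by move=> pP u; rewrite mul1r rproj_le. Qed.

(** Tested on a vector of the range of [Q], the form bound leaves no room for [P], so [P Q = 0]. *)
Lemma rproj_ortho_add P Q : rproj P -> rproj Q ->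
  (forall u, rdot (P u) u + rdot (Q u) u <= N u ^+ 2) ->
  rproj (fun u => P u + Q u).
Proof.
move=> pP pQ h; have [lP P2 sP] := pP; have [lQ Q2 sQ] := pQ.
have PQ v : P (Q v) = 0.
  apply: hnorm_sqr_le0.
  by have := h (Q v); rewrite Q2 (rproj_sqr _ pP) -hnorm_sqr; lra.
apply: rproj_of_form.
- exact: islinD.
- by move=> u v; rewrite rdotDl rdotDr sP sQ.
move=> u; rewrite hnorm_sqrD rdotDl (rproj_sqr _ pP) (rproj_sqr _ pQ) sP PQ; ring.
Qed.

Lemma rproj_sub P Q : rproj P -> rproj Q -> (forall u, Q (P u) = P u) ->
  rproj (fun u => Q u - P u).
Proof.
move=> pP pQ QP; have [lP P2 sP] := pP; have [lQ Q2 sQ] := pQ.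
apply: rproj_of_form.
- exact: islinB.
- by move=> u v; rewrite rdotBl rdotBr sP sQ.
move=> u; rewrite hnorm_sqrB rdotBl (rproj_sqr _ pP) (rproj_sqr _ pQ) sQ rdotC QP.
rewrite (rproj_sqr _ pP); ring.
Qed.
End Hilbert.
Ltac sign_leaf ::= exact: hnorm_ge0.

Lemma lebesgue_stieltjes_itvoc (R : realType) (f : cumulative R R) a b : a <= b ->
  lebesgue_stieltjes_measure f `]a, b]%classic = (f b - f a)%:E.
Proof.
move=> ab; rewrite /lebesgue_stieltjes_measure /measure_extension.
by rewrite measurable_mu_extE/= ?wlength_itv_bnd//; exact: is_ocitv.
Qed.

(** * From the spectral family to a projection-valued measure *)

Section SpectralMeasure.
Variables (R : realType) (V : lmodType R[i]) (dot : {dot V for @Num.conj R[i]}).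
Implicit Types (u v w : V) (l m : R).
Local Notation rdot := (reform dot).
Local Notation N := (hnorm dot).
Hypothesis cV : hcomplete dot.
Variables (T : V -> V) (K : R) (E : R -> V -> V).
Hypotheses (lT : islin T) (sT : rsym dot T) (bT : hbounded dot K T).
Hypothesis pE : forall l, rproj dot (E l).
Hypothesis E_le : forall l u, E l u = u -> rdot (T u) u <= l * N u ^+ 2.
Hypothesis E_ge : forall l u, E l u = 0 -> l * N u ^+ 2 <= rdot (T u) u.
Hypothesis E_ker : forall l u, E l u = 0 -> rdot (T u) u <= l * N u ^+ 2 -> u = 0.
Hypothesis E_comm : forall l A K', islin A -> hbounded dot K' A -> rsym dot A ->
  (forall u, A (T u) = T (A u)) -> forall u, A (E l u) = E l (A u).

Let ET l u : E l (T u) = T (E l u).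
Proof. by rewrite (E_comm l lT bT sT). Qed.

Let EE l m u : E l (E m u) = E m (E l u).
Proof.
have [lE _ sE] := pE l.
exact: (E_comm m lE (rproj_bounded (pE l)) sE (ET l)).
Qed.

(** The difference [w] lies in the range of [E l] and in the kernel of [E m]. Its form is at most
    [l |w|^2 <= m |w|^2], so [E_ker] at [m] kills it. *)
Let E_nest l m u : l <= m -> E m (E l u) = E l u.
Proof.
move=> lm; have [lE E2 _] := pE l; have [lF F2 _] := pE m.
apply/esym/subr0_eq; set w := _ - _.
have Fw : E m w = 0 by rewrite (linB lF) F2 subrr.
apply: (E_ker Fw); have Ew : E l w = w by rewrite (linB lE) EE !E2.
by rewrite (le_trans (E_le Ew))// ler_wpM2r.
Qed.

Let K1 u : `|rdot (T u) u| <= K * N u ^+ 2.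
Proof.
rewrite (le_trans (rdot_CS _ _ _))// mulrA ler_wpM2r//.
Qed.

Let E_low l u : l < - K -> E l u = 0.
Proof.
move=> lK; have [lE E2 _] := pE l; have := E_le (E2 u).
set w := E l u => h; have := K1 w; rewrite ler_norml => /andP[h1 _].
apply: (@hnorm_sqr_le0 _ _ dot).
rewrite -(@pmulr_rle0 _ (- K - l)); lra.
Qed.

Let E_high l u : K <= l -> E l u = u.
Proof.
move=> Kl; have [lE E2 _] := pE l; apply/esym/subr0_eq.
apply: (@E_ker l); first by rewrite (linB lE) E2 subrr.
rewrite (le_trans (ler_norm _))// (le_trans (K1 _))// ler_wpM2r//.
Qed.

Let F u l : R := rdot (E l u) u.

Let F_sqr u l : F u l = N (E l u) ^+ 2.
Proof. by rewrite /F rproj_sqr. Qed.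

Let F_nd u : nondecreasing (F u).
Proof.
move=> l m lm; rewrite !F_sqr ler_sqr ?nnegrE//.
by rewrite -(E_nest u lm) EE rproj_le.
Qed.

(** Right continuity. The decreasing projections converge strongly to some [q], and [w = q - E l u]
    satisfies [E mu w = w] for every [mu > l] in the sequence. So its form is at most [l |w|^2]
    while [E l w = 0], and [E_ker] applies. *)
Let E_strong l u : hcvg dot (fun n => E (l + n.+1%:R^-1) u) (E l u).
Proof.
pose mu n : R := l + n.+1%:R^-1.
have mu_dec n k : (n <= k)%N -> mu k <= mu n.
  by rewrite lerD2l lef_pV2 ?posrE// ler_nat.
have lmu n : l < mu n by rewrite ltrDl.
pose S n v := v - E (mu n) v.
have pS n : rproj dot (S n) by exact: rproj_compl.
have inc n v : rdot (S n v) v <= rdot (S n.+1 v) v.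
  by rewrite !rdotBl lerD2l lerN2 F_nd// mu_dec.
have [Q [lQ sQ cQ]] : exists Q, [/\ islin Q, rsym dot Q & forall u, hcvg dot (S ^~ u) (Q u)].
  apply: (@monotone_operator_limit _ _ dot cV S 1) => //.
  - by move=> n; have [] := pS n.
  - by move=> n; have [] := pS n.
  - by move=> n v; rewrite rproj_sqr.
  - by move=> n v; rewrite mul1r rproj_sqr// ler_sqr ?nnegrE// rproj_le.
pose q := u - Q u.
have cq : hcvg dot (fun n => E (mu n) u) q.
  have := hcvgB (hcvg_cst dot u) (cQ u).
  by under eq_fun do rewrite /S subKr.
suff -> : E l u = q by [].
apply/esym/subr0_eq; set w := q - _.
have [lE E2 _] := pE l.
have Ew : E l w = 0.
  rewrite (linB lE) E2; apply/eqP; rewrite subr_eq0; apply/eqP.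
  apply: hcvg_unique (hcvg_bounded lE (rproj_bounded (pE l)) cq) _.
  have -> : (fun n => E l (E (mu n) u)) = (fun=> E l u).
    by apply/funext => n; rewrite EE E_nest// ltW.
  exact: hcvg_cst.
have Emw n : E (mu n) w = w.
  have [lEn _ _] := pE (mu n).
  rewrite (linB lEn) E_nest ?ltW//; congr (_ - _).
  apply: hcvg_unique (hcvg_bounded lEn (rproj_bounded (pE (mu n))) cq) _.
  apply: eps_cvg0 => [k|e e0]//.
  have [k0 hk] := cvg0_eps cq e0; exists (maxn n k0) => k.
  rewrite geq_max => /andP[nk /hk]; rewrite ger0_norm//.
  by rewrite E_nest// mu_dec.
apply: (E_ker Ew); apply/ler_addgt0Pl => e e0.
have e1 : 0 < e / (N w ^+ 2 + 1) by [].
have [n /(_ n (leqnn _)) hn] := natinv_le e1.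
rewrite (le_trans (E_le (Emw n)))// mulrDl addrC lerD2r.
rewrite (le_trans (ler_wpM2r (sqr_ge0 _) hn))// -mulrA ler_piMr//.
by rewrite mulrC ler_pdivrMr ?mul1r ?lerDl.
Qed.

Let F_rc u : right_continuous (F u).
Proof.
move=> l; apply/cvgrPdist_le => e e0.
have /cvgrPdist_le /(_ _ e0) [n _ hn] := hcvg_rdot (v := u) (E_strong l u).
have := hn n (leqnn n) => /=; rewrite distrC ger0_norm; last first.
  by rewrite subr_ge0 F_nd// lerDl.
move=> hl; exists n.+1%:R^-1 => //= x /=.
rewrite ltr_norml => /andP[h _] lx.
rewrite distrC ger0_norm ?subr_ge0 ?F_nd ?(ltW lx)//; apply: le_trans hl.
rewrite lerD2r F_nd; move: (n.+1%:R^-1) h => y h; lra.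
Qed.

Let Fc u : cumulative R R :=
  HB.pack (F u) (isCumulative.Build R _ R (F u) (@F_nd u) (@F_rc u)).

Let nu u : {measure set (measurableTypeR R) -> \bar R} := lebesgue_stieltjes_measure (Fc u).

Let nu_itv u a b : a <= b -> nu u `]a, b]%classic = (rdot (E b u) u - rdot (E a u) u)%:E.
Proof.
move=> ab; exact: (lebesgue_stieltjes_itvoc (Fc u) ab).
Qed.

Let nuT u : nu u setT = (N u ^+ 2)%:E.
Proof.
have nd : nondecreasing_seq (fun n : nat => `](- n%:R - K - 1)%R, (n%:R + K)%R]%classic : set R).
  move=> m n mn; apply/subsetPset => x /=; rewrite !in_itv/=.
  have h3 : (m%:R : R) <= n%:R by rewrite ler_nat.
  by lra.
have := @nondecreasing_cvg_mu _ _ _ (nu u) _ _ _ nd.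
rewrite (_ : \bigcup_n _ = setT); last first.
  apply/seteqP; split => // x _.
  exists (Num.bound (`|x| + `|K| + 1)) => //=; rewrite in_itv/=.
  have p0 : 0 <= `|x : R| + `|K| + 1 by [].
  have := archi_boundP p0.
  have := ler_norm x; have := ler_norm (- x); have := ler_norm (- K).
  by rewrite !normrN; lra.
move=> /(_ (fun i => measurable_itv _) measurableT).
set f := _ \o _ => cv.
have K0 : forall n : nat, (- n%:R - K - 1 : R) <= n%:R + K -> f n = (N u ^+ 2)%:E.
  move=> n h; rewrite /f /= nu_itv// E_high; last by rewrite lerDr.
  rewrite E_low ?rdot0l ?subr0 ?hnorm_sqr//.
  by have : (0 : R) <= n%:R by []; lra.
have cv2 : f x @[x --> \oo] --> (N u ^+ 2)%:E.
  apply: cvg_near_cst; exists (Num.bound (`|K|)) => // n  hn; apply: K0.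
  have h := archi_boundP (normr_ge0 K).
  have h2 : (Num.bound `|K|)%:R <= n%:R :> R by rewrite ler_nat.
  have := ler_norm (- K); rewrite normrN; lra.
by rewrite -(cvg_lim _ cv)// (cvg_lim _ cv2).
Qed.

Let good (A : mset R) :=
  exists2 P, rproj dot P & forall u, nu u A = (rdot (P u) u)%:E.

(** The sets whose mass is the form of a projection are a Dynkin class containing the half-open
    intervals. For disjoint unions the total mass [N u ^+ 2] forces the projections to be
    orthogonal, and the partial sums increase to a limit by [monotone_operator_limit]. *)
Let good_all A : measurable A -> good A.
Proof.
apply: (@dynkin_induction _ (measurableTypeR R) (@ocitv R)) => //.
- exact: ocitvI.
- exists (fun u => u) => [|u]//.
  by rewrite nuT hnorm_sqr.
- move=> _ [[a b] _ <-] ; case: (leP a b) => ab; last first.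
    exists (fun=> 0); first exact: rproj0.
    move=> u; rewrite rdot0l (_ : [set` _] = set0) ?measure0//.
    by apply/set_itv_ge; rewrite -leNgt ltW.
  exists (fun u => E b u - E a u); first by apply: rproj_sub => // u; exact: E_nest.
  by move=> u; rewrite nu_itv// rdotBl.
- move=> S mS [P pP hP]; exists (fun u => u - P u); first exact: rproj_compl.
  move=> u; rewrite -setTD measureD//=; last by rewrite nuT ltry.
  by rewrite setTI nuT hP rdotBl hnorm_sqr.
- move=> G mG tG hG.
  have /choice[p hp] : forall n, exists P, rproj dot P /\ forall u, nu u (G n) = (rdot (P u) u)%:E.
    by move=> n; have [P' pP' hP'] := hG n; exists P'.
  pose S n u := \sum_(0 <= k < n) p k u.
  have Sform n u : rdot (S n u) u = \sum_(0 <= k < n) rdot (p k u) u by rewrite rdot_suml.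
  have nuS n u : (\sum_(0 <= k < n) nu u (G k) = (rdot (S n u) u)%:E)%E.
    by rewrite Sform -sumEFin; apply: eq_bigr => k _; rewrite (hp k).2.
  have nuG u : nu u (\bigcup_n G n) = (\sum_(k <oo) nu u (G k))%E.
    by rewrite measure_semi_bigcup//; exact: bigcupT_measurable.
  have Sle n u : rdot (S n u) u <= N u ^+ 2.
    rewrite -lee_fin -nuS -nuT (le_trans (nneseries_lim_ge n _))// -nuG.
    by apply: le_measure; rewrite ?inE//; exact: bigcupT_measurable.
  have pS n : rproj dot (S n).
    elim: n => [|n ih].
      have -> : S 0%N = fun=> 0 by apply/funext => u; rewrite /S big_geq.
      exact: rproj0.
    have -> : S n.+1 = fun u => S n u + p n u.
      by apply/funext => u; rewrite /S big_nat_recr.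
    apply: rproj_ortho_add => //; first exact: (hp n).1.
    by move=> u; rewrite -rdotDl; have := Sle n.+1 u; rewrite /S big_nat_recr.
  have [P [lP sP cP]] : exists Q, [/\ islin Q, rsym dot Q & forall u, hcvg dot (S ^~ u) (Q u)].
    apply: (@monotone_operator_limit _ _ dot cV S 1) => //.
    - by move=> n; have [] := pS n.
    - by move=> n; have [] := pS n.
    - by move=> n v; rewrite rproj_sqr.
    - move=> n v; rewrite !Sform big_nat_recr//= lerDl (rproj_sqr _ (hp n).1).
      by [].
    - by move=> n v; rewrite mul1r.
  exists P.
    apply: rproj_of_form => // u.
    have h2 := hcvg_hnorm (cP u).
    have h4 : rdot (S n u) u @[n --> \oo] --> N (P u) * N (P u).
      apply: cvg_trans (cvgM h2 h2); apply: near_eq_cvg; apply: nearW => n.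
      by rewrite rproj_sqr.
    exact: (cvg_unique _ (hcvg_rdot (v := u) (cP u)) h4).
  move=> u; rewrite nuG; apply/cvg_lim => //.
  under eq_fun do rewrite nuS.
  by apply: cvg_EFin; [exact: nearW|exact: (hcvg_rdot (v := u) (cP u))].
Qed.

Let nu_fin u A : measurable A -> (nu u A < +oo)%E.
Proof.
move=> mA; apply: (@le_lt_trans _ _ (nu u setT)); last by rewrite nuT ltry.
by apply: le_measure; rewrite ?inE.
Qed.

Let int_itv u a b : (nu u).-integrable `]a, b] (EFin \o (fun x : R => x)).
Proof.
apply: measurable_bounded_integrable => //; first exact: nu_fin.
exists (`|a| + `|b|); split => //.
move=> M hM x /=; rewrite in_itv/=.
rewrite ler_norml.
have := ler_norm b; have := ler_norm (- a); have := normr_ge0 a; have := normr_ge0 b.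
by rewrite normrN; lra.
Qed.

Let int_cst u a b (c : R) : (nu u).-integrable `]a, b] (EFin \o (fun x : R => c)).
Proof.
apply: measurable_bounded_integrable => //; [exact: nu_fin|exact: bounded_cst].
Qed.

(** On one interval the form and the integral both lie between [a] and [b] times the mass. Bisecting
    [n] times divides this error by [2^n]. *)
Let itv_form u a b n : a <= b ->
  `|rdot (T (E b u - E a u)) u - \int[nu u]_(x in `]a, b]) x| <=
     (b - a) * 2^-1 ^+ n * (F u b - F u a).
Proof.
elim: n a b => [|n ih] a b ab.
  pose w := E b u - E a u; have [lEa Ea2 sEa] := pE a; have [lEb Eb2 sEb] := pE b.
  have pw : rproj dot (fun v => E b v - E a v) by apply: rproj_sub => // v; exact: E_nest.
  have ew : rdot (T w) u = rdot (T w) w.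
    have [_ w2 sw] := pw.
    have e : T w = E b (T w) - E a (T w).
      by rewrite !ET -(linB lT); congr (T _); rewrite -[LHS]w2.
    by rewrite [LHS]rdotC {1}e rdotC.
  have Fw : F u b - F u a = N w ^+ 2.
    by rewrite -rdotBl (rproj_sqr _ pw).
  have Ebw : E b w = w by rewrite (linB lEb) Eb2 E_nest.
  have Eaw : E a w = 0 by rewrite (linB lEa) Ea2 EE E_nest// subrr.
  have h1 := E_le Ebw; have h2 := E_ge Eaw.
  have m : fine (nu u `]a, b]%classic) = N w ^+ 2 by rewrite nu_itv.
  have h3 : \int[nu u]_(x in `]a, b]) x <= b * N w ^+ 2.
    rewrite -m -Rintegral_cst//; apply: le_Rintegral => //.
    by move=> x /=; rewrite in_itv => /andP[].
  have h4 : a * N w ^+ 2 <= \int[nu u]_(x in `]a, b]) x.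
    rewrite -m -Rintegral_cst//; apply: le_Rintegral => //.
    by move=> x /=; rewrite in_itv => /andP[/ltW].
  rewrite Fw ler_norml; lra.
pose c := (a + b) / 2; have ac : a <= c by rewrite /c; lra.
have cb : c <= b by rewrite /c; lra.
have -> : E b u - E a u = (E c u - E a u) + (E b u - E c u) by rewrite [RHS]addrC addrA subrK.
have ei : \int[nu u]_(x in `]a, b]) x =
    \int[nu u]_(x in `]a, c]) x + \int[nu u]_(x in `]c, b]) x.
  rewrite -Rintegral_setU//.
  - by rewrite -itv_bndbnd_setU.
  - by rewrite -itv_bndbnd_setU.
  - apply/disj_setPS => x /= []; rewrite !in_itv/=.
    by lra.
rewrite (linD lT) rdotDl ei opprD addrACA (le_trans (ler_normD _ _))//.
have := ih _ _ ac; have := ih _ _ cb.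
have -> : b - c = (b - a) / 2 by rewrite /c; lra.
have -> : c - a = (b - a) / 2 by rewrite /c; lra.
rewrite exprS.
by nra.
Qed.

Let pow_half_le (e : R) (c : R) : 0 < e -> exists n, c * 2^-1 ^+ n <= e.
Proof.
move=> e0; have c0 : 0 < e / (`|c| + 1) by [].
have [n _ /(_ n (leqnn n))  h] := near_infty_natSinv_expn_lt (PosNum c0).
exists n; rewrite (le_trans (ler_wpM2r _ (ler_norm c)))//.
have {}h : 2^-1 ^+ n <= e / (`|c| + 1) by rewrite exprVn -(div1r (2 ^+ n)) ltW.
rewrite (le_trans (ler_wpM2l (normr_ge0 c) h))// mulrCA ler_piMr//.
by rewrite ler_pdivrMr ?mul1r ?lerDl.
Qed.

Lemma spectral_measure_exists : exists P, is_spectral_measure dot T P.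
Proof.
have /choice[P hP] : forall A : mset R, exists P, measurable A ->
    rproj dot P /\ forall u, nu u A = (rdot (P u) u)%:E.
  move=> A; have [mA|nA] := pselect (measurable A); last by exists (fun u => u).
  by have [P pP hP] := good_all mA; exists P.
exists P; split.
- by move=> A mA; apply: rproj_orth; exact: (hP A mA).1.
- move=> u; have [pT hT] := hP setT measurableT.
  apply/esym/subr0_eq/(@hnorm_eq0 _ _ dot)/eqP.
  rewrite -sqrf_eq0; have := rproj_pyth u pT; rewrite -(rproj_sqr _ pT).
  by have := hT u; rewrite nuT => -[<-]; lra.
(* The interval is half-open and [E_low] needs a strict inequality, so its left end lies one unit
   below [- |K|]. *)
move=> u; pose a : R := - `|K| - 1; pose b : R := `|K|.
have ab : a <= b by rewrite /a /b; have := normr_ge0 K; lra.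
pose I : mset R := `]a, b]%classic.
have mI : measurable I by exact: measurable_itv.
have nuIC : nu u (~` I) = 0%E.
  rewrite -setTD measureD//=; last by rewrite nuT ltry.
  rewrite setTI nuT nu_itv// E_high ?ler_norm// E_low; last first.
    by rewrite /a; have := ler_norm K; lra.
  by rewrite rdot0l subr0 hnorm_sqr -EFinB subrr.
exists (nu u); split.
- by move=> A mA; exact: (hP A mA).2.
- apply/(negligible_integrable (measurableC mI) measurableT _ nuIC).
    exact: EFin_measurable.
  by rewrite setTD setCK; exact: int_itv.
have -> : \int[nu u]_x x = \int[nu u]_(x in I) x.
  rewrite /Rintegral (negligible_integral (measurableC mI) measurableT _ nuIC).
    by rewrite setTD setCK.
  apply/(negligible_integrable (measurableC mI) measurableT _ nuIC).
    by [].
  by rewrite setTD setCK; exact: int_itv.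
rewrite (dotE dot); apply: complex_eq => /=; last first.
  have : rdot (T u) ('i%C *: u) = - rdot (T u) ('i%C *: u).
    by rewrite {1}sT (linZ lT) -rdotIr rdotC.
  by lra.
have e1 : E b u - E a u = u by rewrite E_high ?ler_norm// E_low ?subr0// /a; have := ler_norm K; lra.
apply/eqP; rewrite -subr_eq0 -normr_eq0 eq_le normr_ge0 andbT.
apply/ler_addgt0Pl => e e0.
have [n hn] := pow_half_le ((b - a) * (F u b - F u a)) e0.
have := itv_form u n ab; rewrite e1 => /le_trans; apply.
by lra.
Qed.

End SpectralMeasure.

Lemma spectral_theorem (R : realType) (V : lmodType R[i])
    (dot : {dot V for @Num.conj R[i]}) (T : V -> V) (K : R) :
  hcomplete dot -> islin T -> rsym dot T -> hbounded dot K T ->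
  is_spectral_measure dot T (spectral_measure dot T).
Proof.
move=> cV lT sT bT.
have /choice[E hE] := fun l => spectral_family cV l lT sT bT.
apply: (@xgetPex _ _ [set E | is_spectral_measure dot T E]).
apply: (@spectral_measure_exists _ _ dot cV T K E) => //.
- by move=> l; have [] := hE l.
- by move=> l; have [] := hE l.
- by move=> l; have [] := hE l.
- by move=> l; have [] := hE l.
- by move=> l; have [] := hE l.
Qed.

(** * Null sets of measures on the line *)

Section NullCovers.
Variable R : realType.
Implicit Types nu : {measure set (measurableTypeR R) -> \bar R}.

(** Lindelof: each point lies in a null interval with rational end points, and there are countably
    many of these. *)
Lemma locally_null nu (O : set R) :
  (forall x, O x -> exists2 r : R, 0 < r & nu `]x - r, x + r[%classic = 0%E) ->
  nu.-negligible O.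
Proof.
move=> h.
pose Ipq (pq : rat * rat) : mset R := `]ratr pq.1, ratr pq.2[%classic.
pose F n : mset R := if unpickle n is Some pq then
  (if `[< nu (Ipq pq) = 0%E >] then Ipq pq else set0) else set0.
have mI pq : measurable (Ipq pq) by exact: measurable_itv.
apply: (@negligibleS _ _ _ nu (\bigcup_n F n)).
  move=> x Ox; have [r r0 nx] := h x Ox.
  have xr : x - r < x by lra.
  have rx : x < x + r by lra.
  have [p] := rat_in_itvoo xr; have [q] := rat_in_itvoo rx.
  rewrite !in_itv/= => /andP[q1 q2] /andP[p1 p2].
  have nI : nu (Ipq (p, q)) = 0%E.
    apply/eqP; rewrite eq_le measure_ge0 andbT -nx; apply: le_measure; rewrite ?inE//.
    move=> y; rewrite /= !in_itv/= => /andP[y1 y2].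
    by rewrite (lt_trans p1)// (lt_trans y2).
  have FE : F (pickle (p, q)) = Ipq (p, q).
    by rewrite /F pickleK; case: asboolP.
  exists (pickle (p, q)); first by [].
  by rewrite FE /Ipq /= in_itv/= p2.
apply: negligible_bigcup => n; rewrite /F; case: unpickle => [pq|].
  case: asboolP => [e|_]; last exact: negligible_set0.
  by apply/negligibleP.
exact: negligible_set0.
Qed.

(** A cover of [S] by intervals of small total length is clipped to the window. Each clipped piece
    lies in some [[m - s, m + s]] to which the hypothesis applies, so the measure is absolutely
    continuous there. *)
Lemma null_of_lipschitz nu (l r C : R) (S : mset R) : 0 < r ->
  (forall m e, `|m - l| < r -> 0 < e -> e <= r ->
     (nu `[(m - e)%R, (m + e)%R]%classic <= (C * e)%:E)%E) ->
  measurable S -> lebesgue_measure S = 0%E ->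
  nu (S `&` `]l - r, l + r[%classic) = 0%E.
Proof.
move=> r0 h mS S0; pose J : mset R := `]l - r, l + r[%classic.
have mJ : measurable J by exact: measurable_itv.
apply/eqP; rewrite eq_le measure_ge0 andbT; apply/lee_addgt0Pr => e e0; rewrite add0e.
pose C1 := `|C| + 1; have C0 : 0 < C1 by rewrite ltr_wpDl.
pose d := e / C1; have d0 : 0 < d by rewrite divr_gt0.
have : (lebesgue_measure S < d%:E)%E by rewrite S0.
move=> /ereal_inf_lt[_  [F [mF SF] <-] Fd].
have mF' k : measurable (F k : mset R) by apply: sub_sigma_algebra.
have mFJ k : measurable (F k `&` J : mset R) by exact: measurableI.
have key k : (nu (F k `&` J) <= C1%:E * wlength idfun (F k))%E.
  have [[a b] _  <-] := mF k.
  case: (ltP a b) => ab; last first.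
    rewrite (_ : [set` `]a, b]] = set0) ?set0I ?measure0 ?mule0//.
    by apply/set_itv_ge; rewrite -leNgt.
  rewrite wlength_itv_bnd ?(ltW ab)//=.
  pose a' := Num.max a (l - r); pose b' := Num.min b (l + r).
  case: (ltP a' b') => ab'; last first.
    rewrite (_ : _ `&` _ = set0) ?measure0.
      by rewrite lee_fin mulr_ge0// ?subr_ge0 ltW.
    apply/seteqP; split => x [] /=; rewrite !in_itv/= => /andP[x1 x2] /andP[x3 x4].
    have : a' < x by rewrite gt_max x1.
    have : x <= b' by rewrite le_min x2 ltW.
    by lra.
  have /andP[a1 a2] : (a <= a') && (l - r <= a') by rewrite !le_max !lexx orbT.
  have /andP[b1 b2] : (b' <= b) && (b' <= l + r) by rewrite !ge_min !lexx orbT.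
  pose m := (a' + b') / 2; pose s := (b' - a') / 2.
  have hm : `|m - l| < r by rewrite /m ltr_norml; lra.
  have s0 : 0 < s by rewrite /s; lra.
  have sr : s <= r by rewrite /s; lra.
  rewrite (@le_trans _ _ (nu `[m - s, m + s]%classic))//.
    apply: le_measure; rewrite ?inE//; first exact: measurableI.
    move=> x [] /=; rewrite !in_itv/= => /andP[x1 x2] /andP[x3 x4].
    have -> : m - s = a' by rewrite /m /s; lra.
    have -> : m + s = b' by rewrite /m /s; lra.
    by rewrite ge_max le_min x2 (ltW x1) (ltW x3) (ltW x4).
  rewrite (le_trans (h _ _ hm s0 sr))// lee_fin /C1.
  rewrite (@le_trans _ _ (`|C| * s))//; first by rewrite ler_wpM2r ?ler_norm.
  have := normr_ge0 C; rewrite /s; nra.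
apply: (@le_trans _ _ (\sum_(k <oo) nu (F k `&` J))%E).
  apply: (@le_trans _ _ (nu (\bigcup_k (F k `&` J)))).
    apply: le_measure; rewrite ?inE; [exact: measurableI|exact: bigcupT_measurable|].
    by move=> x [/SF[k _ Fx] Jx]; exists k.
  by apply: generalized_Boole_inequality => //; exact: bigcupT_measurable.
apply: (@le_trans _ _ (\sum_(k <oo) (C1%:E * wlength idfun (F k)))%E).
  exact: lee_nneseries => [k *|k *].
rewrite nneseriesZl//.
have -> : e = C1 * d by rewrite mulrCA divff ?mulr1.
by rewrite EFinM lee_pmul2l// ltW.
Qed.

End NullCovers.

(** * Calculus with a given spectral measure *)

Section SpectralMeasureTheory.
Variables (R : realType) (V : lmodType R[i]) (dot : {dot V for @Num.conj R[i]}).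
Implicit Types (u v w f : V) (l m : R) (A B : mset R).
Local Notation rdot := (reform dot).
Local Notation N := (hnorm dot).
Variables (T : V -> V) (P : mset R -> V -> V).
Hypotheses (lT : islin T) (sT : rsym dot T).
Hypothesis hP : is_spectral_measure dot T P.

Lemma spectral_proj A : measurable A -> rproj dot (P A).
Proof. by move=> mA; case: hP => h _ _; apply: orth_rproj; exact: h. Qed.
Lemma spectral_setT u : P setT u = u.
Proof. by case: hP. Qed.

Lemma spectral_nu u : exists nu : {measure set (measurableTypeR R) -> \bar R},
  [/\ forall A, measurable A -> nu A = (N (P A u) ^+ 2)%:E,
      nu.-integrable setT (fun x => x%:E) & rdot (T u) u = \int[nu]_x x].
Proof.
case: hP => _ _ /(_ u)[nu [h1 h2 h3]]; exists nu; split => //.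
  by move=> A mA; rewrite h1// -rproj_sqr//; exact: spectral_proj.
by rewrite /reform h3.
Qed.

Lemma spectral_add A B u : measurable A -> measurable B -> A `&` B = set0 ->
  P (A `|` B) u = P A u + P B u.
Proof.
move=> mA mB AB; have mAB : measurable (A `|` B) by exact: measurableU.
have [lA _ sA] := spectral_proj mA; have [lB _ sB] := spectral_proj mB.
have [lC _ sC] := spectral_proj mAB.
apply/subr0_eq.
pose D u := P (A `|` B) u - (P A u + P B u).
apply: (@rsym_form0 _ _ dot D).
- by apply: islinB => //; exact: islinD.
- by move=> v w; rewrite !(rdotBl, rdotBr, rdotDl, rdotDr) sA sB sC.
move=> v; have [nu [h _ _]] := spectral_nu v.
have : nu (A `|` B) = (nu A + nu B)%E by rewrite measureU.
rewrite !h// => -[e].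
by rewrite rdotBl rdotDl !rproj_sqr ?e ?subrr//; exact: spectral_proj.
Qed.

Lemma spectral_ortho A B u : measurable A -> measurable B -> A `&` B = set0 ->
  P A (P B u) = 0.
Proof.
move=> mA mB AB; have mAB : measurable (A `|` B) by exact: measurableU.
have pB := spectral_proj mB; have pC := spectral_proj mAB.
have [_ B2 _] := pB.
apply: (@hnorm_sqr_le0 _ _ dot).
have : rdot (P (A `|` B) (P B u)) (P B u) <= N (P B u) ^+ 2.
  by rewrite rproj_sqr// ler_sqr ?nnegrE// rproj_le.
by rewrite spectral_add// rdotDl B2 (rproj_sqr _ (spectral_proj mA)) -hnorm_sqr; lra.
Qed.

Lemma spectral_setI A B u : measurable A -> measurable B ->
  P A (P B u) = P (A `&` B) u.
Proof.
move=> mA mB; have mI := measurableI _ _ mA mB; have mD := measurableD mA mB.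
have mD' := measurableD mB mA.
have splitID (S S' : mset R) : S `&` S' `|` S `\` S' = S.
  apply/seteqP; split => x; first by move=> [] [].
  by have [Bx|nBx] := pselect (S' x); [left|right].
have e1 v : P A v = P (A `&` B) v + P (A `\` B) v.
  rewrite -spectral_add//; first by rewrite splitID.
  by apply/seteqP; split => x //= [[_ ?] [_ ?]].
have e2 v : P B v = P (A `&` B) v + P (B `\` A) v.
  rewrite -spectral_add//; first by rewrite (setIC A) splitID.
  by apply/seteqP; split => x //= [[? _] [_ ?]].
have [lI I2 _] := spectral_proj mI.
rewrite e1 (@spectral_ortho (A `\` B))//; last first.
  by apply/seteqP; split => x //= [[_ ?] ?].
rewrite e2 (linD lI) I2 spectral_ortho ?addr0//.
by apply/seteqP; split => x //= [[? _] [_ ?]].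
Qed.

Lemma spectral_compl A u : measurable A -> P (~` A) u = u - P A u.
Proof.
move=> mA; have := spectral_add u mA (measurableC mA) (setICr A).
by rewrite setUCr spectral_setT => /eqP; rewrite addrC -subr_eq => /eqP.
Qed.

(** Only the quadratic form of [T] is given as an integral, so commutation must be derived. For [a]
    in the range of [P A] and [b] in that of the complement, the measure of [a + b] is the sum of
    the measures of [a] and [b]; hence the cross term [<T a, b>] vanishes. *)
Lemma spectral_comm A u : measurable A -> T (P A u) = P A (T u).
Proof.
move=> mA; have mC := measurableC mA.
have [lA A2 sA] := spectral_proj mA.
have key v w : rdot (T (P A v)) (w - P A w) = 0.
  rewrite -spectral_compl//; set a := P A v; set b := P (~` A) w.
  have cross B : measurable B -> rdot (P B a) b = 0.
    move=> mB; rewrite spectral_setI//.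
    have [_ _ sC] := spectral_proj mC.
    rewrite -sC spectral_ortho ?rdot0l//; first exact: measurableI.
    by apply/seteqP; split => x //= [? [_ ?]].
  have [na [ha ia Ta]] := spectral_nu a; have [nb [hb ib Tb]] := spectral_nu b.
  have [nc [hc ic Tc]] := spectral_nu (a + b).
  have : rdot (T (a + b)) (a + b) = rdot (T a) a + rdot (T b) b.
    rewrite Ta Tb Tc -fineD; [|exact: integrable_fin_num..].
    congr fine; rewrite -integral_measure_add//; apply: eq_measure_integral => B mB _.
    have [lB _ sB] := spectral_proj mB.
    rewrite -[RHS]/(measure_add na nb B) measure_addE hc// ha// hb// (linD lB) hnorm_sqrD.
    have [_ B2 _] := spectral_proj mB.
    by rewrite -sB B2 cross// mulr0 addr0.
  rewrite (linD lT) !(rdotDl, rdotDr) (rdotC dot (T b) a) -sT; lra.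
have h v : T (P A v) = P A (T (P A v)).
  apply/subr0_eq/(@rdot_eq0 _ _ dot).
  have := key v (T (P A v)); set y := T (P A v) => e.
  by rewrite {1}rdotBl e (sA y) (linB lA) A2 subrr rdot0r subrr.
rewrite h; apply/subr0_eq/(@rdot_eq0 _ _ dot).
set z := _ - _.
have q1 : rdot (P A (T (P A u))) z = rdot u (P A (T (P A z))) by rewrite sA sT.
have q2 : rdot (P A (T u)) z = rdot u (T (P A z)) by rewrite sA.
by rewrite rdotBl q1 q2 -h subrr.
Qed.

Lemma spectral_form_bounds A v : measurable A -> P A v = v ->
  (forall c, (forall x, A x -> x <= c) -> rdot (T v) v <= c * N v ^+ 2) /\
  (forall c, (forall x, A x -> c <= x) -> c * N v ^+ 2 <= rdot (T v) v).
Proof.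
move=> mA Av; have [nu [hnu inu ->]] := spectral_nu v.
have nuC : nu (~` A) = 0%E.
  by rewrite hnu ?spectral_compl ?Av ?subrr ?hnorm0 ?expr0n//; exact: measurableC.
have nuA : fine (nu A) = N v ^+ 2 by rewrite hnu//= Av.
have iA : nu.-integrable A (EFin \o (fun x : R => x)).
  exact: integrableS inu.
have icst c : nu.-integrable A (EFin \o (fun _ : R => c)).
  apply: measurable_bounded_integrable => //; first by rewrite hnu// ltry.
  exact: bounded_cst.
rewrite (_ : \int[nu]_x x = \int[nu]_(x in A) x); last first.
  rewrite /Rintegral (negligible_integral (measurableC mA) measurableT inu nuC).
  by rewrite setTD setCK.
by split=> c hc; rewrite -nuA -Rintegral_cst//; apply: le_Rintegral.
Qed.

Lemma spectral_local A l (e : R) u : measurable A -> 0 <= e ->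
  A `<=` `[l - e, l + e]%classic -> P A u = u -> N (T u - l%:C *: u) <= e * N u.
Proof.
move=> mA e0 sub; have pA := spectral_proj mA; have [lA A2 sA] := pA.
pose D v := T v - l%:C *: v.
have lD : islin D by apply: islinB => //; apply: islinZ.
apply: (@rsym_numrange _ _ dot [set v | P A v = v] D) => //.
- by move=> v w; rewrite rdotBl rdotBr rdotZl rdotZr sT.
- by move=> v w /= hv hw; rewrite (linD lA) hv hw.
- by move=> a v /= hv; rewrite (linZ lA) hv.
- by move=> v /= hv; rewrite (linB lA) (linZ lA) -spectral_comm// hv.
move=> v Av; rewrite rdotBl rdotZl -hnorm_sqr.
have [h1 h2] := spectral_form_bounds mA Av.
have : rdot (T v) v <= (l + e) * N v ^+ 2 by apply: h1 => x /sub; rewrite /= in_itv => /andP[].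
have : (l - e) * N v ^+ 2 <= rdot (T v) v by apply: h2 => x /sub; rewrite /= in_itv => /andP[].
by rewrite ler_norml; lra.
Qed.

(* The bound on [<E(I) f, f>] makes the spectral measure of each f of D absolutely
   continuous near l. *)
Definition smooth_point (D : set V) l := exists2 r : R, 0 < r & forall f, D f ->
  exists C : R, forall m e, `|m - l| < r -> 0 < e -> e <= r ->
    N (P `[(m - e)%R, (m + e)%R]%classic f) ^+ 2 <= C * e.

(** The measure of [u] vanishes near every smooth point. The remaining points are isolated
    exceptions or belong to the finite list [X]; they carry no mass since [u] has no atom. *)
Lemma no_singular_continuous (X : seq R) (Df : set V) u :
  (forall u, (forall f, Df f -> rdot u f = 0) -> u = 0) ->
  (forall l, l \notin X -> exists2 r : R, 0 < r & forall m, `|m - l| < r -> m <> l ->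
     smooth_point Df m) ->
  (forall x, P [set x] u = 0) ->
  (exists S : mset R, [/\ measurable S, lebesgue_measure S = 0%E & P (~` S) u = 0]) ->
  u = 0.
Proof.
move=> dense hX noatom [S [mS S0 uS]].
have [nu [hnu _ _]] := spectral_nu u.
have uE : P S u = u.
  by have := spectral_compl u mS; rewrite uS => /esym/eqP; rewrite subr_eq0 => /eqP.
have atom x : nu [set x] = 0%E.
  by rewrite hnu ?noatom ?hnorm0 ?expr0n.
(* For [f] in [Df] the measure of [f] is Lipschitz on [J], so it does not charge the Lebesgue-null
   set [J] meet [S]. Thus [P J u = P (J meet S) u] is orthogonal to the total set [Df]. *)
have sp l : smooth_point Df l -> exists2 r : R, 0 < r & nu `]l - r, l + r[%classic = 0%E.
  move=> [r r0 hr]; exists r => //; set J := [set` _].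
  have mJ : measurable J by exact: measurable_itv.
  suff -> : nu J = (N (P J u) ^+ 2)%:E; last by rewrite hnu.
  suff -> : P J u = 0 by rewrite hnorm0 expr0n.
  rewrite -uE spectral_setI//; apply: dense => f Dff.
  have mI : measurable (J `&` S) by exact: measurableI.
  have [_ _ sI] := spectral_proj mI; rewrite sI.
  have [C hC] := hr f Dff; have [nf [hnf _ _]] := spectral_nu f.
  suff -> : P (J `&` S) f = 0 by rewrite rdot0r.
  apply: (@hnorm_eq0 _ _ dot); apply/eqP; rewrite -sqrf_eq0; apply/eqP.
  apply: EFin_inj; rewrite -hnf// setIC; apply: (@null_of_lipschitz _ nf l r C) => //.
  by move=> m e h1 h2 h3; rewrite hnf// lee_fin hC.
have X0 : nu.-negligible [set x | x \notin X].
  apply: locally_null => l /hX[r r0 hr]; exists r => //.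
  apply/negligibleP => //; apply: (@negligibleS _ _ _ nu ((`]l - r, l + r[%classic `\ l) `|` [set l])).
    by move=> x hx; have [->|xl] := eqVneq x l; [right|left; split => //; exact/eqP].
  apply: negligibleU; last by apply/negligibleP; [|exact: atom].
  apply: locally_null => m [/= hm ml]; apply/sp/hr => //.
  by move: hm; rewrite in_itv/= ltr_norml; lra.
have X1 : nu.-negligible [set x | x \in X].
  elim: (X) => [|x s ih]; first by rewrite (_ : [set` [::]] = set0); [exact: negligible_set0|apply/seteqP; split].
  apply: (@negligibleS _ _ _ nu ([set x] `|` [set x | x \in s])).
    by move=> y /=; rewrite inE => /orP[/eqP ->|]; [left|right].
  by apply: negligibleU => //; apply/negligibleP; [|exact: atom].
have : nu.-negligible setT.
  rewrite (_ : setT = [set x | x \notin X] `|` [set x | x \in X]); first exact: negligibleU.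
  by apply/seteqP; split => // x _ /=; case: (x \in X); [right|left].
move=> h; have := hnu _ measurableT; rewrite (measure_negligible measurableT h) spectral_setT.
by move=> -[] /esym/eqP; rewrite sqrf_eq0 => /eqP/hnorm_eq0.
Qed.

End SpectralMeasureTheory.

(** * One-variable calculus and Gronwall's inequality *)

Section RealCalculus.
Variable R : realType.

Lemma is_derive_of_quadratic (f : R -> R) (x d C : R) :
  (forall h, `|h| <= 1 -> `|f (x + h) - f x - h * d| <= C * h ^+ 2) -> is_derive x 1 f d.
Proof.
move=> hf; have C0 : 0 <= C.
  by have := hf 1; rewrite normr1 expr1n mulr1 => /(_ (lexx _)); apply: le_trans.
suff cv : h^-1 *: (f (h *: 1%R + x) - f x) @[h --> 0^'] --> d.
  by split; [apply/cvg_ex; exists d|exact: cvg_lim cv].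
apply/cvgrPdist_le => e e0; near=> h.
have h0 : h != 0 by near: h; exact: nbhs_dnbhs_neq.
have hp : 0 < `|h| by rewrite normr_gt0.
have h1 : `|h| <= 1 by near: h; apply: dnbhs0_le.
have h2 : `|h| <= e / (C + 1) by near: h; apply: dnbhs0_le.
rewrite [h *: 1%R]mulr1 (addrC h) -(ler_pM2l hp) -normrM mulrBr.
rewrite [X in _ - X](_ : _ = f (x + h) - f x); last by rewrite mulrA divff// mul1r.
rewrite distrC (le_trans (hf h h1))// -real_normK ?num_real// mulrCA ler_wpM2l//.
rewrite (le_trans (ler_wpM2l C0 h2))// mulrCA ler_piMr//.
by rewrite ler_pdivrMr ?mul1r ?lerDl.
Unshelve. all: by end_near. Qed.

Lemma is_derive_scale (f : R -> R) (a x df : R) :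
  is_derive (a * x) 1 f df -> is_derive x 1 (fun r => f (a * r)) (a * df).
Proof.
move=> h; have d : is_derive x 1 (fun r : R => a * r) a by apply: is_derive_eq; rewrite [LHS]mulr1.
by have := @is_derive1_comp _ f (fun r => a * r) x _ _ h d; rewrite mulrC.
Qed.

(** The function [(1 + F s) exp (A s)] is nondecreasing on [[0, 1]]. The estimate is transported
    backwards, from the fully regularized end 1 to the unregularized end 0. *)
Lemma gronwall01 (F F' : R -> R) (A : R) : (forall s, 0 <= F s) ->
  (forall s : R, is_derive s 1 F (F' s)) -> (forall s, 0 < s -> s < 1 -> `|F' s| <= A * (1 + F s)) ->
  1 + F 0 <= (1 + F 1) * expR A.
Proof.
move=> F0 dF bF; pose G s := (1 + F s) * expR (A * s).
have dG (s : R) : is_derive s 1 G (F' s * expR (A * s) + (1 + F s) * (A * expR (A * s))).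
  have d1 : is_derive s 1 (fun s => 1 + F s) (F' s).
    have h := is_deriveD (is_derive_cst (1 : R) s 1) (dF s).
    by rewrite add0r in h.
  rewrite (_ : _ + _ = (1 + F s) *: (A * expR (A * s)) + expR (A * s) *: F' s).
    exact: is_deriveM d1 (is_derive_scale (is_derive_expR (A * s))).
  by rewrite addrC; congr (_ + _); rewrite [LHS]mulrC.
have cG : {within `[0, 1], continuous G}.
  apply: continuous_subspaceT => s.
  by apply: differentiable_continuous; apply/derivable1_diffP.
have [c c01 eG] := MVT ltr01 (fun x _ => dG x) cG.
have : G 0 <= G 1.
  rewrite -subr_ge0 eG subr0 mulr1 mulrA -mulrDl mulr_ge0//.
  move: c01; rewrite in_itv => /andP[c0 c1].
  by have := bF c c0 c1; rewrite ler_norml; lra.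
by rewrite /G mulr0 expR0 !mulr1.
Qed.

End RealCalculus.

(** * Virial identity and limiting absorption estimate *)

Section ConjugateFamily.
Variables (R : realType) (V : lmodType R[i]) (dot : {dot V for @Num.conj R[i]}).
Implicit Types (u v w f g h : V) (t l e : R).
Local Notation rdot := (reform dot).
Local Notation N := (hnorm dot).
Hypothesis cV : hcomplete dot.
Variables (H B : V -> V) (U U' : R -> V -> V) (K KB c : R).
Hypotheses (lH : islin H) (sH : rsym dot H) (bH : hbounded dot K H).
Hypotheses (lB : islin B) (sB : rsym dot B) (bB : hbounded dot KB B).
Hypotheses (K0 : 0 <= K) (KB0 : 0 <= KB) (c0 : 0 <= c).
Hypothesis lU : forall t, `|t| <= 2^-1 -> islin (U t).
Hypothesis lU' : forall t, `|t| <= 2^-1 -> islin (U' t).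
Hypothesis UU' : forall t u, `|t| <= 2^-1 -> U t (U' t u) = u.
Hypothesis U'U : forall t u, `|t| <= 2^-1 -> U' t (U t u) = u.
Hypothesis isoU : forall t u v, `|t| <= 2^-1 -> rdot (U t u) (U t v) = rdot u v.
Hypothesis contU' : forall u e, 0 < e -> exists2 d, 0 < d &
  forall t, `|t| <= d -> `|t| <= 2^-1 -> N (U' t u - u) <= e.
Hypothesis jetH : forall t u, `|t| <= 2^-1 ->
  N (U t (H (U' t u)) - H u - t%:C *: B u) <= c * t ^+ 2 * N u.
Hypothesis jetB : forall t u, `|t| <= 2^-1 ->
  N (U t (B (U' t u)) - B u) <= c * `|t| * N u.

Let normU t u : `|t| <= 2^-1 -> N (U t u) = N u.
Proof. by move=> ht; rewrite /hnorm -!/(rdot _ _) isoU. Qed.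
Let normU' t u : `|t| <= 2^-1 -> N (U' t u) = N u.
Proof. by move=> ht; rewrite -(normU _ ht) UU'. Qed.
Let adjU t u v : `|t| <= 2^-1 -> rdot (U t u) v = rdot u (U' t v).
Proof. by move=> ht; rewrite -{1}(UU' v ht) isoU. Qed.
Let adjU' t u v : `|t| <= 2^-1 -> rdot (U' t u) v = rdot u (U t v).
Proof. by move=> ht; rewrite rdotC -adjU// rdotC. Qed.

Let small e d : 0 < e -> 0 < d -> exists t : R, [/\ 0 < t, t <= e, t <= d & t <= 2^-1].
Proof.
move=> e0 d0; exists (Num.min e (Num.min d 2^-1)).
by rewrite !lt_min e0 d0 invr_gt0 ltr0n !ge_min !lexx !orbT.
Qed.

Let vsubACA (x y z w : V) : (x - y) - (z - w) = (x - z) - (y - w).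
Proof. by rewrite !opprD addrACA. Qed.

Lemma le_of_eps (x y w : R) : (forall e, 0 < e -> e <= 1 -> x <= y + e * w) -> x <= y.
Proof.
move=> h; apply/ler_addgt0Pr => e e0.
pose d := Num.min 1 (e / (`|w| + 1)).
have d0 : 0 < d by rewrite lt_min ltr01 divr_gt0.
have d1 : d <= 1 by rewrite ge_min lexx.
rewrite (le_trans (h d d0 d1))//.
have : d * (`|w| + 1) <= e by rewrite -ler_pdivlMr// ge_min lexx orbT.
by have := ler_norm w; nra.
Qed.

(** Because [H u = l u], the form [<(U t H U t^-1 - H) U t u, u>] is exactly zero. Its expansion
    starts with [t <B (U t u), u>]; divide by [t] and let [t] tend to 0. *)
Lemma virial l u : H u = l%:C *: u -> rdot (B u) u = 0.
Proof.
move=> Hu; apply/eqP; rewrite -normr_eq0 eq_le normr_ge0 andbT.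
apply: (@le_of_eps _ _ (KB * N u + c * N u ^+ 2)) => e e0 e1.
have [d d0 hd] := contU' u e0; have [t [t0 te td t2]] := small e0 d0.
have at2 : `|t| <= 2^-1 by rewrite gtr0_norm.
have atd : `|t| <= d by rewrite gtr0_norm.
have e_U : N (U t u - u) <= e.
  have := hd t atd at2; rewrite -(normU (U' t u - u) at2) (linB (lU at2)) UU'//.
  by rewrite hnorm_distC.
have z : rdot (U t (H (U' t (U t u))) - H (U t u)) u = 0.
  by rewrite U'U// rdotBl sH Hu (linZ (lU at2)) rdotZl rdotZr subrr.
have h1 := jetH (U t u) at2; rewrite normU// in h1.
have h2 := rdot_CS dot (U t (H (U' t (U t u))) - H (U t u) - t%:C *: B (U t u)) u.
rewrite rdotBl z sub0r normrN rdotZl normrM (gtr0_norm t0) in h2.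
have h3 : t * `|rdot (B (U t u)) u| <= t * (c * t * N u ^+ 2).
  by rewrite (le_trans h2)// (le_trans (ler_wpM2r (hnorm_ge0 _ _) h1))//; lra.
rewrite ler_pM2l// in h3.
have h4 : `|rdot (B (U t u - u)) u| <= KB * e * N u.
  rewrite (le_trans (rdot_CS _ _ _))// ler_wpM2r// (le_trans (bB _))//.
  by rewrite ler_wpM2l.
have -> : rdot (B u) u = rdot (B (U t u)) u - rdot (B (U t u - u)) u.
  by rewrite -rdotBl -(linB lB) subKr.
rewrite (le_trans (ler_normB _ _))//.
have : c * t * N u ^+ 2 <= c * e * N u ^+ 2.
  by rewrite ler_wpM2r// ler_wpM2l.
lra.
Qed.

Section LimitingAbsorption.
Variables (Nn cc lmax l eta : R).
Hypotheses (Nn0 : 0 <= Nn) (cc0 : 0 < cc) (lmax0 : 0 <= lmax) (hl : `|l| <= lmax).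
Hypotheses (eta0 : 0 < eta) (eta1 : eta <= 1).

(** Mourre's regularization with [M = B + Nn (H - l)^2] in place of a localized commutator: [M] is
    at least [cc] on the whole space. [L false e] is [H - l - i (eta + e M)] and [L true e] is its
    adjoint. The constants [m] and [cM] bound [M] and its variation under the dilations. *)
Let Hl u := H u - l%:C *: u.
Let M u := B u + Nn%:C *: Hl (Hl u).
Let Q (e : R) u := eta%:C *: u + e%:C *: M u.
Let z (b : bool) : R[i] := if b then - 'i%C else 'i%C.
Let L b e u := Hl u - z b *: Q e u.
Let m := KB + Nn * (K + lmax) ^+ 2.
Let cM := c + 2 * Nn * (K + lmax) * (KB + c).

Let rdotz b u v : rdot (z b *: u) v = - rdot u (z b *: v).
Proof. by case: b; rewrite ?scaleNr ?rdotNl ?rdotNr rdotIr. Qed.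
Let rdotzz b u v : rdot (z b *: u) (z b *: v) = rdot u v.
Proof. by case: b; rewrite ?scaleNr ?rdotNl ?rdotNr ?opprK rdotII. Qed.
Let hnormz b u : N (z b *: u) = N u.
Proof. by case: b; rewrite ?scaleNr ?hnormNE hnormI. Qed.
Let zN b : z (~~ b) = - z b.
Proof. by case: b; rewrite //= opprK. Qed.
Let lHl : islin Hl.
Proof. by apply: islinB => //; apply: islinZ. Qed.
Let sHl : rsym dot Hl.
Proof. by move=> u v; rewrite rdotBl rdotBr rdotZl rdotZr sH. Qed.
Let lM : islin M.
Proof. by apply: islinD => //; apply: islinZ; exact: islin_comp. Qed.
Let sM : rsym dot M.
Proof. by move=> u v; rewrite rdotDl rdotDr rdotZl rdotZr sB !sHl. Qed.
Let lQ e : islin (Q e).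
Proof. by apply: islinD; apply: islinZ. Qed.
Let sQ e : rsym dot (Q e).
Proof. by move=> u v; rewrite rdotDl rdotDr !rdotZl !rdotZr sM. Qed.
Let lL b e : islin (L b e).
Proof. by apply: islinB => //; apply: islinZ. Qed.

Let bHl : hbounded dot (K + lmax) Hl.
Proof.
move=> u; rewrite (le_trans (hnorm_triangB _ _ _))// hnorm_real mulrDl.
by rewrite lerD// ler_wpM2r.
Qed.

Let bM : hbounded dot m M.
Proof.
move=> u; rewrite (le_trans (hnorm_triang _ _ _))// hnorm_real mulrDl lerD//.
rewrite ger0_norm// -mulrA ler_wpM2l// (le_trans (bHl _))// -mulrA.
by rewrite ler_wpM2l.
Qed.

Let bQ e u : 0 <= e -> N (Q e u) <= (eta + e * m) * N u.
Proof.
move=> e0; rewrite (le_trans (hnorm_triang _ _ _))// !hnorm_real !ger0_norm// mulrDl lerD//.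
by rewrite -mulrA ler_wpM2l.
Qed.

Let jetH1 t u : `|t| <= 2^-1 -> N (U t (H (U' t u)) - H u) <= (KB + c) * `|t| * N u.
Proof.
move=> ht; rewrite -[X in N X](subrK (t%:C *: B u)) (le_trans (hnorm_triang _ _ _))//.
have := jetH u ht; rewrite hnorm_real.
have h3 : `|t| * N (B u) <= `|t| * (KB * N u) by rewrite ler_wpM2l.
have h4 : c * t ^+ 2 * N u <= c * `|t| * N u.
  rewrite ler_wpM2r// ler_wpM2l// -real_normK ?num_real//.
  by rewrite ler_piMr// (le_trans ht)// invf_le1 ?ler1n.
by lra.
Qed.

Let UHl t u : `|t| <= 2^-1 -> U t (Hl (U' t u)) = U t (H (U' t u)) - l%:C *: u.
Proof. by move=> ht; rewrite (linB (lU ht)) (linZ (lU ht)) UU'. Qed.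

Let jetM t u : `|t| <= 2^-1 -> N (U t (M (U' t u)) - M u) <= cM * `|t| * N u.
Proof.
move=> ht; pose X v := U t (Hl (U' t v)).
have XB v : X v - Hl v = U t (H (U' t v)) - H v.
  by rewrite /X UHl// opprB addrA subrK.
have bX v : N (X v) <= (K + lmax) * N v by rewrite normU// (le_trans (bHl _))// normU'.
have -> : U t (M (U' t u)) - M u = (U t (B (U' t u)) - B u) +
    Nn%:C *: ((X (X u) - Hl (X u)) + Hl (X u - Hl u)).
  rewrite (linB lHl) addrA subrK (linD (lU ht)) (linZ (lU ht)).
  by rewrite opprD addrACA -scalerBr /X U'U.
rewrite (le_trans (hnorm_triang _ _ _))// hnorm_real (ger0_norm Nn0).
have h1 := jetB u ht.
have h2 : N (X (X u) - Hl (X u) + Hl (X u - Hl u)) <=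
    2 * ((K + lmax) * ((KB + c) * `|t| * N u)).
  rewrite (le_trans (hnorm_triang _ _ _))// !XB mulr_natl lerD//.
    by rewrite (le_trans (jetH1 _ ht))// mulrCA ler_wpM2l.
  by rewrite (le_trans (bHl _))// ler_wpM2l// jetH1.
have h3 := ler_wpM2l Nn0 h2.
by rewrite /cM; lra.
Qed.

Let LL b e u v : rdot (L b e u) v = rdot u (L (~~ b) e v).
Proof. by rewrite rdotBl rdotBr sHl rdotz opprK zN scaleNr rdotNr opprK sQ (linZ (lQ e)). Qed.

Let Hl_im b u : rdot (Hl u) (z b *: u) = 0.
Proof.
have : rdot (Hl u) (z b *: u) = - rdot (Hl u) (z b *: u).
  by rewrite {1}sHl (linZ lHl) rdotC.
lra.
Qed.

Hypothesis mourre : forall u, cc * N u ^+ 2 <= rdot (B u) u + Nn * N (Hl u) ^+ 2.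

(** Pairing with [z b *: u] isolates the imaginary part of [L b e], since the real part [H - l] is
    symmetric. What remains is the form of [eta + e M]. *)
Let coer b e u : 0 <= e -> (eta + e * cc) * N u ^+ 2 <= - rdot (L b e u) (z b *: u).
Proof.
move=> e0; rewrite rdotBl Hl_im rdotzz !rdotDl !rdotZl !rdotDl rdotZl sHl -!hnorm_sqr.
by have := ler_wpM2l e0 (mourre u); lra.
Qed.

Let below b e u : 0 <= e -> (eta + e * cc) * N u <= N (L b e u).
Proof.
by move=> e0; apply: (coercive_le (hnormz b u)); rewrite (le_trans (coer b u e0))// -normrN ler_norm.
Qed.

Let bL b e : 0 <= e -> hbounded dot (K + lmax + (eta + e * m)) (L b e).
Proof. by move=> e0 u; rewrite (le_trans (hnorm_triangB _ _ _))// hnormz mulrDl lerD// bQ. Qed.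

(** The existence claim covers negative parameters with an arbitrary value, so that a single choice
    produces one resolvent family in both arguments. *)
Let G_ex (p : bool * R) : exists G, 0 <= p.2 -> [/\ islin G, forall u, L p.1 p.2 (G u) = u,
  forall u, G (L p.1 p.2 u) = u & hbounded dot (eta + p.2 * cc)^-1 G].
Proof.
case: p => b e; have [e0|] := boolP (0 <= e); last by exists id.
have k0 : 0 < eta + e * cc by [].
have [||G hG] := @invertible_of_bounded_below _ _ dot cV _ _ _ _ (lL b e) (bL b e0) (LL b e) k0.
- by move=> u; exact: below.
- move=> u Lu; apply: (@hnorm_le0 _ _ dot).
  by have := below (~~ b) u e0; rewrite Lu hnorm0 pmulr_rle0.
by exists G.
Qed.

Variables (f : V) (ell : R).
Hypothesis ell0 : 0 <= ell.
Hypothesis hf : forall t, `|t| <= 2^-1 -> N (U' t f - f) <= ell * `|t|.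

(** [mu] satisfies [eta + e m <= mu (eta + e cc)], comparing the size of the regularizer with its
    coercivity constant. [A] collects the terms of the differential inequality [bF]; it depends
    neither on [eta] nor on [l], which is the whole point. *)
Let mu := 1 + m / cc.
Let A := 2 * (2 * ell * (cc^-1 + 1) + cM / cc + 2 * Nn * (N f ^+ 2 + mu ^+ 2 * (1 + cc))).

Let m0 : 0 <= m. Proof. by rewrite /m. Qed.
Let cM0 : 0 <= cM. Proof. by rewrite /cM. Qed.

Section Flow.
Variable G : bool -> R -> V -> V.
Hypothesis hG : forall b e, 0 <= e -> [/\ islin (G b e), forall u, L b e (G b e u) = u,
  forall u, G b e (L b e u) = u & hbounded dot (eta + e * cc)^-1 (G b e)].
Let g b e := G b e f.
(** The imaginary part of [<g, f>] for the regularized resolvent vector [g], nonnegative by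
    coercivity. *)
Let F e := rdot (g false e) ('i%C *: f).

Let lG b e : 0 <= e -> islin (G b e).
Proof. by move=> /(hG b)[]. Qed.
Let LG b e u : 0 <= e -> L b e (G b e u) = u.
Proof. by move=> /(hG b)[]. Qed.
Let GL b e u : 0 <= e -> G b e (L b e u) = u.
Proof. by move=> /(hG b)[]. Qed.
Let bG b e : 0 <= e -> hbounded dot (eta + e * cc)^-1 (G b e).
Proof. by move=> /(hG b)[]. Qed.
Let GG b e u v : 0 <= e -> rdot (G b e u) v = rdot u (G (~~ b) e v).
Proof. by move=> e0; rewrite -{1}(LG (~~ b) v e0) -[b in rdot (G b _ _)]negbK -LL negbK LG. Qed.

Let Fg b e : 0 <= e -> (eta + e * cc) * N (g b e) ^+ 2 <= F e.
Proof.
move=> e0; rewrite (le_trans (coer b _ e0))// LG// rdotC rdotz opprK.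
case: b; rewrite /F GG// (linZ (lG _ e0)) scaleNr rdotNr rdotC rdotIr opprK.
by [].
Qed.

Let F0 e : 0 <= e -> 0 <= F e.
Proof. by move=> e0; rewrite (le_trans _ (Fg false e0)). Qed.

Let jetQ t e u : 0 <= e -> `|t| <= 2^-1 -> N (U t (Q e (U' t u)) - Q e u) <= e * (cM * `|t| * N u).
Proof.
move=> e0 ht; rewrite (linD (lU ht)) !(linZ (lU ht)) UU'// opprD addrACA subrr add0r -scalerBr.
by rewrite hnorm_real ger0_norm// ler_wpM2l// jetM.
Qed.

Let norm_rdot_le a b u v : N u <= a -> N v <= b -> `|rdot u v| <= a * b.
Proof. by move=> ha hb; rewrite (le_trans (rdot_CS _ _ _))// ler_pM. Qed.

(** [B] is to first order the change of [H] under [U t]. In the pairing of the two resolvent vectors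
    this change can be moved onto [f], where the Lipschitz orbit costs [ell t], and onto the
    regularizer, which costs [e cM t]. Divide by [t] and let [t] tend to 0. *)
Let commutator_bound e : 0 <= e -> `|rdot (B (g false e)) (g true e)| <=
  ell * (N (g false e) + N (g true e)) + cM * e * N (g false e) * N (g true e).
Proof.
move=> e0; set g1 := g false e; set h1 := g true e.
apply: (@le_of_eps _ _ (ell + c * N g1 * (N h1 + 1) + cM * e * N g1 + KB * N g1)) => d d0 d1.
have k0 : 0 < eta + e * cc by [].
have d2 : 0 < d / 2 by [].
have [r r0 hr] := contU' h1 d2.
have r'0 : 0 < Num.min d (d / 2 * (eta + e * cc) / (ell + 1)) by rewrite lt_min d0 /=.
have [t [t0 tr + t2]] := small r0 r'0; rewrite le_min ler_pdivlMr// => /andP[td tk].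
have at2 : `|t| <= 2^-1 by rewrite gtr0_norm.
pose ht := U t (G true e (U' t f)).
have U'ht : U' t ht = G true e (U' t f) by rewrite U'U.
have b0 := hf at2; rewrite (gtr0_norm t0) in b0.
have dht : N (ht - h1) <= d.
  rewrite -(normU' _ at2) (linB (lU' at2)) U'ht (le_trans (hnorm_dist_triang _ h1 _ _))//.
  have b1 : N (U' t h1 - h1) <= d / 2 by rewrite hr// gtr0_norm.
  have b2 : N (G true e (U' t f) - h1) <= d / 2.
    rewrite -(linB (lG _ e0)) (le_trans (bG _ e0 _))// ler_pdivrMl// (le_trans b0)//.
    by lra.
  by rewrite hnorm_distC in b1; lra.
have nht : N ht <= N h1 + d.
  by rewrite -lerBlDl (le_trans (hnorm_subrev _ _ _)).
pose DH := U t (H (U' t g1)) - H g1; pose DQ := U t (Q e (U' t g1)) - Q e g1.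
have eL : U t (L false e (U' t g1)) - f = DH - z false *: DQ.
  rewrite -{1}(LG false f e0) (linB (lU at2)) (linZ (lU at2)) UHl// vsubACA -scalerBr.
  by rewrite opprB addrA subrK.
have id1 : rdot (DH - z false *: DQ) ht = - (rdot (U' t f - f) (U' t ht) + rdot g1 (U' t f - f)).
  have := GG false f (U' t f) e0; rewrite -eL !rdotBl adjU// U'ht LL LG//.
  by rewrite !adjU'// UU'//; lra.
have bnd1 : `|rdot (DH - z false *: DQ) ht| <= t * (ell * (N ht + N g1)).
  rewrite id1 normrN (le_trans (ler_normD _ _))//.
  have := norm_rdot_le b0 (lexx (N (U' t ht))); have := norm_rdot_le (lexx (N g1)) b0.
  by rewrite normU'//; lra.
have id2 : t * rdot (B g1) ht = rdot (DH - z false *: DQ) ht - rdot (DH - t%:C *: B g1) ht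
    + rdot (z false *: DQ) ht.
  by rewrite !rdotBl rdotZl; lra.
have := norm_rdot_le (jetH g1 at2) (lexx (N ht)); rewrite -/DH => bnd2.
have bnd3 : `|rdot (z false *: DQ) ht| <= e * (cM * t * N g1) * N ht.
  by apply: norm_rdot_le => //; rewrite hnormz -{1}(gtr0_norm t0); exact: jetQ.
have bnd4 : `|rdot (B g1) ht| <= ell * (N ht + N g1) + c * t * N g1 * N ht + e * cM * N g1 * N ht.
  rewrite -(ler_pM2l t0) -{1}(gtr0_norm t0) -normrM id2 (le_trans (ler_normD _ _))//.
  by rewrite (le_trans (lerD (ler_normB _ _) (lexx _)))//; lra.
have bnd5 := norm_rdot_le (bB g1) dht.
have -> : rdot (B g1) h1 = rdot (B g1) ht - rdot (B g1) (ht - h1) by lra.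
rewrite (le_trans (ler_normB _ _))//.
have s1 : ell * N ht <= ell * (N h1 + d) by rewrite ler_wpM2l.
have s2 : e * cM * N g1 * N ht <= e * cM * N g1 * (N h1 + d) by rewrite ler_wpM2l.
have s3 : c * N g1 * (t * N ht) <= c * N g1 * (d * (N h1 + 1)).
  by rewrite ler_wpM2l// ler_pM// (le_trans nht)// lerD2l.
lra.
Qed.

Let dG b e e' : 0 <= e -> 0 <= e' ->
  g b e' - g b e = G b e' (z b *: ((e' - e)%:C *: M (g b e))).
Proof.
move=> e0 e0'; rewrite -{1}[g b e](GL b _ e0') -(linB (lG b e0')) -(LG b f e0).
rewrite vsubACA subrr sub0r -scalerBr -scalerN opprB.
by rewrite opprD addrACA subrr add0r -scalerBl rmorphB.
Qed.

(** The parameter is [e = s^2]. By [commutator_bound] and [Fg] the derivative in [e] may blow up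
    like [e^(-1/2)]; the factor [2 s] removes this singularity, and [bF] becomes an inequality to
    which [gronwall01] applies up to 0. *)
Let F' s := 2 * s * rdot (M (g false (s ^+ 2))) (g true (s ^+ 2)).

Let dF (s : R) : is_derive s 1 (fun s => F (s ^+ 2)) (F' s).
Proof.
have s20 := sqr_ge0 s; pose e := s ^+ 2; pose g1 := g false e; pose h1 := g true e.
pose W := m * N g1 * (eta^-1 * m * N h1).
apply: (@is_derive_of_quadratic _ _ _ _ ((2 * `|s| + 1) ^+ 2 * W + `|rdot (M g1) h1|)) => d d1.
pose e' := (s + d) ^+ 2; have e0' : 0 <= e' by exact: sqr_ge0.
have diffF : F e' - F e = (e' - e) * rdot (M g1) (g true e').
  by rewrite -rdotBl dG// GG// (linZ (lG _ e0')) rdotII rdotZl.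
have dh : N (g true e' - h1) <= eta^-1 * (`|e' - e| * (m * N h1)).
  rewrite dG// (le_trans (bG _ e0' _))// hnormz hnorm_real ler_pM//.
    by rewrite lef_pV2 ?posrE// lerDl.
  by rewrite ler_wpM2l.
have ee : e' - e = d * (2 * s + d) by rewrite /e' /e; ring.
have aee : `|e' - e| <= `|d| * (2 * `|s| + 1).
  by rewrite ee normrM ler_wpM2l// (le_trans (ler_normD _ _))// normrM ger0_norm// lerD2l.
rewrite diffF.
have -> : (e' - e) * rdot (M g1) (g true e') - d * (2 * s * rdot (M g1) h1) =
   (e' - e) * rdot (M g1) (g true e' - h1) + d ^+ 2 * rdot (M g1) h1.
  by rewrite ee; ring.
rewrite (le_trans (ler_normD _ _))// [leRHS]mulrDl; apply: lerD; last first.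
  by rewrite normrM ger0_norm// mulrC.
rewrite normrM (le_trans (ler_wpM2l _ (norm_rdot_le (bM g1) dh)))//.
have -> : `|e' - e| * (m * N g1 * (eta^-1 * (`|e' - e| * (m * N h1)))) = `|e' - e| ^+ 2 * W.
  by rewrite /W; ring.
rewrite [leRHS]mulrAC ler_wpM2r//; first by rewrite /W.
have -> : (2 * `|s| + 1) ^+ 2 * d ^+ 2 = (`|d| * (2 * `|s| + 1)) ^+ 2.
  by rewrite exprMn real_normK ?num_real// mulrC.
by rewrite ler_sqr ?nnegrE.
Qed.

Let bF (s : R) : 0 < s -> s < 1 -> `|F' s| <= A * (1 + F (s ^+ 2)).
Proof.
move=> s0 s1; pose e := s ^+ 2; have e0 : 0 <= e by exact: sqr_ge0.
have e1 : e <= 1 by rewrite expr_le1// ltW.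
have Fe0 := F0 e0; pose g1 := g false e; pose h1 := g true e; pose y := F e / cc.
have y0 : 0 <= y by rewrite /y.
have sg b : e * N (g b e) ^+ 2 <= y.
  rewrite ler_pdivlMr//; apply: le_trans (Fg b e0).
  by have : 0 <= eta * N (g b e) ^+ 2 by []; lra.
have sg' b : s * N (g b e) <= y + 1.
  by have := sg b; have := sqr_ge0 (s * N (g b e) - 2^-1); rewrite /e; lra.
have t1 : s * `|rdot (B g1) h1| <= 2 * ell * (y + 1) + cM * y.
  rewrite (le_trans (ler_wpM2l (ltW s0) (commutator_bound e0)))// mulrDr lerD//.
    by have := ler_wpM2l ell0 (lerD (sg' false) (sg' true)); lra.
  have q4 : e * (N g1 * N h1) <= y.
    have : 0 <= e * (N g1 - N h1) ^+ 2 by [].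
    by have := sg false; have := sg true; lra.
  have q6 : cM * (e * (N g1 * N h1)) <= cM * y by rewrite ler_wpM2l.
  have : s * (cM * (e * (N g1 * N h1))) <= cM * (e * (N g1 * N h1)) by rewrite ler_piMl// ltW.
  by lra.
(* The resolvent equation reads [(H - l) g = f + z Q g], so the term [Nn (H - l)^2] of [M] is
   bounded through [Q g], which [Fg] controls by [F]. *)
have hb b : N (Hl (g b e)) ^+ 2 <= 2 * N f ^+ 2 + 2 * mu ^+ 2 * (1 + cc) * F e.
  have x1 := Fg b e0; set X := g b e in x1 *; pose k := eta + e * cc; have kp : 0 <= k by rewrite /k.
  have x2 : N (Hl X) <= N f + (eta + e * m) * N X.
    have -> : Hl X = f + z b *: Q e X by rewrite -(LG b f e0) subrK.
    by rewrite (le_trans (hnorm_triang _ _ _))// lerD2l hnormz bQ.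
  have x3 : eta + e * m <= mu * k.
    have -> : mu * k = eta + e * m + (e * cc + m / cc * eta) by rewrite /mu /k; field.
    by rewrite lerDl.
  have x4 : (k * N X) ^+ 2 <= (1 + cc) * F e.
    have k1 : k <= 1 + cc by rewrite lerD// ler_piMl.
    by have := ler_wpM2r Fe0 k1; have := ler_wpM2l kp x1; rewrite -/k; lra.
  have mu0 : 0 <= mu by rewrite /mu.
  have x5 : N (Hl X) <= N f + mu * (k * N X).
    by rewrite (le_trans x2)// lerD2l mulrA ler_wpM2r.
  have x6 : N (Hl X) ^+ 2 <= (N f + mu * (k * N X)) ^+ 2 by rewrite ler_sqr ?nnegrE.
  have := ler_wpM2l (sqr_ge0 mu) x4.
  by have := sqr_ge0 (N f - mu * (k * N X)); lra.
have t2 : s * `|rdot (Nn%:C *: Hl (Hl g1)) h1| <= Nn * (2 * N f ^+ 2 + 2 * mu ^+ 2 * (1 + cc) * F e).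
  rewrite rdotZl sHl normrM (ger0_norm Nn0) mulrCA ler_wpM2l//.
  have y2 : s * `|rdot (Hl g1) (Hl h1)| <= `|rdot (Hl g1) (Hl h1)| by rewrite ler_piMl// ltW.
  have := sqr_ge0 (N (Hl g1) - N (Hl h1)); have := rdot_CS dot (Hl g1) (Hl h1).
  by have := hb false; have := hb true; lra.
have t3 : `|F' s| <= 2 * (s * `|rdot (B g1) h1| + s * `|rdot (Nn%:C *: Hl (Hl g1)) h1|).
  rewrite /F' -mulrA normrM ger0_norm// ler_wpM2l// normrM (gtr0_norm s0) -mulrDr.
  by rewrite ler_wpM2l// rdotDl ler_normD.
rewrite (le_trans t3)//.
have -> : A * (1 + F e) = 2 * (2 * ell * (y + 1) + cM * y + Nn * (2 * N f ^+ 2 + 2 * mu ^+ 2 * (1 + cc) * F e))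
    + 2 * (2 * ell * F e + 2 * ell / cc + cM / cc + 2 * Nn * N f ^+ 2 * F e + 2 * Nn * mu ^+ 2 * (1 + cc)).
  by rewrite /A /y; field.
by rewrite -[leLHS]addr0 lerD// ler_wpM2l// lerD.
Qed.

Lemma flow_bound : eta * N (g false 0) ^+ 2 <= (1 + N f ^+ 2 / cc) * expR A.
Proof.
have := gronwall01 (fun s => F0 (sqr_ge0 s)) dF bF; rewrite expr0n expr1n.
have F1 : F 1 <= N f ^+ 2 / cc.
  rewrite ler_pdivlMr// (le_trans (ler_wpM2r (ltW cc0) (ler_norm _)))//.
  rewrite (le_trans (ler_wpM2r (ltW cc0) (rdot_CS _ _ _)))// hnormI mulrAC ler_wpM2r//.
  have := below false (g false 1) ler01; rewrite LG// mul1r; apply: le_trans.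
  by rewrite mulrC ler_wpM2r// lerDr.
have : (1 + F 1) * expR A <= (1 + N f ^+ 2 / cc) * expR A by rewrite ler_wpM2r// lerD2l.
by have := Fg false (lexx 0); lra.
Qed.
End Flow.

(** The limiting absorption principle: at [e = 0] the left side is at most [Im <R f, f>] for the
    resolvent [R] at [l + i eta], and the flow from [e = 1] bounds this independently of [eta] and
    [l]. *)
Lemma lap_bound u : Hl u - 'i%C *: (eta%:C *: u) = f ->
  eta * N u ^+ 2 <= (1 + N f ^+ 2 / cc) * expR A.
Proof.
have /choice[G hG] := G_ex; move=> eu.
have [_ _ GL _] := hG (false, 0) (lexx 0).
have gu : G (false, 0) f = u by rewrite -eu -[RHS]GL /L /Q scale0r addr0.
by have := flow_bound (G := fun b e => G (b, e)) (fun b e => hG (b, e)); rewrite gu.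
Qed.

End LimitingAbsorption.
End ConjugateFamily.

(** * Consequences of a Mourre estimate modulo finite rank *)

Section FiniteRankEstimates.
Variables (R : realType) (V : lmodType R[i]) (dot : {dot V for @Num.conj R[i]}).
Implicit Types (u v w p : V) (l m e : R) (s : seq V) (a : R[i]).
Local Notation rdot := (reform dot).
Local Notation N := (hnorm dot).

Lemma normc_ge0 (a : R[i]) : 0 <= normc a.
Proof. by case: a => x y; exact: sqrtr_ge0. Qed.
Lemma dotZr_real (b : R) u v : dot v (b%:C *: u) = b%:C * dot v u.
Proof. by rewrite dotZr; apply: complex_eq; rewrite !cpartsE oppr0. Qed.

Lemma dot_suml I (r : seq I) (F : I -> V) v :
  dot (\sum_(i <- r) F i) v = \sum_(i <- r) dot (F i) v.
Proof.
elim: r => [|i r ih]; first by rewrite !big_nil linear0l.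
by rewrite !big_cons -ih; exact: (linearDl dot v (F i) _).
Qed.

Fixpoint orthonormal_seq s := if s is v :: s' then
  [/\ N v = 1, forall w, w \in s' -> dot v w = 0 & orthonormal_seq s'] else True.

Lemma orthonormal_norm s v : orthonormal_seq s -> v \in s -> N v = 1.
Proof.
elim: s => [//|z s ih]  [z1 _ os]; rewrite inE => /orP[/eqP -> //|].
exact: ih.
Qed.

Lemma bessel s p : orthonormal_seq s -> \sum_(v <- s) rdot v p ^+ 2 <= N p ^+ 2.
Proof.
elim: s p => [|v s ih] p ; first by rewrite big_nil.
case=> v1 vs hs; have := ih (p - (rdot v p)%:C *: v) hs.
rewrite big_cons (eq_big_seq (fun w => rdot w p ^+ 2)); last first.
  by move=> w ws; rewrite rdotBr rdotZr (rdotC dot w v) /reform (vs w ws) mulr0 subr0.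
rewrite hnorm_sqrB rdotZr hnorm_real exprMn v1 real_normK ?num_real//.
by rewrite (rdotC dot p v); lra.
Qed.

Lemma orthonormal_component s u w : orthonormal_seq s -> w \in s ->
  dot (u - \sum_(v <- s) dot u v *: v) w = 0.
Proof.
elim: s u => [//|v s ih] u  [v1 vs hs] ws.
have e : \sum_(z <- s) dot u z *: z = \sum_(z <- s) dot (u - dot u v *: v) z *: z.
  by apply: eq_big_seq => z zs; rewrite linearBl /= dotZl vs// mulr0 subr0.
rewrite big_cons opprD addrA; move: ws; rewrite inE => /orP[/eqP ->|ws]; last by rewrite e ih.
have -> : dot (u - dot u v *: v - \sum_(z <- s) dot u z *: z) v =
    dot u v - dot u v * dot v v - \sum_(z <- s) dot u z * dot z v.
  rewrite !linearBl /= dotZl dot_suml; congr (_ - _).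
  by apply: eq_bigr => z _; rewrite dotZl.
rewrite big1_seq; last first.
  by move=> z /andP[_ zs]; rewrite [dot z v]dot_conj (vs _ zs) rmorph0 mulr0.
rewrite (_ : dot v v = 1) ?mulr1 ?subrr//.
rewrite dotE -hnorm_sqr v1 expr1n.
have : rdot v ('i%C *: v) = - rdot v ('i%C *: v) by rewrite {1}rdotC rdotIr.
by move=> h; have -> : rdot v ('i%C *: v) = 0 by lra.
Qed.

(** The last clause expresses that [t] lies in the span of [s] without naming coefficients: what is
    orthogonal to [s] is orthogonal to [t]. *)
Lemma gram_schmidt (M : set V) (t : seq V) : subspace M -> (forall p, p \in t -> M p) ->
  exists s, [/\ orthonormal_seq s, forall v, v \in s -> M v &
    forall p w, p \in t -> (forall v, v \in s -> dot w v = 0) -> dot w p = 0].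
Proof.
move=> sM; elim: t => [|p t ih] hM; first by exists [::].
have [|s [os sMs hs]] := ih; first by move=> q qt; apply: hM; rewrite inE qt orbT.
have span (X : seq V) : (forall v, v \in X -> M v) -> M (\sum_(v <- X) dot p v *: v).
  elim: X => [|x X ihX] hX; first by rewrite big_nil; exact: sM.1.
  rewrite big_cons; apply: sM.2; first by apply: hX; rewrite mem_head.
  by apply: ihX => v vX; apply: hX; rewrite inE vX orbT.
have dsum w (X : seq V) : (forall v, v \in X -> dot w v = 0) -> dot w (\sum_(v <- X) dot p v *: v) = 0.
  elim: X => [|x X ihX] hX; first by rewrite big_nil linear0r.
  rewrite big_cons linearDr /= dotZr hX ?mem_head// mulr0 add0r.
  by apply: ihX => v vX; apply: hX; rewrite inE vX orbT.
pose p' := p - \sum_(v <- s) dot p v *: v.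
have Mp' : M p' by apply: subspaceB => //; [apply: hM; rewrite mem_head|exact: span].
have p'p w : (forall v, v \in s -> dot w v = 0) -> dot w p' = 0 -> dot w p = 0.
  by move=> ws; rewrite linearBr /= dsum// subr0.
have [p0|p0] := eqVneq p' 0.
  exists s; split => // q w; rewrite inE => /orP[/eqP -> ws|]; last exact: hs.
  by apply: p'p => //; rewrite p0 linear0r.
have n0 : N p' != 0 by apply: contraNneq p0 => /hnorm_eq0 ->.
exists ((N p')^-1%:C *: p' :: s); split.
- split=> //; first by rewrite hnorm_real ger0_norm// mulVf.
  by move=> w ws; rewrite dotZl orthonormal_component// mulr0.
- by move=> v; rewrite inE => /orP[/eqP ->|/sMs//]; exact: subspaceZ.
move=> q w; rewrite inE => /orP[/eqP -> ws|qt ws]; last first.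
  by apply: hs => // v vs; apply: ws; rewrite inE vs orbT.
apply: p'p; first by move=> v vs; apply: ws; rewrite inE vs orbT.
have := ws _ (mem_head _ _); rewrite dotZr_real => /eqP; rewrite mulf_eq0 => /orP[|/eqP//].
by rewrite eq_complex invr_eq0 (negbTE n0).
Qed.

Lemma dense_of_total (M : set V) : hcomplete dot -> subspace M ->
  (forall u, (forall w, M w -> rdot u w = 0) -> u = 0) ->
  forall v e, 0 < e -> exists2 w, M w & N (v - w) <= e.
Proof.
move=> cV sM tot v e e0.
pose M' := [set w | forall d, 0 < d -> exists2 z, M z & N (w - z) <= d].
have sub w : M w -> M' w by exists w => //; rewrite subrr hnorm0.
have sM' : subspace M'.
  split; first by apply: sub; exact: sM.1.
  move=> a u w Mu Mw d d0.
  have a0 : 0 < normc a + 1 by rewrite ltr_wpDl ?normc_ge0.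
  have [|m1 h1 k1] := Mu (d / 2 / (normc a + 1)) => //.
  have [|m2 h2 k2] := Mw (d / 2) => //.
  exists (a *: m1 + m2); first exact: sM.2.
  rewrite opprD addrACA -scalerBr (le_trans (hnorm_triang _ _ _))// hnormZ.
  have : (normc a + 1) * N (u - m1) <= d / 2 by rewrite mulrC -ler_pdivlMr.
  by have := hnorm_ge0 dot (u - m1); lra.
have clM' : hclosed dot M'.
  move=> x l hx xl d d0; have d2 : 0 < d / 2 by [].
  have [n /(_ n (leqnn _)) hn] := cvg0_eps xl d2; have [m Mm hm] := hx n _ d2.
  exists m => //; rewrite (le_trans (hnorm_dist_triang _ (x n) _ _))//.
  by move: hn; rewrite ger0_norm// hnorm_distC; lra.
have [p Mp hp] := projection_exists v cV sM' clM'.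
have vp : v = p.
  by apply/subr0_eq/tot => m /sub; exact: hp.
by rewrite vp; exact: Mp.
Qed.

Variable H : V -> V.
Hypotheses (lH : islin H) (sH : rsym dot H).

(** A Mourre estimate uniform in [l]. The term with [Nn] replaces restriction to a spectral window,
    and the sum over [s] is the compact remainder. The form [Q] is that of [B] or [- B], or 0 when
    [l] is away from the essential spectrum. *)
Definition mourre_on (Q : V -> R) (al be : R) := exists c Nn (s : seq V), [/\ 0 < c, 0 <= Nn &
  forall l u, al <= l -> l <= be -> c * N u ^+ 2 <=
    Q u + Nn * N (H u - l%:C *: u) ^+ 2 + \sum_(p <- s) rdot u p ^+ 2].

Lemma eigen_ortho l m u v : H u = l%:C *: u -> H v = m%:C *: v -> l != m -> dot u v = 0.
Proof.
move=> hu hv lm; have := rsym_selfadjoint lH sH u v; rewrite hu hv dotZl dotZr_real.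
move=> /eqP; rewrite -subr_eq0 -mulrBl mulf_eq0 => /orP[|/eqP//].
by rewrite eq_complex subr_eq0 (negbTE lm).
Qed.

Section Finiteness.
Variables (Q : V -> R) (al be : R).
Hypothesis virialQ : forall l u, H u = l%:C *: u -> Q u = 0.
Hypothesis hQ : mourre_on Q al be.

Let good s := forall v, v \in s -> exists l, [/\ al <= l, l <= be & H v = l%:C *: v].

(** On a normalized eigenvector [Q] and the residual vanish, leaving [c] at most the finite sum.
    Summing over an orthonormal family and exchanging sums, Bessel's inequality bounds [c (size s)]
    by the sum of the [N p ^+ 2]. *)
Lemma eigen_bound : exists n, forall s, orthonormal_seq s -> good s -> (size s <= n)%N.
Proof.
have [c [Nn [ps [c0 N0 h]]]] := hQ.
pose n := Num.truncn ((\sum_(p <- ps) N p ^+ 2) / c); exists n => s os gs.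
have S0 : 0 <= (\sum_(p <- ps) N p ^+ 2) / c.
  by rewrite divr_ge0// sumr_ge0.
rewrite truncn_ge_nat// ler_pdivlMr//.
apply: (@le_trans _ _ (\sum_(v <- s) \sum_(p <- ps) rdot v p ^+ 2)).
  have -> : (size s)%:R * c = \sum_(v <- s) c by rewrite big_const_seq iter_addr_0 mulr_natl.
  rewrite big_seq [leRHS]big_seq; apply: ler_sum => v vs; have [l [l1 l2 hv]] := gs v vs.
  have := h l v l1 l2; rewrite hv subrr hnorm0 (virialQ hv) expr0n mulr0 !add0r.
  by rewrite (orthonormal_norm os vs) expr1n mulr1.
rewrite exchange_big; apply: ler_sum => p _; exact: bessel.
Qed.

Lemma eigen_normalize l u : H u = l%:C *: u -> u != 0 ->
  exists v, [/\ N v = 1, H v = l%:C *: v & exists a, v = a *: u].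
Proof.
move=> hu u0; have n0 : N u != 0 by apply: contraNneq u0 => /hnorm_eq0 ->.
exists ((N u)^-1%:C *: u); split; last by exists (N u)^-1%:C.
  by rewrite hnorm_real ger0_norm// mulVf.
by rewrite (linZ lH) hu !scalerA mulrC.
Qed.

Lemma eigenvalues_finite : finite_set [set l | [/\ al <= l, l <= be & is_eigenvalue H l]].
Proof.
have [n hn] := eigen_bound; set E := [set l | _]; apply: contrapT => infE.
have ex k : exists t : seq R, [/\ uniq t, size t = k & forall l, l \in t -> E l].
  elim: k => [|k [t [ut st ht]]]; first by exists [::].
  have [l [El lt]] : exists l, E l /\ l \notin t.
    apply: contrapT => nl; apply: infE; apply: (@sub_finite_set _ _ [set` t]) => //.
    by move=> l El ; apply: contraPT nl => lt h; apply: h; exists l.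
  exists (l :: t); rewrite /= lt st; split => // m.
  by rewrite inE => /orP[/eqP ->|/ht].
have [t [ut st ht]] := ex n.+1.
have [s [ss os gs]] : exists s, [/\ size s = size t, orthonormal_seq s &
    forall v, v \in s -> exists l, l \in t /\ H v = l%:C *: v].
  elim: t ut ht {st} => [|l t ih] ; first by exists [::].
  move=> /andP[lt /ih] h ht; have [|s [ss os gs]] := h.
    by move=> m mt; apply: ht; rewrite inE mt orbT.
  have [_ _ [u [u0 hu]]] := ht l (mem_head _ _).
  have [v [v1 hv _]] := eigen_normalize hu u0.
  exists (v :: s); rewrite /= ss; split => //; first split => // w /gs[m [mt hw]].
    by apply: (eigen_ortho hv hw); apply: contraNneq lt => ->.
  move=> w; rewrite inE => /orP[/eqP ->|/gs[m [mt hw]]]; first by exists l; rewrite mem_head.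
  by exists m; rewrite inE mt orbT.
have := hn s os; rewrite ss st ltnn => /(_ _)/notF; apply.
by move=> v /gs[l [/ht[h1 h2 _] hv]]; exists l.
Qed.

Lemma eigen_finite_multiplicity l : al <= l -> l <= be -> finite_multiplicity H l.
Proof.
move=> l1 l2; have [n hn] := eigen_bound.
pose P k := `[< exists s, [/\ orthonormal_seq s, forall v, v \in s -> H v = l%:C *: v & size s = k] >].
have exP : exists k, P k by exists 0; apply/asboolP; exists [::].
have bP k : P k -> (k <= n)%N.
  move=> /asboolP[s [os hs <-]]; apply: hn => // v /hs hv.
  by exists l.
case: (ex_maxnP exP bP) => k /asboolP[s [os hs sk]] kmax.
exists (size s), (fun i => nth 0 s i) => u hu.
have hc w := @orthonormal_component s u w os.
exists (fun i => dot u (nth 0 s i)).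
rewrite -(big_mkord xpredT (fun i => dot u (nth 0 s i) *: nth 0 s i)) -(big_nth 0 xpredT (fun v => dot u v *: v)).
apply/subr0_eq; set u' := u - _.
apply: contrapT => /eqP u0.
have hu' : H u' = l%:C *: u'.
  rewrite (linB lH) hu scalerBr; congr (_ - _).
  rewrite (big_morph H (linD lH) (lin0 lH)) scaler_sumr; apply: eq_big_seq => v vs.
  by rewrite (linZ lH) hs// !scalerA mulrC.
have [v [v1 hv [a va]]] := eigen_normalize hu' u0.
have /kmax : P k.+1.
  apply/asboolP; exists (v :: s); rewrite /= sk; split => //.
    by split => // w /hc h; rewrite va dotZl h mulr0.
  by move=> w; rewrite inE => /orP[/eqP ->|/hs].
by rewrite ltnn.
Qed.

End Finiteness.

(** A vector [u] orthogonal to the range of the symmetric operator [D = H - l] has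
    [|D u|^2 = <u, D (D u)> = 0], so it would be an eigenvector. *)
Lemma dense_range l : hcomplete dot -> ~ is_eigenvalue H l -> forall v e, 0 < e ->
  exists g, N (v - (H g - l%:C *: g)) <= e.
Proof.
move=> cV nl v e e0; pose D u := H u - l%:C *: u.
have lD : islin D by apply: islinB => //; apply: islinZ.
have [||m [g _ <-] hg] := @dense_of_total (range D) cV _ _ v e e0; last by exists g.
  split; first by exists 0 => //; rewrite (lin0 lD).
  by move=> a _ _ [u _ <-] [w _ <-]; exists (a *: u + w) => //; exact: lD.
move=> u hu; apply: contrapT => /eqP u0; apply: nl; exists u; split => //.
apply/subr0_eq/(@rdot_eq0 _ _ dot).
have := hu (D (D u)); rewrite -/(D u) => <-//.
by rewrite rdotBl rdotZl sH -rdotZr -rdotBr.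
Qed.

(** Each [p] is within a small error of some [(H - l0) g], and [<u, (H - l0) g>] is at most
    [|g| |(H - l0) u|]. So the finite-rank term is absorbed by the two others. *)
Lemma mourre_noncompact (Q : V -> R) al be l0 : hcomplete dot -> mourre_on Q al be ->
  al < l0 -> l0 < be -> ~ is_eigenvalue H l0 ->
  exists c Nn r, [/\ 0 < c, 0 <= Nn, 0 < r & forall l u, `|l - l0| < r ->
    c * N u ^+ 2 <= Q u + Nn * N (H u - l%:C *: u) ^+ 2].
Proof.
move=> cV [c [Nn [s [c0 N0 h]]]] al0 l0be nl0; pose D l u := H u - l%:C *: u.
have [C [C0 hC]] : exists C, 0 <= C /\ forall u,
    \sum_(p <- s) rdot u p ^+ 2 <= c / 4 * N u ^+ 2 + C * N (D l0 u) ^+ 2.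
  elim: s {h} (c / 4) (divr_gt0 c0 (ltr0n _ 4)) => [|p s ih] d d0.
    exists 0; split => // u; rewrite big_nil mul0r addr0.
    by [].
  have d2 : 0 < d / 2 by [].
  have [C [C0 hC]] := ih _ d2.
  have sd : 0 < Num.sqrt (d / 4) by rewrite sqrtr_gt0.
  have [g hg] := dense_range cV nl0 p sd.
  exists (C + 2 * N g ^+ 2); split => //.
  move=> u; rewrite big_cons; have := hC u.
  have lH0 : rdot u (D l0 g) = rdot (D l0 u) g by rewrite rdotBr rdotBl rdotZl rdotZr sH.
  have e1 : rdot u p = rdot u (p - D l0 g) + rdot (D l0 u) g by rewrite -lH0 -rdotDr subrK.
  have h1 : rdot u (p - D l0 g) ^+ 2 <= d / 4 * N u ^+ 2.
    rewrite -real_normK ?num_real// -[d / 4]sqr_sqrtr//.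
    rewrite -exprMn ler_sqr ?nnegrE//.
    by rewrite (le_trans (rdot_CS _ _ _))// mulrC ler_wpM2r//.
  have h2 : rdot (D l0 u) g ^+ 2 <= N g ^+ 2 * N (D l0 u) ^+ 2.
    rewrite -real_normK ?num_real// -exprMn ler_sqr ?nnegrE//.
    by rewrite (le_trans (rdot_CS _ _ _))// mulrC.
  have := sqr_ge0 (rdot u (p - D l0 g) - rdot (D l0 u) g); rewrite e1.
  lra.
(* The square root ensures [C |l - l0|^2 <= c / 8]. Passing from [l0] to [l] then costs [c / 4];
   with the [c / 4] of [hC], half of [c] survives. *)
pose r := Num.min (Num.min (l0 - al) (be - l0)) (Num.sqrt (c / (8 * (C + 1)))).
have r0 : 0 < r by rewrite !lt_min !subr_gt0 al0 l0be sqrtr_gt0 mulr_gt0.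
exists (c / 2), (Nn + 2 * C), r; split => //.
move=> l u; rewrite !lt_min => /andP[/andP[l1 l2] l3].
have [m1 m2] : al <= l /\ l <= be.
  by move: l1 l2; rewrite !ltr_norml; lra.
have := h l u m1 m2; have := hC u.
have h1 : N (D l0 u) <= N (D l u) + `|l - l0| * N u.
  by rewrite -hnorm_real (le_trans _ (hnorm_triang _ _ _))// rmorphB scalerBl addrA subrK.
have h2 : `|l - l0| ^+ 2 * C <= c / 8.
  have q1 : `|l - l0| ^+ 2 <= c / (8 * (C + 1)).
    rewrite -[leRHS]sqr_sqrtr//.
    by rewrite ler_sqr ?nnegrE// ltW.
  apply: le_trans (ler_wpM2r C0 q1) _.
  have -> : c / (8 * (C + 1)) * C = c / 8 * (C / (C + 1)) by lra.
  by rewrite ger_pMr// ler_pdivrMr// mul1r lerDl.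
have h3 : N (D l0 u) ^+ 2 <= 2 * N (D l u) ^+ 2 + 2 * `|l - l0| ^+ 2 * N u ^+ 2.
  have := sqr_ge0 (N (D l u) - `|l - l0| * N u).
  have : N (D l0 u) ^+ 2 <= (N (D l u) + `|l - l0| * N u) ^+ 2.
    by rewrite ler_sqr ?nnegrE.
  lra.
have h4 := ler_wpM2l C0 h3.
have h5 := ler_wpM2r (sqr_ge0 (N u)) h2.
lra.
Qed.

Lemma not_spectrum_of_bound K l c : hcomplete dot -> hbounded dot K H -> 0 < c ->
  (forall u, c * N u <= N (H u - l%:C *: u)) -> ~ spectrum dot H l.
Proof.
move=> cV bH c0 h; apply; pose D u := H u - l%:C *: u.
have lD : islin D by apply: islinB => //; apply: islinZ.
have [|||||G [lG DG GD bG]] := @invertible_of_bounded_below _ _ dot cV D D (K + `|l|) c lD.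
- by move=> u; rewrite (le_trans (hnorm_triangB _ _ _))// hnorm_real mulrDl lerD.
- by move=> u v; rewrite rdotBl rdotBr rdotZl rdotZr sH.
- by [].
- by [].
- move=> u Du; apply: (@hnorm_le0 _ _ dot).
  by have := h u; rewrite -/(D u) Du hnorm0 pmulr_rle0.
by exists G; split=> // [|u _|u _]; [by exists c^-1|exact: GD|exact: DG].
Qed.

(** With [Q = 0] the estimate says that [H - l] is bounded below up to finite rank. Points that are
    not eigenvalues are then outside the spectrum, and the eigenvalues are finitely many and of
    finite multiplicity. *)
Lemma discrete_of_mourre K al be l0 : hcomplete dot -> hbounded dot K H ->
  mourre_on (fun=> 0) al be -> al < l0 -> l0 < be -> ~ essential_spectrum dot H l0.
Proof.
move=> cV bH h a1 b1 [sp]; apply.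
have ns m : al < m -> m < be -> ~ is_eigenvalue H m -> ~ spectrum dot H m.
  move=> m1 m2 nm; have [c [Nn [r [c0 N0 r0 hr]]]] := mourre_noncompact cV h m1 m2 nm.
  apply: (@not_spectrum_of_bound K m (Num.sqrt (c / (Nn + 1)))) => //.
    by rewrite sqrtr_gt0.
  move=> u; have := hr m u; rewrite subrr normr0 => /(_ r0); rewrite add0r => hu.
  rewrite -ler_sqr ?nnegrE//.
  rewrite exprMn sqr_sqrtr// mulrAC ler_pdivrMr// (le_trans hu)// mulrC.
  by rewrite ler_wpM2l// lerDl.
have ev : is_eigenvalue H l0 by apply: contrapT => /(ns _ a1 b1).
have V0 l u : H u = l%:C *: u -> (fun=> 0 : R) u = 0 by [].
split => //; last exact: (eigen_finite_multiplicity V0 h (ltW a1) (ltW b1)).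
have := eigenvalues_finite V0 h; set E := [set l | _] => fE.
have [r r0 hr] : exists2 r : R, 0 < r & forall m, E m -> `|m - l0| < r -> m = l0.
  have /finite_seqP[t Et] := fE; rewrite Et.
  elim: t {Et} => [|x t [r r0 hr]]; first by exists 1.
  have [->|xl] := eqVneq x l0.
    by exists r => // m; rewrite /= => /orP[/eqP//|]; exact: hr.
  exists (Num.min r `|x - l0|); first by rewrite lt_min r0 normr_gt0 subr_eq0.
  move=> m; rewrite lt_min => /orP[/eqP ->|mt] /andP[m1 m2]; first by rewrite ltxx in m2.
  exact: hr.
exists (Num.min r (Num.min (l0 - al) (be - l0))); first by rewrite !lt_min r0 !subr_gt0 a1.
move=> m sm; rewrite !lt_min => /andP[mr /andP[m1 m2]].
have [n1 n2] : al < m /\ m < be.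
  by move: m1 m2; rewrite !ltr_norml; lra.
apply: hr => //; split; [exact: ltW|exact: ltW|].
by apply: contrapT => /(ns m n1 n2).
Qed.

(** * Weyl's criterion for the essential spectrum *)

Section WeylCriterion.
Hypothesis cV : hcomplete dot.
Variable P : mset R -> V -> V.
Hypothesis hP : is_spectral_measure dot H P.

(** On the range of [P A] the form of [sg (H - l)] is at least [r], and [P A] commutes with [H]. The
    sign [sg] says on which side of [l] the set [A] lies. *)
Lemma spectral_outside (A : mset R) l r (sg : R) u :
  measurable A -> sg = 1 \/ sg = -1 -> 0 < r ->
  (forall x, A x -> r <= sg * (x - l)) -> r * N (P A u) <= N (H u - l%:C *: u).
Proof.
move=> mA hsg r0 hA; have pA := spectral_proj hP mA; have [lA A2 sA] := pA.
set v := P A u; have Av : P A v = v by exact: A2.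
have [h1 h2] := spectral_form_bounds hP mA Av.
have e2 : r * N v ^+ 2 <= sg * (rdot (H v) v - l * N v ^+ 2).
  case: hsg hA => -> hA.
    have : (l + r) * N v ^+ 2 <= rdot (H v) v by apply: h2 => x /hA; lra.
    lra.
  have : rdot (H v) v <= (l - r) * N v ^+ 2 by apply: h1 => x /hA; lra.
  lra.
have e3 : rdot (H v) v - l * N v ^+ 2 = rdot (H u - l%:C *: u) v.
  rewrite hnorm_sqr -rdotZl -rdotBl (spectral_comm lH sH hP)// -(linZ lA) -(linB lA) sA.
  by rewrite Av.
apply: (coercive_le (erefl (N v))); rewrite -e3 (le_trans e2)// (le_trans (ler_norm _))//.
by rewrite normrM; case: hsg => ->; rewrite ?normrN normr1 mul1r.
Qed.

(** If [l] were discrete, a unit vector would split into its component in the eigenspace, controlled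
    by finitely many inner products, and two outer components controlled by [(H - l) u]. All three
    can be made small together. *)
Lemma weyl_criterion l :
  (forall e s, 0 < e -> exists u, [/\ N u = 1, N (H u - l%:C *: u) <= e &
     forall p, p \in s -> normc (dot u p) <= e]) ->
  essential_spectrum dot H l.
Proof.
move=> h; have nb S K : 0 <= K -> (forall u, S (H u - l%:C *: u) = u) ->
    (forall u, N (S u) <= K * N u) -> False.
  move=> K0 SH bS; have e0 : 0 < (K + 1)^-1 by [].
  have [u [u1 hu _]] := h _ [::] e0; have := bS (H u - l%:C *: u); rewrite SH u1.
  have := ler_wpM2l K0 hu; have K1 : K / (K + 1) < 1 by rewrite ltr_pdivrMr// mul1r ltrDl.
  lra.
split.
  move=> [S [_ [K bS] SH HS]]; apply: (nb S `|K|) => // u; first exact: SH.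
  by rewrite (le_trans (bS u I))// ler_wpM2r// ler_norm.
move=> [_ [r r0 hr] _ [n [e hE]]].
have gap : P (`]l - r, l + r[%classic `\ l) = fun=> 0.
  apply/funext => u; have [nu [hnu _ _]] := spectral_nu hP u.
  set A : mset R := _ `\ _.
  have mA : measurable A by apply: measurableD.
  apply: (@hnorm_eq0 _ _ dot); apply/eqP; rewrite -sqrf_eq0; apply/eqP; apply: EFin_inj.
  rewrite -hnu//; apply/negligibleP => //; apply: locally_null => m [/= hm ml].
  have mr : `|m - l| < r by move: hm; rewrite in_itv/= ltr_norml; lra.
  have /contrapT[S [_ [K bS] SH HS]] : ~ spectrum dot H m by move=> /hr /(_ mr).
  (* On the spectral range of radius [d] about [m] the operator [H - m] shrinks vectors by [d],
     while its inverse stretches by at most [|K|]. As [|K| d <= 1/2], that range is zero. *)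
  pose d := (2 * (`|K| + 1))^-1; have d0 : 0 < d by rewrite invr_gt0.
  exists d => //; have mJ : measurable (`]m - d, m + d[%classic : mset R) by [].
  rewrite hnu//; set v := P _ u; congr EFin; apply/eqP; rewrite sqrf_eq0 eq_le hnorm_ge0 andbT.
  have [_ J2 _] := spectral_proj hP mJ.
  have lo : N (H v - m%:C *: v) <= d * N v.
    apply: (spectral_local lH sH hP mJ (ltW d0)); last exact: J2.
    by move=> x /=; rewrite !in_itv/= => /andP[/ltW -> /ltW ->].
  have := bS (H v - m%:C *: v) I; rewrite SH//.
  have q1 : K * N (H v - m%:C *: v) <= `|K| * (d * N v).
    by rewrite (le_trans (ler_wpM2r (hnorm_ge0 _ _) (ler_norm K)))// ler_wpM2l.
  have q2 : `|K| * d <= 2^-1.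
    by rewrite /d invfM mulrCA ger_pMr// ler_pdivrMr// mul1r lerDl.
  have := ler_wpM2r (hnorm_ge0 dot v) q2; lra.
pose A1 : mset R := `[l + r, +oo[%classic.
pose A2 : mset R := `]-oo, l - r]%classic.
have mA1 : measurable A1 by exact: measurable_itv.
have mA2 : measurable A2 by exact: measurable_itv.
have m1 : measurable ([set l] : mset R) by [].
have dec u : u = P [set l] u + P A1 u + P A2 u.
  have mg : measurable (`]l - r, l + r[%classic `\ l : mset R).
    exact: measurableD.
  rewrite -[LHS](spectral_setT hP).
  have -> : setT = ([set l] `|` (`]l - r, l + r[%classic `\ l)) `|` A1 `|` A2 :> mset R.
    apply/seteqP; split => // x _.
    have [xr|xr] := leP (l + r) x; first by left; right; rewrite /A1 /= in_itv/= xr.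
    have [xl|xl] := leP x (l - r); first by right.
    left; left; have [->|/eqP xn] := eqVneq x l; [by left|right].
    by rewrite /= in_itv/= xl.
  have mU := measurableU _ _ m1 mg.
  rewrite (spectral_add hP)//; last 2 first.
  - exact: measurableU.
  - apply/seteqP; split => // x [[[->|[+ _]]|]]; rewrite /A1 /A2 /= !in_itv/=; try lra.
  rewrite (spectral_add hP)//; last first.
    by apply/seteqP; split => // x [[->|[+ _]]]; rewrite /A1 /= !in_itv/=; lra.
  rewrite (spectral_add hP)//; last by apply/seteqP; split => // x [->] [_ /=].
  by rewrite gap addr0.
have eig u : H (P [set l] u) = l%:C *: P [set l] u.
  have [_ P2 _] := spectral_proj hP m1.
  apply/subr0_eq/(@hnorm_eq0 _ _ dot); apply/eqP.
  rewrite eq_le hnorm_ge0 andbT -[leRHS](mul0r (N (P [set l] u))).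
  apply: (spectral_local lH sH hP m1 (lexx 0)) => //.
  by move=> x ->; rewrite /= in_itv/= subr0 addr0 lexx.
have fixP v : H v = l%:C *: v -> P [set l] v = v.
  move=> hv; rewrite [RHS](dec v).
  have z (A : mset R) sg : measurable A -> sg = 1 \/ sg = -1 -> (forall x : R, A x -> r <= sg * (x - l)) -> P A v = 0.
    move=> mA hs hA; apply: (@hnorm_le0 _ _ dot).
    by have := spectral_outside v mA hs r0 hA; rewrite hv subrr hnorm0 pmulr_rle0.
  rewrite (z A1 1) ?(z A2 (-1)) ?addr0//; [by lra| |by lra|].
    by move=> x; rewrite /A2 /= in_itv/=; lra.
  by move=> x; rewrite /A1 /= in_itv/=; lra.
pose M := [set v | H v = l%:C *: v].
have sM : subspace M.
  split; first by rewrite /M /= (lin0 lH) scaler0.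
  by move=> a u v; rewrite /M /= => hu hv; rewrite lH hu hv scalerDr !scalerA mulrC.
have [|s [os sMs hs]] := @gram_schmidt M [seq P [set l] (e i) | i <- enum 'I_n] sM.
  by move=> p /mapP[i _ ->].
have Pu u : N (P [set l] u) <= \sum_(v <- s) normc (dot u v).
  have [lP P2 sP] := spectral_proj hP m1.
  set x := P [set l] u; pose x' := x - \sum_(v <- s) dot x v *: v.
  have Mx' : M x'.
    apply: subspaceB => //; first exact: eig.
    elim: (s) sMs => [|z s' ih] hz; first by rewrite big_nil; exact: sM.1.
    rewrite big_cons; apply: sM.2; first by apply: hz; rewrite mem_head.
    by apply: ih => v vX; apply: hz; rewrite inE vX orbT.
  have x'0 : x' = 0.
    apply: (@rdot_eq0 _ _ dot); have [c ec] := hE _ Mx'.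
    have ec' : x' = \sum_(i < n) c i *: P [set l] (e i).
      rewrite -{1}(fixP _ Mx') {1}ec (big_morph _ (linD lP) (lin0 lP)).
      by apply: eq_bigr => i _; rewrite (linZ lP).
    rewrite {2}ec' rdotC rdot_suml big1// => i; rewrite rdotC /reform dotZr hs ?mulr0//.
      by apply: map_f; rewrite mem_enum.
    by move=> v vs; exact: orthonormal_component.
  have -> : x = \sum_(v <- s) dot x v *: v by apply/eqP; rewrite -subr_eq0 -/x' x'0.
  rewrite (le_trans (hnorm_sum _ _ _ _))// big_seq [leRHS]big_seq ler_sum// => v vs.
  rewrite hnormZ (_ : dot _ v = dot u v); last first.
    by rewrite (rsym_selfadjoint lP sP) fixP//; exact: sMs.
  by rewrite (orthonormal_norm os vs) mulr1.
(* The eigencomponent is at most [(size s) d] and each outer component at most [d / r]. The sum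
   stays below 1, contradicting [N u = 1]. *)
pose d := ((size s)%:R + 2 / r + 1)^-1.
have d0 : 0 < d by rewrite invr_gt0.
have [u [u1 hu us]] := h d s d0.
have b1 : N (P A1 u) <= d / r.
  rewrite ler_pdivlMr// mulrC; apply: le_trans hu; apply: (spectral_outside _ mA1 (or_introl erefl) r0).
  by move=> x; rewrite /A1 /= in_itv/=; lra.
have b2 : N (P A2 u) <= d / r.
  rewrite ler_pdivlMr// mulrC; apply: le_trans hu; apply: (spectral_outside _ mA2 (or_intror erefl) r0).
  by move=> x; rewrite /A2 /= in_itv/=; lra.
have b3 : N (P [set l] u) <= (size s)%:R * d.
  have -> : (size s)%:R * d = \sum_(v <- s) d by rewrite big_const_seq iter_addr_0 mulr_natl.
  rewrite (le_trans (Pu u))//.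
  by rewrite big_seq [leRHS]big_seq ler_sum.
have : N u <= (size s)%:R * d + d / r + d / r.
  rewrite [in leLHS](dec u) (le_trans (hnorm_triang _ _ _))// lerD//.
  by rewrite (le_trans (hnorm_triang _ _ _))// lerD.
have : ((size s)%:R + 2 / r + 1) * d = 1 by rewrite divff.
lra.
Qed.

End WeylCriterion.
End FiniteRankEstimates.

(** * Mourre theory for a bounded operator with a conjugate family *)

Section MourreTheory.
Variables (R : realType) (V : lmodType R[i]) (dot : {dot V for @Num.conj R[i]}).
Implicit Types (u v w f g : V) (t l e : R).
Local Notation rdot := (reform dot).
Local Notation N := (hnorm dot).
Hypothesis cV : hcomplete dot.
Variables (H : V -> V) (D : set V) (K : R) (P : mset R -> V -> V).
Hypotheses (lH : islin H) (sH : rsym dot H) (bH : hbounded dot K H) (K0 : 0 <= K).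
Hypothesis denseD : forall v e, 0 < e -> exists2 f, D f & N (v - f) <= e.
Hypothesis hP : is_spectral_measure dot H P.

Definition conjugate_family B U U' (c : R) := 0 <= c /\ forall t, `|t| <= 2^-1 ->
  [/\ islin (U t), islin (U' t), forall u, U t (U' t u) = u, forall u, U' t (U t u) = u &
      forall u v, rdot (U t u) (U t v) = rdot u v] /\
  [/\ forall u, N (U t (H (U' t u)) - H u - t%:C *: B u) <= c * t ^+ 2 * N u &
      forall u, N (U t (B (U' t u)) - B u) <= c * `|t| * N u].

Definition lipschitz_orbits U' := forall f, D f -> exists ell : R, 0 <= ell /\
  forall t, `|t| <= 2^-1 -> N (U' t f - f) <= ell * `|t|.

(** Reversing the parameter changes the sign of the first-order term. It turns an estimate for [- B]
    into one for the commutator of a conjugate family. *)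
Lemma conjugate_family_opp B U U' c : conjugate_family B U U' c ->
  conjugate_family (fun u => - B u) (fun t => U (- t)) (fun t => U' (- t)) c.
Proof.
move=> [c0 h]; split=> // t ht; have [|h1 [h2 h3]] := h (- t); first by rewrite normrN.
split => //; split=> u; last first.
  have [[l1 _ _ _ _] _] : [/\ islin (U (- t)), True, True, True & True] /\ True by case: h1.
  by have := h3 u; rewrite normrN (linN l1) -opprD hnormNE.
by have := h2 u; rewrite sqrrN rmorphN scaleNr scalerN.
Qed.

Section Positive.
Variables (B : V -> V) (U U' : R -> V -> V) (KB c : R).
Hypotheses (lB : islin B) (sB : rsym dot B) (bB : hbounded dot KB B) (KB0 : 0 <= KB).
Hypothesis hU : conjugate_family B U U' c.
Hypothesis lipU : lipschitz_orbits U'.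

Let c0 : 0 <= c. Proof. by case: hU. Qed.
Let lU t : `|t| <= 2^-1 -> islin (U t). Proof. by move=> /(hU.2 t)[[]]. Qed.
Let lU' t : `|t| <= 2^-1 -> islin (U' t). Proof. by move=> /(hU.2 t)[[]]. Qed.
Let UU' t u : `|t| <= 2^-1 -> U t (U' t u) = u. Proof. by move=> /(hU.2 t)[[]]. Qed.
Let U'U t u : `|t| <= 2^-1 -> U' t (U t u) = u. Proof. by move=> /(hU.2 t)[[]]. Qed.
Let isoU t u v : `|t| <= 2^-1 -> rdot (U t u) (U t v) = rdot u v.
Proof. by move=> /(hU.2 t)[[]]. Qed.
Let jetH t u : `|t| <= 2^-1 ->
  N (U t (H (U' t u)) - H u - t%:C *: B u) <= c * t ^+ 2 * N u.
Proof. by move=> /(hU.2 t)[_ []]. Qed.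
Let jetB t u : `|t| <= 2^-1 -> N (U t (B (U' t u)) - B u) <= c * `|t| * N u.
Proof. by move=> /(hU.2 t)[_ []]. Qed.
Let normU' t u : `|t| <= 2^-1 -> N (U' t u) = N u.
Proof. by move=> ht; rewrite -[in RHS](UU' u ht) /hnorm -!/(rdot _ _) isoU. Qed.

Let contU' u e : 0 < e -> exists2 d, 0 < d &
  forall t, `|t| <= d -> `|t| <= 2^-1 -> N (U' t u - u) <= e.
Proof.
move=> e0; have e3 : 0 < e / 3 by [].
have [f Df uf] := denseD u e3; have [ell [l0 hf]] := lipU Df.
exists (e / 3 / (ell + 1)) => [|t td t2]//.
have h1 := hf t t2; have h2 : N (U' t u - U' t f) <= e / 3 by rewrite -(linB (lU' t2)) normU'.
have h3 : ell * `|t| <= e / 3.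
  have : `|t| * (ell + 1) <= e / 3 by rewrite -ler_pdivlMr.
  by have := normr_ge0 t; lra.
rewrite (le_trans (hnorm_dist_triang _ (U' t f) _ _))//.
have := hnorm_dist_triang dot f (U' t f) u; rewrite (hnorm_distC _ f u); lra.
Qed.

Lemma mourre_virial l u : H u = l%:C *: u -> rdot (B u) u = 0.
Proof. exact: (virial sH lB bB KB0 c0 lU UU' U'U isoU contU' jetH). Qed.

(** For [I = [m - e, m + e]] and [G] the resolvent at [m + i e], [P I f = (H - m - i e) P I (G f)]
    has norm at most [2 e |G f|]. Limiting absorption bounds [e |G f|^2] by [C], so
    [|P I f|^2 <= 4 C e]. *)
Lemma mourre_smooth_point al be l0 : mourre_on dot H (fun u => rdot (B u) u) al be ->
  al < l0 -> l0 < be -> ~ is_eigenvalue H l0 -> smooth_point dot P D l0.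
Proof.
move=> hm h1 h2 nl0; have [cc [Nn [r [cc0 N0 r0 hr]]]] := mourre_noncompact lH sH cV hm h1 h2 nl0.
pose r1 := Num.min r 1; exists r1; first by rewrite lt_min r0 ltr01.
move=> f Df; have [ell [l00 hf]] := lipU Df.
have lm0 : 0 <= `|l0| + r by [].
(* The constant is fixed before [l] and [eta]; this is possible because the bound of [lap_bound]
   involves neither. *)
have [C hC] : exists C, forall l eta g, `|l| <= `|l0| + r -> 0 < eta -> eta <= 1 ->
    (forall u, cc * N u ^+ 2 <= rdot (B u) u + Nn * N (H u - l%:C *: u) ^+ 2) ->
    H g - l%:C *: g - 'i%C *: (eta%:C *: g) = f -> eta * N g ^+ 2 <= C.
  eexists => l eta g hl e0 e1 hm' eg.
  exact: (lap_bound cV lH sH bH lB sB bB K0 KB0 c0 lU lU' UU' U'U isoU contU' jetH jetB N0 cc0 lm0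
    hl e0 e1 hm' l00 hf eg).
exists (4 * C) => m e mr e0 er.
have hm' u : cc * N u ^+ 2 <= rdot (B u) u + Nn * N (H u - m%:C *: u) ^+ 2.
  by apply: hr; rewrite (lt_le_trans mr)// ge_min lexx.
have e1 : e <= 1 by rewrite (le_trans er)// ge_min lexx orbT.
have hl : `|m| <= `|l0| + r.
  by rewrite -lerBlDl (le_trans (lerB_dist _ _))// ltW// (lt_le_trans mr)// ge_min lexx.
pose L u := H u - m%:C *: u.
have lL : islin L by apply: islinB => //; apply: islinZ.
have sL u v : rdot (L u) v = rdot u (L v) by rewrite rdotBl rdotBr rdotZl rdotZr sH.
pose X a u := L u - a *: (e%:C *: u).
have lX a : islin (X a) by apply: islinB => //; apply: islinZ; apply: islinZ.
have im u : rdot (L u) ('i%C *: u) = 0.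
  have : rdot (L u) ('i%C *: u) = - rdot (L u) ('i%C *: u) by rewrite {1}sL (linZ lL) -rdotIr rdotC.
  lra.
have nX a u : a = 'i%C \/ a = - 'i%C -> e * N u <= N (X a u).
  move=> ha; rewrite -ler_sqr ?nnegrE// hnorm_sqrB.
  have -> : N (a *: (e%:C *: u)) = e * N u.
    by case: ha => ->; rewrite ?scaleNr ?hnormNE hnormI hnorm_real gtr0_norm.
  have -> : rdot (L u) (a *: (e%:C *: u)) = 0.
    have z : rdot (L u) ('i%C *: (e%:C *: u)) = 0.
      by rewrite scalerA mulrC -scalerA rdotZr im mulr0.
    by case: ha => ->; rewrite ?scaleNr ?rdotNr z ?oppr0.
  by rewrite mulr0 subr0 lerDr.
have [|||||G [lG XG GX bG]] := @invertible_of_bounded_below _ _ dot cV (X 'i%C) (X (- 'i%C)) (K + `|m| + e) e (lX _).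
- move=> u; rewrite (le_trans (hnorm_triangB _ _ _))// hnormI hnorm_real (gtr0_norm e0) mulrDl lerD//.
  by rewrite (le_trans (hnorm_triangB _ _ _))// hnorm_real mulrDl lerD.
- move=> u v; rewrite rdotBl rdotBr sL scaleNr rdotNr rdotIr.
  by rewrite !scalerA ['i%C * _]mulrC -scalerA rdotZr rdotZl.
- by [].
- by move=> u; apply: nX; left.
- move=> u Xu; apply: (@hnorm_le0 _ _ dot).
  by have := nX _ u (or_intror erefl); rewrite Xu hnorm0 pmulr_rle0.
set I : mset R := [set` _].
have mI : measurable I by exact: measurable_itv.
have [lP P2 _] := spectral_proj hP mI.
have -> : P I f = L (P I (G f)) - 'i%C *: (e%:C *: P I (G f)).
  rewrite -{1}(XG f) (linB lP) (linB lP (H _)) -(spectral_comm lH sH hP)//.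
  by rewrite !(linZ lP).
have b1 : N (L (P I (G f))) <= e * N (P I (G f)).
  exact: (spectral_local lH sH hP mI (ltW e0)).
have b3 : N (L (P I (G f)) - 'i%C *: (e%:C *: P I (G f))) <= 2 * e * N (G f).
  rewrite (le_trans (hnorm_triangB _ _ _))// hnormI hnorm_real (gtr0_norm e0).
  by have := ler_wpM2l (ltW e0) (rproj_le (G f) (spectral_proj hP mI)); lra.
rewrite (@le_trans _ _ ((2 * e * N (G f)) ^+ 2))//.
  by rewrite ler_sqr ?nnegrE.
by have := ler_wpM2l (ltW e0) (hC m e (G f) hl e0 e1 hm' (XG f)); lra.
Qed.

End Positive.

Variables (B : V -> V) (U U' : R -> V -> V) (KB c : R) (X : seq R).
Hypotheses (lB : islin B) (sB : rsym dot B) (bB : hbounded dot KB B) (KB0 : 0 <= KB).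
Hypothesis hU : conjugate_family B U U' c.
Hypothesis lipU : lipschitz_orbits U'.
Hypothesis mourreX : forall al be, al <= be -> (forall x, x \in X -> ~ (al <= x <= be)) ->
  mourre_on dot H (fun u => rdot (B u) u) al be \/
  mourre_on dot H (fun u => - rdot (B u) u) al be.

Let lB' : islin (fun u => - B u).
Proof. by move=> a u v; rewrite lB opprD scalerN. Qed.
Let sB' : rsym dot (fun u => - B u).
Proof. by move=> u v; rewrite rdotNl rdotNr sB. Qed.
Let bB' : hbounded dot KB (fun u => - B u).
Proof. by move=> u; rewrite hnormNE. Qed.
Let lipU_opp : lipschitz_orbits (fun t => U' (- t)).
Proof.
move=> f /lipU[ell [l0 h]]; exists ell; split => // t ht.
by rewrite -[`|t|]normrN h// normrN.
Qed.
Let hU' := conjugate_family_opp hU.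
Let mourreN al be : mourre_on dot H (fun u => - rdot (B u) u) al be ->
  mourre_on dot H (fun u => rdot (- B u) u) al be.
Proof.
by move=> [cc [Nn [s [h1 h2 h]]]]; exists cc, Nn, s; split => // l u; rewrite rdotNl; exact: h.
Qed.

Let virialB l u : H u = l%:C *: u -> rdot (B u) u = 0.
Proof. exact: (mourre_virial lB bB KB0 hU lipU). Qed.

Lemma mourre_eigenvalues al be : al <= be -> (forall x, x \in X -> ~ (al <= x <= be)) ->
  finite_set [set l | [/\ al <= l, l <= be & is_eigenvalue H l]] /\
  (forall l, al <= l -> l <= be -> finite_multiplicity H l).
Proof.
move=> ab hX; have virialN l u (hu : H u = l%:C *: u) : - rdot (B u) u = 0.
  by rewrite (virialB hu) oppr0.
have [h|h] := mourreX ab hX; split.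
- exact: (eigenvalues_finite lH sH virialB h).
- by exact: (eigen_finite_multiplicity lH virialB h).
- exact: (eigenvalues_finite lH sH virialN h).
- by exact: (eigen_finite_multiplicity lH virialN h).
Qed.

Lemma isolating_radius (t : seq R) l : exists2 r : R, 0 < r &
  forall m, m \in t -> `|m - l| <= r -> m = l.
Proof.
elim: t => [|x t [r r0 hr]]; first by exists 1.
have [->|xl] := eqVneq x l.
  by exists r => // m; rewrite inE => /orP[/eqP//|]; exact: hr.
have d0 : 0 < `|x - l| by rewrite normr_gt0 subr_eq0.
exists (Num.min r (`|x - l| / 2)); first by rewrite lt_min r0 divr_gt0.
move=> m; rewrite le_min => /orP[/eqP ->|mt] /andP[m1 m2]; first by lra.
exact: hr.
Qed.

Lemma mourre_no_singular u : (forall x : R, P [set x] u = 0) ->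
  (exists S : mset R,
    [/\ measurable S, lebesgue_measure S = 0%E & P (~` S) u = 0]) -> u = 0.
Proof.
apply: (no_singular_continuous (X := X) (Df := D) hP).
  move=> v hv; apply: (@rdot_eq0 _ _ dot); apply/eqP; rewrite eq_le rdot_ge0 andbT.
  apply: (@le_of_eps _ _ _ (N v)) => e e0 _; rewrite add0r; have [f Df vf] := denseD v e0.
  rewrite (_ : rdot v v = rdot v (v - f)); last by rewrite rdotBr (hv f)// subr0.
  by rewrite (le_trans (ler_norm _))// (le_trans (rdot_CS _ _ _))// mulrC ler_wpM2r.
move=> l lX; have [r r0 hr] := isolating_radius X l.
have avoid x : x \in X -> ~ (l - r <= x <= l + r).
  move=> xX /andP[x1 x2]; have := hr x xX; move=> h.
  have xl : x = l by apply: h; rewrite ler_norml; lra.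
  by rewrite -xl xX in lX.
have lr : l - r <= l + r by lra.
have [/finite_seqP[t Et] _] := mourre_eigenvalues lr avoid.
have [r' r'0 hr'] := isolating_radius t l.
exists (Num.min r r'); first by rewrite lt_min r0.
move=> m; rewrite lt_min => /andP[m1 m2] ml.
have [m3 m4] : l - r < m /\ m < l + r.
  by move: m1; rewrite ltr_norml; lra.
have nm : ~ is_eigenvalue H m.
  move=> em; apply/ml/hr'; last exact: ltW.
  have : [set l0 | [/\ l - r <= l0, l0 <= l + r & is_eigenvalue H l0]] m by split => //; exact: ltW.
  by rewrite Et.
have [h|h] := mourreX lr avoid.
  exact: (mourre_smooth_point lB sB bB KB0 hU lipU h m3 m4 nm).
exact: (mourre_smooth_point lB' sB' bB' KB0 hU' lipU_opp (mourreN h) m3 m4 nm).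
Qed.

End MourreTheory.

(** On the zero subspace any map inverts [T - l], so the singular continuous spectrum is empty as
    soon as the singular continuous subspace is zero. *)
Lemma spectrum_on_trivial (R : realType) (V : lmodType R[i]) (dot : {dot V for @Num.conj R[i]})
  (M : set V) (T : V -> V) : islin T -> (forall u, M u -> u = 0) -> spectrum_on dot M T = set0.
Proof.
move=> lT h; apply/seteqP; split => // l; apply; exists id; split => //.
- by exists 1 => u _; rewrite mul1r.
- by move=> u /h ->; rewrite (lin0 lT) scaler0 subr0.
- by move=> u /h ->; rewrite (lin0 lT) scaler0 subr0.
Qed.

(** * Real square-integrable functions *)

Section RealL2.
Context d (T : measurableType d) (R : realType).
Variable mu : {measure set T -> \bar R}.
Implicit Types (f g h : T -> R) (a b : R).

Definition L1 f := mu.-integrable setT (EFin \o f).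

Definition l2 f := measT f /\ L1 (fun x => f x ^+ 2).

Definition sqint f : R := \int[mu]_x (f x ^+ 2).

Lemma L1D f g : L1 f -> L1 g -> L1 (fun x => f x + g x).
Proof. by move=> hf hg; exact: (integrableD measurableT hf hg). Qed.
Lemma L1Z a f : L1 f -> L1 (fun x => a * f x).
Proof. by move=> hf; exact: (integrableZl measurableT a hf). Qed.
Lemma L1B f g : L1 f -> L1 g -> L1 (fun x => f x - g x).
Proof. by move=> hf hg; exact: (integrableB measurableT hf hg). Qed.
Lemma L1_measurable f : L1 f -> measT f.
Proof. by move=> /measurable_int /measurable_EFinP. Qed.

Lemma L1_le f g : measT f -> (forall x, `|f x| <= g x) ->
  L1 g -> L1 f.
Proof.
move=> mf fg ig; apply: (le_integrable _ _ _ ig) => //; first exact/measurable_EFinP.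
by move=> x _ ; rewrite lee_fin (le_trans (fg x)) ?ler_norm.
Qed.

Lemma L1_norm f : L1 f -> L1 (fun x => `|f x|).
Proof.
move=> hf; apply: (@L1_le _ (fun x => `|f x|)).
- exact/measurableT_comp/L1_measurable.
- by move=> x; rewrite normr_id.
exact: (integrable_abse hf).
Qed.

Lemma L1_ltP f : measT f -> (forall x, 0 <= f x) ->
  (\int[mu]_x (f x)%:E < +oo)%E -> L1 f.
Proof.
move=> mf f0 h; apply/integrableP; split; first exact/measurable_EFinP.
by under eq_integral do rewrite /= ger0_norm//.
Qed.

Lemma rintE f : L1 f -> (\int[mu]_x (f x)%:E)%E = (\int[mu]_x f x)%:E.
Proof. by move=> hf; rewrite fineK// integrable_fin_num. Qed.

Lemma rintD f g : L1 f -> L1 g ->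
  \int[mu]_x (f x + g x) = \int[mu]_x f x + \int[mu]_x g x.
Proof. by move=> hf hg; exact: (RintegralD measurableT hf hg). Qed.

Lemma rintB f g : L1 f -> L1 g ->
  \int[mu]_x (f x - g x) = \int[mu]_x f x - \int[mu]_x g x.
Proof. by move=> hf hg; exact: (RintegralB measurableT hf hg). Qed.
Lemma rintZ a f : L1 f -> \int[mu]_x (a * f x) = a * \int[mu]_x f x.
Proof. by move=> hf; rewrite RintegralZl. Qed.

Lemma rint_le f g : L1 f -> L1 g -> (forall x, f x <= g x) ->
  \int[mu]_x f x <= \int[mu]_x g x.
Proof. by move=> hf hg fg; apply: le_Rintegral. Qed.
Lemma rint_ge0 f : (forall x, 0 <= f x) -> 0 <= \int[mu]_x f x.
Proof. by move=> f0; apply: Rintegral_ge0. Qed.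
Lemma rint_abs f : L1 f -> `|\int[mu]_x f x| <= \int[mu]_x `|f x|.
Proof. exact: le_normr_Rintegral. Qed.

Lemma l2_measurable f : l2 f -> measT f. Proof. by case. Qed.

Lemma l2_mul f g : l2 f -> l2 g -> L1 (fun x => f x * g x).
Proof.
move=> [mf hf] [mg hg]; apply: (@L1_le _ (fun x => f x ^+ 2 + g x ^+ 2)).
- exact: measurable_funM.
- move=> x; rewrite normrM -[f x ^+ 2]real_normK ?num_real// -[g x ^+ 2]real_normK ?num_real//.
  by nra.
exact: L1D.
Qed.

Lemma l2D f g : l2 f -> l2 g -> l2 (fun x => f x + g x).
Proof.
move=> lf lg; have [mf hf] := lf; have [mg hg] := lg; split; first exact: measurable_funD.
rewrite (_ : (fun x => _) = (fun x => (f x ^+ 2 + g x ^+ 2) + 2 * (f x * g x))).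
  by apply: L1D; [exact: L1D|apply: L1Z; exact: l2_mul].
by apply/funext => x; ring.
Qed.

Lemma l2Z a f : l2 f -> l2 (fun x => a * f x).
Proof.
move=> [mf hf]; split; first exact: measurable_funM.
rewrite (_ : (fun x => _) = (fun x => a ^+ 2 * f x ^+ 2)); first exact: L1Z.
by apply/funext => x; rewrite exprMn.
Qed.

Lemma l2B f g : l2 f -> l2 g -> l2 (fun x => f x - g x).
Proof.
move=> lf /(l2Z (-1)) /(l2D lf); rewrite (_ : (fun x => _) = (fun x => f x - g x))//.
by apply/funext => x; rewrite mulN1r.
Qed.

Lemma l2_0 : l2 (fun=> 0).
Proof.
split => //; rewrite (_ : (fun _ => _) = fun=> 0); first exact: integrable0.
by rewrite expr0n.
Qed.

Lemma l2_le f g (K : R) : measT f -> l2 g -> (forall x, `|f x| <= K * `|g x|) -> l2 f.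
Proof.
move=> mf [mg hg] fg; split => //; apply: (@L1_le _ (fun x => K ^+ 2 * g x ^+ 2)).
- exact: measurable_funX.
- move=> x; rewrite normrX -[g x ^+ 2]real_normK ?num_real// -exprMn ler_sqr//.
  exact: le_trans (fg x).
exact: L1Z.
Qed.

Lemma sqint_ge0 f : 0 <= sqint f.
Proof. exact: rint_ge0 => x. Qed.

Lemma l2_CS f g : l2 f -> l2 g -> (\int[mu]_x (f x * g x)) ^+ 2 <= sqint f * sqint g.
Proof.
move=> lf lg; have ifg := l2_mul lf lg; have [_ if2] := lf; have [_ ig2] := lg.
set p := \int[mu]_x (f x * g x).
have h t : 0 <= sqint f - 2 * t * p + t ^+ 2 * sqint g.
  have -> : sqint f - 2 * t * p + t ^+ 2 * sqint g = \int[mu]_x ((f x - t * g x) ^+ 2).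
    rewrite -!rintZ// -rintB//; last exact: L1Z.
    rewrite -rintD; [|by apply: L1B => //; exact: L1Z|exact: L1Z].
    by apply: eq_Rintegral => x _; ring.
  exact: rint_ge0 => x.
have [g0|g0] := eqVneq (sqint g) 0.
  rewrite g0 mulr0; have [p0|p0] := eqVneq p 0; first by rewrite p0 expr0n.
  have := h ((sqint f + 1) / (2 * p)); rewrite g0.
  have -> : 2 * ((sqint f + 1) / (2 * p)) * p = sqint f + 1 by field.
  by lra.
have gp : 0 < sqint g by rewrite lt_neqAle eq_sym g0 sqint_ge0.
have := h (p / sqint g).
have -> : sqint f - 2 * (p / sqint g) * p + (p / sqint g) ^+ 2 * sqint g = sqint f - p ^+ 2 / sqint g.
  by field.
by rewrite subr_ge0 ler_pdivrMr.
Qed.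

Lemma l2P f : (f \in Lfun mu 2%:E) <-> l2 f.
Proof.
split=> [hf|[mf hf]].
  split; last exact: Lfun2_integrable_sqr.
  by move: hf; rewrite inE => /andP[/[!inE]].
apply/andP; split; rewrite inE//= /finite_norm unlock.
apply: poweR_lty.
case/integrableP: hf => _; apply: le_lt_trans; apply: ge0_le_integral => //.
- by move=> x _; rewrite lee_fin.
- apply/measurable_EFinP/(@measurableT_comp _ _ _ _ _ _ (fun x : R => x `^ 2)) => //.
  exact/measurableT_comp.
- by apply: measurableT_comp => //; apply/measurable_EFinP; exact: measurable_funX.
by move=> t _ /=; rewrite powR_mulrn// normrX.
Qed.

Lemma sqint0_ae f : l2 f -> sqint f = 0 -> \forall x \ae mu, f x = 0.
Proof.
move=> [mf hf] f0.
have /(ae_eq_integral_abs mu measurableT (measurable_int mu hf)) :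
    (\int[mu]_x `|(EFin \o (fun x => f x ^+ 2)%R) x| = 0)%E.
  under eq_integral do rewrite gee0_abs ?lee_fin//.
  by rewrite (rintE hf) -/(sqint f) f0.
by apply: filterS => x /(_ I) [] /eqP; rewrite sqrf_eq0 => /eqP.
Qed.

Lemma ae_sqint0 f : measT f -> (\forall x \ae mu, f x = 0) -> l2 f /\ sqint f = 0.
Proof.
move=> mf f0.
have h : (\int[mu]_x (f x ^+ 2)%:E = 0)%E.
  rewrite (ae_eq_integral (cst 0%E))//; first exact: integral0.
    by apply/measurable_EFinP; exact: measurable_funX.
  by apply: filterS f0 => x -> _; rewrite expr0n.
split; last by rewrite /sqint /Rintegral h.
split => //; apply: L1_ltP; first exact: measurable_funX.
  by [].
by rewrite h.
Qed.

(** Riesz-Fischer: a fast subsequence converges almost everywhere, and Fatou's lemma carries the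
    Cauchy bound to its limit. *)
Lemma l2_complete (f : nat -> T -> R) : (forall n, l2 (f n)) ->
  (forall e, 0 < e -> exists K, forall m n, (K <= m)%N -> (K <= n)%N ->
     sqint (fun x => f m x - f n x) <= e) ->
  exists g, l2 g /\ forall e, 0 < e -> exists K, forall n, (K <= n)%N ->
     sqint (fun x => f n x - g x) <= e.
Proof.
move=> lf cf.
have e8 k : 0 < 8^-1 ^+ k :> R by [].
pose K k := projT1 (cid (cf _ (e8 k))).
have hK k m n : (K k <= m)%N -> (K k <= n)%N -> sqint (fun x => f m x - f n x) <= 8^-1 ^+ k.
  by rewrite /K; case: cid => K' /= h' h1 h2; exact: h'.
pose s := fix s k := if k is j.+1 then maxn (K k) (s j).+1 else K 0.
have sK k : (K k <= s k)%N by case: k => [//|k] ; exact: leq_maxl.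
have sS k : (s k <= s k.+1)%N by rewrite (leq_trans (leqnSn _)) ?leq_maxr.
(* The increments have square integral at most [8^-k]. The weight [4^k] leaves a summable [2^-k],
   and wherever the sum of the [D k x] is finite it gives pointwise increments of order [2^-k]. *)
pose g k := f (s k); pose D k x := 4 ^+ k * (g k.+1 x - g k x) ^+ 2.
have lg k : l2 (g k) by exact: lf.
have D0 k x : 0 <= D k x by rewrite mulr_ge0.
have iD k : (\int[mu]_x (D k x)%:E <= (2^-1 ^+ k)%:E)%E.
  have [_ lB] := l2B (lg k.+1) (lg k).
  rewrite (rintE (L1Z (4 ^+ k) lB)) rintZ// lee_fin.
  have := hK k (s k.+1) (s k); rewrite sK => /(_ (leq_trans (sK k) (sS k)) isT) h.
  rewrite (le_trans (ler_wpM2l _ h))// -exprMn.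
  by rewrite (_ : 4 / 8 = 2^-1)//; field.
have mD k : measT (EFin \o D k).
  apply/measurable_EFinP; apply: measurable_funM => //.
  by apply: measurable_funX; apply: measurable_funB; case: (lg k.+1); case: (lg k).
pose h x : \bar R := (\sum_(0 <= k <oo) (D k x)%:E)%E.
have ih : (\int[mu]_x h x < +oo)%E.
  rewrite integral_nneseries//; last by move=> k x _; rewrite lee_fin.
  apply: (@le_lt_trans _ _ 2%:E); last by rewrite ltry.
  apply: lime_le.
    by apply: is_cvg_nneseries => k _ _; apply: integral_ge0 => x _; rewrite lee_fin.
  apply: nearW => n; apply: (@le_trans _ _ (\sum_(0 <= k < n) (2^-1 ^+ k)%:E)%E).
    exact: lee_sum => k _.
  rewrite sumEFin lee_fin (_ : \sum_(0 <= k < n) 2^-1 ^+ k = 2 - 2 * 2^-1 ^+ n).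
    by rewrite gerBl.
  elim: n => [|n ihn]; first by rewrite big_geq//; ring.
  by rewrite big_nat_recr//= ihn exprS; field.
have mh : measT h.
  apply: (@ge0_emeasurable_sum _ _ _ setT (fun k x => (D k x)%:E) xpredT) => [k x _ _|k _].
    by rewrite lee_fin.
  exact: mD.
have h0 x : (0 <= h x)%E by apply: nneseries_ge0 => k _ _; rewrite lee_fin.
pose A := [set x | h x < +oo]%E.
have mA : measurable A by rewrite -[X in measurable X]setTI; exact: emeasurable_fun_infty_o.
(* Cutting off to [A] makes the sequence converge at every point, so the limit is measurable, and
   changes it only on a null set. *)
pose g' k x := g k x * \1_A x.
have mg' k : measT (g' k).
  by apply: measurable_funM; case: (lg k).
have aeA : \forall x \ae mu, A x.
  have : mu.-integrable setT h.
    by apply/integrableP; under eq_integral do rewrite gee0_abs//.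
  by move=> /(integrable_ae measurableT); apply: filterS => x /(_ I); rewrite ge0_fin_numE.
have g'g k : \forall x \ae mu, g' k x = g k x.
  by apply: filterS aeA => x Ax; rewrite /g' indicE mem_set// mulr1.
have hc x : cvgn (g'^~ x).
  have [Ax|Ax] := pselect (A x); last first.
    rewrite (_ : g'^~ x = fun=> 0); first exact: is_cvg_cst.
    by apply/funext => k; rewrite /g' indicE memNset// mulr0.
  have hx : h x \is a fin_num by rewrite ge0_fin_numE.
  pose S := fine (h x); have S0 : 0 <= S by rewrite fine_ge0.
  have DS k : D k x <= S.
    rewrite -lee_fin fineK// /h (@nneseriesD1 _ _ k)//; last by move=> *; rewrite lee_fin.
    by rewrite leeDl// nneseries_ge0// => *; rewrite lee_fin.
  have dk k : `|g k.+1 x - g k x| <= geometric (Num.sqrt S) 2^-1 k.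
    rewrite /= -ler_sqr ?nnegrE// exprMn sqr_sqrtr//.
    rewrite real_normK ?num_real// -exprM mulnC exprM exprVn (_ : 2 ^+ 2 = 4); last by ring.
    by rewrite exprVn ler_pdivlMr// mulrC; exact: DS.
  have -> : g'^~ x = fun k => g 0 x + series (fun k => g k.+1 x - g k x) k.
    apply/funext => k; rewrite /g' indicE mem_set// /series /= telescope_sumr//.
    by lra.
  apply: is_cvgD; first exact: is_cvg_cst.
  apply: normed_cvg; apply: (@series_le_cvg _ _ (geometric (Num.sqrt S) 2^-1)) => [k|k|//|]; first exact: normr_ge0.
    by rewrite /=.
  by apply: is_cvg_geometric_series; rewrite ger0_norm// invf_lt1// ltr1n.
pose G x := limn (g'^~ x).
have mG : measT G.
  exact: (measurable_fun_cvg mg') => x _.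
have bound m K0 e : (forall n, (K0 <= n)%N -> sqint (fun x => f m x - f n x) <= e) ->
    l2 (fun x => f m x - G x) /\ sqint (fun x => f m x - G x) <= e.
  move=> he; have mf : measT (f m) by case: (lf m).
  have sk k : (k <= s k)%N by elim: k => [//|k ihk] ; rewrite (leq_trans _ (leq_maxr _ _)).
  pose F k x := ((f m x - g' (k + K0) x) ^+ 2)%:E.
  have mF k : measT (F k).
    by apply/measurable_EFinP; apply: measurable_funX; exact: measurable_funB.
  have Flim x : limn_einf (F^~ x) = ((f m x - G x) ^+ 2)%:E.
    have : F^~ x @ \oo --> ((f m x - G x) ^+ 2)%:E.
      apply: cvg_EFin; first exact: nearW.
      have c0 : g' (k + K0) x @[k --> \oo] --> G x.
        by rewrite (cvg_shiftn K0 (g'^~ x)).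
      have c1 : f m x - g' (k + K0) x @[k --> \oo] --> f m x - G x by apply: cvgB => //; exact: cvg_cst.
      by exact: cvgM.
    by move=> /cvg_limn_einf_sup[].
  have iF k : (\int[mu]_x F k x <= e%:E)%E.
    have ae1 : \forall x \ae mu, f m x - g (k + K0) x = f m x - g' (k + K0) x.
      by apply: filterS (g'g (k + K0)) => x ->.
    have lm := l2B (lf m) (lg (k + K0)).
    rewrite (ae_eq_integral (fun x => ((f m x - g (k + K0) x) ^+ 2)%:E))//.
    - rewrite rintE; last by case: lm.
      by rewrite lee_fin he// (leq_trans _ (sk _))// leq_addl.
    - by apply/measurable_EFinP; apply: measurable_funX; case: lm.
    - by apply: filterS ae1 => x ->.
  have iG : (\int[mu]_x ((f m x - G x) ^+ 2)%:E <= e%:E)%E.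
    under eq_integral do rewrite -Flim.
    apply: (le_trans (fatou mu measurableT mF _)); first by move=> k x _; rewrite lee_fin.
    rewrite limn_einf_lim; apply: lime_le; first exact: is_cvg_einfs.
    by apply: nearW => n; apply: le_trans (iF n); apply: ereal_inf_lbound; exists n => /=.
  have mfG : measT (fun x => f m x - G x) by exact: measurable_funB.
  have lfG : l2 (fun x => f m x - G x).
    split => //; apply: L1_ltP; first exact: measurable_funX.
      by [].
    by rewrite (le_lt_trans iG)// ltry.
  by rewrite -lee_fin -rintE; case: lfG.
exists G; split; last first.
  move=> e /cf[K0 hK0]; exists K0 => n Kn; have [|//] := bound n K0 e.
  by move=> k Kk; exact: hK0.
have [K0 hK0] := cf 1 ltr01; have [|l0 _] := bound K0 K0 1; first by move=> n Kn; exact: hK0.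
have := l2B (lf K0) l0; rewrite (_ : (fun x => _) = G)//.
by apply/funext => x; rewrite subKr.
Qed.

End RealL2.

(** * Complex classes and completeness *)

Section ComplexClasses.
Context d (T : measurableType d) (R : realType).
Variable mu : {measure set T -> \bar R}.
Implicit Types (f g : T -> R[i]) (u v : cL2 mu).
Local Notation rdot := (reform (@cL2_dot _ _ _ mu)).
Local Notation N := (hnorm (@cL2_dot _ _ _ mu)).

Definition cl2 f := l2 mu (fun x => Re (f x)) /\ l2 mu (fun x => Im (f x)).

Lemma csqintP f : (f \in csqint mu) <-> cl2 f.
Proof.
split=> [/andP[h1 h2]|[h1 h2]]; first by split; exact/l2P.
by apply/andP; split; exact/l2P.
Qed.

(** Total on functions: one that is not square integrable receives the class of 0, so statements
    about [classof] carry [cl2]. *)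
Definition classof f : cL2 mu := cL2_class (insubd (0 : cLfun mu) f).

Lemma insubd_cl2 f : cl2 f -> insubd (0 : cLfun mu) f = f :> (T -> R[i]).
Proof. by move=> /csqintP hf; exact: (@insubdK _ _ (cLfun mu) 0 f hf). Qed.
Lemma cLfun_cl2 (f : cLfun mu) : cl2 f.
Proof. by apply/csqintP; exact: valP. Qed.
Lemma classof_cLfun (f : cLfun mu) : classof f = cL2_class f.
Proof. by congr cL2_class; apply: val_inj; exact: (insubd_cl2 (cLfun_cl2 f)). Qed.
Lemma classof_repr u : classof (repr u) = u.
Proof. by rewrite classof_cLfun; exact: reprK. Qed.
Lemma classofP u : exists2 f, cl2 f & u = classof f.
Proof. by exists (repr u); [exact: cLfun_cl2|rewrite classof_repr]. Qed.
Lemma classof_eq f g : cl2 f -> cl2 g -> (\forall x \ae mu, f x = g x) -> classof f = classof g.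
Proof. by move=> hf hg fg; apply/cL2_classP; rewrite !insubd_cl2. Qed.
Lemma repr_classof f : cl2 f -> \forall x \ae mu, repr (classof f) x = f x.
Proof. by move=> hf; have := cL2_repr (insubd (0 : cLfun mu) f); rewrite insubd_cl2. Qed.

Lemma cl2_lin (a : R[i]) f g : cl2 f -> cl2 g -> cl2 (fun x => a * f x + g x).
Proof.
move=> /csqintP hf /csqintP hg; apply/csqintP.
by have [_ h] := csqint_submod_closed mu; exact: h.
Qed.

Lemma classof_lin (a : R[i]) f g : cl2 f -> cl2 g ->
  classof (fun x => a * f x + g x) = a *: classof f + classof g.
Proof.
move=> hf hg; rewrite -cL2_classZ -cL2_classD; apply/cL2_classP; apply: aeW => x.
rewrite (insubd_cl2 (cl2_lin a hf hg)).
by rewrite -[RHS]/(a * insubd (0 : cLfun mu) f x + insubd (0 : cLfun mu) g x) !insubd_cl2.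
Qed.

Lemma cl2_0 : cl2 (fun=> 0). Proof. by split; exact: l2_0. Qed.

Lemma cl2_real (g : T -> R) : l2 mu g -> cl2 (fun x => (g x)%:C).
Proof. by split => //; exact: l2_0. Qed.
Lemma cl2Z (a : R[i]) f : cl2 f -> cl2 (fun x => a * f x).
Proof. by move=> hf; have := cl2_lin a hf cl2_0; under eq_fun do rewrite addr0. Qed.
Lemma classof0 : classof (fun=> 0) = 0.
Proof. by have := classof_lin (-1) cl2_0 cl2_0; rewrite scaleN1r addNr; under eq_fun do rewrite mulr0 addr0. Qed.
Lemma classofZ (a : R[i]) f : cl2 f -> classof (fun x => a * f x) = a *: classof f.
Proof. by move=> hf; have := classof_lin a hf cl2_0; rewrite classof0 addr0; under eq_fun do rewrite addr0. Qed.

Lemma rdot_classof f g : cl2 f -> cl2 g -> rdot (classof f) (classof g) =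
  \int[mu]_x (Re (f x) * Re (g x)) + \int[mu]_x (Im (f x) * Im (g x)).
Proof.
move=> hf hg; transitivity (complex.Re (cL2_dot (classof f) (classof g))) => //.
rewrite cL2_dotE !insubd_cl2//.
have [f1 f2] := hf; have [g1 g2] := hg.
rewrite -rintD; [|exact: l2_mul..]; apply: eq_Rintegral => x _.
by rewrite !cpartsE mulrN opprK.
Qed.

Lemma hnorm_classof f : cl2 f ->
  N (classof f) ^+ 2 = sqint mu (fun x => Re (f x)) + sqint mu (fun x => Im (f x)).
Proof. by move=> hf; rewrite hnorm_sqr rdot_classof. Qed.

Lemma cL2_complete : hcomplete (@cL2_dot _ _ _ mu).
Proof.
move=> x cx; pose f n : T -> R[i] := repr (x n).
have lf n : cl2 (f n) by exact: cLfun_cl2.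
have xE n : x n = classof (f n) by rewrite classof_repr.
have dE m n : N (x m - x n) ^+ 2 = sqint mu (fun t => Re (f m t) - Re (f n t)) +
    sqint mu (fun t => Im (f m t) - Im (f n t)).
  have -> : x m - x n = classof (fun t => -1 * f n t + f m t).
    by rewrite classof_lin// -!xE scaleN1r addrC.
  rewrite hnorm_classof; last exact: cl2_lin.
  by congr (sqint mu _ + sqint mu _); apply/funext => t; rewrite !cpartsE /=; ring.
have part (p : R[i] -> R) : (forall n, l2 mu (fun t => p (f n t))) ->
    (forall m n, sqint mu (fun t => p (f m t) - p (f n t)) <= N (x m - x n) ^+ 2) ->
    exists g : T -> R, l2 mu g /\ forall e, 0 < e -> exists K, forall n, (K <= n)%N ->
      sqint mu (fun t => p (f n t) - g t) <= e.
  move=> lp hp; apply: l2_complete => // e e0.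
  have [|K hK] := cx (Num.sqrt e); first by rewrite sqrtr_gt0.
  exists K => m n Km Kn; rewrite (le_trans (hp m n))// -[leRHS]sqr_sqrtr//.
  by rewrite ler_sqr ?nnegrE//; exact: hK.
have [||g1 [lg1 h1]] := part (@complex.Re R).
- by move=> n; case: (lf n).
- by move=> m n; rewrite dE lerDl sqint_ge0.
have [||g2 [lg2 h2]] := part (@complex.Im R).
- by move=> n; case: (lf n).
- by move=> m n; rewrite dE lerDr sqint_ge0.
exists (classof (fun t => g1 t +i* g2 t)); apply: eps_cvg0 => [n|e e0]//.
have e2 : 0 < e ^+ 2 / 2 by [].
have [K1 hK1] := h1 _ e2; have [K2 hK2] := h2 _ e2; exists (maxn K1 K2) => n.
rewrite geq_max => /andP[/hK1 k1 /hK2 k2].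
rewrite -ler_sqr ?nnegrE//.
have -> : x n - classof (fun t => g1 t +i* g2 t) = classof (fun t => -1 * (g1 t +i* g2 t) + f n t).
  by rewrite classof_lin// -xE scaleN1r addrC.
rewrite hnorm_classof; last exact: cl2_lin.
rewrite [leRHS](splitr (e ^+ 2)) lerD//; [move: k1|move: k2]; apply: le_trans; rewrite le_eqVlt; apply/orP; left; apply/eqP.
  by congr (sqint mu _); apply/funext => t; rewrite !cpartsE /=; ring.
by congr (sqint mu _); apply/funext => t; rewrite !cpartsE /=; ring.
Qed.

End ComplexClasses.

(** * Real operators on functions and their complex lifts *)

Section RealOperators.
Context d1 (T1 : measurableType d1) d2 (T2 : measurableType d2) (R : realType).
Variables (mu1 : {measure set T1 -> \bar R}) (mu2 : {measure set T2 -> \bar R}).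
Implicit Types (F G : (T2 -> R) -> (T1 -> R)) (K : R) (f g : T2 -> R).

(** The operators act on functions, not on classes, and are linear everywhere, so that compositions
    and kernels are computed by equality of functions. The norm bound alone makes them respect
    almost everywhere equality ([real_op_ae]), whence [lift]. *)
Definition real_op K F := [/\ 0 <= K,
  forall f, l2 mu2 f -> l2 mu1 (F f),
  forall a f g, l2 mu2 f -> l2 mu2 g -> F (fun y => a * f y + g y) = fun x => a * F f x + F g x &
  forall f, l2 mu2 f -> sqint mu1 (F f) <= K ^+ 2 * sqint mu2 f].

Definition complexified F (f : T2 -> R[i]) (x : T1) : R[i] :=
  F (fun y => Re (f y)) x +i* F (fun y => Im (f y)) x.

Definition lift F (u : cL2 mu2) : cL2 mu1 := classof mu1 (complexified F (repr u)).

Lemma real_opB K F f g : real_op K F -> l2 mu2 f -> l2 mu2 g ->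
  F (fun y => f y - g y) = fun x => F f x - F g x.
Proof.
case=> _ _ lF _ lf lg; rewrite (_ : (fun y => _) = (fun y => -1 * g y + f y)).
  by rewrite lF//; apply/funext => x; ring.
by apply/funext => y; ring.
Qed.

Lemma real_op_ae K F f g : real_op K F -> l2 mu2 f -> l2 mu2 g ->
  (\forall y \ae mu2, f y = g y) -> \forall x \ae mu1, F f x = F g x.
Proof.
move=> hF lf lg fg; have [_ h1 _ h3] := hF; have lfg := l2B lf lg.
have [|_ s0] := @ae_sqint0 _ _ _ mu2 _ (l2_measurable lfg); first by apply: filterS fg => y ->; rewrite subrr.
have := h3 _ lfg; rewrite s0 mulr0 => h.
have /(sqint0_ae (h1 _ lfg)) : sqint mu1 (F (fun y => f y - g y)) = 0.
  by apply/eqP; rewrite eq_le h sqint_ge0.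
by rewrite (real_opB hF)//; apply: filterS => x /eqP; rewrite subr_eq0 => /eqP.
Qed.

Lemma cl2_complexified K F (f : T2 -> R[i]) : real_op K F -> cl2 mu2 f -> cl2 mu1 (complexified F f).
Proof. by case=> _ h _ _ [h1 h2]; split; exact: h. Qed.

Lemma lift_classof K F (f : T2 -> R[i]) : real_op K F -> cl2 mu2 f ->
  lift F (classof mu2 f) = classof mu1 (complexified F f).
Proof.
move=> hF hf; have hr : cl2 mu2 (repr (classof mu2 f)) by exact: cLfun_cl2.
apply: classof_eq; [exact: cl2_complexified hF hr|exact: cl2_complexified hF hf|].
have [r1 r2] := hr; have [f1 f2] := hf; have ae := repr_classof hf.
have a1 : \forall x \ae mu1, F (fun y => Re (repr (classof mu2 f) y)) x = F (fun y => Re (f y)) x.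
  by apply: real_op_ae hF _ _ _ => //; apply: filterS ae => y ->.
have a2 : \forall x \ae mu1, F (fun y => Im (repr (classof mu2 f) y)) x = F (fun y => Im (f y)) x.
  by apply: real_op_ae hF _ _ _ => //; apply: filterS ae => y ->.
by apply: filterS2 a1 a2 => x; rewrite /complexified => -> ->.
Qed.

Lemma lift_lin K F : real_op K F -> forall (a : R[i]) u v, lift F (a *: u + v) = a *: lift F u + lift F v.
Proof.
move=> hF a u v; have [f hf ->] := classofP u; have [g hg ->] := classofP v.
rewrite -classof_lin// !(lift_classof hF)//; last exact: cl2_lin.
rewrite -classof_lin; [|exact: cl2_complexified hF _..]; congr (classof mu1 _).
have [f1 f2] := hf; have [g1 g2] := hg; have [_ _ lF _] := hF.
apply/funext => x; apply: complex_eq; rewrite !cpartsE /=.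
- rewrite (_ : (fun y => Re _) = (fun y => Re a * Re (f y) + (- Im a * Im (f y) + Re (g y)))).
    by rewrite lF//; [rewrite lF//; ring|have := l2D (l2Z (- Im a) f2) g1].
  by apply/funext => y; rewrite !cpartsE; ring.
- rewrite (_ : (fun y => Im _) = (fun y => Re a * Im (f y) + (Im a * Re (f y) + Im (g y)))).
    by rewrite lF//; [rewrite lF//; ring|have := l2D (l2Z (Im a) f1) g2].
  by apply/funext => y; rewrite !cpartsE; ring.
Qed.

Lemma lift_bound K F u : real_op K F ->
  hnorm (@cL2_dot _ _ _ mu1) (lift F u) <= K * hnorm (@cL2_dot _ _ _ mu2) u.
Proof.
move=> hF; have [f hf ->] := classofP u; have [K0 _ _ h] := hF; have [f1 f2] := hf.
rewrite (lift_classof hF)// -ler_sqr ?nnegrE// exprMn.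
rewrite !hnorm_classof//; last exact: cl2_complexified hF hf.
by rewrite mulrDr lerD// h.
Qed.

Lemma lift_ext K F K' G : real_op K F -> real_op K' G ->
  (forall f, l2 mu2 f -> F f = G f) -> lift F = lift G.
Proof.
move=> hF hG h; apply/funext => u; have [f hf ->] := classofP u; have [f1 f2] := hf.
by rewrite (lift_classof hF)// (lift_classof hG)// /complexified h// h.
Qed.

Lemma real_op_comb K K' F G (a : R) : real_op K F -> real_op K' G ->
  real_op (`|a| * K + K') (fun f x => a * F f x + G f x).
Proof.
move=> [K0 F1 F2 F3] [K'0 G1 G2 G3]; split.
- by [].
- by move=> f lf; have := l2D (l2Z a (F1 _ lf)) (G1 _ lf).
- by move=> c f g lf lg; rewrite F2// G2//; apply/funext => x; ring.
move=> f lf; have l1 := F1 _ lf; have l2' := G1 _ lf; have [_ i1] := l1; have [_ i2] := l2'.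
have i3 := l2_mul l1 l2'.
have -> : sqint mu1 (fun x => a * F f x + G f x) =
    a ^+ 2 * sqint mu1 (F f) + (2 * a * \int[mu1]_x (F f x * G f x) + sqint mu1 (G f)).
  rewrite /sqint -!rintZ// -!rintD//; last 2 first.
  - by apply: L1D => //; exact: L1Z.
  - exact: L1Z.
  - by apply: eq_Rintegral => x _; ring.
  exact: L1Z.
set s := sqint mu2 f; have s0 : 0 <= s by exact: sqint_ge0.
have h1 : a ^+ 2 * sqint mu1 (F f) <= `|a| ^+ 2 * (K ^+ 2 * s).
  by rewrite real_normK ?num_real// ler_wpM2l//; exact: F3.
have h2 := G3 _ lf; rewrite -/s in h2.
have h3 : `|\int[mu1]_x (F f x * G f x)| <= K * K' * s.
  rewrite -ler_sqr ?nnegrE// real_normK ?num_real// (le_trans (l2_CS l1 l2'))//.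
  have := ler_pM (sqint_ge0 _ _) (sqint_ge0 _ _) (F3 _ lf) h2; rewrite -/s.
  by lra.
have h4 : 2 * a * \int[mu1]_x (F f x * G f x) <= 2 * `|a| * (K * K' * s).
  rewrite (le_trans (ler_norm _))// !normrM ger0_norm//.
  by rewrite ler_wpM2l.
by lra.
Qed.

Lemma lift_comb K K' F G (a : R) u : real_op K F -> real_op K' G ->
  lift (fun f x => a * F f x + G f x) u = a%:C *: lift F u + lift G u.
Proof.
move=> hF hG; have [f hf ->] := classofP u.
rewrite (lift_classof (real_op_comb a hF hG))// (lift_classof hF)// (lift_classof hG)//.
rewrite -classof_lin; [|exact: cl2_complexified hF _|exact: cl2_complexified hG _].
congr (classof mu1 _); apply/funext => x; apply: complex_eq; rewrite /=; ring.
Qed.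

End RealOperators.
Arguments lift {d1 T1 d2 T2 R} mu1 mu2 F u.

Section OperatorAlgebra.
Context d1 (T1 : measurableType d1) d2 (T2 : measurableType d2) d3 (T3 : measurableType d3) (R : realType).
Variables (mu1 : {measure set T1 -> \bar R}) (mu2 : {measure set T2 -> \bar R})
  (mu3 : {measure set T3 -> \bar R}).

Lemma real_op_comp K K' F G : real_op mu1 mu2 K F -> real_op mu2 mu3 K' G ->
  real_op mu1 mu3 (K * K') (F \o G).
Proof.
move=> [K0 F1 F2 F3] [K'0 G1 G2 G3]; split.
- by [].
- by move=> f lf; apply/F1/G1.
- by move=> a f g lf lg; rewrite /= G2// F2//; exact: G1.
move=> f lf; apply: le_trans (F3 _ (G1 _ lf)) _.
rewrite (le_trans (ler_wpM2l (sqr_ge0 K) (G3 _ lf)))//.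
by lra.
Qed.

Lemma lift_comp K K' F G (u : cL2 mu3) : real_op mu1 mu2 K F -> real_op mu2 mu3 K' G ->
  lift mu1 mu2 F (lift mu2 mu3 G u) = lift mu1 mu3 (F \o G) u.
Proof.
move=> hF hG; have [f hf ->] := classofP u.
rewrite (lift_classof hG)// (lift_classof hF); last exact: cl2_complexified hG hf.
by rewrite (lift_classof (real_op_comp hF hG)).
Qed.

Lemma lift_adj K K' F G (u : cL2 mu2) (v : cL2 mu1) : real_op mu1 mu2 K F -> real_op mu2 mu1 K' G ->
  (forall f g, l2 mu2 f -> l2 mu1 g -> \int[mu1]_x (F f x * g x) = \int[mu2]_x (f x * G g x)) ->
  reform (@cL2_dot _ _ _ mu1) (lift mu1 mu2 F u) v = reform (@cL2_dot _ _ _ mu2) u (lift mu2 mu1 G v).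
Proof.
move=> hF hG h; have [f hf ->] := classofP u; have [g hg ->] := classofP v.
rewrite (lift_classof hF)// (lift_classof hG)// !rdot_classof//; last 2 first.
- exact: cl2_complexified hG hg.
- exact: cl2_complexified hF hf.
have [f1 f2] := hf; have [g1 g2] := hg.
by rewrite !h.
Qed.

End OperatorAlgebra.

(** * Densities and change of variables *)

Section Density.
Local Open Scope ereal_scope.
Context d (T : measurableType d) (R : realType).
Variables (mu : {measure set T -> \bar R}) (p : T -> R).
Hypotheses (mp : measT p) (p0 : forall x, (0 <= p x)%R).

(** The measurability and sign of [p] are arguments, so that a measure structure can be attached to
    the set function itself. *)
Definition density_measure of measT p & (forall x, (0 <= p x)%R) :=
  fun A : set T => \int[mu]_(x in A) (p x)%:E.
Local Notation m := (density_measure mp p0).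
Import HBNNSimple.

Let density0 : m set0 = 0.
Proof. by rewrite /density_measure integral_set0. Qed.

Let mpE : measT (EFin \o p). Proof. exact/measurable_EFinP. Qed.
Let pE0 x : 0 <= (p x)%:E. Proof. by rewrite lee_fin. Qed.

Let density_ge0 A : 0 <= m A.
Proof. exact: integral_ge0 => x _. Qed.

Let density_sigma_additive : semi_sigma_additive m.
Proof.
move=> F mF tF mUF; rewrite /density_measure ge0_integral_bigcup//; last exact: (measurable_funTS mpE).
apply: is_cvg_nneseries => n _ _; apply: integral_ge0 => x _; exact: pE0.
Qed.

HB.instance Definition _ := isMeasure.Build _ _ _ m
  density0 density_ge0 density_sigma_additive.

Lemma integral_density (g : T -> \bar R) : measT g -> (forall x, 0 <= g x) ->
  \int[m]_x g x = \int[mu]_x ((p x)%:E * g x).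
Proof.
move=> mg g0; pose s := nnsfun_approx measurableT mg.
have ms n : measT (EFin \o (s n : T -> R)) by exact/measurable_EFinP.
have s0 n x : 0 <= (EFin \o s n) x by rewrite lee_fin.
have lims x : (EFin \o s n) x @[n --> \oo] --> g x by exact: cvg_nnsfun_approx.
have nds x : {homo (fun n => (EFin \o s n) x) : n m / (n <= m)%N >-> n <= m}.
  by move=> n m nm; exact/lefP/nd_nnsfun_approx.
have -> : \int[m]_x g x = limn (fun n => \int[m]_x (EFin \o s n) x).
  by rewrite -monotone_convergence//; apply: eq_integral => x _; apply/esym/cvg_lim.
have -> : \int[mu]_x ((p x)%:E * g x) = limn (fun n => \int[mu]_x ((p x)%:E * (EFin \o s n) x)).
  rewrite -monotone_convergence//.
  - apply: eq_integral => x _; apply/esym/cvg_lim => //.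
    exact: cvgeZl.
  - by move=> n; exact: (emeasurable_funM mpE (ms n)).
  - by move=> n x _; exact: (mule_ge0 (pE0 x) (s0 n x)).
  - by move=> x _ n m nm; exact: (lee_wpmul2l (pE0 x) (nds x n m nm)).
congr (limn _); apply/funext => n.
have indich r : measT (fun x => (r * \1_(s n @^-1` [set r]) x)%:E).
  by apply/measurable_EFinP; exact: measurable_funM.
transitivity (\int[m]_x
   (\sum_(y \in range (s n)) (y * \1_(s n @^-1` [set y]) x)%:E)).
  by apply: eq_integral => t tE; rewrite /= fimfunE -fsumEFin.
rewrite ge0_integral_fsum//; last by move=> m y Ey; exact: nnfun_muleindic_ge0.
transitivity (\int[mu]_x (\sum_(y \in range (s n))
    ((p x)%:E * (y * \1_(s n @^-1` [set y]) x)%:E))); last first.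
  apply: eq_integral => x _; rewrite -ge0_mule_fsumr => [|y]; last exact: nnfun_muleindic_ge0.
  by rewrite fsumEFin // -(fimfunE _ x).
rewrite ge0_integral_fsum//; last 2 first.
  - by move=> y; exact: (emeasurable_funM mpE (indich y)).
  - by move=> r y _; apply: mule_ge0 (pE0 y) _; exact: nnfun_muleindic_ge0.
apply: eq_fsbigr => r rhn.
rewrite integralZl_indic_nnsfun //.
under [RHS]eq_integral do rewrite EFinM muleCA.
rewrite ge0_integralZl//.
- rewrite integral_indic// setIT; congr (_ * _).
  rewrite [LHS]integral_mkcond.
  by apply: eq_integral => x _; rewrite /patch indicE; case: ifP => _; rewrite ?mule1 ?mule0.
- by apply: emeasurable_funM; exact/measurable_EFinP.
- by move=> t _; rewrite mule_ge0.
- by move: rhn; rewrite inE => -[t _ <-]; rewrite lee_fin.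
Qed.

End Density.

Section ChangeOfVariables.
Context d1 (T1 : measurableType d1) (R : realType).
Variables (mu1 : {measure set T1 -> \bar R}) (phi : T1 -> measurableTypeR R) (p : T1 -> R).
Hypotheses (mphi : measT phi) (mp : measT p) (p0 : forall x, 0 <= p x).
Hypothesis phi_itv : forall a b : R, a < b ->
  (\int[mu1]_(x in phi @^-1` `]a, b]%classic) (p x)%:E = (b - a)%:E)%E.
Local Notation mu := (@lebesgue_measure R).

Let phi_mixin := isMeasurableFun.Build _ _ _ _ _ mphi.
Let phi_pack : {mfun T1 >-> measurableTypeR R} := HB.pack phi phi_mixin.

(** The image under [phi] of the measure with density [p] has the right mass on half-open intervals,
    so it is Lebesgue measure by uniqueness. *)
Lemma ge0_change_of_variables (g : R -> \bar R) : measT (g : measurableTypeR R -> \bar R) ->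
  (forall x, 0 <= g x)%E -> (\int[mu1]_x ((p x)%:E * g (phi x)) = \int[mu]_x g x)%E.
Proof.
move=> mg g0; pose m := pushforward (density_measure mu1 mp p0) phi_pack.
rewrite (@eq_measure_integral _ _ _ setT m); last first.
  move=> A mA _; apply: lebesgue_measure_unique => // _ [[a b] /= _ <-].
  rewrite /pushforward /density_measure; case: (ltP a b) => ab.
    by rewrite lebesgue_measure_itv lte_fin ab phi_itv.
  by rewrite set_itv_ge -?leNgt// integral_set0.
have -> : (\int[m]_x g x = \int[density_measure mu1 mp p0]_(x in phi_pack @^-1` setT) (g \o phi_pack) x)%E.
  exact: ge0_integral_pushforward => y _.
rewrite integral_density//; last by move=> x; exact: g0.
exact: measurableT_comp.
Qed.

Lemma L1_change_of_variables (g : R -> R) : L1 mu g ->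
  L1 mu1 (fun x => p x * g (phi x)).
Proof.
move=> ig; have mg := L1_measurable ig.
apply/integrableP; split.
  by apply/measurable_EFinP/measurable_funM; exact: measurableT_comp.
case/integrableP: ig => mEg; rewrite -ge0_change_of_variables//; last exact: measurableT_comp.
apply: le_lt_trans; rewrite le_eqVlt; apply/orP; left; apply/eqP; apply: eq_integral => x _ /=.
by rewrite normrM (ger0_norm (p0 x)).
Qed.

Lemma rint_change_of_variables (g : R -> R) : L1 mu g ->
  \int[mu1]_x (p x * g (phi x)) = \int[mu]_x g x.
Proof.
have pos (h : R -> R) : L1 mu h -> (forall x, 0 <= h x) ->
    \int[mu1]_x (p x * h (phi x)) = \int[mu]_x h x.
  move=> ih h0; apply: EFin_inj; rewrite -!rintE//; last exact: L1_change_of_variables.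
  have mh : measT (EFin \o h) by case/integrableP: ih.
  rewrite -(ge0_change_of_variables mh); last by move=> x; rewrite lee_fin.
  by [].
move=> ig; have ia := L1_norm ig.
have i1 : L1 mu (fun x => `|g x| + g x) by exact: L1D.
have e1 := pos _ i1 (fun x => _); have e2 := pos _ ia (fun x => normr_ge0 _).
have {}e1 : \int[mu1]_x (p x * (`|g (phi x)| + g (phi x))) = \int[mu]_x (`|g x| + g x).
  by apply: e1 => x; have := ler_norm (- g x); rewrite normrN; lra.
rewrite rintD// -e2 in e1.
have j1 := L1_change_of_variables ig; have j2 := L1_change_of_variables ia.
move: e1; rewrite (_ : (fun x => _) = (fun x => p x * `|g (phi x)| + p x * g (phi x))); last first.
  by apply/funext => x; ring.
by rewrite rintD// => /addrI.
Qed.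

End ChangeOfVariables.

Section AffineChange.
Variable R : realType.
Local Notation mu := (@lebesgue_measure R).
Implicit Types (f : R -> R) (c a : R).

Let integral_cst_itv (c x y : R) (A : mset R) : x < y ->
  lebesgue_measure A = (y - x)%:E -> measurable A -> (\int[mu]_(z in A) c%:E = (c * (y - x))%:E)%E.
Proof. by move=> xy mA ?; rewrite integral_cst// [X in (_ * X)%E]mA. Qed.

Let scale_itv (c a : R) : 0 < c -> forall x y : R, x < y ->
  (\int[mu]_(z in (fun z : R => (c * z + a)%R) @^-1` `]x, y]%classic) c%:E = (y - x)%:E)%E.
Proof.
move=> c0 x y xy.
rewrite (_ : _ @^-1` _ = `](x - a) / c, (y - a) / c]%classic).
  have xy' : (x - a) / c < (y - a) / c by rewrite ltr_pM2r// ltrD2r.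
  rewrite (integral_cst_itv _ xy')//; last by rewrite lebesgue_measure_itv lte_fin xy'.
  by congr EFin; field.
apply/seteqP; split => z /=; by rewrite !in_itv/= ltr_pdivrMr// ler_pdivlMr// ltrBlDr lerBrDr (mulrC z).
Qed.

Let opp_itv : forall x y : R, x < y ->
  (\int[mu]_(z in (fun z : R => - z)%R @^-1` `]x, y]%classic) (1 : R)%:E = (y - x)%:E)%E.
Proof.
move=> x y xy; rewrite (_ : _ @^-1` _ = `[- y, - x[%classic).
  have xy' : - y < - x by lra.
  rewrite (integral_cst_itv _ xy')//; last by rewrite lebesgue_measure_itv lte_fin xy'.
  by congr EFin; ring.
by apply/seteqP; split => z /=; rewrite !in_itv/= lerNl ltrNr andbC.
Qed.

Let mscale (c a : R) : measT (fun z : measurableTypeR R => c * z + a : measurableTypeR R).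
Proof. exact: measurable_funD. Qed.

Lemma L1_scale (c a : R) f : 0 < c -> L1 mu f ->
  L1 mu (fun x => f (c * x + a)).
Proof.
move=> c0 hf.
have h := L1_change_of_variables (p := fun=> c) (mscale c a) _ _ (scale_itv a c0) hf.
have {}h : L1 mu (fun x => c * f (c * x + a)) by apply: h => // x.
have := L1Z c^-1 h; rewrite (_ : (fun x => _) = (fun x => f (c * x + a)))//.
by apply/funext => x; rewrite mulrA mulVf ?mul1r.
Qed.

Lemma rint_scale (c a : R) f : 0 < c -> L1 mu f ->
  \int[mu]_x f (c * x + a) = c^-1 * \int[mu]_x f x.
Proof.
move=> c0 hf; rewrite -(rint_change_of_variables (p := fun=> c) (mscale c a) _ _ (scale_itv a c0) hf)//.
by rewrite rintZ ?mulrA ?mulVf ?mul1r//; exact: L1_scale.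
Qed.

Let mN : measT (fun z : measurableTypeR R => - z : measurableTypeR R).
Proof. exact: measurable_funN. Qed.

Lemma L1_opp f : L1 mu f -> L1 mu (fun x => f (- x)).
Proof.
move=> hf; have h := L1_change_of_variables (p := fun=> 1) mN _ _ opp_itv hf.
have := h (measurable_cst _) (fun=> ler01); rewrite (_ : (fun x => _) = (fun x => f (- x)))//.
by apply/funext => x; rewrite mul1r.
Qed.

Lemma rint_opp f : L1 mu f -> \int[mu]_x f (- x) = \int[mu]_x f x.
Proof.
move=> hf; rewrite -(rint_change_of_variables (p := fun=> 1) mN _ _ opp_itv hf)//.
by apply: eq_Rintegral => x _; rewrite mul1r.
Qed.

Lemma L1_shift a f : L1 mu f -> L1 mu (fun x => f (x + a)).
Proof.
by move=> /(L1_scale a ltr01); under eq_fun do rewrite mul1r.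
Qed.

Lemma rint_shift a f : L1 mu f -> \int[mu]_x f (x + a) = \int[mu]_x f x.
Proof.
move=> hf; rewrite -[RHS]mul1r -{1}invr1 -(rint_scale a ltr01 hf).
by apply: eq_Rintegral => x _; rewrite mul1r.
Qed.

Lemma L1_reflect a f : L1 mu f -> L1 mu (fun x => f (a - x)).
Proof.
move=> hf; have := L1_opp (L1_shift a hf).
by under eq_fun do rewrite addrC.
Qed.

Lemma rint_reflect a f : L1 mu f -> \int[mu]_x f (a - x) = \int[mu]_x f x.
Proof.
move=> hf; rewrite -(rint_shift a hf) -(rint_opp (L1_shift a hf)).
by apply: eq_Rintegral => x _; rewrite addrC.
Qed.

End AffineChange.

(** * Integral operators with exponentially decaying kernels *)

Section Kernels.
Variable R : realType.
Local Notation T := (measurableTypeR R).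
Local Notation mu := (@lebesgue_measure R).
Local Notation mm := (mu \x mu)%E.
Implicit Types (f g h : R -> R) (p : R -> R -> R).

Definition meas2 p := measT (fun z : T * T => p z.1 z.2).

Lemma meas2_l f : measT (f : T -> R) -> meas2 (fun x _ => f x).
Proof. by move=> mf; apply: measurableT_comp. Qed.
Lemma meas2_r f : measT (f : T -> R) -> meas2 (fun _ y => f y).
Proof. by move=> mf; apply: measurableT_comp. Qed.
Lemma meas2M p q : meas2 p -> meas2 q -> meas2 (fun x y => p x y * q x y).
Proof. exact: measurable_funM. Qed.
Lemma meas2D p q : meas2 p -> meas2 q -> meas2 (fun x y => p x y + q x y).
Proof. exact: measurable_funD. Qed.

Lemma meas2_comp p (phi : R -> R) : measT (phi : T -> T) -> meas2 p ->
  meas2 (fun x y => phi (p x y)).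
Proof. exact: measurableT_comp. Qed.
Lemma meas2_sub : meas2 (fun x y => x - y).
Proof. exact: measurable_funB. Qed.

Lemma meas2_swap p : meas2 p -> meas2 (fun x y => p y x).
Proof.
move=> mp; have ms : measT (fun z : T * T => (z.2, z.1)).
  exact: measurable_fun_pair.
exact: (measurableT_comp mp ms).
Qed.

Lemma meas2_section p x : meas2 p -> measT (p x : T -> R).
Proof. by move=> mp; exact: (measurableT_comp mp (pair1_measurable x)). Qed.

Definition L1_2 p := mm.-integrable setT (fun z : T * T => (p z.1 z.2)%:E).

Lemma L1_2_le p q : meas2 p -> (forall x y, `|p x y| <= q x y) ->
  L1_2 q -> L1_2 p.
Proof.
move=> mp pq iq; apply: (le_integrable _ _ _ iq) => //; first exact/measurable_EFinP.
by move=> z _ ; rewrite lee_fin (le_trans (pq _ _)) ?ler_norm.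
Qed.

Lemma L1_2D p q : L1_2 p -> L1_2 q -> L1_2 (fun x y => p x y + q x y).
Proof. by move=> hp hq; have := integrableD measurableT hp hq. Qed.
Lemma L1_2Z (a : R) p : L1_2 p -> L1_2 (fun x y => a * p x y).
Proof. by move=> hp; have := integrableZl measurableT a hp. Qed.

Lemma L1_2_swap p : L1_2 p -> L1_2 (fun x y => p y x).
Proof.
move=> hp; have mp : meas2 p by apply/measurable_EFinP; exact: measurable_int hp.
have mq := meas2_swap mp.
apply/(integrable12ltyP mu mu); first exact/measurable_EFinP.
have /(integrable21ltyP mu mu) : L1_2 p by [].
by apply; exact/measurable_EFinP.
Qed.

(* Sections are assumed integrable everywhere, not only almost everywhere, so that no
   null set of junk values of the inner integrals has to be discarded. *)
Lemma rfubini p : L1_2 p -> (forall x, L1 mu (p x)) ->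
  (forall y, L1 mu (p ^~ y)) ->
  [/\ L1 mu (fun x => \int[mu]_y p x y), L1 mu (fun y => \int[mu]_x p x y) &
  \int[mu]_x (\int[mu]_y p x y) = \int[mu]_y (\int[mu]_x p x y)].
Proof.
move=> ip h1 h2.
have e1 : fubini_F mu (fun z : T * T => (p z.1 z.2)%:E) = fun x => (\int[mu]_y p x y)%:E.
  by apply/funext => x; rewrite /fubini_F /= rintE.
have i1 := integrable_fubini_F ip; rewrite e1 in i1.
have i2 : L1 mu (fun y => \int[mu]_x p x y).
  have := integrable_fubini_F (L1_2_swap ip).
  by apply: eq_integrable => // y _; rewrite /fubini_F /= rintE.
split; [by []|by []|]; apply: EFin_inj.
rewrite -(rintE i1) -(rintE i2).
transitivity (\int[mu]_x \int[mu]_y (p x y)%:E)%E.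
  by apply: eq_integral => x _; rewrite rintE.
rewrite (Fubini ip) /=; by apply: eq_integral => y _; rewrite rintE.
Qed.

Section ExponentialKernels.
Variable dl : R.
Hypothesis dl0 : 0 < dl.

Definition expk (r : R) : R := expR (- (dl * `|r|)).

Lemma expk_gt0 r : 0 < expk r. Proof. exact: expR_gt0. Qed.
Lemma expk_ge0 r : 0 <= expk r. Proof. exact: expR_ge0. Qed.
Lemma expk_sym r : expk (- r) = expk r. Proof. by rewrite /expk normrN. Qed.
Lemma expk_le1 r : expk r <= 1.
Proof. by rewrite -expR0 ler_expR oppr_le0. Qed.

Lemma measurable_expk : measT (expk : T -> R).
Proof.
apply: measurableT_comp => //; apply: measurable_funN.
by exact: measurableT_comp.
Qed.

Lemma L1_expk : L1 mu expk.
Proof.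
have i1 : L1 mu (exponential_pdf dl) by exact: integrable_exponential_pdf.
have i2 := L1_opp i1.
apply: (@L1_le _ T _ mu _ (fun x => dl^-1 * (exponential_pdf dl x + exponential_pdf dl (- x)))).
- exact: measurable_expk.
- move=> x; rewrite ger0_norm ?expk_ge0// /expk -ler_pdivrMl// invrK.
  have nn y : 0 <= exponential_pdf dl y by apply: exponential_pdf_ge0.
  case: (leP 0 x) => x0.
    by rewrite ger0_norm// -[leLHS]addr0 lerD// exponential_pdfE// mulNr.
  rewrite ltr0_norm// -[leLHS]add0r lerD// exponential_pdfE ?oppr_ge0 ?(ltW x0)//.
  by rewrite mulNr.
by apply: L1Z; exact: L1D.
Qed.

Definition expk_mass : R := \int[mu]_r expk r.

Lemma expk_mass_ge0 : 0 <= expk_mass.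
Proof. by apply: rint_ge0 => r; exact: expk_ge0. Qed.
Lemma L1_expk_sub s : L1 mu (fun x => expk (s - x)).
Proof. exact: L1_reflect L1_expk. Qed.
Lemma rint_expk_sub s : \int[mu]_x expk (s - x) = expk_mass.
Proof. exact: rint_reflect L1_expk. Qed.

Lemma l2_expk_sub s : l2 mu (fun x => expk (s - x)).
Proof.
have ii := L1_expk_sub s; have m1 := L1_measurable ii.
split => //; apply: L1_le ii; first exact: measurable_funX.
by move=> x; rewrite ger0_norm// ler_piMr ?expk_ge0// expk_le1.
Qed.

Lemma meas2_expk : meas2 (fun x y => expk (x - y)).
Proof. exact: meas2_comp measurable_expk meas2_sub. Qed.

Lemma L1_expk_mul s h : L1 mu h -> L1 mu (fun y => expk (s - y) * h y).
Proof.
move=> ih; have m1 := L1_measurable (L1_expk_sub s).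
apply: (L1_le _ _ (L1_norm ih)).
  by apply: measurable_funM => //; exact: L1_measurable ih.
by move=> x; rewrite normrM ler_piMl// ger0_norm ?expk_ge0// expk_le1.
Qed.

Lemma L1_2_expk h : L1 mu h -> L1_2 (fun x y => expk (x - y) * h y).
Proof.
move=> ih; have mh := L1_measurable ih.
have mp : meas2 (fun x y => expk (x - y) * h y).
  by apply: meas2M; [exact: meas2_expk|exact: meas2_r].
apply/(integrable21ltyP mu mu); first exact/measurable_EFinP.
have e y : (\int[mu]_x `|(expk (x - y) * h y)%:E| = (expk_mass * `|h y|)%:E)%E.
  have ii : L1 mu (fun x => `|h y| * expk (y - x)).
    by apply: L1Z; exact: L1_expk_sub.
  transitivity (\int[mu]_x (`|h y| * expk (y - x))%:E)%E.
    apply: eq_integral => x _ /=; rewrite normrM ger0_norm ?expk_ge0// mulrC.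
    by rewrite -expk_sym opprB.
  by rewrite rintE// rintZ ?rint_expk_sub 1?mulrC//; exact: L1_expk_sub.
under eq_integral do rewrite e.
by rewrite rintE ?ltry//; apply: L1Z; exact: L1_norm.
Qed.

Definition expkernel (C : R) p := [/\ 0 <= C, meas2 p &
  forall x y, `|p x y| <= C * expk (x - y)].

Definition kop p f (x : R) : R := \int[mu]_y (p x y * f y).

Lemma l2_kernel C p x : expkernel C p -> l2 mu (p x).
Proof.
move=> [C0 mp hp]; apply: (@l2_le _ T _ mu _ (fun y => expk (x - y)) C).
- exact: meas2_section.
- exact: l2_expk_sub.
- by move=> y; rewrite (ger0_norm (expk_ge0 _)).
Qed.

Lemma L1_kop C p f x : expkernel C p -> l2 mu f -> L1 mu (fun y => p x y * f y).
Proof. by move=> hp lf; apply: l2_mul => //; exact: l2_kernel hp. Qed.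

Lemma expkernel_swap C p : expkernel C p -> expkernel C (fun x y => p y x).
Proof.
move=> [C0 mp hp]; split => //; first exact: meas2_swap.
by move=> x y; rewrite -expk_sym opprB.
Qed.

Lemma measurable_section_integral (F : R -> R -> R) : meas2 F ->
  (forall x, L1 mu (F x)) -> measT ((fun x => \int[mu]_y F x y) : T -> R).
Proof.
have pos (G : R -> R -> R) : meas2 G -> (forall x y, 0 <= G x y) ->
    measT ((fun x => \int[mu]_y G x y) : T -> R).
  move=> mG G0; apply: (measurableT_comp (fine_measurable measurableT)).
  apply: (@measurable_fun_fubini_tonelli_F _ _ T T R mu (fun z => (G z.1 z.2)%:E)).
    exact/measurable_EFinP.
  by move=> z; rewrite lee_fin.
move=> mF iF.
have ma : meas2 (fun x y => `|F x y|) by apply: meas2_comp.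
rewrite (_ : (fun x => _) = (fun x => \int[mu]_y (`|F x y| + F x y) - \int[mu]_y `|F x y|)).
  apply: measurable_funB; last by apply: pos.
  apply: pos; first exact: meas2D.
  by move=> x y; have := ler_norm (- F x y); rewrite normrN; lra.
apply/funext => x; rewrite rintD; [|exact: L1_norm|by []].
by lra.
Qed.

Lemma measurable_kop C p f : expkernel C p -> l2 mu f -> measT (kop p f : T -> R).
Proof.
move=> hp lf; apply: measurable_section_integral; last by move=> x; exact: L1_kop hp lf.
by case: hp => _ mp _; apply: meas2M => //; apply: meas2_r; case: lf.
Qed.

(** Schur's test: [expk] is split into two equal square roots [e y], one paired with the constant
    and one with [f] in the Cauchy-Schwarz inequality. *)
Lemma kop_sqr_le C p f x : expkernel C p -> l2 mu f ->
  kop p f x ^+ 2 <= C ^+ 2 * expk_mass * \int[mu]_y (expk (x - y) * f y ^+ 2).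
Proof.
move=> hp lf; have [C0 mp pC] := hp; have [mf if2] := lf; have i1 := L1_kop x hp lf.
pose e y := expR (- (dl / 2 * `|x - y|)).
have me : measT (e : T -> R).
  apply: measurableT_comp => //; apply: measurable_funN; apply: measurable_funM => //.
  by apply: measurableT_comp => //; exact: measurable_funB.
have e2 y : e y ^+ 2 = expk (x - y) by rewrite expr2 -expRD; congr expR; field.
have e0 y : 0 <= e y by exact: expR_ge0.
have le : l2 mu e.
  by split => //; under eq_fun do rewrite e2; exact: L1_expk_sub.
have lef : l2 mu (fun y => e y * `|f y|).
  split; first by apply: measurable_funM => //; exact: measurableT_comp.
  rewrite (_ : (fun y => _) = (fun y => expk (x - y) * f y ^+ 2)); last first.
    by apply/funext => y; rewrite exprMn e2 real_normK ?num_real.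
  exact: L1_expk_mul.
have h1 : `|kop p f x| <= C * \int[mu]_y (e y * (e y * `|f y|)).
  have ii := l2_mul le lef.
  rewrite -rintZ// (le_trans (rint_abs i1))//; apply: rint_le.
  - exact: L1_norm.
  - exact: L1Z.
  - move=> y; rewrite normrM (_ : e y * (e y * `|f y|) = expk (x - y) * `|f y|).
      by rewrite mulrA ler_wpM2r.
    by rewrite -e2; ring.
rewrite -real_normK ?num_real//.
have a0 : 0 <= \int[mu]_y (e y * (e y * `|f y|)).
  by apply: rint_ge0 => y; rewrite !mulr_ge0.
rewrite (@le_trans _ _ ((C * \int[mu]_y (e y * (e y * `|f y|))) ^+ 2))//.
  by rewrite ler_sqr ?nnegrE.
rewrite exprMn -mulrA ler_wpM2l// (le_trans (l2_CS le lef))//.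
rewrite /sqint (_ : \int[mu]_y (e y ^+ 2) = expk_mass); last first.
  by rewrite -(rint_expk_sub x); apply: eq_Rintegral => y _.
rewrite le_eqVlt; apply/orP; left; apply/eqP; congr (_ * _).
by apply: eq_Rintegral => y _; rewrite exprMn e2 real_normK ?num_real.
Qed.

Lemma expk_convolution h : L1 mu h ->
  L1 mu (fun x => \int[mu]_y (expk (x - y) * h y)) /\
  \int[mu]_x (\int[mu]_y (expk (x - y) * h y)) = expk_mass * \int[mu]_y h y.
Proof.
move=> ih; have ea y : (fun x => expk (x - y) * h y) = (fun x => h y * expk (y - x)).
  by apply/funext => x; rewrite mulrC -expk_sym opprB.
have [|y|i1 i2 ->] := rfubini (L1_2_expk ih).
- by move=> x; exact: L1_expk_mul.
- by rewrite ea; apply: L1Z; exact: L1_expk_sub.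
split => //; rewrite -rintZ//; apply: eq_Rintegral => y _.
by rewrite ea rintZ ?rint_expk_sub 1?mulrC//; exact: L1_expk_sub.
Qed.

Lemma kop_op C p : expkernel C p -> real_op mu mu (C * expk_mass) (kop p).
Proof.
move=> hp; have [C0 mp pC] := hp; have m0 := expk_mass_ge0.
have bnd f (lf : l2 mu f) : l2 mu (kop p f) /\ sqint mu (kop p f) <= (C * expk_mass) ^+ 2 * sqint mu f.
  have [mf if2] := lf; have [i1 e1] := expk_convolution if2.
  have mk := measurable_kop hp lf.
  have i2 := L1Z (C ^+ 2 * expk_mass) i1.
  have lk : l2 mu (kop p f).
    split => //; apply: L1_le i2; first exact: measurable_funX.
    by move=> x; rewrite ger0_norm//; exact: kop_sqr_le.
  have [_ ik] := lk.
  have := rint_le ik i2 (fun x => kop_sqr_le x hp lf).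
  rewrite rintZ// e1 => h; rewrite (le_trans h)// le_eqVlt; apply/orP; left; apply/eqP.
  by rewrite /sqint; ring.
split.
- by [].
- by move=> f /bnd[].
- move=> a f g lf lg; apply/funext => x.
  have i1 := L1_kop x hp lf; have i2 := L1_kop x hp lg.
  rewrite -rintZ// -rintD//; last exact: L1Z.
  by apply: eq_Rintegral => y _; ring.
by move=> f /bnd[].
Qed.

Lemma L1_2_kernel C p f g : expkernel C p -> l2 mu f -> l2 mu g ->
  L1_2 (fun x y => p x y * f y * g x).
Proof.
move=> [C0 mp pC] [mf if2] [mg ig2].
apply: (@L1_2_le _ (fun x y => C * (expk (x - y) * f y ^+ 2 + expk (y - x) * g x ^+ 2))).
- by apply: meas2M; [apply: meas2M => //; exact: meas2_r|exact: meas2_l].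
- move=> x y; rewrite !normrM -[f y ^+ 2]real_normK ?num_real// -[g x ^+ 2]real_normK ?num_real//.
  rewrite -(expk_sym (x - y)) opprB -mulrDr mulrA -mulrA ler_pM//.
    by rewrite -expk_sym opprB.
  by nra.
apply: L1_2Z; apply: L1_2D; first exact: L1_2_expk.
exact: (L1_2_swap (L1_2_expk ig2)).
Qed.

Lemma kop_adj C p f g : expkernel C p -> l2 mu f -> l2 mu g ->
  \int[mu]_x (kop p f x * g x) = \int[mu]_y (f y * kop (fun x y => p y x) g y).
Proof.
move=> hp lf lg; have hs := expkernel_swap hp.
have i1 x : L1 mu (fun y => p x y * f y * g x).
  have := L1Z (g x) (L1_kop x hp lf).
  by under eq_fun do rewrite mulrC.
have i2 y : L1 mu (fun x => p x y * f y * g x).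
  have := L1Z (f y) (L1_kop y hs lg).
  by under eq_fun do rewrite mulrA (mulrC (f y)).
have [_ _ e] := rfubini (L1_2_kernel hp lf lg) i1 i2.
transitivity (\int[mu]_x \int[mu]_y (p x y * f y * g x)).
  apply: eq_Rintegral => x _; rewrite mulrC -rintZ; last exact: L1_kop hp lf.
  by apply: eq_Rintegral => y _; rewrite mulrC.
rewrite e; apply: eq_Rintegral => y _; rewrite -rintZ; last exact: L1_kop hs lg.
by apply: eq_Rintegral => x _; ring.
Qed.

End ExponentialKernels.
End Kernels.

(** * Compactness as a finite-rank inequality *)

Section CompactOperators.
Variables (R : realType) (V : lmodType R[i]) (dot : {dot V for @Num.conj R[i]}).
Implicit Types (u v w : V) (T C A : V -> V) (s : seq V).
Local Notation rdot := (reform dot).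
Local Notation N := (hnorm dot).

(** Compactness as an inequality: up to [e], the norm of [T u] is seen by finitely many real
    functionals of [u]. Complex functionals are covered by listing both [p] and [i p]. The right
    side is already of the form needed in [mourre_on]. *)
Definition hcompact T := forall e : R, 0 < e -> exists s, forall u,
  N (T u) ^+ 2 <= e * N u ^+ 2 + \sum_(p <- s) rdot u p ^+ 2.

Lemma sum_sqr_scale (c : R) s u : 0 <= c ->
  \sum_(p <- [seq (Num.sqrt c)%:C *: p | p <- s]) rdot u p ^+ 2 = c * \sum_(p <- s) rdot u p ^+ 2.
Proof.
move=> c0; rewrite big_map mulr_sumr; apply: eq_bigr => p _.
by rewrite rdotZr exprMn sqr_sqrtr.
Qed.

Lemma sum_sqr_ge0 s u : 0 <= \sum_(p <- s) rdot u p ^+ 2.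
Proof. exact: sumr_ge0 => p _. Qed.

Lemma hnorm_sqr_add u v : N (u + v) ^+ 2 <= 2 * N u ^+ 2 + 2 * N v ^+ 2.
Proof.
rewrite hnorm_sqrD; have := sqr_ge0 (N (u - v)); rewrite hnorm_sqrB; lra.
Qed.

Lemma hcompactD T C : hcompact T -> hcompact C -> hcompact (fun u => T u + C u).
Proof.
move=> hT hC e e0; have e4 : 0 < e / 4 by [].
have [s1 h1] := hT _ e4; have [s2 h2] := hC _ e4.
exists ([seq (Num.sqrt 2)%:C *: p | p <- s1 ++ s2]) => u.
rewrite sum_sqr_scale// big_cat /= (le_trans (hnorm_sqr_add _ _))//.
by have := h1 u; have := h2 u; lra.
Qed.

Lemma hcompact_compl T A (K : R) : 0 <= K -> hbounded dot K A -> hcompact T -> hcompact (A \o T).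
Proof.
move=> K0 bA hT e e0; have K1 : 0 < K ^+ 2 + 1 by [].
have [s h] := hT _ (divr_gt0 e0 K1).
exists ([seq (Num.sqrt (K ^+ 2))%:C *: p | p <- s]) => u; rewrite sum_sqr_scale//.
have h1 : N (A (T u)) ^+ 2 <= K ^+ 2 * N (T u) ^+ 2.
  by rewrite -exprMn ler_sqr ?nnegrE.
rewrite (le_trans h1)// (le_trans (ler_wpM2l (sqr_ge0 K) (h u)))// mulrDr lerD//.
by rewrite mulrA ler_wpM2r// mulrCA ger_pMr// ler_pdivrMr// mul1r lerDl.
Qed.

Lemma hcompactZ (a : R[i]) T : hcompact T -> hcompact (fun u => a *: T u).
Proof.
apply: (@hcompact_compl T (fun u => a *: u) (normc a)); first exact: normc_ge0.
by move=> u; rewrite hnormZ.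
Qed.

Lemma hcompactN T : hcompact T -> hcompact (fun u => - T u).
Proof. by move=> hT e /hT[s h]; exists s => u; rewrite hnormNE. Qed.
Lemma hcompactB T C : hcompact T -> hcompact C -> hcompact (fun u => T u - C u).
Proof. by move=> hT hC; exact: hcompactD hT (hcompactN hC). Qed.

Lemma hcompact_compr T A A' (K : R) : hbounded dot K A ->
  (forall u v, rdot (A u) v = rdot u (A' v)) -> hcompact T -> hcompact (T \o A).
Proof.
move=> bA adj hT e e0; have K1 : 0 < K ^+ 2 + 1 by [].
have [s h] := hT _ (divr_gt0 e0 K1); exists [seq A' p | p <- s] => u.
rewrite (le_trans (h (A u)))// big_map lerD//; last first.
  by rewrite le_eqVlt; apply/orP; left; apply/eqP; apply: eq_bigr => p _; rewrite adj.
have h1 : N (A u) ^+ 2 <= (K ^+ 2 + 1) * N u ^+ 2.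
  rewrite (@le_trans _ _ ((K * N u) ^+ 2))//; last by rewrite exprMn ler_wpM2r// lerDl.
  rewrite ler_sqr ?nnegrE//; exact: le_trans (hnorm_ge0 _ _) (bA u).
by rewrite -mulrA ler_wpM2l// ler_pdivrMl.
Qed.

Lemma hcompact_approx T : (forall e : R, 0 < e -> exists2 C, hcompact C &
  forall u, N (T u - C u) <= e * N u) -> hcompact T.
Proof.
move=> h e e0; have e4 : 0 < e / 4 by [].
have [|C hC hTC] := h (Num.sqrt (e / 4)); first by rewrite sqrtr_gt0.
have [s hs] := hC _ e4; exists ([seq (Num.sqrt 2)%:C *: p | p <- s]) => u.
rewrite sum_sqr_scale// -[T u](subrK (C u)) (le_trans (hnorm_sqr_add _ _))//.
have : N (T u - C u) ^+ 2 <= e / 4 * N u ^+ 2.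
  rewrite -[e / 4]sqr_sqrtr// -exprMn ler_sqr ?nnegrE//.
by have := hs u; lra.
Qed.

Lemma hcompact_ext T C : (forall u, T u = C u) -> hcompact T -> hcompact C.
Proof. by move=> h hT e /hT[s hs]; exists s => u; rewrite -h. Qed.

(** Compactness is used with [e^2]: the product [e |T u| |u|] is at most half of
    [|T u|^2 + e^2 |u|^2]. *)
Lemma hcompact_form T : hcompact T -> forall e, 0 < e -> exists s, forall u,
  `|rdot (T u) u| <= e * N u ^+ 2 + \sum_(p <- s) rdot u p ^+ 2.
Proof.
move=> hT e e0; have [s h] := hT (e ^+ 2) (exprn_gt0 _ e0).
exists ([seq (Num.sqrt (e^-1))%:C *: p | p <- s]) => u; rewrite sum_sqr_scale//.
rewrite (le_trans (rdot_CS _ _ _))// -(ler_pM2l e0) mulrDr mulVKf//.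
have := h u; set S := \sum_(p <- s) _ => h1.
have S0 : 0 <= S by exact: sum_sqr_ge0.
nra.
Qed.

Lemma isometry_rdot T : islin T -> (forall u, N (T u) = N u) ->
  forall u v, rdot (T u) (T v) = rdot u v.
Proof.
move=> lT h u v; have := hnorm_sqrD dot (T u) (T v); have := hnorm_sqrD dot u v.
by rewrite -(linD lT) !h; lra.
Qed.

End CompactOperators.
Ltac sign_leaf ::= first [exact: hnorm_ge0 | exact: expk_ge0 | exact: expk_mass_ge0 | exact: sum_sqr_ge0 | exact: normc_ge0].

(** * Multiplications, dilations, truncations and tents on the line *)

Section ConcreteOperators.
Variable R : realType.
Local Notation T := (measurableTypeR R).
Local Notation mu := (@lebesgue_measure R).
Local Notation VL := (cL2 mu).
Local Notation dotL := (@cL2_dot _ _ _ mu).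
Local Notation rdot := (reform dotL).
Local Notation N := (hnorm dotL).
Implicit Types (f g h a b : R -> R) (p : R -> R -> R) (u v : VL).

Definition mulop g f (x : R) := g x * f x.

Definition bounded_by (M : R) g := [/\ 0 <= M, measT (g : T -> R) & forall x, `|g x| <= M].

Lemma mulop_op M g : bounded_by M g -> real_op mu mu M (mulop g).
Proof.
move=> [M0 mg gM]; have bnd f (lf : l2 mu f) : l2 mu (mulop g f).
  apply: (@l2_le _ T _ mu _ f M) => //.
    by apply: measurable_funM; case: lf.
  by move=> x; rewrite normrM ler_wpM2r.
split => //.
- by move=> c f h lf lh; apply/funext => x; rewrite /mulop; ring.
move=> f lf; have [_ i1] := bnd f lf; have [_ i2] := lf.
rewrite -rintZ//; apply: rint_le => //; first exact: L1Z.
move=> x; rewrite exprMn ler_wpM2r// -real_normK ?num_real// ler_sqr//.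
Qed.

Lemma mulop_adj g f h : \int[mu]_x (mulop g f x * h x) = \int[mu]_x (f x * mulop g h x).
Proof. by apply: eq_Rintegral => x _; rewrite /mulop; ring. Qed.

Definition dil (t : R) f (x : R) := Num.sqrt t * f (t * x).

Let scale0 (t : R) f : (fun x => f (t * x)) = (fun x => f (t * x + 0)).
Proof. by apply/funext => x; rewrite addr0. Qed.

Lemma l2_scale t f : 0 < t -> l2 mu f ->
  l2 mu (fun x => f (t * x)) /\ sqint mu (fun x => f (t * x)) = t^-1 * sqint mu f.
Proof.
move=> t0 [mf if2]; split.
  split; first by apply: measurableT_comp.
  by have := L1_scale 0 t0 if2; rewrite -(scale0 t (fun x => f x ^+ 2)).
by rewrite -(rint_scale 0 t0 if2); apply: eq_Rintegral => x _; rewrite addr0.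
Qed.

Lemma dil_op t : 0 < t -> real_op mu mu 1 (dil t).
Proof.
move=> t0; split=> //.
- by move=> f lf; apply: l2Z; have [] := l2_scale t0 lf.
- by move=> c f g lf lg; apply/funext => x; rewrite /dil; ring.
move=> f lf; rewrite expr1n.
have [[_ i1] e] := l2_scale t0 lf.
rewrite (_ : sqint mu (dil t f) = t * sqint mu (fun x => f (t * x))).
  by rewrite e mulrA divff ?mul1r.
rewrite -rintZ//; apply: eq_Rintegral => x _.
by rewrite exprMn sqr_sqrtr.
Qed.

Lemma dilK t f : 0 < t -> dil t^-1 (dil t f) = f.
Proof.
move=> t0; apply/funext => x; rewrite /dil mulrA -sqrtrM//.
by rewrite mulVf// sqrtr1 mul1r mulrA divff// mul1r.
Qed.

Lemma dilVK t f : 0 < t -> dil t (dil t^-1 f) = f.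
Proof. by have := @dilK t^-1 f; rewrite invrK invr_gt0. Qed.

Lemma dil_mulop t g f : 0 < t -> dil t (mulop g (dil t^-1 f)) = mulop (fun x => g (t * x)) f.
Proof.
move=> t0; apply/funext => x; rewrite -[in RHS](dilVK f t0) /dil /mulop.
by lra.
Qed.

Lemma itv_indicator (x y : R) : x <= y -> L1 mu (\1_(`[x, y]%classic : set T)) /\
  \int[mu]_z \1_(`[x, y]%classic : set T) z = y - x.
Proof.
move=> xy; set I := (X in \1_X); have mI : mu I = (y - x)%:E.
  rewrite lebesgue_measure_itv lte_fin.
  by move: xy; rewrite le_eqVlt => /orP[/eqP ->|->]; rewrite ?ltxx ?subrr.
have eI : (\int[mu]_z (\1_I z)%:E = (y - x)%:E)%E by rewrite integral_indic ?setIT//; exact: measurable_itv.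
have iI : L1 mu (\1_I).
  apply: L1_ltP; first by apply: measurable_indic; exact: measurable_itv.
    by [].
  by rewrite eI ltry.
by split => //; apply: EFin_inj; rewrite -rintE.
Qed.

Lemma rdot_real (f : R -> R[i]) g : cl2 mu f -> l2 mu g ->
  rdot (classof mu f) (classof mu (fun y => (g y)%:C)) = \int[mu]_y (Re (f y) * g y).
Proof.
move=> hf lg; have hg := cl2_real lg.
rewrite rdot_classof// [X in _ + X](_ : _ = 0) ?addr0//.
under eq_Rintegral do rewrite mulr0.
by rewrite Rintegral_cst// mul0r.
Qed.

Lemma rdot_imaginary (f : R -> R[i]) g : cl2 mu f -> l2 mu g ->
  rdot (classof mu f) ('i%C *: classof mu (fun y => (g y)%:C)) = \int[mu]_y (Im (f y) * g y).
Proof.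
move=> hf lg; have hg := cl2_real lg; rewrite -classofZ//; have l1 := cl2Z 'i%C hg.
rewrite rdot_classof// [X in X + _](_ : _ = 0) ?add0r.
  by apply: eq_Rintegral => y _; rewrite /= mul0r mul1r add0r.
under eq_Rintegral do rewrite !cpartsE  mul0r mulr0 subrr mulr0.
by rewrite Rintegral_cst// mul0r.
Qed.

Section Kop.
Variable dl : R.
Hypothesis dl0 : 0 < dl.
Local Notation expkernel := (expkernel dl).
Local Notation Jd := (expk_mass dl).

Lemma mulop_kop C a p f : expkernel C p -> l2 mu f ->
  mulop a (kop p f) = kop (fun x y => a x * p x y) f.
Proof.
move=> hp lf; apply/funext => x; rewrite /mulop -rintZ; last exact: L1_kop hp lf.
by apply: eq_Rintegral => y _; rewrite mulrA.
Qed.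

Lemma kop_mulop b p f : kop p (mulop b f) = kop (fun x y => p x y * b y) f.
Proof. by apply/funext => x; apply: eq_Rintegral => y _; rewrite mulrA. Qed.

Lemma dil_kop C t p f : 0 < t -> expkernel C p -> l2 mu f ->
  dil t (kop p (dil t^-1 f)) = kop (fun x y => t * p (t * x) (t * y)) f.
Proof.
move=> t0 hp lf; have tV0 : 0 < t^-1 by [].
have [_ ld _ _] := dil_op tV0; have {}ld := ld _ lf.
apply/funext => x; have ik := L1_kop dl0 (t * x) hp ld.
have := rint_scale 0 t0 ik; rewrite -/(kop p (dil t^-1 f) (t * x)) => e.
have -> : dil t (kop p (dil t^-1 f)) x =
    Num.sqrt t * (t * (t^-1 * kop p (dil t^-1 f) (t * x))) by rewrite mulVKf.
rewrite -e mulrA -rintZ.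
  apply: eq_Rintegral => y _; rewrite addr0 -[in RHS](dilVK f t0) /dil.
  by lra.
by have := L1_scale 0 t0 ik.
Qed.

(** Lipschitz in the output variable only, at distances at most 1, and with the same exponential
    weight as the kernel. *)
Definition klip (Lam : R) p := forall x x' y, `|x - x'| <= 1 ->
  `|p x y - p x' y| <= Lam * `|x - x'| * expk dl (x - y).

Definition trunc (n : nat) : R -> R := \1_(`[- n%:R, n%:R]%classic : set T).

Lemma trunc_bounded n : bounded_by 1 (trunc n).
Proof.
split=> // [|x]; first exact: measurable_indic.
by rewrite /trunc indicE; case: (_ \in _); rewrite ?normr1 ?normr0.
Qed.

Lemma expkernel_expk : expkernel 1 (fun x y => expk dl (x - y)).
Proof. by split => //; [exact: meas2_expk|move=> x y; rewrite mul1r ger0_norm]. Qed.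

Lemma klip_kop_diff C Lam p f x x' : expkernel C p -> klip Lam p -> l2 mu f -> `|x - x'| <= 1 ->
  `|kop p f x - kop p f x'| <= Lam * `|x - x'| * kop (fun x y => expk dl (x - y)) (fun y => `|f y|) x.
Proof.
move=> hp hl lf xx'; have i1 := L1_kop dl0 x hp lf; have i2 := L1_kop dl0 x' hp lf.
have laf : l2 mu (fun y => `|f y|).
  apply: (@l2_le _ T _ mu _ f 1) => //; first by apply: measurableT_comp; case: lf.
  by move=> y; rewrite normr_id mul1r.
have i3 := L1_kop dl0 x expkernel_expk laf.
rewrite -rintB// -rintZ// (le_trans (rint_abs (L1B i1 i2)))//.
apply: rint_le; [exact: L1_norm (L1B i1 i2)|exact: L1Z|].
move=> y; rewrite -mulrBl normrM mulrA ler_wpM2r// hl//.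
Qed.

Lemma grid_exists (n m : nat) (x : R) : `|x| <= n%:R -> exists2 i, (i < (2 * n * m.+1).+1)%N &
  `|x - (- n%:R + i%:R / m.+1%:R)| <= m.+1%:R^-1.
Proof.
rewrite ler_norml => /andP[x1 x2]; have m0 : 0 < m.+1%:R :> R by [].
have y0 : 0 <= (x + n%:R) * m.+1%:R by rewrite mulr_ge0; lra.
have /andP[h1 h2] := truncn_itv y0; set i := Num.truncn _ in h1 h2.
exists i.
  rewrite ltnS -(ler_nat R) (le_trans h1)// !natrM ler_pM2r; lra.
have e : x = (x + n%:R) * m.+1%:R / m.+1%:R - n%:R by rewrite mulfK// addrK.
rewrite {1}e opprD opprK addrA subrK -mulrBl normrM [X in _ * X]ger0_norm//.
rewrite ler_piMl// ger0_norm//.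
by lra.
Qed.

(** On [[-n, n]] the image is known from its samples on a grid of step [1 / (m + 1)], up to a
    Lipschitz error dominated by a convolution of [|f|], which Schur's test bounds. *)
Lemma trunc_kop_bound C Lam p f (n m : nat) : expkernel C p -> klip Lam p -> 0 <= Lam -> l2 mu f ->
  sqint mu (mulop (trunc n) (kop p f)) <=
    4 * n%:R * \sum_(i < (2 * n * m.+1).+1) kop p f (- n%:R + i%:R / m.+1%:R) ^+ 2 +
    2 * (Lam / m.+1%:R * Jd) ^+ 2 * sqint mu f.
Proof.
move=> hp hl L0 lf; pose G := kop (fun x y => expk dl (x - y)) (fun y => `|f y|).
have [_ hk _ _] := kop_op dl0 hp; have lk := hk _ lf.
have [_ ht _ _] := mulop_op (trunc_bounded n); have [_ ltk] := ht _ lk.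
have laf : l2 mu (fun y => `|f y|).
  apply: (@l2_le _ T _ mu _ f 1) => //; first by apply: measurableT_comp; case: lf.
  by move=> y; rewrite normr_id mul1r.
have [_ hG _ bG] := kop_op dl0 expkernel_expk; have [_ lG] := hG _ laf; have {}bG := bG _ laf.
set S := \sum_(i < _) _; have S0 : 0 <= S by apply: sumr_ge0 => i _.
have G0 x : 0 <= G x by apply: rint_ge0 => y.
have pt x : mulop (trunc n) (kop p f) x ^+ 2 <= 2 * S * trunc n x + 2 * (Lam / m.+1%:R) ^+ 2 * G x ^+ 2.
  rewrite exprMn /trunc indicE; case: (boolP (x \in _)) => [|_].
    rewrite inE /= in_itv/= => /andP[x1 x2].
    have [|i im hi] := @grid_exists n m x; first by rewrite ler_norml x1.
    set x' := - n%:R + _ in hi.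
    have m1 : m.+1%:R^-1 <= 1 :> R by rewrite invf_le1// ler1n.
    have h2 : `|kop p f x - kop p f x'| <= Lam / m.+1%:R * G x.
      by rewrite (le_trans (klip_kop_diff hp hl lf (le_trans hi m1)))// ler_wpM2r// ler_wpM2l.
    have h3 : kop p f x' ^+ 2 <= S.
      rewrite /S (bigD1 (Ordinal im))//= lerDl; apply: sumr_ge0 => j _; exact: sqr_ge0.
    have h4 : (kop p f x - kop p f x') ^+ 2 <= (Lam / m.+1%:R) ^+ 2 * G x ^+ 2.
      rewrite -real_normK ?num_real// -exprMn ler_sqr ?nnegrE ?mulr_ge0//.
    have := sqr_ge0 (2 * kop p f x' - kop p f x); rewrite -(mulrA 2 ((Lam / m.+1%:R) ^+ 2)).
    by move: h3 h4; move: (kop p f x) (kop p f x') ((Lam / m.+1%:R) ^+ 2 * G x ^+ 2) => y y' z; lra.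
  rewrite expr0n mul0r//.
have nn : - n%:R <= n%:R :> R by have := ler0n R n; lra.
have [it et] := itv_indicator nn.
have i1 := L1Z (2 * S) it; have i2 := L1Z (2 * (Lam / m.+1%:R) ^+ 2) lG.
rewrite (le_trans (rint_le ltk (L1D i1 i2) pt))//.
rewrite rintD// !rintZ// et lerD//.
  by rewrite le_eqVlt; apply/orP; left; apply/eqP; ring.
have c0 : 0 <= 2 * (Lam / m.+1%:R) ^+ 2 by [].
rewrite (le_trans (ler_wpM2l c0 bG))// le_eqVlt; apply/orP; left; apply/eqP.
have -> : sqint mu (fun y => `|f y|) = sqint mu f.
  by apply: eq_Rintegral => y _; rewrite real_normK ?num_real.
by ring.
Qed.

(** Each sample [kop p f x] is an inner product with the section [p x]. The sections and their
    multiples by [i] read off the real and the imaginary part. *)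
Lemma trunc_kop_compact C Lam p (n : nat) : expkernel C p -> klip Lam p -> 0 <= Lam ->
  hcompact dotL (fun u => lift mu mu (mulop (trunc n)) (lift mu mu (kop p) u)).
Proof.
move=> hp hl L0 e e0.
pose c := 2 * (Lam * Jd) ^+ 2; have c0 : 0 <= c by rewrite mulr_ge0.
have [m hm] : exists m : nat, c * (m.+1%:R^-1) ^+ 2 <= e.
  have [m hm] := natinv_le (divr_gt0 e0 (ltr_wpDl c0 ltr01)); exists m.
  have := hm m (leqnn m); rewrite ler_pdivlMr// => h.
  have i0 : 0 <= m.+1%:R^-1 :> R by [].
  have i1 : m.+1%:R^-1 <= 1 :> R by rewrite invf_le1// ler1n.
  move: i0 i1 h; move: (m.+1%:R^-1) => y y0 y1 h.
  by nra.
pose ph i : VL := classof mu (fun y => (p (- n%:R + i%:R / m.+1%:R) y)%:C).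
pose s := [seq ph i | i <- iota 0 (2 * n * m.+1).+1] ++ [seq 'i%C *: ph i | i <- iota 0 (2 * n * m.+1).+1].
exists [seq (Num.sqrt (4 * n%:R))%:C *: q | q <- s] => u; rewrite sum_sqr_scale//.
have hk := kop_op dl0 hp; have ht := mulop_op (trunc_bounded n).
have [f hf ->] := classofP u; have [f1 f2] := hf.
rewrite (lift_comp _ ht hk) (lift_classof (real_op_comp ht hk))//.
rewrite (hnorm_classof (cl2_complexified (real_op_comp ht hk) hf)).
have lp x : l2 mu (p x) by exact: l2_kernel hp.
have r1 x : rdot (classof mu f) (classof mu (fun y => (p x y)%:C)) = kop p (fun y => Re (f y)) x.
  by rewrite rdot_real//; apply: eq_Rintegral => y _; rewrite mulrC.
have r2 x : rdot (classof mu f) ('i%C *: classof mu (fun y => (p x y)%:C)) = kop p (fun y => Im (f y)) x.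
  by rewrite rdot_imaginary//; apply: eq_Rintegral => y _; rewrite mulrC.
rewrite big_cat !big_map.
have b1 := trunc_kop_bound n m hp hl L0 f1; have b2 := trunc_kop_bound n m hp hl L0 f2.
under eq_bigr do rewrite r1; under [X in _ * (_ + X)]eq_bigr do rewrite r2.
rewrite -(big_mkord xpredT (fun i => kop p _ (- n%:R + i%:R / m.+1%:R) ^+ 2)) in b1.
rewrite -(big_mkord xpredT (fun i => kop p _ (- n%:R + i%:R / m.+1%:R) ^+ 2)) in b2.
have hm' : 2 * (Lam / m.+1%:R * Jd) ^+ 2 <= e.
  by apply: le_trans hm; rewrite le_eqVlt; apply/orP; left; apply/eqP; rewrite /c; ring.
rewrite (hnorm_classof hf).
have fin A1 A2 S1 S2 Q1 Q2 X c4 : A1 <= c4 * S1 + X * Q1 -> A2 <= c4 * S2 + X * Q2 ->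
  X * Q1 <= e * Q1 -> X * Q2 <= e * Q2 -> A1 + A2 <= e * (Q1 + Q2) + c4 * (S1 + S2) by lra.
exact: (fin _ _ _ _ _ _ _ _ b1 b2 (ler_wpM2r (sqint_ge0 mu (fun x => Re (f x))) hm') (ler_wpM2r (sqint_ge0 mu (fun x => Im (f x))) hm')).
Qed.

End Kop.

Lemma sqint_indic_le (f : R -> R) (c x y : R) : x <= y -> measT (f : T -> R) ->
  (forall z, `|f z| <= c * \1_(`[x, y]%classic : set T) z) -> l2 mu f /\ sqint mu f <= c ^+ 2 * (y - x).
Proof.
move=> xy mf hf; pose I : set T := `[x, y]%classic.
have [iI eI] := itv_indicator xy.
have pt z : f z ^+ 2 <= c ^+ 2 * \1_I z.
  have := hf z; rewrite -real_normK ?num_real// indicE; case: (_ \in _); rewrite ?mulr1 ?mulr0.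
    by move=> h; rewrite ler_sqr//; exact: le_trans h.
  by rewrite normr_le0 => /eqP ->; rewrite normr0 expr0n.
have lf : l2 mu f.
  split => //; apply: (L1_le _ _ (L1Z (c ^+ 2) iI)); first exact: measurable_funX.
  by move=> z; rewrite ger0_norm.
split => //; rewrite -eI -rintZ//; apply: rint_le => //; [by case: lf|exact: L1Z].
Qed.

Definition tent (x r z : R) : R := Num.max 0 (1 - `|z - x| / r).

Lemma measurable_tent x r : measT (tent x r : T -> R).
Proof.
apply: measurable_maxr => //; apply: measurable_funB => //; apply: measurable_funM => //.
by apply: measurableT_comp => //; exact: measurable_funB.
Qed.

Lemma tent_ge0 x r z : 0 <= tent x r z. Proof. by rewrite le_max lexx. Qed.

Lemma tent_le1 x r z : 0 < r -> tent x r z <= 1.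
Proof. by move=> r0; rewrite ge_max gerBl divr_ge0// ltW. Qed.
Lemma tent_out x r z : 0 < r -> r <= `|z - x| -> tent x r z = 0.
Proof. by move=> r0 h; apply/max_idPl; rewrite subr_le0 ler_pdivlMr// mul1r. Qed.

Lemma tent_lip x r z z' : 0 < r -> `|tent x r z - tent x r z'| <= `|z - z'| / r.
Proof.
move=> r0; have key (a b : R) : tent x r a - tent x r b <= `|a - b| / r.
  rewrite lerBlDr ge_max; apply/andP; split.
    by rewrite addr_ge0 ?tent_ge0.
  have : 1 - `|b - x| / r <= tent x r b by rewrite le_max lexx orbT.
  have : `|b - x| / r <= `|a - b| / r + `|a - x| / r.
    rewrite -mulrDl ler_pM2r// (distrC a b).
    by rewrite (_ : b - x = (b - a) + (a - x)) ?ler_normD; ring.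
  by lra.
rewrite ler_norml lerNl opprB; apply/andP; split => //.
by rewrite (distrC z z').
Qed.

Lemma tent_integrals x r : 0 < r -> [/\ l2 mu (tent x r), L1 mu (tent x r) &
  r / 2 <= \int[mu]_z tent x r z].
Proof.
move=> r0; have xr : x - r <= x + r by lra.
have pt z : tent x r z <= \1_(`[x - r, x + r]%classic : set T) z.
  rewrite indicE; case: (boolP (z \in _)) => [_|zS]; first exact: tent_le1.
  rewrite tent_out// leNgt; apply: contra zS => /ltW h; rewrite inE /= in_itv/=.
  by move: h; rewrite ler_norml; lra.
have [ii _] := itv_indicator xr.
have it : L1 mu (tent x r).
  apply: L1_le ii; first exact: measurable_tent.
  by move=> z; rewrite ger0_norm ?tent_ge0.
have [|lt _] := @sqint_indic_le (tent x r) 1 (x - r) (x + r) xr (measurable_tent x r).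
- by move=> z; rewrite ger0_norm ?tent_ge0// mul1r.
split => //; have xr2 : x - r / 2 <= x + r / 2 by lra.
have [i2 e2] := itv_indicator xr2.
have -> : r / 2 = 2^-1 * \int[mu]_z \1_(`[x - r / 2, x + r / 2]%classic : set T) z by lra.
rewrite -rintZ//; apply: rint_le => //; first exact: L1Z.
move=> z; rewrite indicE; case: (boolP (z \in _)) => [|_]; last by rewrite mulr0 tent_ge0.
rewrite inE /= in_itv/= => /andP[h1 h2]; rewrite le_max.
have : `|z - x| / r <= 2^-1; last lra.
by rewrite ler_pdivrMr// ler_norml; lra.
Qed.

(** It takes the place of the domain of the generator of dilations: the orbit need only be Lipschitz
    at [t = 0]. *)
Definition lipschitz_orbit : set VL := [set f | exists ell, 0 <= ell /\ forall t, `|t| <= 2^-1 ->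
  N (lift mu mu (dil (1 + t)^-1) f - f) <= ell * `|t|].

Lemma dil_inv_op t : `|t| <= 2^-1 -> 0 < 1 + t /\ real_op mu mu 1 (dil (1 + t)^-1).
Proof.
rewrite ler_norml => /andP[h1 h2]; have t0 : 0 < 1 + t by lra.
by split => //; apply: dil_op; rewrite invr_gt0.
Qed.

Lemma lipschitz_orbit_subspace : subspace lipschitz_orbit.
Proof.
split; first exists 0.
  split => // t /dil_inv_op[_ hd]; rewrite mul0r.
  have := lift_lin hd 0 0 0; rewrite !scale0r !add0r => e.
  have -> : lift mu mu (dil (1 + t)^-1) 0 = 0.
    by have := lift_lin hd (-1) 0 0; rewrite scaleN1r addNr scaleN1r addNr.
  by rewrite subrr hnorm0.
move=> a u v [l1 [l10 h1]] [l2 [l20 h2]]; exists (normc a * l1 + l2); split.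
  by rewrite addr_ge0// mulr_ge0// normc_ge0.
move=> t ht; have [_ hd] := dil_inv_op ht; rewrite (lift_lin hd).
rewrite opprD addrACA -scalerBr (le_trans (hnorm_triang _ _ _))// hnormZ mulrDl lerD ?h2//.
by rewrite -mulrA ler_wpM2l// h1.
Qed.

Lemma lift_dilK t u : 0 < t -> lift mu mu (dil t^-1) (lift mu mu (dil t) u) = u.
Proof.
move=> t0; have tV0 : 0 < t^-1 by [].
rewrite (lift_comp _ (dil_op tV0) (dil_op t0)).
have [f hf ->] := classofP u; rewrite (lift_classof (real_op_comp (dil_op tV0) (dil_op t0)))//.
congr (classof mu _); apply/funext => x; rewrite /complexified /= !dilK//.
by case: (f x).
Qed.

Lemma hnorm_dil t u : 0 < t -> N (lift mu mu (dil t) u) = N u.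
Proof.
move=> t0; have tV0 : 0 < t^-1 by [].
apply/eqP; rewrite eq_le; apply/andP; split.
  by have := lift_bound u (dil_op t0); rewrite mul1r.
by rewrite -{1}(lift_dilK u t0); have := lift_bound (lift mu mu (dil t) u) (dil_op tV0); rewrite mul1r.
Qed.

Lemma tent_orbit x r : 0 < r -> lipschitz_orbit (classof mu (fun z => (tent x r z)%:C)).
Proof.
(* As [1 + t >= 1/2], both the tent and its dilate vanish outside [[-S, S]]. *)
move=> r0; pose S := 2 * (`|x| + r); have S0 : 0 < S by rewrite mulr_gt0// ltr_wpDl.
have [lt _ _] := tent_integrals x r0.
have hc := cl2_real lt.
(* The 1 comes from [|sqrt (1 + t) - 1| <= |t|], and [S / r] from the slope [1 / r] of the tent over
   the displacement [|t z| <= |t| S]. *)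
pose c := 1 + S / r; have c0 : 0 < c by rewrite ltr_wpDr// divr_ge0 ?ltW.
exists (c * Num.sqrt (S + S)); split; first by rewrite mulr_ge0 ?sqrtr_ge0// ltW.
move=> t ht; have [t0 hd] := dil_inv_op ht; set f := classof mu _.
have -> : N (lift mu mu (dil (1 + t)^-1) f - f) = N (lift mu mu (dil (1 + t)) f - f).
  rewrite -[LHS](hnorm_dil _ t0).
  have e := lift_lin (dil_op t0) (-1) f (lift mu mu (dil (1 + t)^-1) f).
  have := lift_dilK f (_ : 0 < (1 + t)^-1); rewrite invrK invr_gt0 => /(_ t0) e2.
  rewrite !scaleN1r e2 in e.
  by rewrite (addrC (lift mu mu (dil (1 + t)^-1) f)) e addrC hnorm_distC.
have lN : l2 mu (fun z => dil (1 + t) (tent x r) z - tent x r z).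
  have [_ h _ _] := dil_op t0; exact: l2B (h _ lt) lt.
have fE : lift mu mu (dil (1 + t)) f - f = classof mu (fun z => (dil (1 + t) (tent x r) z - tent x r z)%:C).
  rewrite (lift_classof (dil_op t0))// -scaleN1r addrC -classof_lin//; last exact: cl2_complexified (dil_op t0) hc.
  congr (classof mu _); apply/funext => z; apply: complex_eq; rewrite /=; first by ring.
  rewrite /dil; ring.
have cN := cl2_real lN.
rewrite fE -ler_sqr ?nnegrE//.
rewrite hnorm_classof// [X in _ + X](_ : _ = 0); last first.
  by rewrite /sqint; under eq_Rintegral do rewrite expr0n; rewrite Rintegral_cst// mul0r.
rewrite exprMn exprMn sqr_sqrtr//.
have [|||h1 h2] := @sqint_indic_le (fun z => dil (1 + t) (tent x r) z - tent x r z) (c * `|t|) (- S) S; first by lra.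
- by case: lN.
- move=> z; rewrite indicE.
  have e : dil (1 + t) (tent x r) z - tent x r z =
      (Num.sqrt (1 + t) - 1) * tent x r ((1 + t) * z) + (tent x r ((1 + t) * z) - tent x r z).
    by rewrite /dil; ring.
  have q1 : `|Num.sqrt (1 + t) - 1| <= `|t|.
    have s0 := sqrtr_ge0 (1 + t); have s2 : (Num.sqrt (1 + t) - 1) * (Num.sqrt (1 + t) + 1) = t.
      by rewrite -subr_sqr sqr_sqrtr//; ring.
    rewrite -{2}s2 normrM ler_peMr// ger0_norm; lra.
  have [zS|zS] := leP `|z| S; last first.
    have [z1 z2] : tent x r ((1 + t) * z) = 0 /\ tent x r z = 0.
      move: ht; rewrite ler_norml.
      have zx : r <= `|z| / 2 - `|x| by move: zS; rewrite /S; lra.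
      split; apply: tent_out => //; rewrite (le_trans zx)//.
        rewrite (le_trans _ (lerB_dist _ _))// lerB// normrM gtr0_norm//.
        by rewrite mulrC ler_wpM2r//; lra.
      rewrite (le_trans _ (lerB_dist _ _)); lra.
    rewrite e z1 z2 mulr0 subrr addr0 normr0 mulr_ge0//.
  have -> : z \in (`[- S, S]%classic : set T) by rewrite inE /= in_itv -ler_norml.
  rewrite mulr1 e (le_trans (ler_normD _ _))// [leRHS]mulrDl mul1r lerD//.
    rewrite normrM (ger0_norm (tent_ge0 _ _ _)) (le_trans _ q1)// ler_piMr//; exact: tent_le1.
  rewrite (le_trans (tent_lip _ _ _ r0))//.
  have -> : (1 + t) * z - z = t * z by ring.
  by rewrite normrM [leRHS]mulrAC ler_pM2r// mulrC ler_wpM2r.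
lra.
Qed.

(** Lebesgue differentiation: at a Lebesgue point [x] the integral of [g] against a narrow tent is
    close to [g x] times the mass of the tent, so [g x = 0] if all these integrals vanish. *)
Lemma tent_total (M : set VL) u : subspace M ->
  (forall x r, 0 < r -> M (classof mu (fun z => (tent x r z)%:C))) ->
  (forall f : VL, M f -> rdot u f = 0) -> u = 0.
Proof.
move=> sM tM hu; have [f hf eu] := classofP u.
have part (g : R -> R) : l2 mu g -> (forall x r, 0 < r -> \int[mu]_z (g z * tent x r z) = 0) ->
    \forall x \ae mu, g x = 0.
  move=> lg h; have [mg ig2] := lg.
  have l2i (x y : R) : x <= y -> l2 mu (\1_(`[x, y]%classic : set T)).
    move=> xy; have [ii _] := itv_indicator xy; split; first exact: L1_measurable ii.
    rewrite (_ : (fun z => _) = \1_(`[x, y]%classic : set T))//.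
    by apply/funext => z; rewrite indicE; case: (_ \in _); rewrite ?expr1n ?expr0n.
  have loc : locally_integrable setT g.
    split => //; first exact: openT.
    move=> K _ cK; have [A [_ hM]] := compact_bounded cK.
    pose B := `|A| + 1; have B0 : 0 <= B by rewrite addr_ge0.
    have KB : K `<=` (`[- B, B]%classic : set T).
      move=> x Kx; have MB : A < B by rewrite (le_lt_trans (ler_norm A))// ltrDl.
      by have := hM B MB x Kx; rewrite /= in_itv/= -ler_norml.
    have mK : measurable (K : set T) by apply: closed_measurable; apply: compact_closed => //; exact: Rhausdorff.
    have ii : L1 mu (fun x => `|g x| * \1_(`[- B, B]%classic : set T) x).
      apply: l2_mul; last by apply: l2i; lra.
      apply: (@l2_le _ T _ mu _ g 1) => //; first exact: measurableT_comp.
      by move=> y; rewrite normr_id mul1r.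
    case/integrableP: ii => _; apply: le_lt_trans.
    rewrite [leLHS]integral_mkcond; apply: ge0_le_integral => //.
    - by move=> x _; rewrite /patch; case: ifP.
    - apply/(measurable_restrictT _ _).1 => //.
      by apply: measurable_funTS; apply/measurable_EFinP; exact: measurableT_comp.
    - apply: measurableT_comp => //; apply/measurable_EFinP; apply: measurable_funM.
        exact: measurableT_comp.
      by apply: measurable_indic; exact: measurable_itv.
    move=> x _; rewrite /patch /=; case: ifP => [xK|_]; last by rewrite lee_fin.
    rewrite indicE mem_set ?mulr1 ?normr_id//; apply: KB.
    by rewrite inE in xK.
  have L : almost_everywhere mu (fun x : T => lebesgue_pt g x) by exact: lebesgue_differentiation loc.
  have F : Filter (almost_everywhere mu) by exact: ae_filter_ringOfSetsType.
  rewrite /prop_near1 /nbhs /=; apply: (filterS _ L) => x hx.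
  apply/eqP; rewrite -normr_eq0 eq_le normr_ge0 andbT; apply/ler_addgt0Pr => e e0; rewrite add0r.
  (* A mean deviation [e / 4] over a ball of length [2 r] integrates to [r e / 2], while the tent
     has mass at least [r / 2]; the quotient is [e]. *)
  have e4 : 0 < e / 4 by rewrite divr_gt0.
  have [r [r0 hd]] : exists r, 0 < r /\ (davg g x r <= (e / 4)%:E)%E.
    have nb : nbhs (0%E : \bar R) [set y | (y < (e / 4)%:E)%E].
      by apply: open_nbhs_nbhs; split; [exact: open_ereal_lt_ereal|rewrite /= lte_fin].
    have h1 := hx _ nb; near (0 : R)^'+ => r; exists r; split => //.
    by apply: ltW; near: r; exact: h1.
  have [lt it tr] := tent_integrals x r0.
  have igt := l2_mul lg lt.
  have id : L1 mu (fun z => (g z - g x) * tent x r z).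
    have := L1B igt (L1Z (g x) it).
    by rewrite (_ : (fun z => _) = (fun z => (g z - g x) * tent x r z))//; apply/funext => z; ring.
  have e1 : \int[mu]_z ((g z - g x) * tent x r z) = - (g x * \int[mu]_z tent x r z).
    rewrite -rintZ// -[RHS]add0r -(h x r r0) -rintB//; last exact: L1Z.
    by apply: eq_Rintegral => z _; ring.
  have b1 : \int[mu]_z `|(g z - g x) * tent x r z| <= r * e / 2.
    have ia := L1_norm id.
    rewrite -lee_fin -rintE//.
    have mb : mu (ball x r : set T) = (r *+ 2)%:E by rewrite lebesgue_measure_ball// ltW.
    move: hd; rewrite /davg /iavg.
    have -> : mu (ball x r : set R) = (r *+ 2)%:E by [].
    have r20 : 0 < r *+ 2 by rewrite mulrn_wgt0.
    rewrite inver gt_eqF// lee_pdivrMl// => hd; apply: le_trans (le_trans hd _).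
      rewrite [leRHS]integral_mkcond; apply: ge0_le_integral => //.
      + by apply/measurable_EFinP; exact: L1_measurable ia.
      + apply/(measurable_restrictT _ _).1 => //; first exact: measurable_ball.
        apply: measurable_funTS; apply: measurableT_comp => //; apply/measurable_EFinP.
        exact: measurable_funB.
      + move=> z _; rewrite /patch; case: ifPn => zb.
          rewrite lee_fin normrM (ger0_norm (tent_ge0 _ _ _)) ler_piMr//; exact: tent_le1.
        rewrite tent_out ?mulr0 ?normr0// leNgt; apply: contra zb => zb; rewrite inE /ball /= distrC.
        by [].
    by rewrite -EFinM lee_fin mulr2n; lra.
  have b2 := rint_abs id; rewrite e1 normrN normrM in b2.
  have b3 : `|g x| * (r / 2) <= `|g x| * `|\int[mu]_z tent x r z|.
    by rewrite ler_wpM2l// (le_trans tr)// ler_norm.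
  have b4 : `|g x| * (r / 2) <= r * e / 2 by apply: le_trans b3 (le_trans b2 b1).
  by rewrite -(ler_pM2r (divr_gt0 r0 (ltr0n R 2))); lra.
have [f1 f2] := hf.
have t1 x r : 0 < r -> rdot u (classof mu (fun z => (tent x r z)%:C)) = 0.
  by move=> r0; apply: hu; exact: tM.
have t2 x r : 0 < r -> rdot u ('i%C *: classof mu (fun z => (tent x r z)%:C)) = 0.
  by move=> r0; apply: hu; apply: subspaceZ sM _; exact: tM.
have lt x r (r0 : 0 < r) : l2 mu (tent x r) by have [] := tent_integrals x r0.
have a1 : \forall x \ae mu, Re (f x) = 0.
  by apply: part => // x r r0; have := t1 x r r0; rewrite eu rdot_real//; exact: lt.
have a2 : \forall x \ae mu, Im (f x) = 0.
  by apply: part => // x r r0; have := t2 x r r0; rewrite eu rdot_imaginary//; exact: lt.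
have l0 := cl2_0 mu.
rewrite eu -(classof0 mu); apply: classof_eq => //; apply: filterS2 a1 a2 => x h1 h2.
by apply: complex_eq; rewrite ?h1 ?h2.
Unshelve. all: by end_near.
Qed.

Lemma tent_dense (M : set VL) : subspace M ->
  (forall x r, 0 < r -> M (classof mu (fun z => (tent x r z)%:C))) ->
  forall v e, 0 < e -> exists2 w, M w & N (v - w) <= e.
Proof.
by move=> sM tM; apply: dense_of_total => //; [exact: cL2_complete|move=> u; exact: tent_total].
Qed.

End ConcreteOperators.

(** * The hyperbolic kernel *)

Section HyperbolicKernel.
Variable R : realType.
Local Notation T := (measurableTypeR R).
Local Notation mu := (@lebesgue_measure R).
Implicit Types (r x s t : R).

Lemma is_derive_expM (a x : R) : is_derive x 1 (fun r => expR (a * r)) (a * expR (a * x)).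
Proof. exact: is_derive_scale. Qed.
Lemma is_derive_cosM (a x : R) : is_derive x 1 (fun r => cos (a * r)) (- (a * sin (a * x))).
Proof. by rewrite -mulrN; exact: is_derive_scale. Qed.
Lemma is_derive_sinM (a x : R) : is_derive x 1 (fun r => sin (a * r)) (a * cos (a * x)).
Proof. exact: is_derive_scale. Qed.

Lemma is_deriveDD (f g : R -> R) x a b : is_derive x 1 f a -> is_derive x 1 g b ->
  is_derive x 1 (fun r => f r + g r) (a + b).
Proof. by move=> hf hg; exact: is_deriveD hf hg. Qed.

Lemma is_deriveMM (f g : R -> R) x a b : is_derive x 1 f a -> is_derive x 1 g b ->
  is_derive x 1 (fun r => f r * g r) (a * g x + f x * b).
Proof.
have -> : a * g x + f x * b = f x *: b + g x *: a.
  by rewrite [RHS]addrC [in LHS]mulrC.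
exact: is_deriveM.
Qed.

Lemma is_deriveZZ (f : R -> R) x (k a : R) : is_derive x 1 f a ->
  is_derive x 1 (fun r => k * f r) (k * a).
Proof. by exact: is_deriveZ. Qed.

(** [csh r] is [2 cosh (r/2)] and [snh r] is [2 sinh (r/2)], so [tnh r] is [tanh (r/2)] and [kk b]
    is [(2 cosh (r/2))^(- 2 b)]. The application takes [b = rho + 1/2]; other [b] enter through the
    recurrence of the symbol. *)
Definition csh r := expR (2^-1 * r) + expR (- 2^-1 * r).
Definition snh r := expR (2^-1 * r) - expR (- 2^-1 * r).
Definition tnh r := snh r / csh r.
Definition kk (b r : R) := expR (- (2 * b) * ln (csh r)).

Lemma csh_gt0 r : 0 < csh r. Proof. by rewrite addr_gt0. Qed.
Lemma csh_even r : csh (- r) = csh r. Proof. by rewrite /csh !mulrN !mulNr !opprK addrC. Qed.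
Lemma snh_odd r : snh (- r) = - snh r. Proof. by rewrite /snh !mulrN !mulNr !opprK opprB. Qed.
Lemma tnh_odd r : tnh (- r) = - tnh r. Proof. by rewrite /tnh snh_odd csh_even mulNr. Qed.
Lemma kk_even b r : kk b (- r) = kk b r. Proof. by rewrite /kk csh_even. Qed.
Lemma kk_ge0 b r : 0 <= kk b r. Proof. exact: expR_ge0. Qed.

Lemma csh_snh r : csh r ^+ 2 - snh r ^+ 2 = 4.
Proof.
rewrite /csh /snh; have : expR (2^-1 * r) * expR (- 2^-1 * r) = 1.
  by rewrite -expRD mulNr subrr expR0.
by lra.
Qed.

Lemma tnh_le1 r : `|tnh r| <= 1.
Proof.
rewrite normrM normfV (gtr0_norm (csh_gt0 r)) ler_pdivrMr ?csh_gt0// /snh /csh.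
have := expR_gt0 (2^-1 * r); have := expR_gt0 (- 2^-1 * r).
by rewrite ler_norml; lra.
Qed.

Lemma kk_le b r : 0 <= b -> kk b r <= expk b r.
Proof.
move=> b0; rewrite ler_expR mulNr lerN2.
have -> : b * `|r| = 2 * b * (2^-1 * `|r|) by lra.
rewrite ler_wpM2l// -[leLHS]expRK ler_ln ?posrE ?csh_gt0// /csh.
have [r0|r0] := leP 0 r; first by rewrite ger0_norm// lerDl.
by rewrite ltr0_norm// mulrN mulNr lerDr.
Qed.

Lemma is_derive_csh x : is_derive x 1 csh (2^-1 * snh x).
Proof.
have h := is_deriveDD (is_derive_expM 2^-1 x) (is_derive_expM (- 2^-1) x).
by rewrite mulrBr -mulNr.
Qed.

Lemma is_derive_snh x : is_derive x 1 snh (2^-1 * csh x).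
Proof.
rewrite (_ : snh = fun r => expR (2^-1 * r) + -1 * expR (- 2^-1 * r)).
  by apply: (@is_derive_eq _ _ _ _ _ _ _ _ (is_deriveDD (is_derive_expM 2^-1 x) (is_deriveZZ (-1) (is_derive_expM (- 2^-1) x)))); rewrite /csh; ring.
by apply/funext => r; rewrite mulN1r.
Qed.

Lemma is_derive_kk b x : is_derive x 1 (kk b) (- b * tnh x * kk b x).
Proof.
have d1 : is_derive x 1 (fun r => ln (csh r)) ((csh x)^-1 * (2^-1 * snh x)).
  by have := @is_derive1_comp _ (@ln R) csh x _ _ (is_derive1_ln (csh_gt0 x)) (is_derive_csh x).
apply: (@is_derive_eq _ _ _ _ _ _ _ _ (@is_derive1_comp _ expR _ x _ _ (is_derive_expR _) (is_deriveZZ (- (2 * b)) d1))).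
rewrite -/(kk b x) /tnh.
by lra.
Qed.

Lemma kkS b r : kk (b + 1) r = kk b r / csh r ^+ 2.
Proof.
rewrite /kk (_ : - (2 * (b + 1)) * ln (csh r) = - (2 * b) * ln (csh r) - (ln (csh r) + ln (csh r))); last by ring.
by rewrite expRD expRN expRD lnK ?posrE ?csh_gt0.
Qed.

Lemma is_derive_tnh x : is_derive x 1 tnh (2 / csh x ^+ 2).
Proof.
have c0 := csh_gt0 x; have cn : csh x != 0 by [].
have dV : is_derive x 1 (fun r => (csh r)^-1) (- (csh x) ^- 2 *: (2^-1 * snh x)).
  exact: (is_deriveV cn (is_derive_csh x)).
apply: (@is_derive_eq _ _ _ _ _ _ _ _ (is_deriveMM (is_derive_snh x) dV)).
rewrite -[_ *: _]/(_ * _); have := csh_snh x; move: (csh x) (snh x) cn => c s cn e.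
have -> : 2 / c ^+ 2 = (2^-1 * (c ^+ 2 - s ^+ 2)) / c ^+ 2 by rewrite e; field.
by field.
Qed.

End HyperbolicKernel.
Ltac sign_leaf ::= lazymatch goal with
  | |- is_true (0 <= hnorm _ _) => exact: hnorm_ge0
  | |- is_true (0 <= expk _ _) => exact: expk_ge0
  | |- is_true (0 <= expk_mass _) => exact: expk_mass_ge0
  | |- is_true (0 <= normc _) => exact: normc_ge0
  | |- is_true (0 <= kk _ _) => exact: kk_ge0
  | |- is_true (0 < csh _) => exact: csh_gt0
  end.

(** * The symbol: recurrence, monotonicity, positivity of the commutator *)

Section Symbol.
Variable R : realType.
Local Notation T := (measurableTypeR R).
Local Notation mu := (@lebesgue_measure R).
Implicit Types (r x y s t xi : R).

Lemma is_derive_continuous (f : R -> R) x a : is_derive x 1 f a -> {for x, continuous f}.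
Proof. by move=> h; apply: differentiable_continuous; apply/derivable1_diffP. Qed.

Lemma derive_measurable (f g : R -> R) : (forall x, is_derive x 1 f (g x)) ->
  measT (f : T -> R).
Proof. by move=> h; apply: continuous_measurable_fun => x; exact: is_derive_continuous (h x). Qed.

Lemma mean_value (f df : R -> R) x y : (forall z : R, is_derive z 1 f (df z)) ->
  exists2 c, `|c - x| <= `|y - x| & f y - f x = df c * (y - x).
Proof.
move=> h; have cf a b : {within `[a, b], continuous f}.
  by apply: continuous_subspaceT => z; exact: is_derive_continuous (h z).
have [xy|/ltW yx] := leP x y.
  have [c] := MVT_segment xy (fun z _ => h z) (cf _ _).
  rewrite /= => /andP[c1 c2]; exists c => //.
  by rewrite !ger0_norm// lerD2r.
have [c] := MVT_segment yx (fun z _ => h z) (cf _ _).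
rewrite /= => /andP[c1 c2] e; exists c; last by rewrite -[RHS]opprK -mulrN opprB -e opprB.
by rewrite !ler0_norm ?subr_le0// !opprB lerB.
Qed.

Lemma derive_continuous (f g : R -> R) : (forall x : R, is_derive x 1 f (g x)) -> continuous f.
Proof. by move=> h x; exact: is_derive_continuous (h x). Qed.
Lemma continuous_add (f g : R -> R) : continuous f -> continuous g -> continuous (fun x => f x + g x).
Proof. by move=> cf cg x; apply: cvgD; [exact: cf|exact: cg]. Qed.
Lemma continuous_mul (f g : R -> R) : continuous f -> continuous g -> continuous (fun x => f x * g x).
Proof. by move=> cf cg x; apply: cvgM; [exact: cf|exact: cg]. Qed.
Lemma continuous_scale (a : R) (f : R -> R) : continuous f -> continuous (fun x => a * f x).
Proof. by move=> cf x; apply: cvgM; [exact: cvg_cst|exact: cf]. Qed.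

Lemma norm_sin_le x : `|sin x| <= `|x|.
Proof.
have [c _] := @mean_value sin cos 0 x (fun z => is_derive_sin z).
rewrite sin0 !subr0 => ->; rewrite normrM ler_piMl// ler_norml cos_geN1 cos_le1//.
Qed.

Lemma cos_ge x : 1 - x ^+ 2 / 2 <= cos x.
Proof.
have -> : x = 2^-1 * x + 2^-1 * x by lra.
rewrite cosD; have := cos2Dsin2 (2^-1 * x); have := norm_sin_le (2^-1 * x).
rewrite -(@ler_sqr _ `|_|)// !real_normK ?num_real//.
by lra.
Qed.

Lemma norm_sin_sub x : `|sin x - x| <= x ^+ 2.
Proof.
have d (z : R) : is_derive z 1 (fun z => sin z + -1 * z) (cos z + -1 * 1).
  exact: (is_deriveDD (is_derive_sin z) (is_deriveZZ (-1) (is_derive_id z 1))).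
have [c] := mean_value 0 x d; rewrite sin0 mulr0 addr0 !subr0 mulN1r => cx ->.
rewrite normrM -[leRHS]real_normK ?num_real// ler_wpM2r// (le_trans _ cx)//.
rewrite ler0_norm//.
have [c2|c2] := leP `|c| 2.
  have := cos_ge c; rewrite -(real_normK (num_real c)); move: `|c| (normr_ge0 c) c2 (cos c) => n n0 n2 k h.
  suff : n ^+ 2 <= 2 * n by lra.
  by rewrite ler_wpM2r.
by have := cos_geN1 c; lra.
Qed.

Lemma norm_cos_taylor (a d : R) : `|cos (a + d) - cos a + d * sin a| <= 2 * d ^+ 2.
Proof.
have -> : cos (a + d) - cos a + d * sin a = cos a * (cos d - 1) - sin a * (sin d - d).
  by rewrite cosD; ring.
rewrite (le_trans (ler_normB _ _))// !normrM.
have h1 : `|cos a| * `|cos d - 1| <= d ^+ 2 / 2.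
  rewrite -[leRHS]mul1r ler_pM//; first by rewrite ler_norml cos_geN1 cos_le1.
  by rewrite ler0_norm//; have := cos_ge d; lra.
have h2 : `|sin a| * `|sin d - d| <= d ^+ 2.
  by rewrite -[leRHS]mul1r ler_pM ?sin_max ?norm_sin_sub.
by have := sqr_ge0 d; lra.
Qed.

Lemma le_inv_nat (x K : R) : 0 <= K -> (forall n, x <= K / n.+1%:R) -> x <= 0.
Proof.
move=> K0 h; apply/ler_addgt0Pl => e e0; rewrite addr0.
have [n hn] := ltr_add_invr (divr_gt0 e0 (ltr_wpDl K0 (@ltr01 R)) : 0 < e / (K + 1)).
rewrite (le_trans (h n)); move: hn; rewrite add0r ltr_pdivlMr// => /ltW.
by apply: le_trans; rewrite mulrC ler_wpM2l// lerDl.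
Qed.

Lemma expk_le_inv dl r : 0 < dl -> 0 < `|r| -> expk dl r <= (dl * `|r|)^-1.
Proof.
move=> d0 r0; rewrite /expk expRN lef_pV2 ?posrE//.
by rewrite (le_trans _ (expR_ge1Dx _))// lerDr.
Qed.

Lemma norm_expk dl r : 0 < dl -> `|r| * expk dl r <= 2 / dl * expk (dl / 2) r.
Proof.
move=> d0; have -> : expk dl r = expk (dl / 2) r * expk (dl / 2) r.
  by rewrite -expRD; congr expR; field.
rewrite mulrA ler_wpM2r//.
have [->|/eqP] := eqVneq r 0; first by rewrite normr0 mul0r.
move=> /eqP; rewrite -normr_gt0 => r0.
rewrite (le_trans (ler_wpM2l (ltW r0) (expk_le_inv (divr_gt0 d0 (ltr0Sn R 1)) r0)))//.
by rewrite le_eqVlt; apply/orP; left; apply/eqP; field; rewrite gt_eqF//=.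
Qed.

Lemma L1_exp dl C (f : R -> R) : 0 < dl -> measT (f : T -> R) ->
  (forall r, `|f r| <= C * expk dl r) -> L1 mu f.
Proof.
move=> d0 mf hf; apply: (@L1_le _ T _ mu _ (fun r => C * expk dl r) mf hf).
exact: L1Z (L1_expk d0).
Qed.

(** The fundamental theorem on [[-n, n]]: both the boundary values and the tails are [O(1/n)]. All
    integrations by parts below are instances. *)
Lemma integral_derive0 dl C (F f : R -> R) : 0 < dl -> (forall x, is_derive x 1 F (f x)) ->
  continuous f -> (forall r, `|F r| <= C * expk dl r) -> (forall r, `|f r| <= C * expk dl r) ->
  \int[mu]_x f x = 0.
Proof.
move=> d0 dF cf hF hf.
have mf : measT (f : T -> R) by exact: continuous_measurable_fun.
have intf := L1_exp d0 mf hf.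
have C0 : 0 <= C by have := le_trans (normr_ge0 _) (hf 0); rewrite pmulr_lge0 ?expk_gt0.
pose D := 2 / dl * C; have D0 : 0 <= D by rewrite !mulr_ge0.
have d20 : 0 < dl / 2 by [].
apply/eqP; rewrite -normr_le0; apply: (@le_inv_nat _ (D * (expk_mass (dl / 2) + 1))).
  by [].
move=> n; set N := n.+1%:R; have N0 : 0 < N by [].
pose I : set T := `[- N, N]%classic.
have mI : measurable I by exact: measurable_itv.
have NN : - N < N by lra.
have e1 : \int[mu]_(x in I) f x = F N - F (- N).
  rewrite /Rintegral (@continuous_FTC2 _ f F)//.
  - exact: continuous_subspaceT.
  - split.
    + by [].
    + by apply: cvg_at_right_filter; exact: is_derive_continuous (dF _).
    + by apply: cvg_at_left_filter; exact: is_derive_continuous (dF _).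
  - by move=> z _; rewrite derive1E; apply: derive_val.
have hN : `|F N - F (- N)| <= D / N.
  rewrite (le_trans (ler_normB _ _))// (le_trans (lerD (hF _) (hF _)))// expk_sym.
  have h := expk_le_inv d0 (_ : 0 < `|N|); rewrite gtr0_norm// in h.
  rewrite -mulr2n -mulr_natl (le_trans (ler_wpM2l _ (ler_wpM2l C0 (h N0))))//.
  by rewrite /D le_eqVlt; apply/orP; left; apply/eqP; field; rewrite !gt_eqF.
have hT : `|\int[mu]_x f x - \int[mu]_(x in I) f x| <= D / N * expk_mass (dl / 2).
  rewrite (Rintegral_mkcond mu I).
  have mfI : measT (f \_ I : T -> R).
    by apply/measurable_restrict => //; exact: measurable_funTS.
  have ifI : L1 mu (f \_ I).
    apply: L1_exp d0 mfI _ => r; rewrite patchE; case: ifP => _//.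
    by rewrite normr0.
  rewrite -rintB// (le_trans (rint_abs (L1B intf ifI)))//.
  rewrite -rintZ; last exact: L1_expk.
  apply: rint_le.
  - exact/L1_norm/L1B.
  - exact/L1Z/L1_expk.
  move=> r; rewrite patchE; case: ifPn => rI.
    by rewrite subrr normr0.
  rewrite subr0 (le_trans (hf r))//.
  have rN : N <= `|r|.
    rewrite leNgt; apply: contra rI; rewrite ltr_norml => /andP[a1 a2].
    by rewrite inE; apply/andP; split; exact: ltW.
  have -> : expk dl r = expk (dl / 2) r * expk (dl / 2) r.
    by rewrite -expRD; congr expR; field.
  rewrite mulrA ler_wpM2r//.
  have -> : 2 / dl * C / N = C * (dl / 2 * N)^-1 by field; rewrite !gt_eqF.
  rewrite ler_wpM2l// (le_trans (expk_le_inv d20 _)) ?(lt_le_trans N0)//.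
  have h1 : 0 < dl / 2 * N by [].
  have h2 := ler_wpM2l (ltW d20) rN.
  by rewrite lef_pV2 ?posrE ?(lt_le_trans h1 h2).
rewrite -[X in `|X|](subrK (\int[mu]_(x in I) f x)) (le_trans (ler_normD _ _))//.
rewrite mulrDr mulr1 mulrDl lerD//; last by rewrite e1.
by rewrite mulrAC.
Qed.

Lemma expk_mono a c r : a <= c -> expk c r <= expk a r.
Proof. by move=> ac; rewrite ler_expR lerN2 ler_wpM2r. Qed.
Lemma measurable_kk b : measT (kk b : T -> R).
Proof. exact: derive_measurable (is_derive_kk b). Qed.
Lemma measurable_tnh : measT (@tnh R : T -> R).
Proof. exact: derive_measurable (@is_derive_tnh R). Qed.
Lemma measurable_cosM xi : measT ((fun r => cos (xi * r)) : T -> R).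
Proof. exact: derive_measurable (is_derive_cosM xi). Qed.
Lemma measurable_sinM xi : measT ((fun r => sin (xi * r)) : T -> R).
Proof. exact: derive_measurable (is_derive_sinM xi). Qed.
Lemma norm_cos_le1 x : `|cos x| <= 1.
Proof. by rewrite ler_norml cos_geN1 cos_le1. Qed.
Lemma norm_kk b r : 0 <= b -> `|kk b r| <= expk b r.
Proof. by move=> b0; rewrite ger0_norm ?kk_le. Qed.
Lemma mulr_norm_le (a c y : R) : `|a| <= y -> `|c| <= 1 -> `|a * c| <= y.
Proof. by move=> h1 h2; rewrite normrM -[leRHS]mulr1 ler_pM. Qed.
Lemma norm_add_le (a c x y : R) : `|a| <= x -> `|c| <= y -> `|a + c| <= x + y.
Proof. by move=> h1 h2; rewrite (le_trans (ler_normD _ _))// lerD. Qed.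
Lemma norm_mul_le (a c x y : R) : `|a| <= x -> `|c| <= y -> `|a * c| <= x * y.
Proof. by move=> h1 h2; rewrite normrM ler_pM. Qed.
Lemma norm_kk_trig b r c : 0 <= b -> `|c| <= 1 -> `|kk b r * c| <= expk b r.
Proof. by move=> b0; apply: mulr_norm_le; exact: norm_kk. Qed.

Lemma L1_mulb C g h : L1 mu g -> measT (h : T -> R) -> (forall x, `|h x| <= C) ->
  L1 mu (fun x => g x * h x).
Proof.
move=> ig mh hC; apply: (L1_le _ _ (L1Z C (L1_norm ig))).
  exact: measurable_funM (L1_measurable ig) mh.
by move=> x; rewrite mulrC; exact: norm_mul_le.
Qed.

Lemma L1_cosM g xi : L1 mu g -> L1 mu (fun r => g r * cos (xi * r)).
Proof. by move=> ig; apply: (L1_mulb ig (measurable_cosM xi)) => x; exact: norm_cos_le1. Qed.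
Lemma L1_sinM g xi : L1 mu g -> L1 mu (fun r => g r * sin (xi * r)).
Proof. by move=> ig; apply: (L1_mulb ig (measurable_sinM xi)) => x; exact: sin_max. Qed.

Section PositiveParameter.
Variables (b : R) (b0 : 0 < b).

Lemma L1_kk : L1 mu (kk b).
Proof.
by apply: (@L1_exp b 1) => // [|r]; [exact: measurable_kk|rewrite mul1r norm_kk].
Qed.

Lemma norm_rkk r : `|r * kk b r| <= 2 / b * expk (b / 2) r.
Proof. by rewrite normrM (le_trans _ (norm_expk r b0))// ler_wpM2l// norm_kk. Qed.

Lemma L1_rkk : L1 mu (fun r => r * kk b r).
Proof.
apply: (@L1_exp (b / 2) (2 / b)) norm_rkk => //.
exact: measurable_funM (@measurable_id _ _ _) (measurable_kk b).
Qed.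

Lemma L1_r2kk : L1 mu (fun r => r ^+ 2 * kk b r).
Proof.
have b2 : 0 < b / 2 by [].
apply: (@L1_exp (b / 2 / 2) (2 / b * (2 / (b / 2)))).
- by [].
- apply: measurable_funM (measurable_kk b); exact: measurable_funX.
move=> r; rewrite expr2 -mulrA normrM (le_trans (ler_wpM2l (normr_ge0 r) (norm_rkk r)))//.
have h := ler_wpM2l (ltW (divr_gt0 (ltr0Sn R 1) b0)) (norm_expk r b2).
by lra.
Qed.

(** The derivative of [r kk b r]. As a convolution kernel it is the first-order change of
    convolution by [kk b] under dilations. *)
Definition lk r := kk b r + r * (- b * tnh r * kk b r).

Lemma norm_lk r : `|lk r| <= 3 * expk (b / 2) r.
Proof.
rewrite (le_trans (ler_normD _ _))//.
have b2 : b / 2 <= b by move: b0; lra.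
rewrite mulrDl mul1r lerD ?(le_trans (norm_kk _ (ltW b0))) ?expk_mono//.
rewrite (_ : _ * _ = b * (r * kk b r) * - tnh r); last by ring.
rewrite mulr_norm_le ?normrN ?tnh_le1// normrM gtr0_norm//.
by rewrite (le_trans (ler_wpM2l (ltW b0) (norm_rkk r)))// mulrA mulrCA divff// mulr1.
Qed.

Lemma measurable_lk : measT (lk : T -> R).
Proof.
apply: measurable_funD; first exact: measurable_kk.
apply: measurable_funM => //.
apply: measurable_funM; last exact: measurable_kk.
by apply: measurable_funM; [|exact: measurable_tnh].
Qed.

Lemma L1_lk : L1 mu lk.
Proof. exact: L1_exp measurable_lk norm_lk. Qed.

End PositiveParameter.

(** [phi] is the symbol of [K], [chi] is [- phi'] (see [phi_taylor]), and [psi] is the symbol of the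
    commutator, equal to [- xi phi'] by [psi_chi]. *)
Definition phi b xi := \int[mu]_r (kk b r * cos (xi * r)).
Definition chi b xi := \int[mu]_r (r * kk b r * sin (xi * r)).
Definition psi b xi := \int[mu]_r (lk b r * cos (xi * r)).

(** From [csh^2 - snh^2 = 4] the second derivative of [kk b] is
    [b^2 kk b - 2 b (2 b + 1) kk (b + 1)]. Integrating it twice by parts against the cosine yields
    the factor [- xi^2]. It amounts to the functional equation of [|Gamma (b + i xi)|^2]. *)
Lemma phi_recurrence b xi : 0 < b ->
  (b ^+ 2 + xi ^+ 2) * phi b xi = 2 * b * (2 * b + 1) * phi (b + 1) xi.
Proof.
move=> b0; have b1 : 0 < b + 1 by [].
have i1 := L1_cosM xi (L1_kk b0).
have i2 := L1_cosM xi (L1_kk b1).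
apply/eqP; rewrite -subr_eq0 -!rintZ// -rintB; [|exact: L1Z..].
set A := b ^+ 2 + xi ^+ 2; set B := 2 * b * (2 * b + 1).
pose F r := - b * tnh r * kk b r * cos (xi * r) + xi * (kk b r * sin (xi * r)).
pose f r := A * (kk b r * cos (xi * r)) + - B * (kk (b + 1) r * cos (xi * r)).
rewrite (@eq_Rintegral _ _ _ mu setT f); last by move=> x _; rewrite /f mulNr.
pose C := (b + `|xi|) + (A + B).
have c2 : 0 <= A by rewrite addr_ge0.
have c3 : 0 <= B by rewrite !mulr_ge0.
have bn := ltW b0; have e0 := expk_ge0 b.
apply/eqP; apply: (@integral_derive0 b C F f b0).
- move=> x; have hk := is_derive_kk b x; have hc := is_derive_cosM xi x; have hs := is_derive_sinM xi x.
  apply: (@is_derive_eq _ _ _ _ _ _ _ _ (is_deriveDD (is_deriveMM (is_deriveMM (is_deriveZZ (- b) (is_derive_tnh x)) hk) hc) (is_deriveZZ xi (is_deriveMM hk hs)))); rewrite /f kkS.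
  have := csh_snh x; rewrite /tnh; have := csh_gt0 x; rewrite /A /B.
  move: (csh x) (snh x) (kk b x) (cos _) (sin _) => c s k co si cp e.
  have e2 : s / c * (s / c) = 1 - 4 / c ^+ 2 by rewrite -e; field.
  have -> : - b * (s / c) * (- b * (s / c) * k) = b ^+ 2 * k * (s / c * (s / c)) by lra.
  by rewrite e2; field.
- have ck d := derive_continuous (is_derive_kk d); have cc := derive_continuous (is_derive_cosM xi).
  by apply: continuous_add; apply: continuous_scale; apply: continuous_mul.
- move=> r; suff h : `|F r| <= (b + `|xi|) * expk b r.
    by rewrite (le_trans h)// [leRHS]mulrDl lerDl.
  rewrite [leRHS]mulrDl; apply: norm_add_le; last by apply: norm_mul_le => //; rewrite norm_kk_trig ?sin_max.
  rewrite (_ : _ * _ = b * (kk b r * cos (xi * r)) * - tnh r); last by ring.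
  apply: mulr_norm_le; last by rewrite normrN tnh_le1.
  by rewrite -[X in X * expk _ _]gtr0_norm//; apply: norm_mul_le => //; rewrite norm_kk_trig ?norm_cos_le1.
- move=> r; suff h : `|f r| <= (A + B) * expk b r.
    by rewrite (le_trans h)// [leRHS]mulrDl lerDr.
  rewrite [leRHS]mulrDl; apply: norm_add_le; apply: norm_mul_le; rewrite ?normrN ?(ger0_norm c2) ?(ger0_norm c3)//.
    by rewrite norm_kk_trig ?norm_cos_le1.
  by rewrite (le_trans (norm_kk_trig _ (ltW b1) (norm_cos_le1 _)))// expk_mono// lerDl.
Qed.

Lemma psi_chi b xi : 0 < b -> psi b xi = xi * chi b xi.
Proof.
move=> b0.
have i1 := L1_cosM xi (L1_lk b0).
have i2 := L1_sinM xi (L1_rkk b0).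
apply/eqP; rewrite -subr_eq0 -!rintZ// -rintB//; last exact: L1Z.
pose F r := r * kk b r * cos (xi * r).
pose f r := lk b r * cos (xi * r) + - xi * (r * kk b r * sin (xi * r)).
rewrite (@eq_Rintegral _ _ _ mu setT f); last by move=> x _; rewrite /f mulNr.
pose C := 2 / b + (3 + `|xi| * (2 / b)).
apply/eqP; apply: (@integral_derive0 (b / 2) C F f); first by rewrite divr_gt0.
- move=> x; have hk := is_derive_kk b x; have hc := is_derive_cosM xi x.
  by apply: (@is_derive_eq _ _ _ _ _ _ _ _ (is_deriveMM (is_deriveMM (is_derive_id x 1) hk) hc)); rewrite /f /lk; ring.
- have ck := derive_continuous (is_derive_kk b); have cc := derive_continuous (is_derive_cosM xi).
  have cs := derive_continuous (is_derive_sinM xi); have ct := derive_continuous (@is_derive_tnh R).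
  have ci : continuous (fun r : R => r) by move=> x.
  apply: continuous_add; last by apply: continuous_scale; do 2 apply: continuous_mul => //.
  apply: continuous_mul => //; apply: continuous_add => //; apply: continuous_mul => //.
  by apply: continuous_mul => //; exact: continuous_scale.
- move=> r; suff h : `|F r| <= 2 / b * expk (b / 2) r.
    by rewrite (le_trans h)// [leRHS]mulrDl lerDl.
  by apply: mulr_norm_le; [exact: norm_rkk|exact: norm_cos_le1].
- move=> r; suff h : `|f r| <= (3 + `|xi| * (2 / b)) * expk (b / 2) r.
    by rewrite (le_trans h)// [leRHS]mulrDl lerDr.
  rewrite [leRHS]mulrDl; apply: norm_add_le; first by apply: mulr_norm_le; [exact: norm_lk|exact: norm_cos_le1].
  rewrite -[leRHS]mulrA; apply: norm_mul_le; first by rewrite normrN.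
  by apply: mulr_norm_le; [exact: norm_rkk|exact: sin_max].
Qed.

(** The case [xi = 0] of [psi_chi]: the integral of [(r kk b r)'] is zero. *)
Lemma rtnh_integral b : 0 < b -> \int[mu]_r kk b r = b * \int[mu]_r (r * tnh r * kk b r) /\
  L1 mu (fun r => r * tnh r * kk b r).
Proof.
move=> b0; have it : L1 mu (fun r => r * tnh r * kk b r).
  apply: (@L1_le _ T _ mu _ (fun r => `|r * kk b r|)).
  - apply: measurable_funM (measurable_kk b); apply: measurable_funM measurable_tnh; exact: measurable_id.
  - by move=> r; rewrite mulrAC; apply: mulr_norm_le => //; exact: tnh_le1.
  - exact: L1_norm (L1_rkk b0).
split => //; apply/eqP; rewrite -subr_eq0 -rintZ// -rintB; [|exact: L1_kk|exact: L1Z].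
have := psi_chi 0 b0; rewrite mul0r => h; apply/eqP; rewrite -[RHS]h; apply: eq_Rintegral => r _.
by rewrite mul0r cos0 /lk; ring.
Qed.

(** For [r >= 0] and [x = exp (r/2)] one has [tanh (r/2) = (x^2 - 1) / (x^2 + 1)], which increases
    with [x^2], and [x^2 >= 1 + r]. *)
Lemma rtnh_ge r : r ^+ 2 / (2 + `|r|) <= r * tnh r.
Proof.
wlog r0 : r / 0 <= r.
  move=> h; have [/h//|/ltW r0] := leP 0 r.
  by have := h (- r); rewrite oppr_ge0 sqrrN normrN tnh_odd mulrNN; exact.
rewrite (ger0_norm r0) -mulrA ler_wpM2l// ler_pdivrMr// mulrAC ler_pdivlMr//.
rewrite /csh /snh mulNr; set x := expR (2^-1 * r); set y := expR (- (2^-1 * r)).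
have xy : x * y = 1 by rewrite -expRD subrr expR0.
have x2 : 1 + r <= x * x by rewrite -expRD -mulrDl (_ : 2^-1 + 2^-1 = 1) ?mul1r ?expR_ge1Dx; field.
have y0 : 0 <= y by exact: expR_ge0.
have : (1 + r) * y <= x by rewrite (le_trans (ler_wpM2r y0 x2))// -mulrA xy mulr1.
by lra.
Qed.

(** For [|r| <= 1] use [1 - cos y <= y^2 / 2] and [r^2 <= 3 r tnh r]; for larger [|r|] use
    [1 - cos y <= 2] and [|r| <= 3 r tnh r]. *)
Lemma one_sub_cos_le xi r : 1 - cos (xi * r) <= (6 + 3 / 2 * xi ^+ 2) * (r * tnh r).
Proof.
have h := rtnh_ge r; have := cos_ge (xi * r); have := cos_geN1 (xi * r); have := sqr_ge0 xi.
rewrite exprMn; set A := xi ^+ 2 => A0 c1 c2.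
have r2 : r ^+ 2 = `|r| * `|r| by rewrite -expr2 real_normK ?num_real.
have t0 : 0 <= r * tnh r by apply: le_trans h.
have {}h : r ^+ 2 <= r * tnh r * (2 + `|r|) by rewrite -ler_pdivrMr.
move: (r * tnh r) t0 h => t t0 h; have At := mulr_ge0 A0 t0.
have [r1|r1] := leP `|r| 1.
  have h3 : t * (2 + `|r|) <= t * 3 by rewrite ler_wpM2l//; lra.
  have h4 : A * r ^+ 2 <= A * (t * 3) by rewrite ler_wpM2l// (le_trans h).
  by lra.
have h5 : `|r| * `|r| <= 3 * t * `|r|.
  rewrite -r2 (le_trans h)// mulrDr (_ : 3 * t * `|r| = t * `|r| * 2 + t * `|r|); last by ring.
  by rewrite lerD2r -mulrA ler_wpM2l//; lra.
by move: h5; rewrite ler_pM2r; lra.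
Qed.

Lemma phi_le_phi0 b xi : 0 < b -> phi b xi <= phi b 0.
Proof.
move=> b0; apply: rint_le; [exact: L1_cosM (L1_kk b0)..|] => r.
by rewrite ler_wpM2l// mul0r cos0.
Qed.

Lemma phi0E b : phi b 0 = \int[mu]_r kk b r.
Proof. by apply: eq_Rintegral => r _; rewrite mul0r cos0 mulr1. Qed.

Lemma phi0_gt0 b : 0 < b -> 0 < phi b 0.
Proof.
move=> b0; rewrite phi0E; pose c := expR (- (2 * b) * ln (2 * expR 2^-1 : R)).
have [lt it ht] := tent_integrals 0 (ltr01 : 0 < (1 : R)).
apply: (lt_le_trans (_ : 0 < c * \int[mu]_z tent 0 1 z)).
  by rewrite mulr_gt0 ?expR_gt0// (lt_le_trans _ ht).
rewrite -rintZ//; apply: rint_le; [exact: L1Z|exact: L1_kk|].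
move=> r; have [r1|r1] := leP 1 `|r|.
  have -> : tent 0 1 r = 0 by apply: tent_out => //; rewrite subr0.
  by rewrite mulr0.
have hc : c * tent 0 1 r <= c by apply: ler_piMr; [exact: expR_ge0|exact: tent_le1].
apply: (le_trans hc).
rewrite ler_expR !mulNr lerN2 ler_wpM2l//.
rewrite ler_ln ?posrE// /csh.
have e1 : expR (2^-1 * r) <= expR 2^-1.
  by rewrite ler_expR; move: r1; rewrite ltr_norml; lra.
have e2 : expR (- 2^-1 * r) <= expR 2^-1.
  by rewrite ler_expR; move: r1; rewrite ltr_norml; lra.
lra.
Qed.

(** The weight [r tnh r] dominates [1 - cos (xi r)] and has integral [phi b 0 / b] against [kk b].
    As [b] grows the kernel concentrates and [phi b xi / phi b 0] tends to 1 at the rate [1 / b]. *)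
Lemma phi_defect b xi : 0 < b -> phi b 0 - phi b xi <= (6 + 3 / 2 * xi ^+ 2) / b * phi b 0.
Proof.
move=> b0; have [e i] := rtnh_integral b0; have ik := L1_kk b0.
have ic := L1_cosM xi ik.
rewrite phi0E [in leRHS]e mulrA divfK// -rintB// -rintZ//.
apply: rint_le; [exact: L1B|exact: L1Z|] => r.
rewrite -[X in X - _]mulr1 -mulrBr (mulrC (kk b r)) mulrA ler_wpM2r//.
exact: one_sub_cos_le.
Qed.

Lemma const_ge0 xi : 0 <= 6 + 3 / 2 * xi ^+ 2.
Proof. by []. Qed.

Definition rphi b xi := phi b xi / phi b 0.

Lemma rphi_recurrence b xi : 0 < b -> rphi b xi = b ^+ 2 / (b ^+ 2 + xi ^+ 2) * rphi (b + 1) xi.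
Proof.
move=> b0; have b1 : 0 < b + 1 by [].
have := phi_recurrence 0 b0; have := phi_recurrence xi b0; rewrite expr0n addr0.
have := phi0_gt0 b1; have := phi0_gt0 b0; rewrite /rphi.
have hk : 2 * b * (2 * b + 1) != 0 by [].
move: (phi b 0) (phi b xi) (phi (b + 1) 0) (phi (b + 1) xi) => p0 p q0 q p0p q0p.
move: (2 * b * (2 * b + 1)) hk => K K0 e2 e1.
have -> : q = (b ^+ 2 + xi ^+ 2) * p / K by rewrite e2 mulrAC divff ?mul1r.
have -> : q0 = b ^+ 2 * p0 / K by rewrite e1 mulrAC divff ?mul1r.
by field; rewrite K0 !gt_eqF.
Qed.

Lemma rphi_defect b xi : 0 < b -> 1 - rphi b xi <= (6 + 3 / 2 * xi ^+ 2) / b.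
Proof.
move=> b0; have p0 := phi0_gt0 b0; rewrite -(ler_pM2r p0) (le_trans _ (phi_defect xi b0))//.
by rewrite mulrBl mul1r divfK.
Qed.

Lemma ratio_bounds b xi : 0 < b -> 0 <= b ^+ 2 / (b ^+ 2 + xi ^+ 2) <= 1.
Proof.
move=> b0.
by rewrite divr_ge0// ler_pdivrMr// mul1r lerDl sqr_ge0.
Qed.

(** Induction along the recurrence: [n] steps lead to [b + n], where the normalized symbol is at
    least [1 - K / (b + n)], and all factors passed on the way lie in [[0, 1]]. Letting [n] grow
    replaces the infinite product for the symbol. *)
Lemma rphi_approx_ge0 xi K n b : 6 + 3 / 2 * xi ^+ 2 <= K -> 0 < b -> 0 <= rphi b xi + K / (b + n%:R).
Proof.
move=> hK; elim: n b => [|n IH] b b0.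
  have := rphi_defect xi b0; rewrite addr0.
  have : (6 + 3 / 2 * xi ^+ 2) / b <= K / b by rewrite ler_wpM2r.
  by lra.
have b1 : 0 < b + 1 by [].
have := IH _ b1; rewrite -addrA nat1r (rphi_recurrence xi b0); have /andP[h0 h1] := ratio_bounds xi b0.
have K0 : 0 <= K / (b + n.+1%:R).
  by rewrite divr_ge0// (le_trans (const_ge0 xi) hK).
move: (b ^+ 2 / (b ^+ 2 + xi ^+ 2)) (rphi (b + 1) xi) (K / _) h0 h1 K0 => c p k c0 c1 k0 pk.
have := mulr_ge0 c0 pk; have : c * k <= k by rewrite ler_piMl.
by lra.
Qed.

(** The same induction. Each factor [b^2 / (b^2 + xi^2)] decreases in [xi], and at [b + n] both
    normalized symbols agree with 1 up to [K / (b + n)] on the needed side. *)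
Lemma rphi_approx_mono xi eta K n b : 0 <= xi -> xi <= eta -> 6 + 3 / 2 * xi ^+ 2 <= K -> 0 < b ->
  rphi b eta <= rphi b xi + K / (b + n%:R).
Proof.
move=> xi0 xe hK; elim: n b => [|n IH] b b0.
  have : rphi b eta <= 1 by rewrite ler_pdivrMr ?phi0_gt0// mul1r phi_le_phi0.
  have := rphi_defect xi b0; rewrite addr0.
  have : (6 + 3 / 2 * xi ^+ 2) / b <= K / b by rewrite ler_wpM2r.
  by lra.
have b1 : 0 < b + 1 by [].
have := IH _ b1; have := rphi_approx_ge0 n hK b1.
rewrite -addrA nat1r (rphi_recurrence eta b0) (rphi_recurrence xi b0).
have /andP[h0 h1] := ratio_bounds xi b0; have /andP[g0 g1] := ratio_bounds eta b0.
have gh : b ^+ 2 / (b ^+ 2 + eta ^+ 2) <= b ^+ 2 / (b ^+ 2 + xi ^+ 2).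
  apply: (ler_wpM2l (sqr_ge0 b)).
  rewrite lef_pV2 ?posrE//.
  by rewrite lerD2l ler_sqr ?nnegrE// (le_trans xi0).
have K0 : 0 <= K / (b + n.+1%:R).
  by rewrite divr_ge0// (le_trans (const_ge0 xi) hK).
move: (b ^+ 2 / (b ^+ 2 + eta ^+ 2)) (b ^+ 2 / (b ^+ 2 + xi ^+ 2)) (rphi (b + 1) eta) (rphi (b + 1) xi) (K / _) h0 h1 g0 g1 gh K0.
move=> g h p q k h0 h1 g0 g1 gh k0 qk pq.
rewrite (le_trans (ler_wpM2l g0 pq))// (le_trans (ler_wpM2r qk gh))// mulrDr lerD2l.
by rewrite ler_piMl.
Qed.

Lemma inv_shift_le b K n : 0 < b -> 0 <= K -> K / (b + n.+1%:R) <= K / n.+1%:R :> R.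
Proof.
by move=> b0 K0; rewrite ler_wpM2l// lef_pV2 ?posrE// lerDr.
Qed.

Lemma phi_ge0 b xi : 0 < b -> 0 <= phi b xi.
Proof.
move=> b0; rewrite -oppr_le0 -[leRHS](mul0r (phi b 0)) -ler_pdivrMr ?phi0_gt0// mulNr.
apply: (le_inv_nat (const_ge0 xi)) => n; have := rphi_approx_ge0 n.+1 (lexx _) b0 (xi := xi).
rewrite -/(rphi b xi); have := inv_shift_le n b0 (const_ge0 xi).
by move: ((6 + _) / n.+1%:R) ((6 + _) / (b + _)) (rphi _ _) => x y z; lra.
Qed.

Lemma phi_mono b xi eta : 0 < b -> 0 <= xi -> xi <= eta -> phi b eta <= phi b xi.
Proof.
move=> b0 xi0 xe; have p0 := phi0_gt0 b0; rewrite -(ler_pM2r (_ : 0 < (phi b 0)^-1))//.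
rewrite -subr_le0; apply: (le_inv_nat (const_ge0 xi)) => n.
have := rphi_approx_mono n.+1 xi0 xe (lexx _) b0; have := inv_shift_le n b0 (const_ge0 xi).
rewrite -/(rphi b xi) -/(rphi b eta).
by move: ((6 + _) / n.+1%:R) ((6 + _) / (b + _)) (rphi _ eta) (rphi _ xi) => x y z u; lra.
Qed.

Lemma phi_even b xi : phi b (- xi) = phi b xi.
Proof. by apply: eq_Rintegral => r _; rewrite mulNr cosN. Qed.
Lemma psi_even b xi : psi b (- xi) = psi b xi.
Proof. by apply: eq_Rintegral => r _; rewrite mulNr cosN. Qed.

Definition r2mass b := \int[mu]_r (r ^+ 2 * kk b r).

Lemma r2mass_ge0 b : 0 <= r2mass b.
Proof. exact: rint_ge0 => r. Qed.

Lemma phi_taylor b xi h : 0 < b -> `|phi b (xi + h) - phi b xi + h * chi b xi| <= 2 * r2mass b * h ^+ 2.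
Proof.
move=> b0; have ik := L1_kk b0; have i1 := L1_cosM (xi + h) ik.
have i2 := L1_cosM xi ik; have i3 := L1_sinM xi (L1_rkk b0).
have i4 := L1_r2kk b0.
have iB := L1B i1 i2; have iZ := L1Z h i3; have iD := L1D iB iZ.
rewrite -rintZ// -rintB// -rintD// (le_trans (rint_abs iD))//.
rewrite mulrAC -rintZ//.
apply: rint_le; [exact: L1_norm|exact: L1Z|] => r.
have -> : kk b r * cos ((xi + h) * r) - kk b r * cos (xi * r) + h * (r * kk b r * sin (xi * r))
   = kk b r * (cos (xi * r + h * r) - cos (xi * r) + h * r * sin (xi * r)) by rewrite mulrDl; ring.
rewrite normrM ger0_norm// (le_trans (ler_wpM2l (kk_ge0 _ _) (norm_cos_taylor _ _)))//.
by lra.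
Qed.

(** [(b^2 + xi^2) phi b] is a positive multiple of [phi (b + 1)], hence decreasing for [xi >= 0];
    the claim is the sign of its derivative, taken through difference quotients of step [h]. *)
Lemma chi_ge b xi : 0 < b -> 0 <= xi -> 2 * xi * phi b xi <= (b ^+ 2 + xi ^+ 2) * chi b xi.
Proof.
move=> b0 x0; set A := b ^+ 2 + xi ^+ 2; set M := 2 * r2mass b.
have M0 : 0 <= M by rewrite mulr_ge0 ?r2mass_ge0.
have A0 : 0 <= A by rewrite addr_ge0.
apply: (@le_of_eps _ _ _ (A * M + 2 * xi * (`|chi b xi| + M))) => h h0 h1.
have b1 : 0 < b + 1 by [].
have := phi_mono b1 x0 (_ : xi <= xi + h); rewrite lerDl (ltW h0).
have K0 : 0 < 2 * b * (2 * b + 1) by [].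
rewrite -(ler_pM2l K0) -!phi_recurrence//.
have := phi_taylor xi h b0; rewrite -/M ler_norml => /andP[t1 _].
have := phi_ge0 (xi + h) b0; have := ler_norm (chi b xi).
move: (phi b (xi + h)) (phi b xi) (chi b xi) t1 => q p c t1 cn q0 hm.
have {}hm : A * (q - p) + 2 * xi * h * q <= 0.
  have := mulr_ge0 (sqr_ge0 h) q0; rewrite /A; lra.
have tt : 0 <= q - p + h * c + M * h ^+ 2 by lra.
have xh : 0 <= 2 * xi * h by [].
have xhh := mulr_ge0 xh (ltW h0); have t2 := mulr_ge0 A0 tt; have t3 := mulr_ge0 xh tt.
have cc : 0 <= `|c| - c by [].
have hh : 0 <= 1 - h by [].
have t4 := mulr_ge0 xhh cc; have t5 := mulr_ge0 (mulr_ge0 xhh M0) hh.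
rewrite -(ler_pM2l h0).
lra.
Qed.

Lemma psi_ge b xi : 0 < b -> 2 * xi ^+ 2 / (b ^+ 2 + xi ^+ 2) * phi b xi <= psi b xi.
Proof.
move=> b0; have A0 : 0 < b ^+ 2 + xi ^+ 2 by [].
rewrite mulrAC ler_pdivrMr//.
wlog x0 : xi A0 / 0 <= xi.
  move=> h; have [/h|/ltW x0] := leP 0 xi; first exact.
  by have := h (- xi); rewrite sqrrN oppr_ge0 phi_even psi_even; exact.
rewrite psi_chi// -!mulrA (mulrCA 2) ler_wpM2l// mulrA mulrC [leRHS]mulrC mulrC.
exact: chi_ge.
Qed.

Lemma phi_decay b xi : 0 < b -> (b ^+ 2 + xi ^+ 2) * phi b xi <= 2 * b * (2 * b + 1) * phi (b + 1) 0.
Proof.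
move=> b0; rewrite phi_recurrence//; apply: ler_wpM2l; last by rewrite phi_le_phi0.
by [].
Qed.

Lemma phi_defect_sqr b xi : 0 < b -> phi b 0 - phi b xi <= r2mass b * xi ^+ 2.
Proof.
move=> b0; have ik := L1_kk b0; have i2 := L1_r2kk b0.
have ic := L1_cosM xi ik.
rewrite phi0E mulrC -rintB// -rintZ//; apply: rint_le; [exact: L1B|exact: L1Z|] => r.
have := cos_ge (xi * r); have := kk_ge0 b r; have := mulr_ge0 (kk_ge0 b r) (sqr_ge0 (xi * r)).
rewrite exprMn; move: (kk b r) (cos _) (xi ^+ 2) (r ^+ 2) => k c X Y h k0 hc.
by have := ler_wpM2l k0 hc; lra.
Qed.

Lemma phi_continuous b : 0 < b -> continuous (phi b).
Proof.
move=> b0 xi; apply/cvgrPdist_le => e e0.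
pose M := `|chi b xi| + 2 * r2mass b + 1.
have M0 : 0 < M by rewrite ltr_wpDl// addr_ge0// mulr_ge0// r2mass_ge0.
have d0 : 0 < Num.min 1 (e / M) by rewrite lt_min ltr01 divr_gt0.
near=> eta.
have : `|xi - eta| < Num.min 1 (e / M) by [].
rewrite lt_min => /andP[/ltW h1 /ltW h2]; rewrite distrC in h1 h2.
set h := eta - xi in h1 h2; have -> : eta = xi + h by rewrite /h; ring.
have t := phi_taylor xi h b0; rewrite ler_pdivlMr// in h2; apply: le_trans h2.
have -> : phi b xi - phi b (xi + h) = - (phi b (xi + h) - phi b xi + h * chi b xi) + h * chi b xi by lra.
rewrite (le_trans (ler_normD _ _))// normrN normrM /M.
have h3 : h ^+ 2 <= `|h| by rewrite -real_normK ?num_real// ler_piMl.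
have := ler_wpM2l (mulr_ge0 (ltW (ltr0Sn R 1)) (r2mass_ge0 b)) h3; have := normr_ge0 h.
lra.
Unshelve. all: by end_near.
Qed.

Lemma phi_onto b y : 0 < b -> 0 < y -> y <= phi b 0 -> exists xi, phi b xi = y.
Proof.
move=> b0 y0 yp; set K := 2 * b * (2 * b + 1) * phi (b + 1) 0.
(* Then [X >= 1] gives [X^2 >= K / y], and the decay [(b^2 + X^2) phi b X <= K] brings the symbol
   below [y], ready for the intermediate value theorem. *)
pose X := K / y + 1.
have K0 : 0 <= K.
  by have := phi_decay 0 b0; rewrite mulr_ge0 ?phi_ge0.
have X1 : 1 <= X by rewrite lerDr.
have X0 : 0 <= X by lra.
have px : phi b X <= y.
  have hX : K / y <= X ^+ 2 by rewrite (le_trans _ (_ : X <= _)) ?lerDl// ler_peMl.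
  rewrite ler_pdivrMr// in hX.
  have hd := phi_decay X b0; rewrite -/K in hd.
  have b2 : 0 < b ^+ 2 by [].
  have A0 : 0 < b ^+ 2 + X ^+ 2 by [].
  rewrite -(ler_pM2l A0) (le_trans hd)// (le_trans hX)// ler_wpM2r//.
  by lra.
have cf : {within `[0, X], continuous (phi b)}.
  by apply: continuous_subspaceT; exact: phi_continuous.
have hy : Num.min (phi b 0) (phi b X) <= y <= Num.max (phi b 0) (phi b X).
  by rewrite ge_min le_max px yp orbT.
by have [c _ hc] := IVT X0 cf hy; exists c.
Qed.

(** If [q <= 0], [q phi] stays [al] away from [l] and the square dominates the bounded [psi]. If
    [q > 0], either the square is large, or [q phi] is near [l]: then [phi] is bounded below and
    away from its maximum, so [xi] is away from 0 and [psi_ge] applies. *)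
Lemma symbol_positive b q d al be : 0 < b -> 0 < al -> 0 < d ->
  exists c N, [/\ 0 < c, 0 <= N & forall l xi, al <= l -> l <= be -> d <= `|l - q * phi b 0| ->
    c <= q * psi b xi + N * (q * phi b xi - l) ^+ 2].
Proof.
move=> b0 al0 d0; pose M := \int[mu]_r `|lk b r|.
have pM xi : `|psi b xi| <= M.
  have il := L1_lk b0; have ic := L1_cosM xi il.
  rewrite (le_trans (rint_abs ic))//; apply: rint_le.
  - exact: L1_norm.
  - exact: L1_norm.
  by move=> r; apply: mulr_norm_le => //; exact: norm_cos_le1.
have M0 : 0 <= M := le_trans (normr_ge0 _) (pM 0).
have [q0|q0] := leP q 0.
  exists 1, ((`|q| * M + 1) / al ^+ 2); split => //.
  move=> l xi l1 _ _.
  have h1 : - (`|q| * M) <= q * psi b xi.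
    have : `|q * psi b xi| <= `|q| * M by rewrite normrM ler_wpM2l.
    by rewrite ler_norml => /andP[].
  have h2 : al ^+ 2 <= (q * phi b xi - l) ^+ 2.
    have h3 : q * phi b xi <= 0 by rewrite mulr_le0_ge0// phi_ge0.
    by rewrite -[leRHS]sqrrN ler_sqr ?nnegrE; lra.
  have h4 : `|q| * M + 1 <= (`|q| * M + 1) / al ^+ 2 * (q * phi b xi - l) ^+ 2.
    by rewrite -mulrA ler_peMr// mulrC ler_pdivlMr// mul1r.
  lra.
(* When [|q phi - l| < e], the first bound keeps [q phi] above [al / 2] and the second keeps it
   [d / 2] below the threshold [q phi b 0]. *)
pose e := Num.min (al / 2) (d / 2).
have e0 : 0 < e by rewrite lt_min !divr_gt0.
pose m := r2mass b + 1; have m0 : 0 < m by rewrite ltr_wpDl ?r2mass_ge0.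
(* The defect satisfies [d / 2 <= q (phi b 0 - phi b xi) <= q m xi^2], hence [xi^2 >= X]. *)
pose X := d / (2 * q * m); have X0 : 0 < X by rewrite divr_gt0.
pose c2 := 2 * X / (b ^+ 2 + X) * (al / 2).
have r0 : 0 < 2 * X / (b ^+ 2 + X) by [].
have c20 : 0 < c2 by exact: mulr_gt0 r0 (divr_gt0 al0 (ltr0Sn R 1)).
exists (Num.min (e ^+ 2) c2), 1; split => //; first by rewrite lt_min exprn_gt0.
move=> l xi l1 l2 ld.
have ps := psi_ge xi b0; have p0 := phi_ge0 xi b0.
have ps0 : 0 <= psi b xi by apply: le_trans ps.
have [he|he] := leP e `|q * phi b xi - l|.
  rewrite ge_min.
  have : e ^+ 2 <= (q * phi b xi - l) ^+ 2.
    by rewrite -[leRHS]real_normK ?num_real// ler_sqr ?nnegrE.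
  by have := mulr_ge0 (ltW q0) ps0; lra.
rewrite ge_min.
move: he; rewrite lt_min => /andP[]; rewrite !ltr_norml => /andP[e1 e2] /andP[e3 e4].
have hp : q * phi b xi <= q * phi b 0 by rewrite ler_wpM2l// phi_le_phi0.
have hd : d / 2 <= q * (phi b 0 - phi b xi).
  by move: ld e3 e4 hp; rewrite ler_normr; lra.
have hx : X <= xi ^+ 2.
  have : q * (phi b 0 - phi b xi) <= q * (m * xi ^+ 2).
    rewrite ler_wpM2l// (le_trans (phi_defect_sqr xi b0))// ler_wpM2r//.
    by rewrite lerDl.
  rewrite ler_pdivrMr//; lra.
have h1 : 2 * X / (b ^+ 2 + X) <= 2 * xi ^+ 2 / (b ^+ 2 + xi ^+ 2).
  rewrite ler_pdivrMr// mulrAC ler_pdivlMr// -subr_ge0.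
  rewrite (_ : _ - _ = 2 * b ^+ 2 * (xi ^+ 2 - X)); last by ring.
  by [].
have h2 : c2 <= q * (2 * xi ^+ 2 / (b ^+ 2 + xi ^+ 2) * phi b xi).
  rewrite mulrCA ler_pM//.
  lra.
have h3 : 0 <= (q * phi b xi - l) ^+ 2 := sqr_ge0 _.
have h4 := ler_wpM2l (ltW q0) ps.
lra.
Qed.

End Symbol.

(** * The half-line in the logarithmic variable, and the Beta integral *)

Section HalfLine.
Variable R : realType.
Local Notation T := (measurableTypeR R).
Local Notation mu := (@lebesgue_measure R).
Local Notation half := (@lebesgue_halfline R).
Local Notation D := (`]0%R, +oo[%classic : set T).
Implicit Types (f g : R -> R) (s t u x y : R).

Let measurable_lnT : measT (@ln R : T -> T). Proof. by []. Qed.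

Let mD : measurable D. Proof. by []. Qed.

Let ge0_integral_halfline (F : T -> \bar R) : measT F -> (forall x, 0 <= F x)%E ->
  (\int[half]_x F x = \int[mu]_(x in D) F x)%E.
Proof.
move=> mF F0; pose p : T -> R := \1_D.
have mp : measT p by exact: measurable_indic.
have p0 x : 0 <= p x by [].
rewrite (@eq_measure_integral _ _ _ setT (density_measure mu mp p0)); last first.
  move=> A mA _; rewrite -[RHS]/(\int[mu]_(x in A) (\1_D x)%:E)%E.
  by rewrite integral_indic// setIC.
rewrite integral_density// [RHS]integral_mkcond; apply: eq_integral => x _.
by rewrite /p indicE patchE; case: ifP => _; rewrite ?mul1e ?mul0e.
Qed.

Lemma integral_halfline (F : T -> \bar R) : measT F ->
  (\int[half]_x F x = \int[mu]_(x in D) F x)%E.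
Proof.
move=> mF; rewrite integralE [RHS]integralE; congr (_ - _)%E; apply: ge0_integral_halfline => //.
- exact: measurable_funepos.
- exact: measurable_funeneg.
Qed.

Lemma rint_halfline f : measT (f : T -> R) -> \int[half]_x f x = \int[mu]_(x in D) f x.
Proof. by move=> mf; rewrite /Rintegral integral_halfline//; exact/measurable_EFinP. Qed.

Lemma halfline_ae (P : R -> Prop) : (\forall x \ae half, P x) <-> (\forall x \ae mu, D x -> P x).
Proof.
split=> -[N [mN N0 hN]].
  exists (N `&` D); split; [exact: measurableI|by []|].
  move=> x  h; apply: contrapT => h2; apply: h => Dx; apply: contrapT => nP; apply: h2; split => //.
  exact: hN.
exists (N `|` ~` D); split.
- by apply: measurableU => //; exact: measurableC.
- have -> : half (N `|` ~` D) = mu ((N `|` ~` D) `&` D) by [].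
  rewrite setIUl setICl setU0; apply/eqP; rewrite eq_le measure_ge0 -N0 le_measure ?inE//.
  exact: measurableI.
- move=> x  nP; have [Dx|] := pselect (D x); last by right.
  by left; apply: hN => /=; apply: contra_not nP; exact.
Qed.

(** The derivative of [ln] on the half-line. The absolute value keeps it nonnegative everywhere, as
    a density must be. *)
Definition loginv x : R := `|x|^-1.

Lemma measurable_loginv : measT (loginv : T -> R).
Proof.
have /continuous_measurable_fun h : continuous (fun x : R => `|x|) by exact: norm_continuous.
rewrite (_ : loginv = fun x => `|x| `^ (-1)); last by apply/funext => x; rewrite powR_inv1.
have h2 : measT ((fun x => x `^ (-1)) : T -> T) by [].
exact: (measurableT_comp h2 h).
Qed.

Lemma loginv_ge0 x : 0 <= loginv x. Proof. by rewrite invr_ge0. Qed.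

Lemma log_itv a b : a < b ->
  (\int[half]_(x in (@ln R : T -> T) @^-1` `]a, b]%classic) (loginv x)%:E = (b - a)%:E)%E.
Proof.
move=> ab; rewrite integral_mkcond ge0_integral_halfline; last 2 first.
- apply/measurable_restrict => //; last by apply: measurable_funTS; apply/measurable_EFinP; exact: measurable_loginv.
  by rewrite -[X in measurable X]setTI; exact: measurable_ln.
- by move=> x; rewrite patchE; case: ifP => // _; rewrite lee_fin loginv_ge0.
rewrite -integral_mkcondl; have eab : expR a < expR b by rewrite ltr_expR.
have -> : (@ln R) @^-1` `]a, b]%classic `&` D = `]expR a, expR b]%classic.
  apply/seteqP; split => x /=; rewrite !in_itv/= ?andbT.
    by move=> [/andP[h1 h2] x0]; rewrite -[x]lnK// ltr_expR ler_expR h1.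
  move=> /andP[h1 h2]; have x0 := lt_trans (expR_gt0 a) h1.
  by rewrite -ltr_expR -ler_expR lnK// h1.
rewrite integral_itv_obnd_cbnd; last first.
  by apply: measurable_funTS; apply/measurable_EFinP; exact: measurable_loginv.
have pos x : expR a <= x -> 0 < x := lt_le_trans (expR_gt0 a).
have cln x : 0 < x -> {for x, continuous (@ln R)} by exact: continuous_ln.
rewrite (@continuous_FTC2 _ _ (@ln R))//.
- by rewrite !expRK.
- apply: continuous_in_subspaceT => x; rewrite inE => /andP[/pos x0 _].
  apply: cvgV; first by rewrite normr_eq0.
  exact: norm_continuous.
- split.
  + by move=> x; rewrite in_itv => /andP[/ltW/pos x0 _]; apply: ex_derive; exact: is_derive1_ln.
  + by apply: cvg_at_right_filter; apply: cln.
  + by apply: cvg_at_left_filter; apply: cln.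
- move=> x; rewrite in_itv => /andP[/ltW/pos x0 _]; rewrite derive1E.
  by have h := is_derive1_ln x0; rewrite derive_val /loginv gtr0_norm.
Qed.

(** The integrand of [Gamma s] after [t = exp u], Jacobian included. *)
Definition gdens s u : R := expR (s * u - expR u).

Lemma gdens_le s u : 0 < s -> gdens s u <= expR (4 * s ^+ 2) * expk s u.
Proof.
rewrite -expRD ler_expR; have e0 := expR_gt0 u.
have [u0|/ltW u0] := leP 0 u; last by rewrite ler0_norm; have := sqr_ge0 s; lra.
rewrite ger0_norm//; have : (1 + u / 2) ^+ 2 <= expR u.
  have -> : expR u = expR (u / 2) ^+ 2 by rewrite expr2 -expRD; congr expR; field.
  by rewrite ler_sqr ?nnegrE ?expR_ge1Dx.
by have := sqr_ge0 (u / 2 - 2 * s); lra.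
Qed.

Lemma measurable_gdens s : measT (gdens s : T -> R).
Proof.
apply: continuous_measurable_fun => u; apply: continuous_comp; last exact: continuous_expR.
by apply: cvgB; [apply: cvgM; [exact: cvg_cst|]|exact: continuous_expR].
Qed.

Lemma L1_gdens s : 0 < s -> L1 mu (gdens s).
Proof.
move=> s0; apply: (@L1_exp _ s (expR (4 * s ^+ 2))) => //; first exact: measurable_gdens.
by move=> r; rewrite ger0_norm ?expR_ge0 ?gdens_le.
Qed.

Lemma GammaE s : 0 < s -> Gamma s = \int[mu]_u gdens s u.
Proof.
move=> s0; have ig := L1_gdens s0.
rewrite -(@rint_change_of_variables _ T R half (@ln R) loginv measurable_lnT measurable_loginv loginv_ge0 log_itv _ ig).
have mm : measT ((fun x => loginv x * gdens s (ln x)) : T -> R).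
  apply: measurable_funM measurable_loginv _; apply: measurableT_comp (measurable_gdens s) _.
  exact: measurable_ln.
rewrite rint_halfline//; apply: eq_Rintegral => x; rewrite inE /= in_itv/= andbT => x0.
rewrite /loginv gtr0_norm// /gdens lnK// /powR gt_eqF// expRD mulrA; congr (_ * _).
by rewrite mulrBl mul1r expRD expRN lnK// mulrC.
Qed.

Lemma Gamma_gt0 s : 0 < s -> 0 < Gamma s.
Proof.
move=> s0; rewrite GammaE//; have ig := L1_gdens s0; pose c := expR (- s - expR 1 : R).
have [lt it ht] := tent_integrals 0 (ltr01 : 0 < (1 : R)).
apply: (lt_le_trans (_ : 0 < c * \int[mu]_z tent 0 1 z)).
  by rewrite mulr_gt0 ?expR_gt0// (lt_le_trans _ ht).
rewrite -rintZ//; apply: rint_le; [exact: L1Z|by []|].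
move=> r; have [r1|r1] := leP 1 `|r|.
  have -> : tent 0 1 r = 0 by apply: tent_out => //; rewrite subr0.
  by rewrite mulr0; exact: expR_ge0.
have hc : c * tent 0 1 r <= c by apply: ler_piMr; [exact: expR_ge0|exact: tent_le1].
apply: (le_trans hc); rewrite ler_expR; move: r1; rewrite ltr_norml => /andP[h1 h2].
have : expR r <= expR 1 by rewrite ler_expR ltW.
have : s * -1 <= s * r by rewrite ler_wpM2l// ltW.
lra.
Qed.

Lemma gdens_mul b r v : gdens b (v - r) * gdens b v =
  kk b r * gdens (2 * b) (v + ln (1 + expR (- r))).
Proof.
have e0 : 0 < 1 + expR (- r) by [].
have lc : ln (csh r) = 2^-1 * r + ln (1 + expR (- r)).
  rewrite -[X in X + _]expRK -lnM ?posrE//; congr ln.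
  by rewrite mulrDr -expRD; congr (_ + expR _); field.
rewrite -!expRD lc; congr expR; rewrite !(expRD v) lnK//.
by lra.
Qed.

(** [Gamma b ^+ 2] is the double integral of [gdens b (v - r) gdens b v]. By [gdens_mul] the
    integral in [v] is, up to a translation, that of [gdens (2 b)], leaving [Gamma (2 b)] times the
    integral of [kk b]. *)
Lemma Gamma_beta (b : R) : 0 < b -> phi b 0 = Gamma b ^+ 2 / Gamma (2 * b).
Proof.
move=> b0; have b2 : 0 < 2 * b by [].
have ig := L1_gdens b0; have ig2 := L1_gdens b2.
have g0 x : 0 <= gdens b x := expR_ge0 _.
pose C := expR (4 * b ^+ 2); pose p r v := gdens b (v - r) * gdens b v.
have C0 : 0 <= C := expR_ge0 _.
have mg := measurable_gdens b.
have mp : meas2 p.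
  apply: meas2M; last exact: meas2_r.
  by apply: (meas2_comp mg); exact: (meas2_swap (@meas2_sub R)).
have pb r v : `|p r v| <= C * (expk b (r - v) * gdens b v).
  rewrite ger0_norm ?mulr_ge0// mulrA ler_wpM2r// -expk_sym opprB; exact: gdens_le.
have ip : L1_2 p by apply: (L1_2_le mp pb); exact/L1_2Z/L1_2_expk.
have i1 r : L1 mu (p r).
  apply: (@L1_le _ T _ mu _ (fun v => C * gdens b v)).
  - exact: meas2_section mp.
  - move=> v; rewrite (le_trans (pb r v))// ler_wpM2l// ler_piMl//; exact: expk_le1.
  - exact: L1Z.
have i2 v : L1 mu (p ^~ v).
  rewrite (_ : p ^~ v = fun r => gdens b v * gdens b (v - r)); last by apply/funext => r; rewrite mulrC.
  exact/L1Z/L1_reflect.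
have [_ _ e] := rfubini ip i1 i2.
have G2 := Gamma_gt0 b2; apply: (canRL (mulfK _)); first by [].
move: (GammaE b0) (GammaE b2); move: (Gamma b) (Gamma (2 * b)) => G H eG eH.
rewrite phi0E; transitivity (\int[mu]_r (H * kk b r)).
  by rewrite (rintZ H (L1_kk b0)) mulrC.
transitivity (\int[mu]_r \int[mu]_v p r v).
  apply: eq_Rintegral => r _; rewrite mulrC eH -(rint_shift (ln (1 + expR (- r))) ig2).
  rewrite -(rintZ (kk b r) (L1_shift _ ig2)).
  by apply: eq_Rintegral => v _; rewrite -gdens_mul.
rewrite e expr2 [X in _ * X]eG -(rintZ G ig); apply: eq_Rintegral => v _.
rewrite eG -(rint_reflect v ig) mulrC -(rintZ _ (L1_reflect v ig)).
by apply: eq_Rintegral => r _; rewrite mulrC.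
Qed.

End HalfLine.

(** * Hartley transform with a regularized Parseval identity *)

Section RegularizedParseval.
Variable R : realType.
Local Notation T := (measurableTypeR R).
Local Notation mu := (@lebesgue_measure R).
Implicit Types (f g h : R -> R) (x y t xi d : R).

(** A class stable under the convolutions used, containing the tents. Boundedness gives products and
    Fubini; the Lipschitz bound gives the rate in [parseval_limit]. *)
Definition nice f := [/\ L1 mu f, exists2 M, 0 <= M & forall x, `|f x| <= M &
  exists2 L, 0 <= L & forall x y, `|f x - f y| <= L * `|x - y|].

Lemma nice_integrable f : nice f -> L1 mu f. Proof. by case. Qed.

Lemma nice_measurable f : nice f -> measT (f : T -> R).
Proof. by case=> /L1_measurable. Qed.
Lemma nice_mul f g : nice f -> nice g -> L1 mu (fun x => f x * g x).
Proof. by move=> [iF _ _] ng; have [_ [M _ hM] _] := ng; exact: L1_mulb iF (nice_measurable ng) hM. Qed.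
Lemma nice_l2 f : nice f -> l2 mu f.
Proof. by split; [exact: nice_measurable|exact: nice_mul]. Qed.

Lemma nice_lin (a : R) f g : nice f -> nice g -> nice (fun x => a * f x + g x).
Proof.
move=> [i1 [M1 M10 h1] [Lb L10 k1]] [i2 [M2 M20 h2] [L2 L20 k2]]; split.
- by apply: L1D => //; exact: L1Z.
- exists (`|a| * M1 + M2) => //.
  by move=> x; apply: norm_add_le => //; exact: norm_mul_le.
- exists (`|a| * Lb + L2) => //.
  move=> x y; rewrite (_ : _ - _ = a * (f x - f y) + (g x - g y)); last by ring.
  by rewrite [leRHS]mulrDl -mulrA; apply: norm_add_le => //; exact: norm_mul_le.
Qed.

Lemma tent_nice x r : 0 < r -> nice (tent x r).
Proof.
move=> r0; have [_ it _] := tent_integrals x r0; split => //.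
  by exists 1 => // z; rewrite ger0_norm ?tent_ge0 ?tent_le1.
exists r^-1 => //.
by move=> y z; rewrite mulrC tent_lip.
Qed.

Lemma L1_2_mul f g : L1 mu f -> L1 mu g -> L1_2 (fun x y => f x * g y).
Proof.
move=> iF ig; have mf := L1_measurable iF; have mg := L1_measurable ig.
have mp : meas2 (fun x y => f x * g y).
  by apply: meas2M; [exact: meas2_l|exact: meas2_r].
have nF := L1_norm iF; have ng := L1_norm ig.
apply/(integrable21ltyP mu mu); first exact/measurable_EFinP.
have e y : (\int[mu]_x `|(f x * g y)%:E| = (`|g y| * \int[mu]_x `|f x|)%:E)%E.
  rewrite -rintZ// -rintE; last exact: L1Z.
  by apply: eq_integral => x _ /=; rewrite normrM mulrC.
under eq_integral do rewrite e.
rewrite rintE ?ltry//.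
by under eq_fun do rewrite mulrC; exact: L1Z.
Qed.

Definition mass1 f := \int[mu]_x `|f x|.

Lemma rint_swap a f (c : R -> R -> R) (C : R) : L1 mu a -> L1 mu f -> meas2 c ->
  (forall x y, `|c x y| <= C) -> \int[mu]_x (a x * \int[mu]_y (f y * c x y)) = \int[mu]_y (f y * \int[mu]_x (a x * c x y)).
Proof.
move=> ia iF mc bc; have ma := L1_measurable ia; have mf := L1_measurable iF.
pose p x y := a x * f y * c x y.
have mp : meas2 p by apply: meas2M mc; apply: meas2M; [exact: meas2_l|exact: meas2_r].
have bp x y : `|p x y| <= C * (`|a x| * `|f y|) by rewrite mulrC; apply: norm_mul_le => //; rewrite normrM.
have iy x : L1 mu (fun y => f y * c x y) by exact: L1_mulb iF (meas2_section x mc) (bc x).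
have ix y : L1 mu (fun x => a x * c x y).
  exact: L1_mulb ia (meas2_section y (meas2_swap mc)) (bc^~ y).
have py x : p x = fun y => a x * (f y * c x y) by apply/funext => y; rewrite mulrA.
have px y : p^~ y = fun x => f y * (a x * c x y) by apply/funext => x; rewrite /p; ring.
have [x|y|_ _ e] := rfubini (L1_2_le mp bp (L1_2Z C (L1_2_mul (L1_norm ia) (L1_norm iF)))); [by rewrite py; exact: L1Z|by rewrite px; exact: L1Z|].
transitivity (\int[mu]_x \int[mu]_y p x y); first by apply: eq_Rintegral => x _; rewrite py rintZ.
by rewrite e; apply: eq_Rintegral => y _; rewrite px rintZ.
Qed.

Lemma rint_odd (k : R -> R) xi : L1 mu k -> (forall r, k (- r) = k r) -> \int[mu]_r (k r * sin (xi * r)) = 0.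
Proof.
move=> ik ek; have iS := L1_sinM xi ik; have := rint_opp iS.
under eq_Rintegral do rewrite ek mulrN sinN mulrN -mulN1r.
rewrite rintZ//; lra.
Qed.

(* The kernel of the Hartley transform, a real substitute for [exp (i x)]. *)
Definition cas x : R := cos x + sin x.

Lemma casM x y : cas x * cas y = cos (x - y) + sin (x + y).
Proof. by rewrite cosB sinD /cas; ring. Qed.
Lemma cas_le x : `|cas x| <= 2.
Proof. by rewrite norm_add_le ?norm_cos_le1 ?sin_max. Qed.
Lemma continuous_cas : continuous cas.
Proof. by apply: continuous_add; [exact: continuous_cos|exact: continuous_sin]. Qed.

Lemma meas2_cas : meas2 (fun xi x => cas (xi * x)).
Proof.
apply: meas2_comp (continuous_measurable_fun continuous_cas) _.
by apply: meas2M; [apply: meas2_l|apply: meas2_r].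
Qed.

Lemma L1_cas g xi : L1 mu g -> L1 mu (fun x => g x * cas (xi * x)).
Proof. by move=> ig; apply: (L1_mulb ig (meas2_section xi meas2_cas)) => x; exact: cas_le. Qed.

Definition hartley f xi := \int[mu]_x (f x * cas (xi * x)).

Lemma hartley_le f xi : L1 mu f -> `|hartley f xi| <= 2 * mass1 f.
Proof.
move=> iF; have nF := L1_norm iF; have ic := L1_cas xi iF.
rewrite (le_trans (rint_abs ic))// -rintZ//; apply: rint_le; [exact: L1_norm|exact: L1Z|] => x.
by rewrite mulrC normrM ler_wpM2r// cas_le.
Qed.

Lemma measurable_hartley f : L1 mu f -> measT (hartley f : T -> R).
Proof.
move=> iF; apply: measurable_section_integral => [|xi]; last exact: L1_cas.
by apply: meas2M meas2_cas; apply: meas2_r; exact: L1_measurable iF.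
Qed.

Let k1 := @kk R 1.

Lemma L1_weight d : 0 < d -> L1 mu (fun xi => k1 (d * xi)).
Proof.
move=> d0; have := L1_scale 0 d0 (L1_kk (@ltr01 R)).
by under eq_fun do rewrite addr0.
Qed.

(** The product of two [cas] is a cosine of the difference plus a sine of the sum. The sine is
    killed by the even weight, so the weight transforms into [phi 1] at scale [d], an approximate
    identity. *)
Lemma weight_transform d x y : 0 < d -> \int[mu]_xi (k1 (d * xi) * cas (xi * x) * cas (xi * y)) = d^-1 * phi 1 ((x - y) / d).
Proof.
move=> d0; have iw := L1_weight d0.
rewrite -(rint_scale 0 d0); last exact: L1_cosM (L1_kk (@ltr01 R)).
have e xi : k1 (d * xi) * cas (xi * x) * cas (xi * y) = k1 (d * xi) * cos ((x - y) * xi) + k1 (d * xi) * sin ((x + y) * xi).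
  by rewrite -mulrA casM -mulrBr -mulrDr (mulrC xi) (mulrC xi) mulrDr.
under eq_Rintegral do rewrite e.
have h0 : \int[mu]_xi (k1 (d * xi) * sin ((x + y) * xi)) = 0.
  by apply: (rint_odd _ iw) => r; rewrite mulrN /k1 kk_even.
rewrite (rintD (L1_cosM _ iw) (L1_sinM _ iw)) h0 addr0.
by apply: eq_Rintegral => xi _; rewrite addr0 mulrA divfK.
Qed.

(** At [b = 1] the recurrence reads [(1 + t^2) phi 1 t = 6 phi 2 t], and [phi 2] itself decays
    quadratically. So [phi 1] and its first moment are integrable. *)
Lemma phi1_decay : exists2 K, 0 <= K & forall t, phi 1 t <= K * (oneDsqr t)^-1 /\ `|t| * phi 1 t <= K * (oneDsqr t)^-1.
Proof.
have two0 : 0 < 1 + 1 :> R by [].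
pose M := 2 * (1 + 1) * (2 * (1 + 1) + 1) * phi (1 + 1 + 1) (0 : R).
have hM t : ((1 + 1) ^+ 2 + t ^+ 2) * phi (1 + 1) t <= M := phi_decay t two0.
have M0 : 0 <= M.
  by apply: le_trans (hM 0); rewrite mulr_ge0 ?phi_ge0// addr_ge0// sqr_ge0.
exists (6 * M); first exact: mulr_ge0.
move=> t; have o0 : 0 < oneDsqr t by rewrite (lt_le_trans ltr01) ?oneDsqr_ge1.
have q0 := phi_ge0 t two0; have r1 := phi_recurrence t (@ltr01 R); have {}hM := hM t.
have e1 : phi 1 t * oneDsqr t = 6 * phi (1 + 1) t.
  by rewrite mulrC -[X in (X + _) * _](expr1n R 2) r1; ring.
rewrite !ler_pdivlMr// -[`|t| * _ * _]mulrA e1.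
have {r1 e1} t2 := real_normK (num_real t); rewrite -t2 in hM.
move: (phi (1 + 1) t) `|t| (normr_ge0 t) q0 hM => q n n0 q0 hM.
have := mulr_ge0 (sqr_ge0 n) q0; have := mulr_ge0 (sqr_ge0 (n - 2)) q0; lra.
Qed.

Lemma L1_oneDsqr : L1 mu (fun x : R => (oneDsqr x)^-1).
Proof.
pose I : set T := `[0, +oo[%classic.
have mo : measT ((fun x : R => (oneDsqr x)^-1) : T -> R).
  by apply: continuous_measurable_fun; exact: continuous_oneDsqrV.
pose g x : R := (oneDsqr x)^-1 * \1_I x.
have mI : measurable I by exact: measurable_itv.
have g0 x : 0 <= g x by rewrite /g.
have ig : L1 mu g.
  apply: L1_ltP => //.
    exact: measurable_funM mo _.
  rewrite (_ : (\int[mu]_x _)%E = (\int[mu]_(x in I) ((oneDsqr x)^-1)%:E)%E).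
    by have := integral0y_oneDsqr R; rewrite /I => ->; rewrite ltry.
  rewrite [RHS]integral_mkcond; apply: eq_integral => x _; rewrite /g patchE indicE.
  by case: ifP; rewrite ?mulr1 ?mulr0.
apply: L1_le mo _ (L1D ig (L1_opp ig)) => x.
rewrite ger0_norm// /g !indicE /oneDsqr sqrrN.
have [x0|x0] := leP 0 x.
  have -> : (x \in I) = true by apply: mem_set; rewrite /I /= in_itv andbT.
  by rewrite mulr1 lerDl.
have -> : (- x \in I) = true by apply: mem_set; rewrite /I /= in_itv/= oppr_ge0 ltW.
by rewrite mulr1 lerDr.
Qed.

Lemma measurable_phi b : 0 < b -> measT (phi b : T -> R).
Proof. by move=> b0; apply: continuous_measurable_fun; exact: phi_continuous. Qed.

Lemma L1_phi1 : L1 mu (phi 1) /\ L1 mu (fun t => `|t| * phi 1 t).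
Proof.
have [K K0 hK] := phi1_decay; have io := L1Z K L1_oneDsqr.
have mp := measurable_phi (@ltr01 R).
split; apply: L1_le io => //.
- by move=> t; rewrite ger0_norm ?phi_ge0//; exact: (hK t).1.
- exact: measurable_funM mp.
- by move=> t; rewrite ger0_norm ?mulr_ge0 ?phi_ge0//; exact: (hK t).2.
Qed.

(** The mass of the approximate identity, that is the normalization constant in Parseval's identity.
    The form inequality is homogeneous in it and uses its positivity. *)
Definition kappa := \int[mu]_t phi 1 t.

Lemma kappa_gt0 : 0 < kappa.
Proof.
have [ip _] := L1_phi1; have p0 := phi0_gt0 (@ltr01 R).
pose m := r2mass 1 + 1 : R; have m0 : 0 < m by rewrite ltr_wpDl ?r2mass_ge0.
pose r := Num.sqrt (phi 1 0 / (2 * m)); have r20 : 0 < phi 1 0 / (2 * m) by [].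
have r0 : 0 < r by rewrite sqrtr_gt0.
have [_ it ht] := tent_integrals 0 r0.
apply: (lt_le_trans (_ : 0 < phi 1 0 / 2 * \int[mu]_z tent 0 r z)).
  by rewrite mulr_gt0// (lt_le_trans _ ht)// divr_gt0.
rewrite -rintZ//; apply: rint_le; [exact: L1Z|by []|] => t.
have [rt|rt] := leP r `|t|.
  by rewrite (tent_out r0) ?subr0// mulr0 phi_ge0.
have h : phi 1 0 / 2 * tent 0 r t <= phi 1 0 / 2 by apply: ler_piMr; [|exact: tent_le1].
have := phi_defect_sqr t (@ltr01 R).
have : m * t ^+ 2 <= phi 1 0 / 2.
  have : t ^+ 2 <= r ^+ 2 by rewrite -real_normK ?num_real// ler_sqr ?nnegrE// ltW.
  rewrite sqr_sqrtr//.
  by rewrite ler_pdivlMr; lra.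
by have := sqr_ge0 t; rewrite /m; lra.
Qed.

Definition pairing d f g := \int[mu]_xi (k1 (d * xi) * (hartley f xi * hartley g xi)).

Lemma L1_pairing d f g : L1 mu f -> L1 mu g -> 0 < d ->
  L1 mu (fun xi => k1 (d * xi) * (hartley f xi * hartley g xi)).
Proof.
move=> iF ig d0; apply: (L1_mulb (L1_weight d0)) => [|xi].
  by apply: measurable_funM; exact: measurable_hartley.
by apply: norm_mul_le; exact: hartley_le.
Qed.

Lemma parseval_weighted d f g : nice f -> nice g -> 0 < d ->
  pairing d f g = \int[mu]_x (f x * \int[mu]_t (g (x - d * t) * phi 1 t)).
Proof.
move=> nf ng d0; have iw := L1_weight d0.
have ig := nice_integrable ng; have mc := meas2_cas.
have bc x y : `|cas (x * y)| <= 2 by exact: cas_le.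
have ia : L1 mu (fun xi => k1 (d * xi) * hartley g xi).
  by apply: L1_mulb iw (measurable_hartley ig) _ => xi; exact: hartley_le.
transitivity (\int[mu]_xi (k1 (d * xi) * hartley g xi * hartley f xi)).
  by apply: eq_Rintegral => xi _; rewrite -mulrA (mulrC (hartley g xi)).
rewrite (rint_swap ia (nice_integrable nf) mc bc); apply: eq_Rintegral => x _; congr (_ * _).
have ic : L1 mu (fun xi => k1 (d * xi) * cas (xi * x)).
  by under eq_fun do rewrite (mulrC _ x); exact: L1_cas.
under eq_Rintegral do rewrite mulrAC.
rewrite (rint_swap ic ig mc bc).
pose F z := g (x - z) * phi 1 (z / d).
have iF' : L1 mu F.
  apply: (L1_mulb (C := phi 1 0) (L1_reflect x ig)) => [|z].
    apply: (measurableT_comp (measurable_phi (@ltr01 R))).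
    exact: measurable_funM.
  by rewrite ger0_norm ?phi_ge0// phi_le_phi0.
transitivity (\int[mu]_y (d^-1 * F (x - y))).
  by apply: eq_Rintegral => y _; rewrite weight_transform// mulrCA; congr (_ * (g _ * _)); ring.
rewrite (rintZ _ (L1_reflect x iF')) (rint_reflect x iF') -(rint_scale 0 d0 iF').
by apply: eq_Rintegral => t _; rewrite /F addr0 mulrAC divff// mul1r.
Qed.

(** The convolution of [g] with the approximate identity differs from [kappa g] by at most [d] times
    the Lipschitz constant and the first moment of [phi 1]. *)
Lemma parseval_limit f g : nice f -> nice g ->
  exists2 K, 0 <= K & forall d, 0 < d -> `|pairing d f g - kappa * \int[mu]_x (f x * g x)| <= d * K.
Proof.
move=> nf ng; have iF := nice_integrable nf; have mf := nice_measurable nf; have mg := nice_measurable ng.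
have [ig [M M0 hM] [L L0 hL]] := ng; have [ip it] := L1_phi1.
set m := \int[mu]_t (`|t| * phi 1 t); have m0 : 0 <= m by apply: rint_ge0 => t; rewrite mulr_ge0 ?phi_ge0.
exists (L * m * mass1 f); first by rewrite !mulr_ge0// rint_ge0.
move=> d d0; rewrite parseval_weighted//.
have mgx : meas2 (fun x t => g (x - d * t) * phi 1 t).
  apply: meas2M; last by apply: meas2_r; exact: measurable_phi.
  apply: (meas2_comp mg); apply: meas2D; first by apply: meas2_l.
  by apply: meas2_r; apply: measurableT_comp.
have igx x : L1 mu (fun t => g (x - d * t) * phi 1 t).
  apply: (@L1_le _ T _ mu _ (fun t => M * phi 1 t)); first exact: (meas2_section x mgx).
  - by move=> t; rewrite normrM [X in _ * X]ger0_norm ?phi_ge0// ler_wpM2r ?phi_ge0.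
  - exact: L1Z.
have hx x : `|\int[mu]_t (g (x - d * t) * phi 1 t) - kappa * g x| <= d * (L * m).
  have i1 := L1Z (g x) ip; have iD := L1B (igx x) i1.
  rewrite (mulrC kappa) -rintZ// -rintB// (le_trans (rint_abs iD))//.
  rewrite mulrA -rintZ//; apply: rint_le; [exact: L1_norm|exact: L1Z|] => t.
  rewrite -mulrBl normrM [X in _ * X]ger0_norm ?phi_ge0// mulrA ler_wpM2r ?phi_ge0//.
  have := hL (x - d * t) x; rewrite addrAC subrr add0r normrN normrM (gtr0_norm d0) => h.
  by rewrite (le_trans h)// mulrA (mulrC L).
have ifx : L1 mu (fun x => f x * \int[mu]_t (g (x - d * t) * phi 1 t)).
  apply: (@L1_le _ T _ mu _ (fun x => (d * (L * m) + kappa * M) * `|f x|)).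
  - apply: measurable_funM => //; exact: measurable_section_integral.
  - move=> x; rewrite mulrC normrM ler_wpM2r//.
    rewrite -[X in `|X|](subrK (kappa * g x)); apply: norm_add_le => //.
    by rewrite normrM gtr0_norm ?kappa_gt0// ler_wpM2l// ltW// kappa_gt0.
  - exact/L1Z/L1_norm.
have ifg := L1Z kappa (nice_mul nf ng); have iD := L1B ifx ifg.
rewrite -rintZ; last exact: nice_mul.
rewrite -rintB// (le_trans (rint_abs iD))// mulrA -rintZ; last exact: L1_norm.
apply: rint_le; [exact: L1_norm|exact/L1Z/L1_norm|] => x.
by rewrite mulrCA -mulrBr normrM mulrC ler_wpM2r.
Qed.

End RegularizedParseval.

(** * Convolution operators and their symbols *)

Section FormPerturbation.
Variables (R : realType) (V : lmodType R[i]) (dot : {dot V for @Num.conj R[i]}).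
Local Notation rdot := (reform dot).
Local Notation N := (hnorm dot).

Lemma form_perturb (A B : V -> V) (KA KB e : R) v w : islin A -> islin B ->
  hbounded dot KA A -> hbounded dot KB B -> 0 <= KA -> 0 <= KB -> N (v - w) <= e -> e <= 1 ->
  `|rdot (A w) (B w) - rdot (A v) (B v)| <= e * (KA * KB * (2 * N v + 1)).
Proof.
move=> lA lB bA bB A0 B0; set z := v - w => hz e1.
have -> : w = v - z by rewrite opprB addrC subrK.
rewrite (linB lA) (linB lB) !(rdotBl, rdotBr) (_ : _ - _ = - rdot (A v) (B z) + (- rdot (A z) (B v) + rdot (A z) (B z))); last by ring.
have b x y : `|rdot (A x) (B y)| <= KA * KB * (N x * N y).
  rewrite (le_trans (rdot_CS _ _ _))// (_ : _ * (_ * _) = KA * N x * (KB * N y)); last by ring.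
  exact: ler_pM.
have c1 : N v * N z <= N v * e by rewrite ler_wpM2l.
have c2 : N z * N z <= e by rewrite -[leRHS]mulr1 ler_pM// (le_trans hz).
have h1 : `|rdot (A v) (B z)| <= KA * KB * (N v * e) by rewrite (le_trans (b _ _))// ler_wpM2l.
have h2 : `|rdot (A z) (B v)| <= KA * KB * (N v * e).
  by rewrite (le_trans (b _ _))// ler_wpM2l// mulrC.
have h3 : `|rdot (A z) (B z)| <= KA * KB * e by rewrite (le_trans (b _ _))// ler_wpM2l.
rewrite (_ : e * _ = KA * KB * (N v * e) + (KA * KB * (N v * e) + KA * KB * e)); last by ring.
by do 2 (apply: norm_add_le; rewrite ?normrN//).
Qed.

End FormPerturbation.

Section Convolution.
Variable R : realType.
Local Notation T := (measurableTypeR R).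
Local Notation mu := (@lebesgue_measure R).
Local Notation VL := (cL2 mu).
Local Notation rdot := (reform (@cL2_dot _ _ _ mu)).
Local Notation N := (hnorm (@cL2_dot _ _ _ mu)).
Implicit Types (f g : R -> R) (x y t xi : R).

Definition conv (k f : R -> R) := kop (fun x y => k (x - y)) f.

Definition ksymbol (k : R -> R) xi := \int[mu]_r (k r * cos (xi * r)).

Definition expbounded dl C (k : R -> R) := [/\ 0 < dl, 0 <= C, measT (k : T -> R) &
  forall r, `|k r| <= C * expk dl r].

Section OneKernel.
Variables (dl C : R) (k : R -> R).
Hypothesis hk : expbounded dl C k.

Let d0 : 0 < dl. Proof. by case: hk. Qed.
Let mk : measT (k : T -> R). Proof. by case: hk. Qed.

Lemma conv_expkernel : expkernel dl C (fun x y => k (x - y)).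
Proof. by have [_ C0 _ bk] := hk; split => //; exact: meas2_comp mk (@meas2_sub R). Qed.
Lemma conv_op : real_op mu mu (C * expk_mass dl) (conv k).
Proof. have := kop_op d0 conv_expkernel; exact. Qed.
Lemma L1_expbounded : L1 mu k.
Proof. by have [_ _ _ bk] := hk; exact: L1_exp d0 mk bk. Qed.

Lemma L1_conv_shift f x : nice f -> L1 mu (fun r => k r * f (x - r)).
Proof.
move=> [iF [M M0 hM] _]; apply: (L1_mulb L1_expbounded) => [|r]//.
exact: L1_measurable (L1_reflect x iF).
Qed.

Lemma convE f x : nice f -> conv k f x = \int[mu]_r (k r * f (x - r)).
Proof.
move=> nf; rewrite -(rint_reflect x (L1_conv_shift x nf)).
by apply: eq_Rintegral => y _; congr (_ * f _); ring.
Qed.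

Lemma nice_conv f : nice f -> nice (conv k f).
Proof.
move=> nf; have [iF [M M0 hM] [L L0 hL]] := nf; have ik := L1_expbounded.
have mkx := nice_l2 nf; have [_ C0 _ bk] := hk.
pose m := \int[mu]_r `|k r|; have m0 : 0 <= m by apply: rint_ge0.
split.
- apply: (@L1_le _ T _ mu _ (fun x => C * \int[mu]_y (expk dl (x - y) * `|f y|))).
  + have := measurable_kop d0 conv_expkernel mkx; exact.
  + move=> x; have ip := L1_kop d0 x conv_expkernel mkx.
    have ie := L1_expk_mul d0 x (L1_norm iF).
    rewrite (le_trans (rint_abs ip))// -rintZ//; apply: rint_le.
    * exact: L1_norm.
    * exact: L1Z.
    * by move=> y; rewrite normrM mulrA ler_wpM2r.
  + by apply: L1Z; have [] := expk_convolution d0 (L1_norm iF).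
- exists (M * m) => //.
  move=> x; have ix := L1_conv_shift x nf.
  rewrite convE// (le_trans (rint_abs ix))// -rintZ; last exact: L1_norm.
  apply: rint_le; [exact: L1_norm|exact/L1Z/L1_norm|] => r.
  by rewrite normrM mulrC ler_wpM2r.
- exists (L * m) => //.
  move=> x y; have ix := L1_conv_shift x nf; have iy := L1_conv_shift y nf.
  have iB := L1B ix iy.
  rewrite !convE// -rintB// (le_trans (rint_abs iB))// mulrAC -rintZ; last exact: L1_norm.
  apply: rint_le; [exact: L1_norm|exact/L1Z/L1_norm|] => r.
  rewrite -mulrBr normrM mulrC ler_wpM2r// (le_trans (hL _ _))// (_ : _ - _ - _ = x - y)//; ring.
Qed.

Hypothesis even_k : forall r, k (- r) = k r.

(** By the addition formula [cas (xi (r + y))] has a part in [cos (xi r)] and a part in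
    [sin (xi r)]. An even kernel integrates the second to zero, so the transform diagonalizes the
    convolution. *)
Lemma hartley_conv f xi : nice f -> hartley (conv k f) xi = ksymbol k xi * hartley f xi.
Proof.
move=> nf; have [iF _ _] := nf; have mf := nice_measurable nf; have [_ C0 _ bk] := hk.
have ik := L1_expbounded; have mc := meas2_section xi (@meas2_cas R).
pose p x y := k (x - y) * f y * cas (xi * x).
have mp : meas2 p.
  apply: meas2M; last exact: meas2_l.
  by apply: meas2M; [exact: meas2_comp mk (@meas2_sub R)|exact: meas2_r].
have bp x y : `|p x y| <= C * 2 * (expk dl (x - y) * `|f y|).
  rewrite [leRHS](_ : _ = C * expk dl (x - y) * `|f y| * 2); last by ring.
  by apply: norm_mul_le; [rewrite normrM ler_wpM2r|exact: cas_le].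
have ip : L1_2 p.
  exact: L1_2_le mp bp (L1_2Z _ (L1_2_expk d0 (L1_norm iF))).
have e1 x : p x = fun y => cas (xi * x) * (k (x - y) * f y) by apply/funext => y; rewrite /p mulrC.
have iS := L1_sinM xi ik; have iC := L1_cosM xi ik.
have e2 y : p ^~ y = fun x => f y * (fun r => k r * cas (xi * (r + y))) (x - y).
  by apply/funext => x; rewrite /p subrK mulrCA mulrA.
have ecas y r : k r * cas (xi * (r + y)) = cas (xi * y) * (k r * cos (xi * r)) + (cos (xi * y) - sin (xi * y)) * (k r * sin (xi * r)).
  by rewrite /cas (mulrDr xi) cosD sinD; ring.
have ikc y : L1 mu (fun r => k r * cas (xi * (r + y))).
  by under eq_fun do rewrite ecas; apply: L1D; exact: L1Z.
have i2 y : L1 mu (p ^~ y) by rewrite e2; apply: L1Z; exact: L1_shift (- y) _ (ikc y).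
have iK x := L1_kop d0 x conv_expkernel (nice_l2 nf).
have [x||_ _ e] := rfubini ip; [by rewrite e1; exact: L1Z|exact: i2|].
transitivity (\int[mu]_x \int[mu]_y p x y).
  by apply: eq_Rintegral => x _; rewrite mulrC e1 rintZ//; exact: iK.
rewrite e -rintZ; last exact: L1_cas.
apply: eq_Rintegral => y _; rewrite -[p ^~ y]/(fun x => p x y) e2 (rintZ _ (L1_shift (- y) (ikc y))).
rewrite (rint_shift (- y) (ikc y)) mulrCA; congr (_ * _); under eq_Rintegral do rewrite ecas.
by rewrite rintD ?rintZ ?rint_odd ?mulr0 ?addr0 1?mulrC//; exact: L1Z.
Qed.

End OneKernel.

Section SymbolForm.
Variables (d1 C1 d2 C2 : R) (k1 k2 : R -> R).
Hypotheses (hk1 : expbounded d1 C1 k1) (hk2 : expbounded d2 C2 k2).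
Hypotheses (e1 : forall r, k1 (- r) = k1 r) (e2 : forall r, k2 (- r) = k2 r).
Variables (a m q l c : R).
Hypothesis m0 : 0 <= m.
Hypothesis symb : forall xi, c <= a * ksymbol k1 xi + m * (q * ksymbol k2 xi - l) ^+ 2.

(** The symbol inequality is multiplied by the weighted square of the transform of [f] and
    integrated; [parseval_limit] then removes the weight as [d] tends to 0. *)
Lemma real_symbol_form f : nice f ->
  c * sqint mu f <= a * \int[mu]_x (conv k1 f x * f x) + m * sqint mu (fun x => q * conv k2 f x - l * f x).
Proof.
move=> nf; have n1 := nice_conv hk1 nf; have n2 := nice_conv hk2 nf.
pose v x := q * conv k2 f x + - l * f x.
have zn : nice (fun x => - l * f x).
  have := nice_lin (- l - 1) nf nf; rewrite (_ : (fun x => _) = (fun x => - l * f x))//.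
  by apply/funext => x; ring.
have nv : nice v := nice_lin q n2 zn.
have i0 := nice_integrable nf; have i1 := nice_integrable n1; have iv := nice_integrable nv.
have hv xi : hartley v xi = (q * ksymbol k2 xi - l) * hartley f xi.
  have ic := L1_cas xi i0; have ic2 := L1_cas xi (nice_integrable n2).
  transitivity (q * hartley (conv k2 f) xi + - l * hartley f xi); last by rewrite (hartley_conv hk2)//; ring.
  rewrite -(rintZ q ic2) -(rintZ (- l) ic) -(rintD (L1Z q ic2) (L1Z (- l) ic)).
  by apply: eq_Rintegral => x _; rewrite /v; ring.
have [K1 K10 p1] := parseval_limit n1 nf; have [K2 K20 p2] := parseval_limit nv nv.
have [K3 K30 p3] := parseval_limit nf nf.
rewrite (_ : sqint mu (fun x => q * conv k2 f x - l * f x) = \int[mu]_x (v x * v x)); last first.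
  by apply: eq_Rintegral => x _; rewrite /v mulNr.
rewrite (_ : sqint mu f = \int[mu]_x (f x * f x))//.
rewrite -(ler_pM2l (kappa_gt0 R)).
apply: (@le_of_eps _ _ _ (`|a| * K1 + m * K2 + `|c| * K3)) => d dd0 d1'.
have {}p1 := p1 d dd0; have {}p2 := p2 d dd0; have {}p3 := p3 d dd0.
have pos : c * pairing d f f <= a * pairing d (conv k1 f) f + m * pairing d v v.
  have j1 := L1_pairing i1 i0 dd0; have j2 := L1_pairing iv iv dd0.
  have j3 := L1_pairing i0 i0 dd0.
  rewrite -(rintZ c j3) -(rintZ a j1) -(rintZ m j2).
  rewrite -(rintD (L1Z a j1) (L1Z m j2)).
  apply: rint_le; [exact: L1Z|by apply: L1D; exact: L1Z|] => xi.
  rewrite hv (hartley_conv hk1)//; have w0 : 0 <= kk 1 (d * xi) * hartley f xi ^+ 2 by [].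
  by have := ler_wpM2r w0 (symb xi); lra.
move: p1 p2 p3 pos; move: (pairing d f f) (pairing d v v) (pairing d _ f) => P3 P2 P1.
set I1 := \int[mu]_x (conv _ _ _ * _); set I2 := \int[mu]_x (v x * v x); set I3 := \int[mu]_x (f x * f x).
move: I1 I2 I3 (kappa R) => I1 I2 I3 K p1 p2 p3 pos.
have h1 : `|a * P1 - a * (K * I1)| <= `|a| * (d * K1) by rewrite -mulrBr normrM ler_wpM2l.
have h2 : m * (P2 - K * I2) <= m * (d * K2) by rewrite ler_wpM2l// (le_trans (ler_norm _)).
have h3 : `|c * P3 - c * (K * I3)| <= `|c| * (d * K3) by rewrite -mulrBr normrM ler_wpM2l.
move: h1 h3; rewrite !ler_norml; lra.
Qed.

Definition nice_class : set VL := [set u | exists f : R -> R[i], [/\ nice (fun x => Re (f x)), nice (fun x => Im (f x)) & u = classof mu f]].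

Lemma nice_cl2 (f : R -> R[i]) : nice (fun x => Re (f x)) -> nice (fun x => Im (f x)) -> cl2 mu f.
Proof. by split; exact: nice_l2. Qed.

Lemma nice_zero : nice (fun=> 0 : R).
Proof.
split; first exact: integrable0.
- by exists 0 => // x; rewrite normr0.
- by exists 0 => // x y; rewrite subrr normr0.
Qed.

Lemma nice_class_subspace : subspace nice_class.
Proof.
split.
  by exists (fun=> 0); split; [exact: nice_zero|exact: nice_zero|rewrite classof0].
move=> b u v [f [f1 f2 ->]] [g [g1 g2 ->]]; exists (fun x => b * f x + g x); split.
- have := nice_lin (Re b) f1 (nice_lin (- Im b) f2 g1).
  rewrite (_ : (fun x => _) = (fun x => Re (b * f x + g x)))//.
  by apply/funext => x; rewrite !cpartsE; ring.
- have := nice_lin (Re b) f2 (nice_lin (Im b) f1 g2).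
  rewrite (_ : (fun x => _) = (fun x => Im (b * f x + g x)))//.
  by apply/funext => x; rewrite !cpartsE; ring.
- by rewrite classof_lin//; exact: nice_cl2.
Qed.

Let Lb := lift mu mu (conv k1).
Let L2 := lift mu mu (conv k2).

Let nice_form u : nice_class u ->
  c * rdot u u <= a * rdot (Lb u) u + m * rdot (q%:C *: L2 u - l%:C *: u) (q%:C *: L2 u - l%:C *: u).
Proof.
move=> [f [f1 f2 ->]]; have hf := nice_cl2 f1 f2.
have o1 := conv_op hk1; have O2 := conv_op hk2.
have h2 := cl2_complexified O2 hf.
have hl := cl2Z (- l%:C) hf.
have -> : q%:C *: L2 (classof mu f) - l%:C *: classof mu f =
    classof mu (fun x => q%:C * complexified (conv k2) f x + - l%:C * f x).
  by rewrite classof_lin// /L2 (lift_classof O2)// -scaleNr classofZ.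
have hz := cl2_lin q%:C h2 hl.
rewrite /Lb (lift_classof o1)// (rdot_classof hf hf) (rdot_classof (cl2_complexified o1 hf) hf) (rdot_classof hz hz).
have s1 := real_symbol_form f1; have s2 := real_symbol_form f2.
set X := \int[mu]_x (_ * _) + _; set Y := \int[mu]_x (_ * _) + _; set Z := \int[mu]_x (_ * _) + _.
have -> : X = sqint mu (fun x => Re (f x)) + sqint mu (fun x => Im (f x)) by [].
have -> : Z = sqint mu (fun x => q * conv k2 (fun x => Re (f x)) x - l * Re (f x)) +
    sqint mu (fun x => q * conv k2 (fun x => Im (f x)) x - l * Im (f x)).
  by congr (_ + _); apply: eq_Rintegral => x _; rewrite !cpartsE !(mul0r, oppr0, addr0, subr0) mulNr.
rewrite /Y; lra.
Qed.

(** The inequality holds on the dense class of nice functions, and all three forms are continuous by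
    [form_perturb]. *)
Lemma symbol_form u : c * N u ^+ 2 <= a * rdot (Lb u) u + m * N (q%:C *: L2 u - l%:C *: u) ^+ 2.
Proof.
have o1 := conv_op hk1; have O2 := conv_op hk2.
have l1 : islin Lb by move=> *; exact: lift_lin o1 _ _ _.
have l2' : islin L2 by move=> *; exact: lift_lin O2 _ _ _.
have b1 : hbounded (@cL2_dot _ _ _ mu) (C1 * expk_mass d1) Lb by move=> w; exact: lift_bound o1.
have b2 : hbounded (@cL2_dot _ _ _ mu) (C2 * expk_mass d2) L2 by move=> w; exact: lift_bound O2.
have [K1 _ _ _] := o1; have [K2 _ _ _] := O2.
pose G w := q%:C *: L2 w - l%:C *: w.
have lG : islin G.
  move=> b w z; rewrite /G l2' scalerDr scalerDr opprD addrACA scalerBr !scalerA.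
  by rewrite (mulrC b) (mulrC b).
have KG0 : 0 <= `|q| * (C2 * expk_mass d2) + `|l| by [].
have bG : hbounded (@cL2_dot _ _ _ mu) (`|q| * (C2 * expk_mass d2) + `|l|) G.
  move=> w; rewrite (le_trans (hnorm_triangB _ _ _))// mulrDl !hnorm_real; apply: lerD => //.
  by rewrite -[leRHS]mulrA; apply: ler_wpM2l.
have lI : islin (fun w : VL => w) by [].
have bI : hbounded (@cL2_dot _ _ _ mu) 1 (fun w : VL => w) by move=> w; rewrite mul1r.
rewrite !hnorm_sqr.
set KG := `|q| * _ + `|l| in KG0 bG.
apply: (@le_of_eps _ _ _ ((`|c| + `|a| * (C1 * expk_mass d1) + m * (KG * KG)) * (2 * N u + 1))) => e e0 e1'.
have [w Mw hw] := tent_dense nice_class_subspace (fun x r (r0 : 0 < r) => ex_intro _ (fun z => (tent x r z)%:C)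
  (And3 (tent_nice x r0) nice_zero erefl)) u e0.
have f1 := form_perturb lI lI bI bI ler01 ler01 hw e1'.
have f2 := form_perturb l1 lI b1 bI K1 ler01 hw e1'.
have f3 := form_perturb lG lG bG bG KG0 KG0 hw e1'.
have := nice_form Mw; rewrite !mulr1 mul1r in f1 f2.
move: f1 f2 f3; move: (rdot u u) (rdot w w) (rdot (Lb u) u) (rdot (Lb w) w) (rdot (G u) (G u)) (rdot (G w) (G w)) => U W A B E F f1 f2 f3 h.
have h1 : `|c * W - c * U| <= `|c| * (e * (2 * N u + 1)) by rewrite -mulrBr normrM ler_wpM2l.
have h2 : `|a * B - a * A| <= `|a| * (e * (C1 * expk_mass d1 * (2 * N u + 1))) by rewrite -mulrBr normrM ler_wpM2l.
have h3 : m * (F - E) <= m * (e * (KG * KG * (2 * N u + 1))) by rewrite ler_wpM2l// (le_trans (ler_norm _)).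
clear -h h1 h2 h3.
by move: h1 h2; rewrite !ler_norml; lra.
Qed.

End SymbolForm.
End Convolution.

(** The bookkeeping of [mourre_two_channels]: the three compact remainders take [c / 6] each, so
    [c / 2] is left, and the factor 2 on [m] is the price of squaring sums. *)
Lemma two_channel_arith (R : realType) (a1 a2 b1 b2 x1 x2 y z1 z2 w w1 w2 S0 S1 S2 n c th q1 q2 m : R) :
  c * a1 <= th * q1 * x1 + m * z1 -> c * a2 <= th * q2 * x2 + m * z2 ->
  m * z1 <= m * (2 * w1 + 2 * b1) -> m * z2 <= m * (2 * w2 + 2 * b2) ->
  - (c / 6 * n + S0) <= th * y -> 2 * m * b1 <= c / 6 * n + S1 -> 2 * m * b2 <= c / 6 * n + S2 ->
  a1 + a2 = n -> w1 + w2 = w ->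
  c / 2 * n <= th * (q1 * x1 + q2 * x2 + y) + 2 * m * w + (S0 + (S1 + S2)).
Proof.
move=> f1 f2 g1 g2 h0 h1 h2 pu pH; rewrite -pu -pH in h0 h1 h2 *.
lra.
Qed.

(** * Operator jets along an isometry family and the two-channel estimate *)

Section OperatorJets.
Variables (R : realType) (V : lmodType R[i]) (dot : {dot V for @Num.conj R[i]}).
Variables U U' : R -> V -> V.
Implicit Types (u v w : V) (T S B C : V -> V) (t : R).
Local Notation rdot := (reform dot).
Local Notation N := (hnorm dot).

Definition isometry_family := forall t, `|t| <= 2^-1 ->
  [/\ islin (U t), islin (U' t), forall u, U t (U' t u) = u, forall u, U' t (U t u) = u &
      forall u v, rdot (U t u) (U t v) = rdot u v].

Hypothesis hU : isometry_family.

Let isoU t u : `|t| <= 2^-1 -> N (U t u) = N u.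
Proof. by move=> /hU[_ _ _ _ h]; rewrite /hnorm -!/(reform dot _ _) h. Qed.
Let isoU' t u : `|t| <= 2^-1 -> N (U' t u) = N u.
Proof. by move=> ht; rewrite -(isoU _ ht); have [_ _ -> _ _] := hU ht. Qed.

Definition operator_jet (c : R) T B := forall t, `|t| <= 2^-1 -> forall u,
  N (U t (T (U' t u)) - T u - t%:C *: B u) <= c * t ^+ 2 * N u /\
  N (U t (B (U' t u)) - B u) <= c * `|t| * N u.

(** [B] plays the role of the commutator of [T] with the generator of the family. The quadratic
    remainder for [T] and the Lipschitz bound for [B] are the two regularity inputs of limiting
    absorption. *)
Definition has_jet T B := exists K c, [/\ islin T, islin B, 0 <= K, 0 <= c &
  [/\ hbounded dot K T, hbounded dot K B & operator_jet c T B]].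

Lemma has_jet_ext T T1 B B1 : T =1 T1 -> B =1 B1 -> has_jet T B -> has_jet T1 B1.
Proof. by move=> /funext <- /funext <-. Qed.

Lemma has_jetD T B S C : has_jet T B -> has_jet S C -> has_jet (fun u => T u + S u) (fun u => B u + C u).
Proof.
move=> [K1 [c1 [lT lB K10 c10 [bT bB j1]]]] [K2 [c2 [lS lC K20 c20 [bS bC j2]]]].
exists (K1 + K2), (c1 + c2); split.
- by move=> a u v; rewrite lT lS scalerDr addrACA.
- by move=> a u v; rewrite lB lC scalerDr addrACA.
- by [].
- by [].
split.
- by move=> u; rewrite mulrDl (le_trans (hnorm_triang _ _ _))// lerD.
- by move=> u; rewrite mulrDl (le_trans (hnorm_triang _ _ _))// lerD.
move=> t ht u; have [lU lU' _ _ _] := hU ht; have [a1 a2] := j1 t ht u; have [b1 b2] := j2 t ht u.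
rewrite !(linD lU) scalerDr; split.
  rewrite (_ : _ - _ - _ = (U t (T (U' t u)) - T u - t%:C *: B u) + (U t (S (U' t u)) - S u - t%:C *: C u)).
    by rewrite !mulrDl (le_trans (hnorm_triang _ _ _))// lerD.
  by rewrite [LHS](_ : _ = (U t (T (U' t u)) - T u) + (U t (S (U' t u)) - S u) - (t%:C *: B u + t%:C *: C u)) opprD addrACA.
by rewrite opprD addrACA !mulrDl (le_trans (hnorm_triang _ _ _))// lerD.
Qed.

Lemma has_jetZ (a : R[i]) T B : has_jet T B -> has_jet (fun u => a *: T u) (fun u => a *: B u).
Proof.
move=> [K1 [c1 [lT lB K10 c10 [bT bB j1]]]].
exists (normc a * K1), (normc a * c1); split.
- by move=> b u v; rewrite lT scalerDr !scalerA mulrC.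
- by move=> b u v; rewrite lB scalerDr !scalerA mulrC.
- by [].
- by [].
split.
- by move=> u; rewrite hnormZ -mulrA ler_wpM2l.
- by move=> u; rewrite hnormZ -mulrA ler_wpM2l.
move=> t ht u; have [lU lU' _ _ _] := hU ht; have [a1 a2] := j1 t ht u.
rewrite !(linZ lU) (scalerA t%:C) (mulrC t%:C) -scalerA -!scalerBr !hnormZ -!mulrA; split.
  by apply: ler_wpM2l => //; apply: le_trans a1 _; rewrite !mulrA.
by apply: ler_wpM2l => //; rewrite !mulrA.
Qed.

Lemma has_jet_conj E T B : islin E -> hbounded dot 1 E ->
  (forall t u, `|t| <= 2^-1 -> U t (E (U' t u)) = E u) -> has_jet T B ->
  has_jet (fun u => E (T (E u))) (fun u => E (B (E u))).
Proof.
move=> lE bE UE [K [c [lT lB K0 c0 [bT bB j]]]].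
have b1 u : N (E u) <= N u by rewrite -[leRHS]mul1r.
have bb X k : 0 <= k -> hbounded dot k X -> hbounded dot k (fun u => E (X (E u))).
  by move=> k0 bX u; rewrite (le_trans (b1 _))// (le_trans (bX _))// ler_wpM2l.
exists K, c; split=> //; [by move=> a u v; rewrite lE lT|by move=> a u v; rewrite lE lB|].
split; [exact: bb|exact: bb|] => t ht u; have [lU lU' UU' U'U _] := hU ht.
have EU w : U t (E w) = E (U t w) by rewrite -{1}(U'U w) UE.
have EU' w : E (U' t w) = U' t (E w) by rewrite -[LHS]U'U UE.
have [j1 j2] := j t ht (E u); rewrite !EU' !EU -(linZ lE) -!(linB lE).
by split; rewrite (le_trans (b1 _)) ?(le_trans j1, le_trans j2)// ler_wpM2l.
Qed.

(* The derivative is a norm limit of difference quotients. *)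
Lemma jet_compact T B : has_jet T B -> hcompact dot T -> hcompact dot B.
Proof.
move=> [K [c [lT lB K0 c0 [bT bB j]]]] cT; apply: hcompact_approx => e e0.
pose t := Num.min (2^-1) (e / (c + 1)).
have t0 : 0 < t by rewrite lt_min invr_gt0 ltr0n divr_gt0.
have ht : `|t| <= 2^-1 by rewrite gtr0_norm// ge_min lexx.
have te : c * t <= e.
  have h : t <= e / (c + 1) by rewrite ge_min lexx orbT.
  have := ler_wpM2l c0 h; move/le_trans; apply.
  by rewrite mulrCA ger_pMr// ler_pdivrMr// mul1r lerDl.
have [lU lU' UU' U'U iso] := hU ht.
exists (fun u => (t^-1)%:C *: (U t (T (U' t u)) - T u)).
  apply: hcompactZ; apply: hcompactB => //.
  apply: (@hcompact_compl _ _ _ (fun u => T (U' t u)) (U t) 1) => //.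
    by move=> u; rewrite isoU// mul1r.
  apply: (@hcompact_compr _ _ _ T (U' t) (U t) 1) => //.
    by move=> u; rewrite isoU'// mul1r.
  by move=> u v; rewrite -(iso (U' t u) v) UU'.
move=> u; have [h _] := j t ht u.
have -> : B u - (t^-1)%:C *: (U t (T (U' t u)) - T u) =
    - ((t^-1)%:C *: (U t (T (U' t u)) - T u - t%:C *: B u)).
  by rewrite [in RHS]scalerBr scalerA -rmorphM mulVf// scale1r opprB.
rewrite hnormNE hnorm_real gtr0_norm// ler_pdivrMl// (le_trans h)//.
by rewrite !mulrA ler_wpM2r// mulrC ler_pM2l.
Qed.

Section TwoChannels.
Variables (H B K L E1 E2 : V -> V) (q1 q2 : R).
Hypotheses (jH : has_jet H B) (jK : has_jet K L).
Hypotheses (lE1 : islin E1) (lE2 : islin E2) (sE1 : rsym dot E1) (sE2 : rsym dot E2).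
Hypotheses (E1E1 : forall u, E1 (E1 u) = E1 u) (E2E2 : forall u, E2 (E2 u) = E2 u).
Hypotheses (E1E2 : forall u, E1 (E2 u) = 0) (E2E1 : forall u, E2 (E1 u) = 0).
Hypothesis E12 : forall u, E1 u + E2 u = u.
Hypotheses (UE1 : forall t u, `|t| <= 2^-1 -> U t (E1 (U' t u)) = E1 u)
  (UE2 : forall t u, `|t| <= 2^-1 -> U t (E2 (U' t u)) = E2 u).
Hypothesis modelH : hcompact dot (fun u => H u - (q1%:C *: E1 (K (E1 u)) + q2%:C *: E2 (K (E2 u)))).
Hypotheses (cross21 : hcompact dot (fun u => E2 (K (E1 u)))) (cross12 : hcompact dot (fun u => E1 (K (E2 u)))).

Let pyth u : N (E1 u) ^+ 2 + N (E2 u) ^+ 2 = N u ^+ 2.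
Proof. by rewrite -{3}(E12 u) hnorm_sqrD sE1 E1E2 rdot0r mulr0 addr0. Qed.
Let bE1 : hbounded dot 1 E1.
Proof. by move=> u; rewrite mul1r -ler_sqr ?nnegrE// -(pyth u) lerDl. Qed.
Let bE2 : hbounded dot 1 E2.
Proof. by move=> u; rewrite mul1r -ler_sqr ?nnegrE// -(pyth u) lerDr. Qed.

(** The difference between [H] and its model is compact and has a jet. The derivative of a compact
    jet is compact, so the commutator of [H] is that of the model modulo compact operators. *)
Lemma model_derivative :
  hcompact dot (fun u => B u - (q1%:C *: E1 (L (E1 u)) + q2%:C *: E2 (L (E2 u)))).
Proof.
have j2 := has_jetZ q2%:C (has_jet_conj lE2 bE2 UE2 jK).
have := jet_compact (has_jetD jH (has_jetZ (-1) (has_jetD (has_jetZ q1%:C (has_jet_conj lE1 bE1 UE1 jK)) j2))) (hcompact_ext _ modelH) => h.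
by apply: hcompact_ext (h _) => u ; rewrite scaleN1r.
Qed.

(** The symbol inequality of each channel is applied to [E1 u] and [E2 u]. By orthogonality the
    norms add up, and the couplings between the channels are compact. *)
Lemma mourre_two_channels th m c al be : 0 < c -> 0 <= m ->
  (forall l u, al <= l -> l <= be -> [/\
    c * N u ^+ 2 <= th * q1 * rdot (L u) u + m * N (q1%:C *: K u - l%:C *: u) ^+ 2 &
    c * N u ^+ 2 <= th * q2 * rdot (L u) u + m * N (q2%:C *: K u - l%:C *: u) ^+ 2]) ->
  mourre_on dot H (fun u => th * rdot (B u) u) al be.
Proof.
move=> c0 m0 symb.
pose CH u := H u - (q1%:C *: E1 (K (E1 u)) + q2%:C *: E2 (K (E2 u))).
pose CB' u := B u - (q1%:C *: E1 (L (E1 u)) + q2%:C *: E2 (L (E2 u))).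
have cCH : hcompact dot CH := modelH; have CB : hcompact dot CB' := model_derivative.
pose D1 u := q1%:C *: E2 (K (E1 u)) - E1 (CH u).
pose D2 u := q2%:C *: E1 (K (E2 u)) - E2 (CH u).
have cD1 : hcompact dot D1 by apply: hcompactB; [exact: hcompactZ|exact: (hcompact_compl ler01 bE1 cCH)].
have cD2 : hcompact dot D2 by apply: hcompactB; [exact: hcompactZ|exact: (hcompact_compl ler01 bE2 cCH)].
(* One sixth of [c] is spent on each of the three compact remainders: that of the commutator and
   those of the two residuals, scaled by [sqrt (2 m)] to match their coefficient. *)
have c6 : 0 < c / 6 by [].
have [s0 h0] := hcompact_form (hcompactZ th%:C CB) c6.
have [s1 h1] := hcompactZ (Num.sqrt (2 * m))%:C cD1 c6.
have [s2 h2] := hcompactZ (Num.sqrt (2 * m))%:C cD2 c6.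
exists (c / 2), (2 * m), (s0 ++ s1 ++ s2); split => //.
move=> l u l1 l2; have [f1 _] := symb l (E1 u) l1 l2; have [_ f2] := symb l (E2 u) l1 l2.
have {h0} h0 := h0 u; have {h1} h1 := h1 u; have {h2} h2 := h2 u.
rewrite !hnorm_real !exprMn !real_normK// sqr_sqrtr// in h1 h2.
rewrite rdotZl in h0.
rewrite !big_cat.
have eB : rdot (B u) u = q1 * rdot (L (E1 u)) (E1 u) + q2 * rdot (L (E2 u)) (E2 u) + rdot (CB' u) u.
  by rewrite rdotBl rdotDl !rdotZl (sE1 (L _)) (sE2 (L _)); ring.
(* The residual of the model in the first channel is the projected residual of [H] plus the compact
   [D1], made of the off-diagonal block of [K] and of the error of the model. *)
have dec1 : q1%:C *: K (E1 u) - l%:C *: E1 u = E1 (H u - l%:C *: u) + D1 u.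
  have eH : H u = CH u + (q1%:C *: E1 (K (E1 u)) + q2%:C *: E2 (K (E2 u))) by rewrite subrK.
  rewrite (linB lE1) eH (linD lE1) (linD lE1 (q1%:C *: _)) !(linZ lE1) E1E1 E1E2 scaler0 addr0.
  rewrite -{1}(E12 (K (E1 u))) scalerDr.
  by rewrite (addrC (E1 (CH u))) -[RHS]addrA (addrC (- (l%:C *: _))) -!addrA; congr (_ + _);
    rewrite addrCA (addrC (q1%:C *: E2 _)) addrA subrr add0r.
have dec2 : q2%:C *: K (E2 u) - l%:C *: E2 u = E2 (H u - l%:C *: u) + D2 u.
  have eH : H u = CH u + (q1%:C *: E1 (K (E1 u)) + q2%:C *: E2 (K (E2 u))) by rewrite subrK.
  rewrite (linB lE2) eH (linD lE2) (linD lE2 (q1%:C *: _)) !(linZ lE2) E2E2 E2E1 scaler0 add0r.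
  rewrite -{1}(E12 (K (E2 u))) scalerDr (addrC (q2%:C *: E1 _)).
  by rewrite (addrC (E2 (CH u))) -[RHS]addrA (addrC (- (l%:C *: _))) -!addrA; congr (_ + _);
    rewrite addrCA (addrC (q2%:C *: E1 _)) addrA subrr add0r.
have p1 := @hnorm_sqr_add _ _ dot (E1 (H u - l%:C *: u)) (D1 u); rewrite -dec1 in p1.
have p2 := @hnorm_sqr_add _ _ dot (E2 (H u - l%:C *: u)) (D2 u); rewrite -dec2 in p2.
have pH := pyth (H u - l%:C *: u).
have g2 := ler_wpM2l m0 p2.
rewrite eB; move: h0; rewrite ler_norml => /andP[h0 _].
move: f1 f2 (ler_wpM2l m0 p1) g2 h0 h1 h2 (pyth u) pH.
exact: two_channel_arith.
Qed.

End TwoChannels.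
End OperatorJets.

(** * Profiles, amplitudes and twice differentiable dilated kernels *)

Section Profiles.
Variable R : realType.
Implicit Types (f g : R -> R) (r s t x y tau : R).

Definition profile (M C : R) f f1 f2 := [/\ 0 <= M, 0 <= C,
  forall s, is_derive s 1 f (f1 s) /\ is_derive s 1 f1 (f2 s) &
  forall s, [/\ `|f s| <= M, `|f1 s| <= C / (1 + `|s|) & `|f2 s| <= C / (1 + `|s|) ^+ 2]].

Lemma mean_value_itv f (df : R -> R) (x y : R) : (forall z, Num.min x y <= z -> z <= Num.max x y -> is_derive z 1 f (df z)) ->
  exists c, [/\ Num.min x y <= c, c <= Num.max x y & f y - f x = df c * (y - x)].
Proof.
move=> h; have cf a b : (forall z : R, a <= z -> z <= b -> is_derive z 1 f (df z)) -> {within `[a, b], continuous f}.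
  move=> hab; apply: continuous_in_subspaceT => z; rewrite inE => /andP[z1 z2].
  exact: is_derive_continuous (hab z z1 z2).
have [xy|/ltW yx] := leP x y.
  rewrite (min_idPl xy) (max_idPr xy) in h.
  have hd z : z \in `]x, y[ -> is_derive z 1 f (df z).
    by rewrite in_itv => /andP[/ltW z1 /ltW z2]; exact: h.
  have [c] := MVT_segment xy hd (cf _ _ h).
  by rewrite /= => /andP[c1 c2]; exists c.
rewrite (min_idPr yx) (max_idPl yx) in h.
have hd z : z \in `]y, x[ -> is_derive z 1 f (df z).
  by rewrite in_itv => /andP[/ltW z1 /ltW z2]; exact: h.
have [c] := MVT_segment yx hd (cf _ _ h).
rewrite /= => /andP[c1 c2]; exists c; split => //.
by lra.
Qed.

(** Beyond [s] the derivative stays above [f1 s - C / (1 + s)], because [f1 - C / (1 + .)] is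
    nondecreasing. A positive value would make [f] grow linearly, against its bound. *)
Let derivative_bound_pos f f1 f2 (M C : R) : (forall s : R, is_derive s 1 f (f1 s)) -> (forall s : R, is_derive s 1 f1 (f2 s)) ->
  (forall s, `|f s| <= M) -> (forall s, 0 <= s -> f2 s <= C / (1 + s) ^+ 2 /\ - (C / (1 + s) ^+ 2) <= f2 s) ->
  forall s, 0 <= s -> f1 s <= C / (1 + s).
Proof.
move=> d1 d2 hM hC s s0; have M0 : 0 <= M := le_trans (normr_ge0 _) (hM 0).
have C0 : 0 <= C by have [h1 h2] := hC 0 (lexx _); move: h1 h2; rewrite addr0; lra.
have dV (z : R) : 0 <= z -> is_derive z 1 (fun t => (1 + t)^-1) (- (1 + z) ^- 2 * 1).
  move=> z0; have zn : 1 + z != 0 by [].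
  have dz : is_derive z 1 (fun t : R => 1 + t) 1.
    by have h := is_deriveDD (is_derive_cst (1 : R) z 1) (is_derive_id z 1); apply: is_derive_eq h _; rewrite add0r.
  exact: (is_deriveV zn dz).
have low t : s <= t -> f1 s - C / (1 + s) <= f1 t.
  move=> st; pose g z := f1 z + - C * (1 + z)^-1.
  have [z|c [c1 c2 e]] := @mean_value_itv g (fun z => f2 z + - C * (- (1 + z) ^- 2 * 1)) s t.
    by rewrite (min_idPl st) => z1 _; apply: is_deriveDD; apply: is_deriveZZ; apply: dV; exact: le_trans z1.
  have c0 : 0 <= c by rewrite (min_idPl st) in c1; exact: le_trans c1.
  have [_ h] := hC c c0.
  have ge : 0 <= g t - g s.
    rewrite e mulr_ge0; lra.
  have t0 : 0 <= C * (1 + t)^-1 by rewrite mulr_ge0// invr_ge0 addr_ge0// (le_trans s0).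
  move: ge; rewrite /g; lra.
rewrite -subr_le0; apply: (@le_inv_nat _ _ (2 * M)) => //.
move=> n; have n0 : 0 < n.+1%:R :> R by [].
have sn : s <= s + n.+1%:R by lra.
have [c [c1 c2 e]] := @mean_value_itv f f1 s (s + n.+1%:R) (fun z _ _ => d1 z).
rewrite (min_idPl sn) in c1; have h := low c c1.
rewrite ler_pdivlMr// (le_trans (ler_wpM2r (ltW n0) h))//.
rewrite (_ : n.+1%:R = s + n.+1%:R - s); last by ring.
rewrite -e (le_trans (ler_norm _))// (le_trans (ler_normB _ _))// mulrDl mul1r lerD//.
Qed.

Lemma derivative_bound f f1 f2 (M C : R) : (forall s : R, is_derive s 1 f (f1 s)) -> (forall s : R, is_derive s 1 f1 (f2 s)) ->
  (forall s, `|f s| <= M) -> (forall s, `|f2 s| <= C / (1 + `|s|) ^+ 2) ->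
  forall s, `|f1 s| <= C / (1 + `|s|).
Proof.
have key g g1 g2 : (forall s : R, is_derive s 1 g (g1 s)) -> (forall s : R, is_derive s 1 g1 (g2 s)) ->
    (forall s, `|g s| <= M) -> (forall s, `|g2 s| <= C / (1 + `|s|) ^+ 2) ->
    forall s, 0 <= s -> `|g1 s| <= C / (1 + s).
  move=> d1 d2 hM hC s s0; rewrite ler_norml; apply/andP; split.
    rewrite lerNl -mulN1r; apply: (@derivative_bound_pos (fun s => -1 * g s) (fun s => -1 * g1 s) (fun s => -1 * g2 s) M) => //.
    - by move=> x; rewrite mulN1r normrN.
    - move=> x x0; have := hC x; rewrite (ger0_norm x0) ler_norml; lra.
  apply: (@derivative_bound_pos g g1 g2 M) => //.
  by move=> x x0; have := hC x; rewrite (ger0_norm x0) ler_norml => /andP[? ?].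
move=> d1 d2 hM hC s; have [s0|/ltW s0] := leP 0 s; first by rewrite [X in _ / (1 + X)]ger0_norm//; exact: (key f f1 f2).
rewrite [X in _ / (1 + X)]ler0_norm// -normrN.
have dN (h h1 : R -> R) x : (forall s : R, is_derive s 1 h (h1 s)) -> is_derive x 1 (fun s => h (- s)) (- h1 (- x)).
  move=> hd; have dn : is_derive x 1 (fun s : R => - s) (-1).
    have := is_deriveZZ (-1) (is_derive_id x 1); rewrite mulr1.
    by rewrite (_ : (fun r : R => -1 * r) = -%R)//; apply/funext => z; rewrite mulN1r.
  by have := @is_derive1_comp _ h -%R x _ _ (hd (- x)) dn; rewrite mulrN1.
have := key (fun s => f (- s)) (fun s => - f1 (- s)) (fun s => f2 (- s)) _ _ _ _ (- s).
rewrite opprK; apply.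
- move=> x; have := is_deriveZZ (-1) (dN f1 f2 x d2); rewrite mulN1r opprK.
  by rewrite (_ : (fun r => -1 * f1 (- r)) = fun s => - f1 (- s))//; apply/funext => z; rewrite mulN1r.
- by [].
- by move=> x; have := hC (- x); rewrite normrN.
- by lra.
Qed.

(** Two derivatives in the dilation parameter on [[1/2, 3/2]], the range of [1 + t] for
    [|t| <= 1/2], with one common bound. *)
Definition jet2 (F : R) f f1 f2 := forall tau, 2^-1 <= tau -> tau <= 3 / 2 ->
  [/\ is_derive tau 1 f (f1 tau), is_derive tau 1 f1 (f2 tau), `|f tau| <= F, `|f1 tau| <= F & `|f2 tau| <= F].

Lemma jet2M F G f f1 f2 g g1 g2 : jet2 F f f1 f2 -> jet2 G g g1 g2 ->
  jet2 (4 * (F * G)) (fun x => f x * g x) (fun x => f1 x * g x + f x * g1 x)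
    (fun x => f2 x * g x + f1 x * g1 x + (f1 x * g1 x + f x * g2 x)).
Proof.
move=> hf hg tau t1 t2; have [a1 a2 a3 a4 a5] := hf tau t1 t2; have [b1 b2 b3 b4 b5] := hg tau t1 t2.
have FG : 0 <= F * G by rewrite mulr_ge0// (le_trans _ a3, le_trans _ b3).
split.
- exact: is_deriveMM.
- exact: is_deriveDD (is_deriveMM a2 b1) (is_deriveMM a1 b2).
- by rewrite (le_trans (norm_mul_le a3 b3)); lra.
- by rewrite (le_trans (norm_add_le (norm_mul_le a4 b3) (norm_mul_le a3 b4))); lra.
- rewrite (le_trans (norm_add_le (norm_add_le (norm_mul_le a5 b3) (norm_mul_le a4 b4))
    (norm_add_le (norm_mul_le a4 b4) (norm_mul_le a3 b5)))); lra.
Qed.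

Lemma jet2_taylor F f f1 f2 t : jet2 F f f1 f2 -> `|t| <= 2^-1 ->
  [/\ `|f (1 + t) - f 1 - t * f1 1| <= F * t ^+ 2 & `|(1 + t) * f1 (1 + t) - f1 1| <= 2 * F * `|t|].
Proof.
move=> hf ht; have half : (2^-1 : R) <= 1 by lra.
have half2 : (1 : R) <= 3 / 2 by lra.
have F0 : 0 <= F by have [_ _ h _ _] := hf 1 half half2; exact: le_trans h.
have sub z : `|z| <= `|t| -> 2^-1 <= 1 + z /\ 1 + z <= 3 / 2.
  by move=> hz; have := le_trans hz ht; rewrite ler_norml; lra.
have mv g (dg : R -> R) z : (forall tau, 2^-1 <= tau -> tau <= 3 / 2 -> is_derive tau 1 g (dg tau)) ->
    `|z| <= `|t| -> exists2 c, `|c| <= `|z| & g (1 + z) - g 1 = dg (1 + c) * z.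
  move=> hd hz; have [tau h1 h2|c [c1 c2 e]] := @mean_value_itv g dg 1 (1 + z).
    have [z1 z2] := sub z hz; apply: hd.
      by apply: le_trans h1; rewrite le_min half.
    by apply: (le_trans h2); rewrite ge_max; lra.
  exists (c - 1); last by rewrite e (addrC 1 (c - 1)) subrK addrAC subrr add0r.
  move: c1 c2; have [z0|/ltW z0] := leP 0 z.
    rewrite (min_idPl _) ?(max_idPr _) ?lerDl// => c2.
    by rewrite !ger0_norm// lerBlDl.
  rewrite (min_idPr _) ?(max_idPl _) ?gerDl// => c1 c2.
  by rewrite !ler0_norm; lra.
have d1 tau : 2^-1 <= tau -> tau <= 3 / 2 -> is_derive tau 1 f (f1 tau) by move=> h1 h2; have [] := hf tau h1 h2.
have d2 tau : 2^-1 <= tau -> tau <= 3 / 2 -> is_derive tau 1 f1 (f2 tau) by move=> h1 h2; have [] := hf tau h1 h2.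
have lip z : `|z| <= `|t| -> `|f1 (1 + z) - f1 1| <= F * `|z|.
  move=> hz; have [c hc ->] := mv f1 f2 z d2 hz; rewrite normrM ler_wpM2r//.
  by have [z1 z2] := sub c (le_trans hc hz); have [_ _ _ _] := hf (1 + c) z1 z2.
split.
  have [c hc e] := mv f f1 t d1 (lexx _).
  rewrite e (mulrC t) -mulrBl normrM -[t ^+ 2]real_normK ?num_real// mulrA ler_wpM2r//.
  by rewrite (le_trans (lip c hc))// ler_wpM2l.
have [z1 z2] := sub t (lexx _); have [_ _ _ h _] := hf (1 + t) z1 z2.
have -> : (1 + t) * f1 (1 + t) - f1 1 = (f1 (1 + t) - f1 1) + t * f1 (1 + t) by ring.
rewrite -mulrA mulrDl mul1r; apply: norm_add_le; first exact: lip.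
by rewrite mulrC; exact: norm_mul_le.
Qed.

(** Differentiating in [tau] produces [s] and [s^2], which the decay of the derivatives at [tau s]
    compensates since [|s| <= 2 (1 + |tau s|)]. This is where the decay in [log t] is used. *)
Lemma profile_jet M C f f1 f2 s : profile M C f f1 f2 ->
  jet2 (M + 4 * C) (fun tau => f (tau * s)) (fun tau => s * f1 (tau * s)) (fun tau => s ^+ 2 * f2 (tau * s)).
Proof.
move=> [M0 C0 d b] tau t1 t2; have [d1 d2] := d (tau * s); have [b0 b1 b2] := b (tau * s).
have ds : is_derive tau 1 (fun z : R => z * s) s.
  by have h := is_deriveMM (is_derive_id tau 1) (is_derive_cst s tau 1); apply: is_derive_eq h _; rewrite mul1r mulr0 addr0.
have hs : `|s| <= 2 * (1 + `|tau * s|).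
  rewrite normrM gtr0_norm; have := ler_wpM2r (normr_ge0 s) t1; lra.
have c1 : `|s * f1 (tau * s)| <= 2 * C.
  rewrite (le_trans (norm_mul_le hs b1))// le_eqVlt; apply/orP; left; apply/eqP; field.
  by [].
have c2 : `|s ^+ 2 * f2 (tau * s)| <= 4 * C.
  have hs2 : `|s ^+ 2| <= (2 * (1 + `|tau * s|)) ^+ 2 by rewrite normrX ler_sqr ?nnegrE.
  rewrite (le_trans (norm_mul_le hs2 b2))// le_eqVlt; apply/orP; left; apply/eqP; field.
  by [].
split; [|  |lra|lra|lra].
- by have := @is_derive1_comp _ f (fun z => z * s) tau _ _ d1 ds; rewrite mulrC.
- have := is_deriveZZ s (@is_derive1_comp _ f1 (fun z => z * s) tau _ _ d2 ds).
  by rewrite (_ : s * (f2 (tau * s) * s) = s ^+ 2 * f2 (tau * s)); last by ring.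
Qed.

Lemma poly_expk dl k : 0 < dl -> exists2 C, 0 <= C & forall r, (1 + `|r|) ^+ k.+1 * expk dl r <= C * expk (dl / 2) r.
Proof.
move=> d0; pose e := dl / (2 * k.+1%:R); have e0 : 0 < e by rewrite divr_gt0.
pose c := 1 + e^-1; have c0 : 0 <= c by rewrite addr_ge0.
exists (c ^+ k.+1) => //.
move=> r; have h : 1 + `|r| <= c * expR (e * `|r|).
  rewrite (le_trans _ (ler_wpM2l c0 (expR_ge1Dx _)))// mulrDl mul1r mulrDr mulKf//.
  have := mulr_ge0 (ltW e0) (normr_ge0 r); have : 0 < e^-1 by [].
  lra.
have h4 : (1 + `|r|) ^+ k.+1 <= (c * expR (e * `|r|)) ^+ k.+1.
  by rewrite lerXn2r ?nnegrE.
rewrite (le_trans (ler_wpM2r (expk_ge0 _ _) h4))// exprMn -[leLHS]mulrA.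
rewrite (_ : expR _ ^+ _ * _ = expk (dl / 2) r)//.
by rewrite -expRM_natl -expRD /e; congr expR; field.
Qed.

Section KernelJets.
Variables (b : R) (b0 : 0 < b).

(** The first and, below, the second derivative of [kk b], the latter in the form that appears in
    the recurrence of the symbol. *)
Definition kk1 r := - b * tnh r * kk b r.
Definition kk2 r := b ^+ 2 * kk b r - 2 * b * (2 * b + 1) * kk (b + 1) r.

Lemma is_derive_kk1 r : is_derive r 1 kk1 (kk2 r).
Proof.
apply: (@is_derive_eq _ _ _ _ _ _ _ _ (is_deriveMM (is_deriveZZ (- b) (is_derive_tnh r)) (is_derive_kk b r))); rewrite /kk2 kkS.
have := csh_snh r; rewrite /tnh; have := csh_gt0 r.
move: (csh r) (snh r) (kk b r) => c s k cp e.
have e2 : s / c * (s / c) = 1 - 4 / c ^+ 2 by rewrite -e; field.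
have -> : - b * (s / c) * (- b * (s / c) * k) = b ^+ 2 * k * (s / c * (s / c)) by lra.
by rewrite e2; field.
Qed.

Let cb := 1 + b + (b ^+ 2 + 2 * b * (2 * b + 1)).

Let cb0 : 0 <= cb.
Proof. by rewrite !addr_ge0. Qed.

Let dscale (r x : R) : is_derive x 1 (fun tau => tau * r) r.
Proof.
by apply: is_derive_eq (is_deriveMM (is_derive_id x 1) (is_derive_cst r x 1)) _; rewrite mul1r mulr0 addr0.
Qed.

Let comp_scale (f : R -> R) (r x v : R) : is_derive (x * r) 1 f v ->
  is_derive x 1 (fun tau => f (tau * r)) (r * v).
Proof.
by move=> h; have := @is_derive1_comp _ f (fun z => z * r) x _ _ h (dscale r x); rewrite mulrC.
Qed.

Lemma kk_jet r : jet2 (cb * (1 + `|r|) ^+ 2 * expk (b / 2) r) (fun tau => kk b (tau * r))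
  (fun tau => r * kk1 (tau * r)) (fun tau => r ^+ 2 * kk2 (tau * r)).
Proof.
move=> tau t1 t2; have t0 : 0 < tau by lra.
have bn := ltW b0.
have e1 a : b <= a -> kk a (tau * r) <= expk (b / 2) r.
  move=> ba; have a0 := le_trans bn ba.
  rewrite (le_trans (kk_le _ a0))// ler_expR lerN2 normrM (gtr0_norm t0) mulrA ler_wpM2r//.
  by rewrite ler_pM.
have k1 := e1 b (lexx _); have k2 : kk (b + 1) (tau * r) <= expk (b / 2) r by apply: e1; rewrite lerDl.
have E0 := expk_ge0 (b / 2) r; have r0 := normr_ge0 r.
have bb := sqr_ge0 b.
set E := expk (b / 2) r in k1 k2 E0 *; set n := `|r| in r0 *.
have n2 := sqr_ge0 n.
have main c m : 0 <= c -> c <= cb -> 0 <= m -> m <= (1 + n) ^+ 2 -> m * (c * E) <= cb * (1 + n) ^+ 2 * E.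
  by move=> c0 cc m0 mm; rewrite mulrA ler_wpM2r// mulrC ler_pM.
split.
- exact: comp_scale (is_derive_kk b _).
- have := is_deriveZZ r (comp_scale (is_derive_kk1 (tau * r))).
  by rewrite (_ : r * (r * _) = r ^+ 2 * kk2 (tau * r)); last by ring.
- rewrite ger0_norm// (le_trans k1)// -[leLHS](mul1r E) -[leLHS](mul1r (1 * E)).
  by apply: main => //; rewrite /cb; lra.
- have h : `|kk1 (tau * r)| <= b * E.
    apply: norm_mul_le; last by rewrite ger0_norm.
    by apply: mulr_norm_le (tnh_le1 _); rewrite normrN gtr0_norm.
  rewrite normrM (le_trans (ler_wpM2l r0 h))//; apply: main => //; rewrite /cb; lra.
- have h : `|kk2 (tau * r)| <= (b ^+ 2 + 2 * b * (2 * b + 1)) * E.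
    rewrite mulrDl; apply: norm_add_le; rewrite ?normrN !ger0_norm//; exact: ler_wpM2l.
  rewrite normrM normrX (le_trans (ler_wpM2l n2 h))//; apply: main => //.
  +
  + by rewrite /cb; lra.
  + by lra.
Qed.

(** [lnsum s s'] is [ln (exp s + exp s')], the logarithm of [x + y], written through [csh]. [lnsum1]
    is its derivative along dilations of both variables. *)
Definition lnsum (s s' : R) := (s + s') / 2 + ln (csh (s - s')).
Definition lnsum1 (s s' : R) := (s + s') / 2 + (s - s') / 2 * tnh (s - s').

Lemma ln_csh_bounds r : 0 <= ln (csh r) /\ ln (csh r) <= 1 + `|r| / 2.
Proof.
have c0 := csh_gt0 r; have c4 : 4 <= csh r ^+ 2 by have := csh_snh r; have := sqr_ge0 (snh r); lra.
have c1 : 1 <= csh r.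
  rewrite leNgt; apply/negP => c1; have : csh r ^+ 2 <= 1 by rewrite expr_le1// ltW.
  by lra.
split; first exact: ln_ge0.
rewrite -ler_expR lnK// expRD /csh.
have h1 : expR (2^-1 * r) <= expR (`|r| / 2) by rewrite ler_expR; have := ler_norm r; lra.
have h2 : expR (- 2^-1 * r) <= expR (`|r| / 2) by rewrite ler_expR; have := ler_norm (- r); rewrite normrN; lra.
have := ler_wpM2l (expR_ge0 (`|r| / 2)) (expR_ge1Dx (1 : R)); lra.
Qed.

(** The two differ by terms in [s - s'] only. The decay of the profile at [lnsum] thus absorbs the
    growth of [lnsum1], up to a polynomial in [s - s'] left to the kernel. *)
Lemma lnsum1_le s s' : `|lnsum1 s s'| <= `|lnsum s s'| + (1 + `|s - s'|).
Proof.
have [l0 l1] := ln_csh_bounds (s - s').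
rewrite (_ : lnsum1 s s' = lnsum s s' + ((s - s') / 2 * tnh (s - s') - ln (csh (s - s')))); last by rewrite /lnsum1 /lnsum; ring.
rewrite (le_trans (ler_normD _ _))// lerD2l (le_trans (ler_normB _ _))// [X in _ + X]ger0_norm//.
have : `|(s - s') / 2 * tnh (s - s')| <= `|s - s'| / 2.
  by apply: mulr_norm_le (tnh_le1 _); rewrite normrM [X in _ * X]ger0_norm.
lra.
Qed.

Let is_derive_ln_csh x : is_derive x 1 (fun r => ln (csh r)) (2^-1 * tnh x).
Proof.
by apply: is_derive_eq (@is_derive1_comp _ (@ln R) (@csh R) x _ _ (is_derive1_ln (csh_gt0 x)) (is_derive_csh x)) _; rewrite /tnh; ring.
Qed.

Let ell s s' tau := lnsum (tau * s) (tau * s').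
Let ell1 s s' tau := (s + s') / 2 + (s - s') / 2 * tnh (tau * (s - s')).
Let ell2 s s' tau := (s - s') / 2 * ((s - s') * (2 / csh (tau * (s - s')) ^+ 2)).

Let ellE s s' : ell s s' = fun tau => tau * ((s + s') / 2) + ln (csh (tau * (s - s'))).
Proof. by apply/funext => tau; rewrite /ell /lnsum -mulrBr; ring. Qed.

Let is_derive_ell s s' tau : is_derive tau 1 (ell s s') (ell1 s s' tau).
Proof.
rewrite ellE; have h := is_deriveDD (dscale ((s + s') / 2) tau) (comp_scale (is_derive_ln_csh (tau * (s - s')))).
by apply: is_derive_eq h _; rewrite /ell1; ring.
Qed.

Let is_derive_ell1 s s' tau : is_derive tau 1 (ell1 s s') (ell2 s s' tau).
Proof.
by apply: is_derive_eq (is_deriveDD (is_derive_cst ((s + s') / 2) tau 1)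
  (is_deriveZZ ((s - s') / 2) (comp_scale (is_derive_tnh (tau * (s - s')))))) _; rewrite add0r.
Qed.

Lemma profile_lnsum_jet M C a a1 a2 s s' : profile M C a a1 a2 -> jet2 ((M + 10 * C) * (1 + `|s - s'|) ^+ 2) (fun tau => a (ell s s' tau))
  (fun tau => a1 (ell s s' tau) * ell1 s s' tau)
  (fun tau => a2 (ell s s' tau) * ell1 s s' tau ^+ 2 + a1 (ell s s' tau) * ell2 s s' tau).
Proof.
move=> [M0 C0 d bd] tau t1 t2; have t0 : 0 < tau by apply: lt_le_trans t1; rewrite invr_gt0.
have [d1 d2] := d (ell s s' tau); have [x0 x1 x2] := bd (ell s s' tau).
have c1 := @is_derive1_comp _ a (ell s s') tau _ _ d1 (is_derive_ell s s' tau).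
have c2 := @is_derive1_comp _ a1 (ell s s') tau _ _ d2 (is_derive_ell s s' tau).
set n := `|s - s'|; have n0 : 0 <= n by exact: normr_ge0.
set y := ell s s' tau in x0 x1 x2 *; set m := `|y| in x1 x2 *; have m0 : 0 <= m by exact: normr_ge0.
have le1 : `|ell1 s s' tau| <= 3 * ((1 + m) * (1 + n)).
  have e : tau * ell1 s s' tau = lnsum1 (tau * s) (tau * s') by rewrite /ell1 /lnsum1 -mulrBr; ring.
  have := lnsum1_le (tau * s) (tau * s'); rewrite -e -mulrBr !normrM (gtr0_norm t0) -/(ell s s' tau) -/y -/m -/n.
  have h1 : tau * n <= 3 / 2 * n by rewrite ler_wpM2r.
  have h2 : 2^-1 * `|ell1 s s' tau| <= tau * `|ell1 s s' tau| by rewrite ler_wpM2r.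
  have := mulr_ge0 m0 n0; lra.
have le2 : `|ell2 s s' tau| <= n ^+ 2.
  rewrite /ell2 (_ : _ * _ = (s - s') ^+ 2 * (csh (tau * (s - s')) ^+ 2)^-1); last by field.
  rewrite -normrX; apply: mulr_norm_le => //.
  have c4 : 4 <= csh (tau * (s - s')) ^+ 2 by have := csh_snh (tau * (s - s')); have := sqr_ge0 (snh (tau * (s - s'))); lra.
  rewrite ger0_norm// invf_le1; lra.
have nn : 1 + n + n ^+ 2 <= (1 + n) ^+ 2 by lra.
have n2 := sqr_ge0 n; set P := (1 + n) ^+ 2 in nn *.
have Cm : C / (1 + m) <= C by rewrite ler_pdivrMr// ler_peMr// lerDl.
have CP : 0 <= C * P by rewrite mulr_ge0 ?sqr_ge0.
have MP : 0 <= M * (P - 1) by rewrite mulr_ge0//; lra.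
have b1 : `|a1 y * ell1 s s' tau| <= 3 * (C * (1 + n)).
  rewrite (le_trans (norm_mul_le x1 le1))// le_eqVlt; apply/orP; left; apply/eqP; field; rewrite gt_eqF//.
have Cn : C * (1 + n) <= C * P by rewrite ler_wpM2l//; lra.
have CnP : C * n ^+ 2 <= C * P by rewrite ler_wpM2l//; lra.
split.
- by [].
- have h := is_deriveMM c2 (is_derive_ell1 s s' tau).
  by rewrite mulrA.
- by lra.
- by lra.
- have le1s : `|ell1 s s' tau ^+ 2| <= 9 * ((1 + m) ^+ 2 * P).
    rewrite normrX (_ : 9 * _ = (3 * ((1 + m) * (1 + n))) ^+ 2); last by rewrite /P; ring.
    by rewrite ler_sqr ?nnegrE.
  have b2 : `|a2 y * ell1 s s' tau ^+ 2| <= 9 * (C * P).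
    by rewrite (le_trans (norm_mul_le x2 le1s))// le_eqVlt; apply/orP; left; apply/eqP; field.
  have b3 : `|a1 y * ell2 s s' tau| <= C * n ^+ 2.
    by apply: norm_mul_le => //; exact: le_trans x1 Cm.
  by rewrite (le_trans (norm_add_le b2 b3))//; lra.
Qed.

Lemma kk_lip r r' : `|r - r'| <= 1 -> `|kk b r - kk b r'| <= b * expR b * `|r - r'| * expk b r.
Proof.
move=> rr; have [c hc] := mean_value r r' (is_derive_kk b); rewrite distrC => ->; rewrite normrM (distrC r).
rewrite [leRHS]mulrAC ler_wpM2r// -[leRHS]mulrA; apply: norm_mul_le.
  by apply: mulr_norm_le (tnh_le1 _); rewrite normrN gtr0_norm.
rewrite (le_trans (norm_kk _ (ltW b0)))// -expRD ler_expR -[X in _ <= X - _](mulr1 b) -mulrBr -mulrN.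
apply: ler_wpM2l => //; have := ler_distD c r 0; rewrite (distrC c) (distrC r') in hc; rewrite !subr0; lra.
Qed.

Lemma meas2_lnsum : meas2 lnsum /\ meas2 lnsum1.
Proof.
have ms : meas2 (fun s s' : R => (s + s') / 2).
  apply: meas2M; last by apply: meas2_l.
  by apply: meas2D; [apply: meas2_l|apply: meas2_r].
split; apply: meas2D => //.
  exact: meas2_comp (derive_measurable is_derive_ln_csh) (@meas2_sub R).
apply: meas2M; last exact: meas2_comp (derive_measurable (@is_derive_tnh R)) (@meas2_sub R).
apply: meas2M; first exact: meas2_sub.
exact: meas2_l.
Qed.

Definition end_limits f (f0 finf : R) := forall e : R, 0 < e -> exists A : R, 0 <= A /\
  forall s, (A <= s -> `|f s - finf| <= e) /\ (s <= - A -> `|f s - f0| <= e).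

(* [A1] is the derivative [(s d/ds + s' d/ds') A] along dilations. *)
Definition amplitude (A A1 : R -> R -> R) (c0 cinf : R) := exists F k, [/\ 0 <= F, meas2 A /\ meas2 A1,
  forall s s', exists g1 g2, jet2 (F * (1 + `|s - s'|) ^+ k) (fun tau => A (tau * s) (tau * s')) g1 g2 /\
    forall tau, tau * g1 tau = A1 (tau * s) (tau * s'),
  forall s s', `|A s s'| <= F /\ forall x, `|A s s' - A x s'| <= F * `|s - x| &
  forall e, 0 < e -> exists n : R, 0 <= n /\ forall s s',
    (n <= s -> n <= s' -> `|A s s' - cinf| <= e) /\ (s <= - n -> s' <= - n -> `|A s s' - c0| <= e)].

Lemma amplitude_comp M C f f1 f2 (f0 finf F : R) (k : nat) (l l1 : R -> R -> R) : profile M C f f1 f2 -> end_limits f f0 finf ->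
  meas2 l -> meas2 l1 -> M <= F -> C <= F ->
  (forall s s', exists g1 g2, jet2 (F * (1 + `|s - s'|) ^+ k) (fun tau => f (l (tau * s) (tau * s'))) g1 g2 /\
    forall tau, tau * g1 tau = f1 (l (tau * s) (tau * s')) * l1 (tau * s) (tau * s')) ->
  (forall s s' x, `|l s s' - l x s'| <= `|s - x|) ->
  (forall n s s', (n <= s -> n <= s' -> n <= l s s') /\ (s <= - (n + 1) -> s' <= - (n + 1) -> l s s' <= - n)) ->
  amplitude (fun s s' => f (l s s')) (fun s s' => f1 (l s s') * l1 s s') f0 finf.
Proof.
move=> [M0 C0 d bd] lf ml ml1 MF CF hj lip lim; exists F, k; split => //.
- exact: le_trans MF.
- split; first exact: meas2_comp (derive_measurable (fun s => (d s).1)) ml.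
  by apply: meas2M => //; exact: meas2_comp (derive_measurable (fun s => (d s).2)) ml.
- split=> [|x]; first by have [h _ _] := bd (l s s'); exact: le_trans MF.
  have [c _ ->] := mean_value (l x s') (l s s') (fun z => (d z).1); apply: norm_mul_le => //.
  have [_ h _] := bd c; by rewrite (le_trans h)// (le_trans _ CF)// ler_pdivrMr// ler_peMr// lerDl.
(* The extra unit is for [lnsum], which may exceed the larger of its arguments, by at most 1. *)
- move=> e /lf[n [n0 hn]]; exists (n + 1); split=> [|s s']//.
  have [l1' l2] := lim n s s'; split=> s1 s2; [apply: (hn _).1; lra|by apply: (hn _).2; exact: l2].
Qed.

Lemma amplitudeM A A1 B B1 c0 cinf d0 dinf : amplitude A A1 c0 cinf -> amplitude B B1 d0 dinf ->
  amplitude (fun s s' => A s s' * B s s') (fun s s' => A1 s s' * B s s' + A s s' * B1 s s') (c0 * d0) (cinf * dinf).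
Proof.
move=> [F [k [F0 [mA mA1] jA bA lA]]] [G [l [G0 [mB mB1] jB bB lB]]]; have FG := mulr_ge0 F0 G0.
exists (4 * (F * G)), (k + l)%N; split => //.
- by split; [exact: meas2M|apply: meas2D; exact: meas2M].
- move=> s s'; have [f1 [f2 [j1 e1]]] := jA s s'; have [g1 [g2 [j2 e2]]] := jB s s'.
  have := jet2M j1 j2; set X := 4 * _; rewrite (_ : X = 4 * (F * G) * (1 + `|s - s'|) ^+ (k + l)); last by rewrite /X exprD; ring.
  by move=> j; eexists; eexists; split; [exact: j|move=> tau; rewrite -e1 -e2; ring].
- move=> s s'; have [a1 a2] := bA s s'; have [b1 b2] := bB s s'; split=> [|x].
    by apply: (le_trans (norm_mul_le a1 b1)); lra.
  have [a3 _] := bA x s'.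
  rewrite (_ : _ - _ = (A s s' - A x s') * B s s' + A x s' * (B s s' - B x s')); last by ring.
  apply: (le_trans (norm_add_le (norm_mul_le (a2 x) b1) (norm_mul_le a3 (b2 x)))).
  have := mulr_ge0 FG (normr_ge0 (s - x)); lra.
- move=> e e0; pose D := F + `|d0| + `|dinf| + 1; have D0 : 0 < D by rewrite ltr_wpDl.
  have [n [n0 hn]] := lA _ (divr_gt0 e0 D0); have [m [m0 hm]] := lB _ (divr_gt0 e0 D0).
  have key x y c d : `|x| <= F -> `|x - c| <= e / D -> `|y - d| <= e / D -> `|d| + F <= D -> `|x * y - c * d| <= e.
    move=> xF xc yd dD; rewrite (_ : _ - _ = x * (y - d) + (x - c) * d); last by ring.
    apply: (le_trans (norm_add_le (norm_mul_le xF yd) (norm_mul_le xc (lexx _)))).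
    rewrite (mulrC F) -mulrDr mulrAC ler_pdivrMr//; apply: ler_wpM2l => //; lra.
  have q0 := normr_ge0 d0; have q1 := normr_ge0 dinf.
  exists (n + m); split=> [|s s']//.
  have [hn1 hn2] := hn s s'; have [hm1 hm2] := hm s s'; have [a1 _] := bA s s'; split=> s1 s2; apply: key => //.
  - by apply: hn1; [apply: le_trans s1|apply: le_trans s2]; rewrite lerDl.
  - by apply: hm1; [apply: le_trans s1|apply: le_trans s2]; rewrite lerDr.
  - by rewrite /D; lra.
  - by apply: hn2; [apply: le_trans s1 _|apply: le_trans s2 _]; rewrite lerN2 lerDl.
  - by lra.
  - by rewrite /D; lra.
Qed.

Section Amplitudes.
Variables (M C : R) (f f1 f2 : R -> R) (f0 finf : R).
Hypotheses (pf : profile M C f f1 f2) (lf : end_limits f f0 finf).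

Lemma amplitude_lnsum : amplitude (fun s s' => f (lnsum s s')) (fun s s' => f1 (lnsum s s') * lnsum1 s s') f0 finf.
Proof.
have [M0 C0 _ _] := pf; have [m1 m2] := meas2_lnsum.
apply: (@amplitude_comp M C f f1 f2 f0 finf (M + 10 * C) 2 lnsum lnsum1) => //; [lra|lra|..].
- eexists; eexists; split; first exact: profile_lnsum_jet pf.
  by move=> tau; rewrite /ell1 /lnsum1 -mulrBr; ring.
- move=> s s' x.
  have dl (z : R) : is_derive z 1 (fun z => lnsum z s') (2^-1 + 2^-1 * tnh (z - s')).
    have ds : is_derive z 1 (fun z : R => z - s') 1.
      by have h2 := is_deriveDD (is_derive_id z 1) (is_derive_cst (- s') z 1); apply: is_derive_eq h2 _; rewrite addr0.
    have h1 : is_derive z 1 (fun z : R => (z + s') / 2) 2^-1.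
      by apply: is_derive_eq (is_deriveMM (is_deriveDD (is_derive_id z 1) (is_derive_cst s' z 1)) (is_derive_cst (2^-1 : R) z 1)) _; rewrite addr0 mul1r mulr0 addr0.
    have := is_deriveDD h1 (@is_derive1_comp _ (fun r => ln (csh r)) (fun z => z - s') z _ _ (is_derive_ln_csh (z - s')) ds).
    by rewrite mulr1.
  have [c _ ->] := mean_value x s dl; rewrite mulrC; apply: mulr_norm_le => //.
  by have := tnh_le1 (c - s'); rewrite !ler_norml; lra.
- move=> n s s'; have [l0 l1] := ln_csh_bounds (s - s'); rewrite /lnsum.
  by case: (ltrP 0 (s - s')) l1 => h; [rewrite (gtr0_norm h)|rewrite (ler0_norm h)]; lra.
Qed.

Lemma amplitude_lr (i : bool) : let l s s' := if i then s else s' in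
  amplitude (fun s s' => f (l s s')) (fun s s' => f1 (l s s') * l s s') f0 finf.
Proof.
move=> l; have [M0 C0 _ _] := pf.
have ml : meas2 l by case: (i) @l => l; [apply: meas2_l|apply: meas2_r].
have lt tau s s' : l (tau * s) (tau * s') = tau * l s s' by rewrite /l; case: (i).
apply: (@amplitude_comp M C f f1 f2 f0 finf (M + 4 * C) 0 l l) => //; [lra|lra|..].
- move=> s s'; rewrite mulr1; have j := profile_jet (l s s') pf; eexists; eexists; split.
    by under eq_fun do rewrite lt; exact: j.
  by move=> tau; rewrite lt; ring.
- by move=> s s' x; rewrite /l; case: (i) => //; rewrite subrr normr0.
- by rewrite /l; case: (i); split; lra.
Qed.

End Amplitudes.

(** [pker1] is the derivative at 1 of [tau pker A (tau s) (tau s')]; its first term comes from the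
    Jacobian factor [tau] of the dilated kernel. *)
Definition pker A s s' : R := A s s' * kk b (s - s').
Definition pker1 A A1 s s' : R := A s s' * kk b (s - s') + (A1 s s' * kk b (s - s') + A s s' * ((s - s') * kk1 (s - s'))).

(** The product rule gives the kernel two derivatives bounded by a polynomial in [s - s'] times an
    exponential; half of the remaining decay rate, from [b / 2] to [b / 4], pays for the
    polynomial. *)
Lemma amplitude_kernel A A1 c0 cinf : amplitude A A1 c0 cinf -> exists E, [/\ 0 <= E,
  klip (b / 4) E (pker A),
  expkernel (b / 4) E (pker A), expkernel (b / 4) E (pker1 A A1) &
  forall s s', exists f2, jet2 (E * expk (b / 4) (s - s')) (fun tau => tau * pker A (tau * s) (tau * s'))
    (fun tau => pker1 A A1 (tau * s) (tau * s')) f2].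
Proof.
move=> [F [k [F0 [mA mA1] jA bA _]]]; have b2 : 0 < b / 2 by [].
have [D D0 hD] := poly_expk k.+1 b2; have bn := ltW b0; have e0 := expR_ge0 b.
(* The factor 24 is [4 * 4 * (3/2)]: two applications of the product rule and the bound of [tau].
   [E2] is the Lipschitz constant of amplitude times kernel. *)
pose E1 := 24 * F * cb * D; pose E2 := F * (1 + b * expR b).
have E10 : 0 <= E1 by rewrite !mulr_ge0.
have E20 : F <= E2 by rewrite ler_peMr// lerDl.
have b4 : b / 4 <= b by lra.
have e1 r : expk b r <= expk (b / 4) r by exact: expk_mono.
have jE s s' : exists f2, jet2 ((E1 + E2) * expk (b / 4) (s - s')) (fun tau => tau * pker A (tau * s) (tau * s'))
    (fun tau => pker1 A A1 (tau * s) (tau * s')) f2.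
  have [g1 [g2 [j e]]] := jA s s'; have ji : jet2 (3 / 2) (fun tau : R => tau) (fun=> 1) (fun=> 0).
    move=> tau t1 t2; split; [exact: is_derive_id|exact: is_derive_cst| | |].
    - by rewrite ger0_norm// (le_trans _ t1)//.
    - by rewrite normr1; lra.
    - by rewrite normr0.
  have := jet2M (jet2M ji j) (kk_jet (s - s')); set G1 := (fun x => (_ + _) * _ + _); set G := (fun x => _ * _ * _).
  have -> : G = (fun tau => tau * pker A (tau * s) (tau * s')).
    by apply/funext => x; rewrite /pker -mulrBr mulrA.
  have -> : G1 = (fun tau => pker1 A A1 (tau * s) (tau * s')).
    by apply/funext => x; rewrite /G1 /pker1 -e -mulrBr; ring.
  move=> {}j; eexists => tau t1 t2; have [j1 j2 j3 j4 j5] := j tau t1 t2.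
  have bnd : 4 * (4 * (3 / 2 * (F * (1 + `|s - s'|) ^+ k)) * (cb * (1 + `|s - s'|) ^+ 2 * expk (b / 2) (s - s'))) <=
      (E1 + E2) * expk (b / 4) (s - s').
    rewrite [leLHS](_ : _ = 24 * F * cb * ((1 + `|s - s'|) ^+ k.+2 * expk (b / 2) (s - s'))); last by rewrite !exprS; field.
    apply: (@le_trans _ _ (E1 * expk (b / 4) (s - s'))); last by rewrite ler_wpM2r// lerDl (le_trans F0).
    rewrite -(mulrA _ D) (_ : b / 4 = b / 2 / 2); last by field.
    by rewrite ler_wpM2l.
  split; [by []|exact: j2|exact: le_trans j3 bnd|exact: le_trans j4 bnd|exact: le_trans j5 bnd].
have one : (2^-1 : R) <= 1 /\ (1 : R) <= 3 / 2 by lra.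
have mk : meas2 (fun s s' : R => kk b (s - s')) by exact: meas2_comp (measurable_kk b) (@meas2_sub R).
have mk1 : meas2 (fun s s' : R => kk1 (s - s')).
  exact: meas2_comp (derive_measurable is_derive_kk1) (@meas2_sub R).
have dE (a a' h h' : R) : a * h - a' * h' = (a - a') * h + a' * (h - h') by lra.
have E2p := le_trans F0 E20.
have EF : E2 <= E1 + E2 by lra.
exists (E1 + E2); split=> //.
- move=> x x' y xx; rewrite (dE (A x y)).
  have := @kk_lip (x - y) (x' - y); rewrite (_ : x - y - (x' - y) = x - x'); last by ring.
  move=> /(_ xx) h; have h2 := norm_add_le (norm_mul_le ((bA x y).2 x') (norm_kk (x - y) bn)) (norm_mul_le (bA x' y).1 h).
  apply: (le_trans h2); rewrite [leLHS](_ : _ = E2 * `|x - x'| * expk b (x - y)); last by rewrite /E2; ring.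
  by apply: ler_pM => //; exact: ler_wpM2r.
- split=> //; first exact: meas2M.
  by move=> s s'; have [f2 j] := jE s s'; have [_ _] := j 1 one.1 one.2; rewrite !mul1r.
- split=> //.
    by do ?apply: meas2D; do ?apply: meas2M => //; exact: meas2_sub.
  by move=> s s'; have [f2 j] := jE s s'; have [_ _ _] := j 1 one.1 one.2; rewrite !mul1r.
Qed.

End KernelJets.
End Profiles.

(* Locked, so that unification does not try to compare multipliers or kernels by computation. *)
HB.lock Definition Mul (R : realType) (g : R -> R) : cL2 (@lebesgue_measure R) -> cL2 (@lebesgue_measure R) :=
  lift (@lebesgue_measure R) (@lebesgue_measure R) (mulop g).
HB.lock Definition Op (R : realType) (p : R -> R -> R) : cL2 (@lebesgue_measure R) -> cL2 (@lebesgue_measure R) :=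
  lift (@lebesgue_measure R) (@lebesgue_measure R) (kop p).

Lemma cross_terms (V : zmodType) (x y z w : V) : (x + y) + (z + w) - (x + w) = y + z.
Proof. by rewrite opprD addrACA addrK (addrAC x) subrr add0r. Qed.

HB.lock Definition hm (R : realType) : R -> R := \1_(`]-oo, 0[%classic : mset R).
HB.lock Definition hp (R : realType) : R -> R := \1_(`[0, +oo[%classic : mset R).

Lemma dotDZl (R : realType) (V : lmodType R[i]) (dot : {dot V for @Num.conj R[i]}) (a : R[i]) u v w :
  dot (a *: u + v) w = a * dot u w + dot v w.
Proof. by rewrite linearDl /= dotZl. Qed.

(** * The operator in the logarithmic variable *)

Section LogOperators.
Variable R : realType.
Local Notation T := (measurableTypeR R).
Local Notation mu := (@lebesgue_measure R).
Local Notation VL := (cL2 mu).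
Local Notation dotL := (@cL2_dot _ _ _ mu).
Local Notation rdot := (reform dotL).
Local Notation N := (hnorm dotL).
Local Notation hm := (@hm R).
Local Notation hp := (@hp R).
Local Notation Em := (Mul hm).
Local Notation Ep := (Mul hp).
Implicit Types (f g h : R -> R) (p q : R -> R -> R) (u v w : VL) (s t x y xi l e : R).

Definition Udil t : VL -> VL := lift mu mu (dil (1 + t)).
Definition Vdil t : VL -> VL := lift mu mu (dil (1 + t)^-1).

Lemma dil_range t : `|t| <= 2^-1 -> [/\ 0 < 1 + t, 2^-1 <= 1 + t & 1 + t <= 3 / 2].
Proof. by rewrite ler_norml; split; lra. Qed.

Lemma dil_family : isometry_family dotL Udil Vdil.
Proof.
move=> t /dil_range[t0 _ _]; have tV : 0 < (1 + t)^-1 by [].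
have lU : islin (Udil t) by move=> a u v; exact: lift_lin (dil_op t0) _ _ _.
split => //.
- by move=> a u v; exact: lift_lin (dil_op tV) _ _ _.
- by move=> u; have := lift_dilK u tV; rewrite invrK.
- by move=> u; exact: lift_dilK.
- by apply: isometry_rdot => // u; exact: hnorm_dil.
Qed.

Lemma expkernel_comb dl C C' (a : R) p q : expkernel dl C p -> expkernel dl C' q ->
  expkernel dl (`|a| * C + C') (fun x y => a * p x y + q x y).
Proof.
move=> [C0 mp hp] [C0' mq hq]; split.
- by [].
- apply: meas2D => //; apply: meas2M => //; exact: measurable_cst.
- by move=> x y; rewrite mulrDl -mulrA; apply: norm_add_le => //; exact: norm_mul_le.
Qed.

Lemma Mul_lin M g : bounded_by M g -> islin (Mul g).
Proof. by rewrite Mul.unlock; move=> bg a u v; exact: lift_lin (mulop_op bg) _ _ _. Qed.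
Lemma Mul_bound M g : bounded_by M g -> hbounded dotL M (Mul g).
Proof. by rewrite Mul.unlock; move=> bg u; exact: lift_bound (mulop_op bg). Qed.

Lemma Mul_sym M g : bounded_by M g -> rsym dotL (Mul g).
Proof.
by rewrite Mul.unlock => bg u v; apply: (lift_adj u v (mulop_op bg) (mulop_op bg)) => f h _ _; exact: mulop_adj.
Qed.

Lemma Mul_mul M M' g h u : bounded_by M g -> bounded_by M' h -> bounded_by (M * M') (fun x => g x * h x) ->
  Mul g (Mul h u) = Mul (fun x => g x * h x) u.
Proof.
move=> bg bh bgh; rewrite Mul.unlock (lift_comp _ (mulop_op bg) (mulop_op bh)).
apply: (f_equal (fun F => F u)); apply: (lift_ext (real_op_comp (mulop_op bg) (mulop_op bh)) (mulop_op bgh)).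
by move=> f _; apply/funext => x; rewrite /mulop /= mulrA.
Qed.

Lemma bounded_mul M M' g h : bounded_by M g -> bounded_by M' h -> bounded_by (M * M') (fun x => g x * h x).
Proof. by move=> [M0 mg hg] [M0' mh hh]; split; [|exact: measurable_funM|by move=> x; exact: norm_mul_le]. Qed.

Lemma bounded_comb (a M M' : R) g h : bounded_by M g -> bounded_by M' h -> bounded_by (`|a| * M + M') (fun x => a * g x + h x).
Proof.
move=> [M0 mg hg] [M0' mh hh]; split => //.
- by apply: measurable_funD => //; apply: measurable_funM.
- by move=> x; apply: norm_add_le => //; exact: norm_mul_le.
Qed.

Lemma Mul_comb (a M M' : R) g h u : bounded_by M g -> bounded_by M' h ->
  Mul (fun x => a * g x + h x) u = a%:C *: Mul g u + Mul h u.
Proof.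
move=> bg bh; have hg := mulop_op bg; have hh := mulop_op bh.
rewrite Mul.unlock -(lift_comb a u hg hh); apply: (f_equal (fun F => F u)).
apply: (lift_ext (mulop_op (bounded_comb a bg bh)) (real_op_comb a hg hh)).
by move=> f _; apply/funext => x; rewrite /mulop; ring.
Qed.

Lemma Mul_const (c : R) u : Mul (fun=> c) u = c%:C *: u.
Proof.
have bc : bounded_by `|c| (fun _ : R => c) by [].
have [f hf ->] := classofP u; rewrite Mul.unlock (lift_classof (mulop_op bc))//.
rewrite -classofZ//; congr (classof mu _); apply/funext => x.
by apply: complex_eq; rewrite !cpartsE ?mul0r ?subr0 ?addr0.
Qed.

Section OpLemmas.
Variables (dl : R) (d0 : 0 < dl).

Lemma Op_lin C p : expkernel dl C p -> islin (Op p).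
Proof. by rewrite Op.unlock => hp a u v; exact: lift_lin (kop_op d0 hp) _ _ _. Qed.
Lemma Op_bound C p : expkernel dl C p -> hbounded dotL (C * expk_mass dl) (Op p).
Proof. by rewrite Op.unlock => hp u; exact: lift_bound (kop_op d0 hp). Qed.

Lemma Op_adj C p u v : expkernel dl C p -> rdot (Op p u) v = rdot u (Op (fun x y => p y x) v).
Proof.
rewrite Op.unlock => hp; apply: (lift_adj u v (kop_op d0 hp) (kop_op d0 (expkernel_swap hp))) => f h lf lh.
exact: kop_adj hp lf lh.
Qed.

Lemma Op_comb C C' (a : R) p q u : expkernel dl C p -> expkernel dl C' q ->
  Op (fun x y => a * p x y + q x y) u = a%:C *: Op p u + Op q u.
Proof.
move=> hp hq; have op := kop_op d0 hp; have oq := kop_op d0 hq.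
rewrite Op.unlock -(lift_comb a u op oq); apply: (f_equal (fun F => F u)).
apply: (lift_ext (kop_op d0 (expkernel_comb a hp hq)) (real_op_comb a op oq)) => f lf.
apply/funext => x; have i1 := L1_kop d0 x hp lf; have i2 := L1_kop d0 x hq lf.
rewrite -(rintZ a i1) -(rintD (L1Z a i1) i2).
by apply: eq_Rintegral => y _; ring.
Qed.

(** Conjugating by a dilation replaces the kernel by [(1 + t) p ((1 + t) x) ((1 + t) y)], so the
    operators are compared by Schur's test on kernels. *)
Lemma Op_dil_le C C' D p q t u : `|t| <= 2^-1 -> expkernel dl C p -> expkernel dl C' q -> 0 <= D ->
  (forall x y, `|(1 + t) * p ((1 + t) * x) ((1 + t) * y) - q x y| <= D * expk dl (x - y)) ->
  N (Udil t (Op p (Vdil t u)) - Op q u) <= D * expk_mass dl * N u.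
Proof.
move=> /dil_range[t0 _ _] hp hq D0; set sp := fun x y => (1 + t) * p ((1 + t) * x) ((1 + t) * y) => hD.
have [C'0 mq bq] := hq; have tV : 0 < (1 + t)^-1 by [].
have hs : expkernel dl (D + C') sp.
  split; [by []| |by move=> x y; rewrite mulrDl -(subrK (q x y) (sp x y)); exact: norm_add_le (hD x y) (bq x y)].
  have ms : measT ((fun x => (1 + t) * x) : T -> T).
    exact: measurable_funM.
  apply: meas2M; first by apply: meas2_l.
  have mz : measT ((fun z : T * T => ((1 + t) * z.1, (1 + t) * z.2)) : T * T -> T * T).
    apply/measurable_fun_pairP; split; apply: (measurableT_comp ms) => //.
  by have [_ mp _] := hp; exact: (measurableT_comp mp mz).
have hd : expkernel dl D (fun x y => -1 * q x y + sp x y).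
  by have [_ m _] := expkernel_comb (-1) hq hs; split=> // x y; rewrite mulN1r addrC; exact: hD.
have -> : Udil t (Op p (Vdil t u)) = Op sp u.
  have op := kop_op d0 hp; have ov := real_op_comp op (dil_op tV).
  rewrite Op.unlock /Udil (lift_comp _ op (dil_op tV)) (lift_comp _ (dil_op t0) ov).
  apply: (f_equal (fun F => F u)); apply: (lift_ext (real_op_comp (dil_op t0) ov) (kop_op d0 hs)) => f lf.
  exact: (dil_kop d0 t0 hp lf).
by have := Op_bound hd u; rewrite (Op_comb (-1) u hq hs) rmorphN scaleN1r addrC.
Qed.

(** Taylor's formula in [tau] at 1 holds pointwise for the dilated kernel, with a remainder of
    exponential decay; Schur's test makes it a bound in operator norm. *)
Lemma Op_jet C F p q : expkernel dl C p -> expkernel dl C q -> 0 <= F ->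
  (forall s s', exists f2, jet2 (F * expk dl (s - s')) (fun tau => tau * p (tau * s) (tau * s'))
     (fun tau => q (tau * s) (tau * s')) f2) ->
  has_jet dotL Udil Vdil (Op p) (Op q).
Proof.
move=> hp hq F0 hj; have [C0 _ _] := hp.
exists (C * expk_mass dl), (2 * F * expk_mass dl); split; rewrite//; [exact: Op_lin hp|exact: Op_lin hq|].
split; [exact: Op_bound hp|exact: Op_bound hq|move=> t ht u].
have hb x y := let: ex_intro _ j := hj x y in jet2_taylor j ht.
split.
  have := Op_dil_le u ht hp (expkernel_comb t hq hp); rewrite (Op_comb t u hq hp) (addrC (_ *: _)) opprD addrA => h.
  rewrite (mulrAC _ (expk_mass dl)); apply: h => [|x y]//.
  have [+ _] := hb x y; rewrite !mul1r (addrC (t * _)) opprD addrA => /le_trans; apply.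
  by rewrite mulrAC ler_wpM2r// ler_wpM2r// ler_peMl// ler1n.
rewrite (mulrAC _ (expk_mass dl)); apply: (Op_dil_le u ht hq hq) => [|x y]//.
by have [_] := hb x y; rewrite !mul1r mulrA mulrAC.
Qed.

Lemma expkernel_mull C M p g : expkernel dl C p -> bounded_by M g -> expkernel dl (M * C) (fun x y => g x * p x y).
Proof.
move=> [C0 mp hp] [M0 mg hg]; split; [by []|by apply: meas2M => //; exact: meas2_l|].
by move=> x y; rewrite -mulrA; exact: norm_mul_le.
Qed.

Lemma expkernel_mulr C M p g : expkernel dl C p -> bounded_by M g -> expkernel dl (M * C) (fun x y => p x y * g y).
Proof.
move=> [C0 mp hp] [M0 mg hg]; split; [by []|by apply: meas2M => //; exact: meas2_r|].
by move=> x y; rewrite mulrC -mulrA; exact: norm_mul_le.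
Qed.

Lemma Mul_Op C M p g u : expkernel dl C p -> bounded_by M g -> Mul g (Op p u) = Op (fun x y => g x * p x y) u.
Proof.
move=> hp bg; have op := kop_op d0 hp; have og := mulop_op bg.
rewrite Mul.unlock Op.unlock (lift_comp _ og op); apply: (f_equal (fun F => F u)).
apply: (lift_ext (real_op_comp og op) (kop_op d0 (expkernel_mull hp bg))) => f lf.
exact: (mulop_kop d0 g hp lf).
Qed.

Lemma Op_Mul C M p g u : expkernel dl C p -> bounded_by M g -> Op p (Mul g u) = Op (fun x y => p x y * g y) u.
Proof.
move=> hp bg; have op := kop_op d0 hp; have og := mulop_op bg.
rewrite Mul.unlock Op.unlock (lift_comp _ op og); apply: (f_equal (fun F => F u)).
apply: (lift_ext (real_op_comp op og) (kop_op d0 (expkernel_mulr hp bg))) => f lf.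
exact: kop_mulop.
Qed.

End OpLemmas.

Lemma Mul_comm M M' g h u : bounded_by M g -> bounded_by M' h -> Mul g (Mul h u) = Mul h (Mul g u).
Proof.
move=> bg bh; rewrite (Mul_mul _ bg bh (bounded_mul bg bh)) (Mul_mul _ bh bg (bounded_mul bh bg)).
by congr Mul; apply/funext => x; rewrite mulrC.
Qed.

Lemma Mul_dil M g t u : bounded_by M g -> `|t| <= 2^-1 -> Udil t (Mul g (Vdil t u)) = Mul (fun x => g ((1 + t) * x)) u.
Proof.
move=> bg ht; have [t0 _ _] := dil_range ht; have tV : 0 < (1 + t)^-1 by [].
have [M0 mg hg] := bg; have og := mulop_op bg.
have bgt : bounded_by M (fun x => g ((1 + t) * x)).
  split => //; apply: (measurableT_comp mg); apply: measurable_funM => //.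
rewrite /Udil Mul.unlock (lift_comp _ og (dil_op tV)) (lift_comp _ (dil_op t0) (real_op_comp og (dil_op tV))).
apply: (f_equal (fun F => F u)).
apply: (lift_ext (real_op_comp (dil_op t0) (real_op_comp og (dil_op tV))) (mulop_op bgt)).
by move=> f _; exact: dil_mulop.
Qed.

Section Far.
Variables (dl : R) (d0 : 0 < dl).

(** The truncations are compact, and the part of the kernel beyond [n] has small norm by Schur's
    test. *)
Lemma far_compact C p : expkernel dl C p -> (forall n, hcompact dotL (fun u => Mul (trunc n) (Op p u))) ->
  (forall e : R, 0 < e -> exists n : nat, forall s s', n%:R < `|s| -> `|p s s'| <= e * expk dl (s - s')) ->
  hcompact dotL (Op p).
Proof.
move=> hp cp far; apply: hcompact_approx => e e0.
have m1 : 0 < expk_mass dl + 1 by [].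
have [n hn] := far _ (divr_gt0 e0 m1).
exists (fun u => Mul (trunc n) (Op p u)) => //.
move=> u; have bt := trunc_bounded R n; have hq := expkernel_mull hp bt.
have -> : Op p u - Mul (trunc n) (Op p u) = Op (fun x y => -1 * (trunc n x * p x y) + p x y) u.
  by rewrite (Op_comb d0 (-1) u hq hp) (Mul_Op d0 u hp bt) rmorphN scaleN1r addrC.
have hr : expkernel dl (e / (expk_mass dl + 1)) (fun x y => -1 * (trunc n x * p x y) + p x y).
  have [_ mr _] := expkernel_comb (-1) hq hp; split=> // x y; rewrite /trunc indicE; case: (boolP (x \in _)) => [_|xn].
    by rewrite mul1r mulN1r addNr normr0.
  rewrite mul0r mulr0 add0r; apply: hn; rewrite ltNge; apply: contra xn => xn.
  by apply: mem_set; rewrite /= in_itv -ler_norml.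
rewrite (le_trans (Op_bound d0 hr u))// ler_wpM2r// mulrAC ler_pdivrMr//.
by lra.
Qed.

End Far.

Lemma hmE x : hm x = if x < 0 then 1 else 0.
Proof.
rewrite unlock indicE; case: ltP => x0; first by rewrite mem_set.
by rewrite memNset//= in_itv/= ltNge x0.
Qed.

Lemma hpE x : hp x = if x < 0 then 0 else 1.
Proof.
rewrite unlock indicE; case: ltP => x0; last by rewrite mem_set//= in_itv/= x0.
by rewrite memNset//= in_itv/= leNgt x0.
Qed.

Lemma hm_bounded : bounded_by 1 hm.
Proof.
split => //; first by rewrite unlock.
by move=> x; rewrite hmE; case: ifP; rewrite ?normr1 ?normr0.
Qed.

Lemma hp_bounded : bounded_by 1 hp.
Proof.
split => //; first by rewrite unlock.
by move=> x; rewrite hpE; case: ifP; rewrite ?normr1 ?normr0.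
Qed.

Lemma EmEm u : Em (Em u) = Em u.
Proof.
rewrite (Mul_mul _ hm_bounded hm_bounded (bounded_mul hm_bounded hm_bounded)).
by congr Mul; apply/funext => x; rewrite hmE; case: ifP; rewrite ?mul1r ?mul0r.
Qed.

Lemma EpEp u : Ep (Ep u) = Ep u.
Proof.
rewrite (Mul_mul _ hp_bounded hp_bounded (bounded_mul hp_bounded hp_bounded)).
by congr Mul; apply/funext => x; rewrite hpE; case: ifP; rewrite ?mul1r ?mul0r.
Qed.

Lemma EmEp u : Em (Ep u) = 0.
Proof.
rewrite (Mul_mul _ hm_bounded hp_bounded (bounded_mul hm_bounded hp_bounded)).
rewrite (_ : (fun x => _) = fun=> 0); first by rewrite Mul_const scale0r.
by apply/funext => x; rewrite hmE hpE; case: ifP; rewrite ?mul0r ?mulr0.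
Qed.

Lemma EpEm u : Ep (Em u) = 0.
Proof. by rewrite (Mul_comm u hp_bounded hm_bounded) EmEp. Qed.

Lemma EmDEp u : Em u + Ep u = u.
Proof.
have := Mul_comb 1 u hm_bounded hp_bounded; rewrite scale1r.
rewrite (_ : (fun x => _) = fun=> 1); first by rewrite Mul_const scale1r.
by apply/funext => x; rewrite hmE hpE; case: ifP; rewrite ?mulr1 ?addr0 ?mulr0 ?add0r.
Qed.

Lemma UdilEm t u : `|t| <= 2^-1 -> Udil t (Em (Vdil t u)) = Em u.
Proof.
move=> ht; have [t0 _ _] := dil_range ht; rewrite (Mul_dil _ hm_bounded)//; congr Mul.
by apply/funext => x; rewrite !hmE pmulr_rlt0.
Qed.

Lemma UdilEp t u : `|t| <= 2^-1 -> Udil t (Ep (Vdil t u)) = Ep u.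
Proof.
move=> ht; have [t0 _ _] := dil_range ht; rewrite (Mul_dil _ hp_bounded)//; congr Mul.
by apply/funext => x; rewrite !hpE pmulr_rlt0.
Qed.

Section Kernel.
Variables (b : R) (b0 : 0 < b).
Let dl := b / 4.
Let d0 : 0 < dl. Proof. by rewrite divr_gt0. Qed.

Definition kker x y := kk b (x - y).
Definition lker x y := lk b (x - y).

(** The constant amplitude 1 makes the model kernel [kker] and its derivative [lker] instances of
    the general kernels. *)
Let one_amplitude : amplitude (fun _ _ : R => 1) (fun _ _ => 0) 1 1.
Proof.
exists 1, 0; split=> //; first by split; apply: meas2_l.
- exists (fun=> 0), (fun=> 0); split=> [tau _ _|tau]; last by rewrite mulr0.
  by split; rewrite ?normr0 ?normr1 ?mulr1//; exact: is_derive_cst.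
- by rewrite ?normr1 subrr normr0.
- by exists 0; rewrite subrr normr0.
Qed.

Let kkerE : pker b (fun _ _ : R => 1) = kker.
Proof. by apply/funext => x; apply/funext => y; rewrite /pker mul1r. Qed.
Let lkerE : pker1 b (fun _ _ : R => 1) (fun _ _ => 0) = lker.
Proof. by apply/funext => x; apply/funext => y; rewrite /pker1 /lker /lk /kk1; ring. Qed.

Lemma kker_has_jet : has_jet dotL Udil Vdil (Op kker) (Op lker).
Proof.
have [E [E0 _ hk hl hj]] := amplitude_kernel b0 one_amplitude; rewrite -kkerE -lkerE; exact: Op_jet hk hl E0 hj.
Qed.

Lemma kker_expkernel : expkernel dl 1 kker.
Proof.
split => //; first exact: meas2_comp (measurable_kk b) (@meas2_sub R).
by move=> x y; rewrite mul1r (le_trans (norm_kk _ (ltW b0)))// expk_mono// ler_pdivrMr// ler_peMr//; lra.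
Qed.

Section Model.
Variables (A A1 : R -> R -> R) (c0 cinf : R).
Hypothesis hA : amplitude A A1 c0 cinf.
Local Notation p := (pker b A).

Let rem x y := - c0 * (hm x * kker x y * hm y) + (- cinf * (hp x * kker x y * hp y) + p x y).

(** For large [|s|] either [|s - s'| >= |s| / 2], where three quarters of the decay rate make the
    kernel small and one quarter remains, or both points lie far out on the same side, where the
    amplitude is within [e] of its limit. *)
Let rem_far (e : R) : 0 < e -> exists n : nat, forall s s', n%:R < `|s| -> `|rem s s'| <= e * expk dl (s - s').
Proof.
move=> e0; have [F [k [F0 _ _ bA /(_ e e0) [n0 [n00 hn]]]]] := hA; pose M3 := `|c0| + (`|cinf| + F).
have M30 : 0 <= M3 by rewrite !addr_ge0.
(* The first term puts both points beyond [n0] in the near-diagonal case; the second makes the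
   off-diagonal kernel smaller than [e]. *)
pose B := 2 * n0 + 8 * M3 / (b * e).
have B0 : 0 <= 8 * M3 / (b * e) by [].
exists (Num.Def.truncn B).+1 => s s' ns.
have nB : B < `|s| by apply: lt_trans ns; exact: truncnS_gt.
set r := s - s'; have bk : `|kker s s'| <= expk b r by exact: norm_kk (ltW b0).
have dl34 : expk b r = expk (3 / 4 * b) r * expk dl r by rewrite -expRD /dl; congr expR; field.
have [hr|hr] := leP (`|s| / 2) `|r|.
  have h01 (h : R -> R) : bounded_by 1 h -> `|h s * kker s s' * h s'| <= expk b r.
    by move=> [_ _ hh]; apply: mulr_norm_le => //; rewrite mulrC; exact: mulr_norm_le.
  have h1 : `|rem s s'| <= M3 * expk b r.
    rewrite !mulrDl; apply: norm_add_le.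
      by apply: norm_mul_le; rewrite ?normrN//; exact: h01 hm_bounded.
    apply: norm_add_le; apply: norm_mul_le; rewrite ?normrN//; first exact: h01 hp_bounded.
    exact: (bA s s').1.
  apply: (le_trans h1); rewrite dl34 mulrA ler_wpM2r//.
  have s0 : 0 < `|s| by apply: le_lt_trans nB; rewrite addr_ge0.
  have r0 : 0 < `|r| by apply: lt_le_trans hr.
  have b34 : 0 < 3 / 4 * b by [].
  rewrite (le_trans (ler_wpM2l M30 (expk_le_inv b34 r0)))// ler_pdivrMr//.
  have h2 : 8 * M3 / (b * e) <= 2 * `|r| by move: nB hr; rewrite /B; lra.
  rewrite ler_pdivrMr// in h2; lra.
have small z : `|z| <= e -> `|z * kker s s'| <= e * expk dl r.
  by move=> hz; apply: norm_mul_le; have [_ _] := kker_expkernel; move/(_ s s'); rewrite mul1r.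
have hs : `|s| / 2 > n0 by move: nB; rewrite /B; lra.
have sr : s' = s - r by rewrite /r; ring.
move: (hr); rewrite ltr_norml => /andP[hr1 hr2].
have [s0|s0] := ltP s 0.
  rewrite (ltr0_norm s0) in hr1 hs; have s1 : s' < 0 by lra.
  have -> : rem s s' = (A s s' - c0) * kker s s'.
    by rewrite /rem /pker !hmE !hpE s0 s1 /kker; ring.
  by apply: small; apply: (hn _ _).2; lra.
rewrite (ger0_norm s0) in hr2 hs; have s1 : 0 <= s' by lra.
have -> : rem s s' = (A s s' - cinf) * kker s s'.
  by rewrite /rem /pker !hmE !hpE !ltNge s0 s1 /kker /=; ring.
by apply: small; apply: (hn _ _).1; lra.
Qed.

Lemma model_compact : hcompact dotL (fun u => Op p u -
  (c0%:C *: Em (Op kker (Em u)) + cinf%:C *: Ep (Op kker (Ep u)))).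
Proof.
have [E [E0 lp hP _ _]] := amplitude_kernel b0 hA; have hK := kker_expkernel.
have [G [G0 lk hG _ _]] := amplitude_kernel b0 one_amplitude; rewrite kkerE in lk hG.
have h1 := expkernel_mulr (expkernel_mull hK hm_bounded) hm_bounded.
have h2 := expkernel_mulr (expkernel_mull hK hp_bounded) hp_bounded.
have hc2 := expkernel_comb (- cinf) h2 hP; have hc := expkernel_comb (- c0) h1 hc2.
have remE u : Op rem u = Op p u - (c0%:C *: Em (Op kker (Em u)) + cinf%:C *: Ep (Op kker (Ep u))).
  rewrite (Op_comb d0 (- c0) u h1 hc2) (Op_comb d0 (- cinf) u h2 hP).
  rewrite -(Op_Mul d0 u (expkernel_mull hK hm_bounded) hm_bounded) -(Mul_Op d0 _ hK hm_bounded).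
  rewrite -(Op_Mul d0 u (expkernel_mull hK hp_bounded) hp_bounded) -(Mul_Op d0 _ hK hp_bounded).
  by rewrite !rmorphN !scaleNr opprD [LHS]addrA [LHS]addrC.
apply: (hcompact_ext remE); apply: (far_compact d0 hc) rem_far => n; have bt := trunc_bounded R n.
have cT D q : 0 <= D -> expkernel dl D q -> klip dl D q -> hcompact dotL (fun u => Mul (trunc n) (Op q u)).
  by move=> D0 hq lq; rewrite Mul.unlock Op.unlock; have := trunc_kop_compact d0 n hq lq D0.
have cE h : bounded_by 1 h -> hcompact dotL (fun u => Mul h (Mul (trunc n) (Op kker (Mul h u)))).
  by move=> bh; exact: (hcompact_compl ler01 (Mul_bound bh) (hcompact_compr (Mul_bound bh) (Mul_sym bh) (cT _ _ G0 hG lk))).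
apply: hcompact_ext (hcompactB (cT _ _ E0 hP lp) (hcompactD (hcompactZ c0%:C (cE _ hm_bounded)) (hcompactZ cinf%:C (cE _ hp_bounded)))) => u.
by rewrite remE (linB (Mul_lin bt)) (linD (Mul_lin bt)) !(linZ (Mul_lin bt)) (Mul_comm _ bt hm_bounded) (Mul_comm _ bt hp_bounded).
Qed.

End Model.

(** For the amplitude 1 the error of the model is exactly the sum of the two off-diagonal blocks;
    multiplying by [Ep] or [Em] separates them. *)
Lemma cross_compact : hcompact dotL (fun u => Ep (Op kker (Em u))) /\ hcompact dotL (fun u => Em (Op kker (Ep u))).
Proof.
have h := model_compact one_amplitude; rewrite kkerE in h.
have lm := Mul_lin hm_bounded; have lp := Mul_lin hp_bounded.
have expand u : Op kker u - (1%:C *: Em (Op kker (Em u)) + 1%:C *: Ep (Op kker (Ep u))) =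
    Ep (Op kker (Em u)) + Em (Op kker (Ep u)).
  have e : Op kker u = (Em (Op kker (Em u)) + Ep (Op kker (Em u))) + (Em (Op kker (Ep u)) + Ep (Op kker (Ep u))).
    by rewrite !EmDEp -(linD (Op_lin d0 kker_expkernel)) EmDEp.
  by rewrite e !scale1r; exact: cross_terms.
split.
  apply: hcompact_ext (hcompact_compl ler01 (Mul_bound hp_bounded) (hcompact_ext expand h)) => u /=.
  by rewrite (linD lp) EpEp EpEm addr0.
apply: hcompact_ext (hcompact_compl ler01 (Mul_bound hm_bounded) (hcompact_ext expand h)) => u /=.
by rewrite (linD lm) EmEm EmEp add0r.
Qed.

End Kernel.

Local Notation has_jet := (has_jet dotL Udil Vdil).

(** [B] is the limit of the symmetric difference quotients of [T], taken at [t = 1 / (n + 2)] so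
    that [t <= 1/2]. *)
Lemma jet_sym T B : has_jet T B -> rsym dotL T -> rsym dotL B.
Proof.
move=> [K [c [lT lB K0 c0 [bT bB j]]]] sT u v; apply/eqP; rewrite -subr_eq0 -normr_eq0; apply/eqP/le_anti.
rewrite normr_ge0 andbT; apply: (@le_inv_nat _ _ (4 * c * N u * N v)).
  by rewrite !mulr_ge0 ?hnorm_ge0.
move=> n; pose t : R := (n.+2%:R)^-1.
have t0 : 0 < t by rewrite invr_gt0.
have ht : `|t| <= 2^-1 by rewrite gtr0_norm// lef_pV2 ?posrE// ler_nat.
have [lU lU' UU' U'U iso] := dil_family ht.
have [r1 _] := j t ht u; have [r2 _] := j t ht v.
have sU w z : rdot (Udil t (T (Vdil t w))) z = rdot w (Udil t (T (Vdil t z))).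
  by rewrite -{1}(UU' z) iso sT -{2}(UU' w) iso.
set X := Udil t (T (Vdil t u)) - T u - t%:C *: B u in r1.
set Y := Udil t (T (Vdil t v)) - T v - t%:C *: B v in r2.
have e : t * (rdot (B u) v - rdot u (B v)) = rdot u Y - rdot X v.
  by rewrite /X /Y !rdotBl !rdotBr sU sT rdotZl rdotZr; ring.
have h1 : `|t * (rdot (B u) v - rdot u (B v))| <= 2 * (c * t ^+ 2 * N u * N v).
  rewrite e (le_trans (ler_normB _ _))// mulr_natl lerD//.
    by rewrite (le_trans (rdot_CS _ _ _))// mulrAC mulrC ler_wpM2r.
  by rewrite (le_trans (rdot_CS _ _ _))// ler_wpM2r.
rewrite normrM gtr0_norm// in h1.
have h2 : `|rdot (B u) v - rdot u (B v)| <= 2 * c * N u * N v * t.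
  rewrite -(ler_pM2l t0) (le_trans h1)// le_eqVlt; apply/orP; left; apply/eqP; ring.
rewrite (le_trans h2)//.
have cc : 0 <= 2 * c * N u * N v by rewrite !mulr_ge0.
have h3 : (n.+2%:R)^-1 <= (n.+1%:R)^-1 :> R by rewrite lef_pV2 ?posrE// ler_nat.
apply: le_trans (ler_wpM2l cc h3) _; rewrite ler_wpM2r//.
have -> : 4 * c * N u * N v = 2 * c * N u * N v + 2 * c * N u * N v by ring.
by rewrite lerDl.
Qed.

(* [weighted f f + weighted g g + i (weighted g f - weighted f g)] is the kernel [om(s) a k conj(om(s'))] for [om = f + i g]. *)
Definition weighted b a f g := pker b (fun s s' => f s * (a (lnsum s s') * g s')).

Section Operator.
Variables (b : R) (b0 : 0 < b).
Let dl := b / 4.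
Let d0 : 0 < dl. Proof. by rewrite divr_gt0. Qed.
Variables (M C : R) (a a1 a2 : R -> R) (a0 ainf : R).
Hypotheses (pa : profile M C a a1 a2) (la : end_limits a a0 ainf).
Local Notation K := (Op (kker b)).
Local Notation W f g := (Op (weighted b a f g)).

Lemma weighted_spec M1 C1 M2 C2 f f1 f2 g g1 g2 (f0 finf g0 ginf : R) :
  profile M1 C1 f f1 f2 -> end_limits f f0 finf -> profile M2 C2 g g1 g2 -> end_limits g g0 ginf -> [/\
  exists B, has_jet (W f g) B, exists E, expkernel dl E (weighted b a f g),
  forall u v, rdot (W f g u) v = rdot u (W g f v) &
  hcompact dotL (fun u => W f g u -
    ((f0 * (a0 * g0))%:C *: Em (K (Em u)) + (finf * (ainf * ginf))%:C *: Ep (K (Ep u))))].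
Proof.
move=> pf lf pg lg.
have hA := amplitudeM (amplitude_lr pf lf true) (amplitudeM (amplitude_lnsum pa la) (amplitude_lr pg lg false)).
have [E [E0 _ hp hq hj]] := amplitude_kernel b0 hA.
split; last exact: (model_compact b0 hA).
- by eexists; exact: (Op_jet d0 hp hq E0 hj).
- by exists E.
- have e : (fun x y => weighted b a f g y x) = weighted b a g f.
    apply/funext => x; apply/funext => y; have e : x - y = - (y - x) by lra.
    by rewrite /weighted /pker /lnsum e kk_even csh_even (addrC x); ring.
  by move=> u v; rewrite (Op_adj d0 _ _ hp) e.
Qed.

Section Hermitian.
Variables (Mf Cf Mg Cg : R) (f f1 f2 g g1 g2 : R -> R) (f0 finf g0 ginf : R).
Hypotheses (pf : profile Mf Cf f f1 f2) (lf : end_limits f f0 finf).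
Hypotheses (pg : profile Mg Cg g g1 g2) (lg : end_limits g g0 ginf).

Definition Hop u := (W f f u + W g g u) + 'i%C *: (W g f u - W f g u).

Lemma Hop_jet : exists B, has_jet Hop B.
Proof.
have dU := dil_family.
have [[B1 j1] _ _ _] := weighted_spec pf lf pf lf; have [[B2 j2] _ _ _] := weighted_spec pg lg pg lg.
have [[B3 j3] _ _ _] := weighted_spec pg lg pf lf; have [[B4 j4] _ _ _] := weighted_spec pf lf pg lg.
have := has_jetD dU (has_jetD dU j1 j2) (has_jetZ dU 'i%C (has_jetD dU j3 (has_jetZ dU (-1) j4))).
by move=> h; eexists; apply: has_jet_ext h => u; rewrite scaleN1r.
Qed.

Lemma Hop_lin : islin Hop.
Proof. by have [B [K' [c [lH _ _ _ _]]]] := Hop_jet. Qed.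

Lemma Hop_sym : rsym dotL Hop.
Proof.
have [_ [E1 h1] s1 _] := weighted_spec pf lf pf lf; have [_ _ s2 _] := weighted_spec pg lg pg lg.
have [_ [E3 h3] s3 _] := weighted_spec pg lg pf lf; have [_ [E4 h4] s4 _] := weighted_spec pf lf pg lg.
move=> u v; rewrite !rdotDl !rdotDr s1 s2.
rewrite rdotIr rdotBl s3 s4 (linZ (Op_lin d0 h4)) (linZ (Op_lin d0 h3)).
by rewrite opprB -rdotBr -scalerBr.
Qed.

(** At each end the limits of the two imaginary terms coincide and cancel, so the channel constants
    are [a0 |omega0|^2] and [ainf |omegainf|^2]. *)
Lemma Hop_model : hcompact dotL (fun u => Hop u -
  ((a0 * (f0 ^+ 2 + g0 ^+ 2))%:C *: Em (K (Em u)) + (ainf * (finf ^+ 2 + ginf ^+ 2))%:C *: Ep (K (Ep u)))).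
Proof.
have [_ _ _ c1] := weighted_spec pf lf pf lf; have [_ _ _ c2] := weighted_spec pg lg pg lg.
have [_ _ _ c3] := weighted_spec pg lg pf lf; have [_ _ _ c4] := weighted_spec pf lf pg lg.
apply: hcompact_ext (hcompactD (hcompactD c1 c2) (hcompactZ 'i%C (hcompactB c3 c4))) => u.
have e (c h k : R) : h * (c * k) = c * h * k by lra.
rewrite !e (mulrAC _ g0 f0) (mulrAC _ ginf finf).
have -> z1 z2 (z : VL) : z1 - z - (z2 - z) = z1 - z2 by rewrite opprB addrA subrK.
rewrite [in LHS]addrACA -opprD addrACA -!scalerDl -!rmorphD !mulrDr !mulrA.
by rewrite -!addrA; congr (_ + (_ + _)); rewrite addrC.
Qed.

Let pi := phi b 0.

Lemma channel_form (c m th q l : R) u : 0 <= m ->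
  (forall xi, c <= th * psi b xi + m * (q * phi b xi - l) ^+ 2) ->
  c * N u ^+ 2 <= th * rdot (Op (lker b) u) u + m * N (q%:C *: K u - l%:C *: u) ^+ 2.
Proof.
move=> m0 h; rewrite Op.unlock.
have hk : expbounded b 1 (kk b).
  by split; rewrite//; [exact: measurable_kk|move=> r; rewrite mul1r norm_kk].
have hl : expbounded (b / 2) 3 (lk b).
  by split; rewrite//; [exact: measurable_lk|exact: norm_lk].
apply: (symbol_form hl hk _ _ m0 h); [|exact: kk_even].
by move=> r; rewrite /lk tnh_odd kk_even; ring.
Qed.

(** An interval that misses [q pi] keeps a positive distance from it, which is the input of
    [symbol_positive]. A negative interval is handled by replacing [q] and [l] by their opposites,
    whence the sign [th]. *)
Lemma model_form (th q al be : R) : 0 < al /\ th = 1 \/ be < 0 /\ th = -1 -> ~ (al <= q * pi <= be) ->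
  exists c m : R, [/\ 0 < c, 0 <= m & forall l u, al <= l -> l <= be ->
    c * N u ^+ 2 <= th * q * rdot (Op (lker b) u) u + m * N (q%:C *: K u - l%:C *: u) ^+ 2].
Proof.
move=> hth hq; have : exists d, 0 < d /\ forall l, al <= l -> l <= be -> d <= `|l - q * pi|.
  have [lo|hi] := ltP (q * pi) al.
    by exists (al - q * pi); split=> [|l h1 _]; rewrite ?subr_gt0// ler_normr lerD2r h1.
  exists (q * pi - be); have hb : be < q * pi by lra.
  by split=> [|l _ h2]; rewrite ?subr_gt0// ler_normr opprB lerD2l lerN2 h2 orbT.
case=> d [d0' hd]; case: hth => [[al0 ->]|[be0 ->]].
  have [c [m [c0 m0 h]]] := @symbol_positive R b q d al be b0 al0 d0'.
  exists c, m; split=> // l u l1 l2; apply: channel_form => // xi; rewrite mul1r.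
  by apply: h => //; exact: hd.
have [c [m [c0 m0 h]]] := @symbol_positive R b (- q) d (- be) (- al) b0 ltac:(by rewrite oppr_gt0) d0'.
exists c, m; split=> // l u l1 l2; apply: channel_form => // xi.
rewrite mulN1r (_ : (q * phi b xi - l) ^+ 2 = (- q * phi b xi - - l) ^+ 2); last by ring.
apply: h; rewrite ?lerN2//; rewrite mulNr opprK addrC -normrN opprD opprK addrC; exact: hd.
Qed.

Let q0 := a0 * (f0 ^+ 2 + g0 ^+ 2).
Let qinf := ainf * (finf ^+ 2 + ginf ^+ 2).

Lemma Hop_two_channels B (th c m al be : R) : has_jet Hop B -> 0 < c -> 0 <= m ->
  (forall l u, al <= l -> l <= be -> [/\
    c * N u ^+ 2 <= th * q0 * rdot (Op (lker b) u) u + m * N (q0%:C *: K u - l%:C *: u) ^+ 2 &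
    c * N u ^+ 2 <= th * qinf * rdot (Op (lker b) u) u + m * N (qinf%:C *: K u - l%:C *: u) ^+ 2]) ->
  mourre_on dotL Hop (fun u => th * rdot (B u) u) al be.
Proof.
move=> jB c0 m0 h; have bhm := hm_bounded; have bhp := hp_bounded.
have [x21 x12] := cross_compact b0.
apply: (mourre_two_channels dil_family jB (kker_has_jet b0) (Mul_lin bhm) (Mul_lin bhp)
  (Mul_sym bhm) (Mul_sym bhp) EmEm EpEp EmEp EpEm EmDEp UdilEm UdilEp
  Hop_model x21 x12 c0 m0 h).
Qed.

(** The points excluded are those where the commutator symbol degenerates: [psi] vanishes at
    [xi = 0], where the symbol is [q pi], and 0 is the limit of the symbol at infinity. Away from 0
    an interval has one sign, which selects [B] or [- B] in both channels. *)
Lemma Hop_mourre B al be : has_jet Hop B -> al <= be ->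
  (forall x, x \in [:: 0; q0 * pi; qinf * pi] -> ~ (al <= x <= be)) ->
  mourre_on dotL Hop (fun u => rdot (B u) u) al be \/ mourre_on dotL Hop (fun u => - rdot (B u) u) al be.
Proof.
move=> jB ab hX.
have [h0 h1 h2] : [/\ ~ (al <= 0 <= be), ~ (al <= q0 * pi <= be) & ~ (al <= qinf * pi <= be)].
  by split; apply: hX; rewrite !inE eqxx ?orbT.
have key th : 0 < al /\ th = 1 \/ be < 0 /\ th = -1 -> mourre_on dotL Hop (fun u => th * rdot (B u) u) al be.
  move=> hth; have [c1 [m1 [c10 m10 k1]]] := model_form hth h1.
  have [c2 [m2 [c20 m20 k2]]] := model_form hth h2.
  have weak c m x y n : Num.min c1 c2 <= c -> m <= Num.max m1 m2 ->
      c * n ^+ 2 <= x + m * y ^+ 2 -> Num.min c1 c2 * n ^+ 2 <= x + Num.max m1 m2 * y ^+ 2.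
    by move=> hc hm h; apply: (le_trans (ler_wpM2r (sqr_ge0 n) hc)); apply: (le_trans h);
      rewrite lerD2l ler_wpM2r.
  apply: (@Hop_two_channels _ _ (Num.min c1 c2) (Num.max m1 m2)) => //.
  - by rewrite lt_min c10.
  - by rewrite le_max m10.
  - split.
      by apply: (@weak c1 m1); rewrite ?ge_min ?le_max ?lexx//; exact: k1.
    by apply: (@weak c2 m2); rewrite ?ge_min ?le_max ?lexx ?orbT//; exact: k2.
have [al0|al0] := ltP 0 al.
  by left; have := key 1 (or_introl (conj al0 erefl)); under eq_fun do rewrite mul1r.
have be0 : be < 0 by lra.
by right; have := key (-1) (or_intror (conj be0 erefl)); under eq_fun do rewrite mulN1r.
Qed.

Lemma scaled_closed_dist (q p l0 : R) : 0 <= p -> ~ scaled_closed q p l0 ->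
  exists2 d, 0 < d & forall t, 0 <= t -> t <= p -> d <= `|q * t - l0|.
Proof.
move=> p0; rewrite /scaled_closed; have [q0'|q0'] := leP 0 q; rewrite /= => /negP; rewrite negb_and -!ltNge.
  case/orP => h; [exists (- l0)|exists (l0 - q * p)]; rewrite ?oppr_gt0 ?subr_gt0// => t t0 tp;
    have := mulr_ge0 q0' t0; have := ler_wpM2l q0' tp; rewrite ler_normr; lra.
case/orP => h; [exists (q * p - l0)|exists l0]; rewrite ?subr_gt0// => t t0 tp;
  have := mulr_le0_ge0 (ltW q0') t0; have := ler_wnM2l (ltW q0') tp; rewrite ler_normr; lra.
Qed.

(** The commutator is switched off by [th = 0]: outside the ranges of both channel symbols
    [(q phi - l)^2] is already bounded below. *)
Lemma Hop_mourre_outside l0 : ~ (scaled_closed q0 pi `|` scaled_closed qinf pi) l0 ->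
  exists al be, [/\ al < l0, l0 < be & mourre_on dotL Hop (fun=> 0) al be].
Proof.
move=> /not_orP[h1 h2]; have [B jB] := Hop_jet.
have p0 : 0 <= pi by rewrite ltW// phi0_gt0.
have [d1 d10 k1] := scaled_closed_dist p0 h1; have [d2 d20 k2] := scaled_closed_dist p0 h2.
pose d := Num.min d1 d2; have dp : 0 < d by rewrite lt_min d10.
exists (l0 - d / 2), (l0 + d / 2); split; [by lra|by lra|].
have key (q : R) l u : l0 - d / 2 <= l -> l <= l0 + d / 2 -> (forall t, 0 <= t -> t <= pi -> d <= `|q * t - l0|) ->
    (d / 2) ^+ 2 * N u ^+ 2 <= 0 * q * rdot (Op (lker b) u) u + 1 * N (q%:C *: K u - l%:C *: u) ^+ 2.
  move=> l1 l2 hq; apply: channel_form => // xi; rewrite !mul0r mul1r add0r -(real_normK (num_real (_ - l))).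
  have := hq (phi b xi) (phi_ge0 xi b0) (phi_le_phi0 xi b0) => h.
  have hl : `|l - l0| <= d / 2 by rewrite ler_norml; lra.
  rewrite ler_pXn2r ?nnegrE//.
  have := ler_distD l (q * phi b xi) l0; lra.
have := @Hop_two_channels B 0 ((d / 2) ^+ 2) 1 (l0 - d / 2) (l0 + d / 2) jB.
rewrite exprn_gt0// ler01 => /(_ erefl erefl) h.
have : mourre_on dotL Hop (fun u => 0 * rdot (B u) u) (l0 - d / 2) (l0 + d / 2).
  apply: h => l u l1 l2; split; apply: key => // t t0 tp; rewrite ge_min.
    by rewrite k1.
  by rewrite k2 ?orbT.
by under eq_fun do rewrite mul0r.
Qed.

End Hermitian.
End Operator.

Lemma trunc_le (m n : nat) u : (m <= n)%N -> Mul (trunc n) u = 0 -> Mul (trunc m) u = 0.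
Proof.
move=> mn h; have b1 k := trunc_bounded R k.
have tmn : (fun x => trunc m x * trunc n x) = trunc m :> (R -> R).
  apply/funext => x; rewrite /trunc !indicE; have [xm|xm] := boolP (x \in (`[- m%:R, m%:R]%classic : set T)); last by rewrite mul0r.
  rewrite mul1r; move: xm; rewrite !inE /= !in_itv -!ler_norml => xm.
  by rewrite mem_set//= in_itv -ler_norml (le_trans xm)// ler_nat.
by rewrite -tmn -(Mul_mul _ (b1 m) (b1 n) (bounded_mul (b1 m) (b1 n))) h (lin0 (Mul_lin (b1 m))).
Qed.

(** The vectors orthogonal to everything supported far out include the tents, hence are dense. Thus
    unit vectors pushed to infinity tend weakly to zero. *)
Lemma tail_small (p : seq VL) e : 0 < e -> exists m : nat, forall u,
  N u = 1 -> Mul (trunc m) u = 0 -> \sum_(v <- p) rdot u v ^+ 2 <= e.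
Proof.
have one v d : 0 < d -> exists m : nat, forall u, N u = 1 -> Mul (trunc m) u = 0 -> rdot u v ^+ 2 <= d.
  move=> d0; pose dd : {dot VL for @Num.conj R[i]} := dotL.
  pose M := [set v : VL | exists m : nat, forall u, Mul (trunc m) u = 0 -> dd u v = 0].
  have sM : subspace M.
    split; first by exists 0%N => u _; rewrite dot_conj linear0l rmorph0.
    move=> a v1 v2 [m1 h1] [m2 h2]; exists (maxn m1 m2) => u hu.
    have e2 := h2 u (trunc_le (leq_maxr _ _) hu).
    have f1 : dd v1 u = 0 by rewrite dot_conj (h1 u (trunc_le (leq_maxl _ _) hu)) rmorph0.
    have f2 : dd v2 u = 0 by rewrite dot_conj e2 rmorph0.
    by rewrite dot_conj dotDZl f1 f2 mulr0 addr0 rmorph0.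
  have tM x r : 0 < r -> M (classof mu (fun z => (tent x r z)%:C)).
    move=> r0; have S0 : 0 <= `|x| + r by [].
    have hk := archi_boundP S0; set k := Num.bound _ in hk; exists k => u hu.
    have [lt _ _] := tent_integrals x r0; have bk := trunc_bounded R k.
    have ef : Mul (trunc k) (classof mu (fun z => (tent x r z)%:C)) = classof mu (fun z => (tent x r z)%:C).
      rewrite Mul.unlock (lift_classof (mulop_op bk) (cl2_real lt)); congr (classof mu _); apply/funext => z.
      apply: complex_eq; rewrite /= /mulop ?mulr0// /trunc indicE.
      have [zk|zk] := boolP (z \in (`[- k%:R, k%:R]%classic : set T)); first by rewrite mul1r.
      rewrite mul0r tent_out//; apply: le_trans (lerB_dist _ _); rewrite lerBrDl ltW//.
      by move: zk; rewrite notin_setE /= in_itv -ler_norml => /negP; rewrite -ltNge; exact: lt_trans.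
    by rewrite -ef -[LHS](rsym_selfadjoint (Mul_lin bk) (Mul_sym bk) u) hu linear0l.
  have sd : 0 < Num.sqrt d by rewrite sqrtr_gt0.
  have [w [m hm] vw] := tent_dense sM tM v sd.
  exists m => u Nu hu; have uw : rdot u w = 0 := congr1 (@complex.Re R) (hm u hu).
  rewrite -(subrK w v) rdotDr uw addr0 -[leRHS](sqr_sqrtr (ltW d0)) -(real_normK (num_real (rdot _ _))).
  by rewrite ler_pXn2r ?nnegrE//; apply: (le_trans (rdot_CS _ _ _)); rewrite Nu mul1r.
elim: p e => [|v p IH] e e0; first by exists 0%N => u _ _; rewrite big_nil.
have e2 : 0 < e / 2 by [].
have [m1 h1] := one v _ e2; have [m2 h2] := IH _ e2.
exists (maxn m1 m2) => u Nu hu; rewrite big_cons (splitr e) lerD//.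
  by apply: h1 => //; apply: trunc_le hu; exact: leq_maxl.
by apply: h2 => //; apply: trunc_le hu; exact: leq_maxr.
Qed.

Lemma nice_defect dl C k g : expbounded dl C k -> nice g ->
  nice (fun s => conv k g s - (\int[mu]_r k r) * g s).
Proof.
move=> hk ng; have := nice_lin (- \int[mu]_r k r) ng (nice_conv hk ng).
by congr nice; apply/funext => s; rewrite mulNr addrC.
Qed.

(** The square of the defect is at most its supremum, of order [L], times its [L^1] norm, of the
    order of the mass of [g]. *)
Lemma slow_convolution dl C k g (L : R) : expbounded dl C k -> nice g -> 0 <= L ->
  (forall x y, `|g x - g y| <= L * `|x - y|) ->
  sqint mu (fun s => conv k g s - (\int[mu]_r k r) * g s) <=
    L * (\int[mu]_r (`|r| * `|k r|) * ((C * expk_mass dl + `|\int[mu]_r k r|) * mass1 g)).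
Proof.
move=> hk ng L0 Lg; have [dl0 C0 mk kb] := hk; have ik := L1_expbounded hk.
have irk : L1 mu (fun r => `|r| * `|k r|).
  apply: (@L1_exp _ (dl / 2) (C * (2 / dl))); rewrite//.
    by apply: measurable_funM; [|exact: (measurableT_comp (@normr_measurable R setT) mk)].
  move=> r; rewrite normrM !normr_id; apply: le_trans (ler_wpM2l (normr_ge0 r) (kb r)) _.
  by rewrite mulrCA -mulrA ler_wpM2l// norm_expk.
pose kap := \int[mu]_r k r; pose D s := conv k g s - kap * g s.
have Dle s : `|D s| <= L * \int[mu]_r (`|r| * `|k r|).
  have i1 := L1_conv_shift hk s ng.
  rewrite /D (convE hk)// (mulrC kap) -(rintZ (g s) ik) -(rintB i1 (L1Z (g s) ik)).
  have i3 : L1 mu (fun r => k r * g (s - r) - g s * k r) by apply: L1B => //; exact: L1Z.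
  apply: (le_trans (rint_abs i3)); rewrite -rintZ//.
  apply: rint_le; [exact: L1_norm|exact: L1Z|] => r.
  rewrite mulrC -mulrBl normrM mulrA ler_wpM2r//; apply: (le_trans (Lg _ _)).
  by rewrite addrAC subrr add0r normrN.
have ig : L1 mu (fun y => `|g y|) by apply: L1_norm; exact: nice_integrable.
have [ie Ee] := expk_convolution dl0 ig.
pose B s := C * (\int[mu]_y (expk dl (s - y) * `|g y|)) + `|kap| * `|g s|.
have iB : L1 mu B by apply: L1D; exact: L1Z.
have DB s : `|D s| <= B s.
  apply: (le_trans (ler_normB _ _)); rewrite lerD ?normrM// -rintZ; last exact: L1_expk_mul.
  have hc := conv_expkernel hk.
  apply: (le_trans (rint_abs (L1_kop dl0 s hc (nice_l2 ng)))).
  apply: rint_le; [exact: L1_norm (L1_kop dl0 s hc (nice_l2 ng))| |].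
    by apply: L1Z; exact: L1_expk_mul.
  by move=> y; rewrite normrM mulrA ler_wpM2r.
have -> : (C * expk_mass dl + `|kap|) * mass1 g = \int[mu]_s B s.
  by rewrite rintD ?rintZ ?Ee//; [rewrite mulrDl mulrA|exact: L1Z..].
rewrite mulrA -rintZ//; apply: rint_le; [by have [] := nice_l2 (nice_defect hk ng)|exact: L1Z|] => s.
rewrite -(real_normK (num_real (conv k g s - _))).
exact: ler_pM (normr_ge0 _) (normr_ge0 _) (Dle s) (DB s).
Qed.

(** The envelope [g] modulated by [exp (i xi s)], an approximate eigenfunction of the convolution
    when [g] varies slowly. *)
Definition wave xi g : VL := classof mu (fun s => (g s * cos (xi * s)) +i* (g s * sin (xi * s))).

Lemma cl2_wave xi g : l2 mu g -> cl2 mu (fun s => (g s * cos (xi * s)) +i* (g s * sin (xi * s))).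
Proof.
move=> lg; have mg := l2_measurable lg.
have key (c : R -> R) : measT (c : T -> R) -> (forall s, `|c s| <= 1) -> l2 mu (fun s => g s * c s).
  by move=> mc c1; apply: (l2_le _ lg (K := 1)) => [|s]; [exact: measurable_funM|rewrite mul1r normrM ler_piMr].
split; apply: key => [|s]; [exact: measurable_cosM|exact: norm_cos_le1|exact: measurable_sinM|].
by rewrite ler_norml sin_geN1 sin_le1.
Qed.

Lemma hnorm_wave xi g : l2 mu g -> N (wave xi g) ^+ 2 = sqint mu g.
Proof.
move=> lg; have [l1 l2'] := cl2_wave xi lg; rewrite hnorm_classof// -rintD; [|exact: l1.2|exact: l2'.2].
by congr (\int[mu]_x _); apply/funext => x ; rewrite !exprMn -mulrDr cos2Dsin2 mulr1.
Qed.

Lemma Mul_wave0 M xi g h : bounded_by M g -> l2 mu h -> (forall s, g s * h s = 0) -> Mul g (wave xi h) = 0.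
Proof.
move=> bg lh gh; rewrite Mul.unlock (lift_classof (mulop_op bg) (cl2_wave xi lh)).
rewrite (_ : complexified _ _ = fun=> 0); last first.
  by apply/funext => s; rewrite /complexified /mulop !mulrA gh !mul0r.
by apply: (@hnorm_eq0 _ _ dotL); apply/eqP; rewrite -sqrf_eq0 hnorm_classof; [rewrite /sqint|split; exact: l2_0];
  rewrite (_ : (fun=> _) = fun=> 0) ?Rintegral_cst ?mul0r ?addr0//; rewrite expr0n.
Qed.

(** * Weyl sequences from modulated tents *)

Section Waves.
Variables (b : R) (b0 : 0 < b).
Local Notation K := (Op (kker b)).

Let d4 : 0 < b / 4. Proof. by []. Qed.

Let kc xi r := kk b r * cos (xi * r).
Let ks xi r := kk b r * sin (xi * r).

Let hkc xi : expbounded b 1 (kc xi).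
Proof.
split; rewrite//; first by apply: measurable_funM; [exact: measurable_kk|exact: measurable_cosM].
by move=> r; rewrite mul1r; exact: norm_kk_trig (ltW b0) (norm_cos_le1 _).
Qed.

Let hks xi : expbounded b 1 (ks xi).
Proof.
split; rewrite//; first by apply: measurable_funM; [exact: measurable_kk|exact: measurable_sinM].
by move=> r; rewrite mul1r; apply: norm_kk_trig (ltW b0) _; rewrite ler_norml sin_geN1 sin_le1.
Qed.

Let hk0 : expbounded b 1 (@kk R b).
Proof.
by split; rewrite//; [exact: measurable_kk|move=> r; rewrite mul1r norm_kk].
Qed.

Lemma ks_integral xi : \int[mu]_r ks xi r = 0.
Proof. exact: rint_odd (L1_kk b0) (@kk_even _ b). Qed.

(* The phase is a character, so that conjugating the convolution by it multiplies the kernel by a phase. *)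
Lemma Op_wave xi g : nice g -> N (K (wave xi g) - (phi b xi)%:C *: wave xi g) ^+ 2 =
  sqint mu (fun s => conv (kc xi) g s - (\int[mu]_r kc xi r) * g s) +
  sqint mu (fun s => conv (ks xi) g s - (\int[mu]_r ks xi r) * g s).
Proof.
move=> ng; have lg := nice_l2 ng; have cw := cl2_wave xi lg.
have ds := conv_expkernel (hks xi).
have ko := conv_op hk0.
have iA s := L1_kop b0 s (conv_expkernel (hkc xi)) lg; have iB s := L1_kop b0 s ds lg.
set A := conv (kc xi) g; set B := conv (ks xi) g.
have ReE s : kop (kker b) (fun y => g y * cos (xi * y)) s = cos (xi * s) * A s + sin (xi * s) * B s.
  rewrite /A /B /conv /kop -!rintZ//.
  rewrite -rintD; [|exact: L1Z..].
  congr (\int[mu]_x _); apply/funext => y; rewrite (_ : xi * y = xi * s - xi * (s - y)); last by ring.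
  by rewrite cosB /kc /ks /kker; ring.
have ImE s : kop (kker b) (fun y => g y * sin (xi * y)) s = sin (xi * s) * A s - cos (xi * s) * B s.
  rewrite /A /B /conv /kop -!rintZ//.
  rewrite -rintB; [|exact: L1Z..].
  congr (\int[mu]_x _); apply/funext => y; rewrite (_ : xi * y = xi * s - xi * (s - y)); last by ring.
  by rewrite sinB /kc /ks /kker; ring.
rewrite Op.unlock (lift_classof ko cw).
have ck := cl2_complexified ko cw.
rewrite -scaleN1r scalerA addrC -classof_lin// hnorm_classof; last exact: cl2_lin.
have [_ i1] := nice_l2 (nice_defect (hkc xi) ng); have [_ i2] := nice_l2 (nice_defect (hks xi) ng).
have [[_ j1] [_ j2]] := cl2_lin (-1 * (phi b xi)%:C) cw ck.
rewrite -!rintD//; congr (\int[mu]_x _); apply/funext => s; rewrite /= /conv.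
rewrite ks_integral !ReE !ImE.
transitivity ((A s - phi b xi * g s) ^+ 2 * (cos (xi * s) ^+ 2 + sin (xi * s) ^+ 2) +
  B s ^+ 2 * (cos (xi * s) ^+ 2 + sin (xi * s) ^+ 2)); first by ring.
by rewrite cos2Dsin2 !mulr1 mul0r subr0.
Qed.

Let moment_ge0 h : 0 <= \int[mu]_r (`|r| * `|h r|).
Proof. exact: rint_ge0 => r. Qed.

Let waste xi := \int[mu]_r (`|r| * `|kc xi r|) * (expk_mass b + `|phi b xi|) +
  \int[mu]_r (`|r| * `|ks xi r|) * expk_mass b.

(** A tent of radius [n] has slope [1 / n] and mass at most [2 n], so the defect is bounded
    independently of [n] and of the centre, whereas the norm of the wave grows with [n]. *)
Lemma wave_tent_defect xi c (n : R) : 0 < n ->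
  N (K (wave xi (tent c n)) - (phi b xi)%:C *: wave xi (tent c n)) ^+ 2 <= 2 * waste xi.
Proof.
move=> n0; have nt := tent_nice c n0; have n1 : 0 <= n^-1 by [].
have Lg x y : `|tent c n x - tent c n y| <= n^-1 * `|x - y| by rewrite mulrC; exact: tent_lip.
have mt : mass1 (tent c n) <= 2 * n.
  have cn : c - n <= c + n by lra.
  have [ii ei] := itv_indicator cn; rewrite (_ : 2 * n = c + n - (c - n)); last by lra.
  rewrite -ei; apply: rint_le => //; first exact: L1_norm (nice_integrable nt).
  move=> z; rewrite indicE ger0_norm ?tent_ge0//; have [_|zS] := boolP (z \in _); first exact: tent_le1.
  rewrite tent_out// leNgt; apply: contra zS => /ltW h; rewrite inE /= in_itv/=.
  by move: h; rewrite ler_norml; lra.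
rewrite (Op_wave xi nt).
have := slow_convolution (hkc xi) nt n1 Lg; have := slow_convolution (hks xi) nt n1 Lg.
rewrite ks_integral normr0 addr0 !mul1r => h1 h2.
apply: (le_trans (lerD h2 h1)).
have key x y : 0 <= x -> 0 <= y -> n^-1 * (x * (y * mass1 (tent c n))) <= 2 * (x * y).
  move=> x0 y0; rewrite (_ : n^-1 * _ = x * y * (n^-1 * mass1 (tent c n))); last by ring.
  by rewrite mulrC ler_wpM2r// mulrC ler_pdivrMr.
by rewrite mulrDr lerD ?key.
Qed.

Lemma far_wave xi (m : nat) e : 0 < e -> exists u, [/\ N u = 1, N (K u - (phi b xi)%:C *: u) <= e,
  Mul (trunc m) u = 0 & Em u = 0] /\ exists v, [/\ N v = 1, N (K v - (phi b xi)%:C *: v) <= e,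
  Mul (trunc m) v = 0 & Ep v = 0].
Proof.
move=> e0; pose W := waste xi; have W0 : 0 <= W.
  by rewrite addr_ge0// mulr_ge0.
(* The squared norm is at least [n / 4], and this [n] gives [2 W <= e^2 n / 4]. *)
pose n := 1 + 8 * W / e ^+ 2; have n0 : 0 < n by rewrite ltr_pwDl.
have key h c Mh : bounded_by Mh h -> (forall s, h s * tent c n s = 0) ->
    (forall s, trunc m s * tent c n s = 0) ->
    exists u, [/\ N u = 1, N (K u - (phi b xi)%:C *: u) <= e, Mul (trunc m) u = 0 & Mul h u = 0].
  move=> bh h1 h2; have [lt _ _] := tent_integrals c n0; set w := wave xi (tent c n).
  have Nw : n / 4 <= N w ^+ 2.
    rewrite hnorm_wave//; have cn : c - n / 2 <= c + n / 2 by lra.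
    have [ii ei] := itv_indicator cn; rewrite (_ : n / 4 = 4^-1 * (c + n / 2 - (c - n / 2))); last by lra.
    rewrite -ei -rintZ//; apply: rint_le; [exact: L1Z|exact: lt.2|] => z.
    rewrite indicE; have [zS|_] := boolP (z \in _); last by rewrite mulr0.
    rewrite mulr1 (_ : 4^-1 = 2^-1 ^+ 2); last by field.
    rewrite ler_pXn2r ?nnegrE ?tent_ge0// le_max.
    have : `|z - c| / n <= 2^-1; last lra.
    move: zS; rewrite inE /= in_itv/=.
    by rewrite ler_pdivrMr// ler_norml; lra.
  have w0 : 0 < N w.
    by rewrite lt_neqAle hnorm_ge0 eq_sym -sqrf_eq0 gt_eqF// (lt_le_trans _ Nw).
  have bm := trunc_bounded R m.
  exists ((N w)^-1%:C *: w); split.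
  - by rewrite hnorm_real gtr0_norm// mulVf.
  - rewrite (linZ (Op_lin d4 (kker_expkernel b0))) scalerA mulrC -scalerA -scalerBr hnorm_real gtr0_norm// mulrC ler_pdivrMr//.
    rewrite -ler_sqr ?nnegrE// exprMn.
    apply: (le_trans (wave_tent_defect xi c n0)); rewrite -/W.
    apply: le_trans (ler_wpM2l (sqr_ge0 e) Nw); rewrite mulrA (_ : e ^+ 2 * n = e ^+ 2 + 8 * W); last by rewrite /n; field.
    have := sqr_ge0 e; lra.
  - by rewrite (linZ (Mul_lin bm)) (Mul_wave0 xi bm lt h2) scaler0.
  - by rewrite (linZ (Mul_lin bh)) (Mul_wave0 xi bh lt h1) scaler0.
have mn : 0 <= m%:R :> R by [].
have far c s : m%:R + n <= `|c| -> trunc m s * tent c n s = 0.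
  move=> hc; rewrite /trunc indicE; have [sS|_] := boolP (s \in _); last by rewrite mul0r.
  move: sS; rewrite inE /= in_itv -ler_norml => sm; rewrite tent_out ?mulr0//.
  by rewrite distrC; have := lerB_dist c s; lra.
have [|s|u hu] := key _ (m%:R + n) _ hm_bounded.
- move=> s; rewrite hmE; case: ifP => s0; last by rewrite mul0r.
  by rewrite tent_out ?mulr0// ler_normr; lra.
- by apply: far; rewrite ger0_norm.
have [|s|v hv] := key _ (- (m%:R + n)) _ hp_bounded.
- move=> s; rewrite hpE; case: ltP => s0; first by rewrite mul0r.
  by rewrite tent_out ?mulr0// ler_normr; lra.
- by apply: far; rewrite normrN ger0_norm.
by exists u; split=> //; exists v.
Qed.

Let pi := phi b 0.

Lemma scaled_closed_symbol (q : R) l e : scaled_closed q pi l -> 0 < e -> exists xi, `|q * phi b xi - l| <= e.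
Proof.
move=> hq e0; have pi0 : 0 < pi := phi0_gt0 b0.
have [y [y0 yp ly]] : exists y, [/\ 0 <= y, y <= pi & l = q * y].
  move: hq; rewrite /scaled_closed; case: ltgtP => q0 /=; rewrite in_itv/= => /andP[h1 h2].
  - exists (l / q); split; [by []|by rewrite ler_pdivrMr// mulrC|by rewrite mulrC divfK].
  - exists (l / q); split; [by rewrite ler_ndivlMr// mul0r| by rewrite ler_ndivrMr// mulrC|by rewrite mulrC divfK// lt_eqF].
  - exists 0; split=> //; apply/eqP; rewrite mulr0 eq_le h1 andbT.
    by move: h2; rewrite -q0 mul0r.
pose d := e / (1 + `|q|).
have d0 : 0 < d by rewrite divr_gt0.
(* The symbol never needs to attain 0: a target [y = 0] is moved up by at most [d], to a positive
   value within the reach of [phi_onto]. *)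
pose y' := Num.max y (Num.min pi d).
have y'0 : 0 < y' by rewrite lt_max lt_min pi0 d0 orbT.
have y'p : y' <= pi by rewrite ge_max yp ge_min lexx.
have [xi hxi] := phi_onto b0 y'0 y'p.
exists xi; rewrite hxi ly -mulrBr normrM.
have hy : `|y' - y| <= d.
  rewrite ger0_norm ?subr_ge0 ?le_max ?lexx// lerBlDr ge_max ge_min.
  by lra.
apply: (le_trans (ler_wpM2l (normr_ge0 q) hy)); rewrite mulrA ler_pdivrMr//.
by lra.
Qed.

(** A wave supported far out on one side sees only that channel, where the model is [q K] cut off to
    that side; the compact error and the listed vectors are weakly negligible on it. *)
Lemma weyl_of_model (H : VL -> VL) (q1 q2 : R) l e (p : seq VL) :
  hcompact dotL (fun u => H u - (q1%:C *: Em (K (Em u)) + q2%:C *: Ep (K (Ep u)))) ->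
  (scaled_closed q1 pi `|` scaled_closed q2 pi) l -> 0 < e ->
  exists u, [/\ N u = 1, N (H u - l%:C *: u) <= e & forall v, v \in p -> normc (dotL u v) <= e].
Proof.
move=> cH hl e0; have bhm := hm_bounded; have bhp := hp_bounded.
have e20 : 0 < (e / 2) ^+ 2 / 2 by rewrite divr_gt0// exprn_gt0// divr_gt0.
have [pc /= hc] := cH _ e20.
(* One truncation serves the functionals of the compact error and the given vectors; their multiples
   by [i] control imaginary parts. *)
have [m hm'] := tail_small (pc ++ (p ++ [seq 'i%C *: v | v <- p])) e20.
have sub (u : VL) (a c : seq VL) : \sum_(v <- a) rdot u v ^+ 2 <= \sum_(v <- a ++ c) rdot u v ^+ 2.
  by rewrite big_cat lerDl sum_sqr_ge0.
have lK := Op_lin d4 (kker_expkernel b0).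
have key (q : R) xi u (X : VL -> VL) : N u = 1 -> Mul (trunc m) u = 0 -> N (K u - (phi b xi)%:C *: u) <= e / (4 * (1 + `|q|)) ->
    `|q * phi b xi - l| <= e / 4 -> islin X -> hbounded dotL 1 X -> X u = u ->
    q1%:C *: Em (K (Em u)) + q2%:C *: Ep (K (Ep u)) = q%:C *: X (K u) ->
    exists u, [/\ N u = 1, N (H u - l%:C *: u) <= e & forall v, v \in p -> normc (dotL u v) <= e].
  move=> Nu tu wu qu lX bX Xu mod; exists u; have small := hm' u Nu tu; split=> //.
    have -> : H u - l%:C *: u = (H u - q%:C *: X (K u)) + X (q%:C *: (K u - (phi b xi)%:C *: u)) +
        (q * phi b xi - l)%:C *: u.
      rewrite (linZ lX) (linB lX) (linZ lX) Xu scalerBr scalerA -rmorphM rmorphB scalerBl.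
      by rewrite !subrKA.
    have h1 : N (H u - q%:C *: X (K u)) <= e / 2.
      rewrite -ler_sqr ?nnegrE ?hnorm_ge0 ?divr_ge0 ?(ltW e0)// -mod; apply: (le_trans (hc u)).
      rewrite Nu expr1n mulr1 [leRHS]splitr lerD2l; exact: le_trans (sub _ _ _) small.
    have h2 : N (X (q%:C *: (K u - (phi b xi)%:C *: u))) <= e / 4.
      apply: (le_trans (bX _)); rewrite mul1r hnorm_real; apply: (le_trans (ler_wpM2l (normr_ge0 q) wu)).
      have q1' : 0 < 1 + `|q| by rewrite ltr_wpDr.
      have -> : `|q| * (e / (4 * (1 + `|q|))) = e / 4 * (`|q| / (1 + `|q|)) by field; rewrite gt_eqF.
      by rewrite ler_piMr ?divr_ge0 ?(ltW e0)// ler_pdivrMr// mul1r lerDr.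
    have h3 : N ((q * phi b xi - l)%:C *: u) <= e / 4 by rewrite hnorm_real Nu mulr1.
    apply: (le_trans (hnorm_triang _ _ _)); apply: (le_trans (lerD (le_trans (hnorm_triang _ _ _) (lerD h1 h2)) h3)).
    by rewrite (_ : e / 2 + e / 4 + e / 4 = e)//; field.
  move=> v vp; have small' : \sum_(w <- p ++ [seq 'i%C *: v | v <- p]) rdot u w ^+ 2 <= (e / 2) ^+ 2.
    apply: (@le_trans _ _ ((e / 2) ^+ 2 / 2)); last by rewrite ler_pdivrMr// ler_peMr// ler1n.
    by apply: le_trans small; rewrite [leRHS]big_cat lerDr sum_sqr_ge0.
  have one w : w \in p ++ [seq 'i%C *: v | v <- p] -> `|rdot u w| <= e / 2.
    move=> wp; rewrite -ler_sqr ?nnegrE// real_normK ?num_real//.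
    by apply: le_trans small'; rewrite (big_rem w)//= lerDl sum_sqr_ge0.
  have c1 : `|rdot u v| <= e / 2 by apply: one; rewrite mem_cat vp.
  have c2 : `|rdot u ('i%C *: v)| <= e / 2 by apply: one; rewrite mem_cat (map_f (fun v => 'i%C *: v))// orbT.
  rewrite dotE; rewrite -(ler_sqr (_ : _ \is Num.nneg)) ?nnegrE// sqr_sqrtr//.
  rewrite -(real_normK (num_real (rdot u v))) -(real_normK (num_real (rdot u ('i%C *: v)))).
  have := normr_ge0 (rdot u v); have := normr_ge0 (rdot u ('i%C *: v)); nra.
have e4 : 0 < e / 4 by [].
have eq (q : R) : 0 < e / (4 * (1 + `|q|)) by [].
case: hl => hl; have [xi hxi] := scaled_closed_symbol hl e4.
  have [_ [_ [v [Nv wv tv Ev]]]] := far_wave xi m (eq q1).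
  have Xv : Em v = v by rewrite -[RHS](EmDEp v) Ev addr0.
  apply: (key q1 xi v Em) => //; [exact: Mul_lin bhm|exact: Mul_bound bhm|].
  by rewrite Xv Ev (lin0 lK) (lin0 (Mul_lin bhp)) scaler0 addr0.
have [v [[Nv wv tv Ev] _]] := far_wave xi m (eq q2).
have Xv : Ep v = v by rewrite -[RHS](EmDEp v) Ev add0r.
apply: (key q2 xi v Ep) => //; [exact: Mul_lin bhp|exact: Mul_bound bhp|].
by rewrite Xv Ev (lin0 lK) (lin0 (Mul_lin bhm)) scaler0 add0r.
Qed.
End Waves.

End LogOperators.

(** * Transport of the spectral conclusions along a unitary *)

Section Transport.
Variables (R : realType) (V W : lmodType R[i]).
Variables (dV : {dot V for @Num.conj R[i]}) (dW : {dot W for @Num.conj R[i]}).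
Variables (J : W -> V) (J' : V -> W).
Hypothesis lJ : forall (a : R[i]) u v, J (a *: u + v) = a *: J u + J v.
Hypothesis lJ' : forall (a : R[i]) u v, J' (a *: u + v) = a *: J' u + J' v.
Hypotheses (JJ' : cancel J' J) (J'J : cancel J J').
Hypothesis isoJ : forall u, hnorm dV (J u) = hnorm dW u.

Definition conj_by (X : V -> V) u := J' (X (J u)).

Let J0 : J 0 = 0.
Proof. by have := lJ 1 0 0; rewrite !scale1r addr0 => /(congr1 (fun x => x - J 0)); rewrite subrr addrK. Qed.

Let JD u v : J (u + v) = J u + J v. Proof. by rewrite -{1}(scale1r u) lJ scale1r. Qed.
Let JZ a u : J (a *: u) = a *: J u. Proof. by rewrite -{1}(addr0 (a *: u)) lJ J0 addr0. Qed.
Let JB u v : J (u - v) = J u - J v. Proof. by rewrite -scaleN1r JD JZ scaleN1r. Qed.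

Let rJ u v : reform dW u v = reform dV (J u) (J v).
Proof.
by have := hnorm_sqrD dV (J u) (J v); have := hnorm_sqrD dW u v; rewrite -JD !isoJ; lra.
Qed.

Let NJ' v : hnorm dW (J' v) = hnorm dV v. Proof. by rewrite -isoJ JJ'. Qed.

Lemma conj_by_lin X : islin X -> islin (conj_by X).
Proof. by move=> lX a u v; rewrite /conj_by lJ lX. Qed.
Lemma conj_by_bound K X : hbounded dV K X -> hbounded dW K (conj_by X).
Proof. by move=> bX u; rewrite NJ' -isoJ. Qed.
Lemma conj_by_sym X : rsym dV X -> rsym dW (conj_by X).
Proof. by move=> sX u v; rewrite !rJ !JJ'. Qed.
Lemma conj_by_shift X l u : hnorm dW (conj_by X u - l%:C *: u) = hnorm dV (X (J u) - l%:C *: J u).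
Proof. by rewrite -isoJ JB JZ JJ'. Qed.

Lemma conj_by_mourre H Q al be : mourre_on dV H Q al be -> mourre_on dW (conj_by H) (fun u => Q (J u)) al be.
Proof.
move=> [c [n [s [c0 n0 h]]]]; exists c, n, [seq J' p | p <- s]; split=> // l u l1 l2.
rewrite -isoJ conj_by_shift big_map; apply: (le_trans (h l (J u) l1 l2)); rewrite lerD2l.
by apply: ler_sum => p _; rewrite rJ JJ'.
Qed.

Section Conclusions.
Variables (H B : V -> V) (U U' : R -> V -> V) (D : set V) (X : seq R) (S : set R).
Hypotheses (cW : hcomplete dW) (hU : isometry_family dV U U') (jH : has_jet dV U U' H B).
Hypotheses (sH : rsym dV H) (sB : rsym dV B).
Hypothesis denseD : forall v e, 0 < e -> exists2 f, D f & hnorm dV (v - f) <= e.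
Hypothesis lipD : lipschitz_orbits dV D U'.
Hypothesis mourreX : forall al be, al <= be -> (forall x, x \in X -> ~ (al <= x <= be)) ->
  mourre_on dV H (fun u => reform dV (B u) u) al be \/ mourre_on dV H (fun u => - reform dV (B u) u) al be.
Hypothesis outside : forall l, ~ S l -> exists al be, [/\ al < l, l < be & mourre_on dV H (fun=> 0) al be].
Hypothesis weylS : forall l e (s : seq V), S l -> 0 < e -> exists u, [/\ hnorm dV u = 1,
  hnorm dV (H u - l%:C *: u) <= e & forall p, p \in s -> normc (dV u p) <= e].
Local Notation T := (conj_by H).

(** All hypotheses live on the space of the line and are conjugated by the unitary [J]. [S] is the
    expected essential spectrum: the estimate with [Q = 0] gives one inclusion, the Weyl vectors the
    other. *)
Lemma transport_spectrum : [/\ bounded_operator dW T, selfadjoint dW T, essential_spectrum dW T = S,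
  singular_continuous_spectrum dW T = set0 & forall al be, al <= be -> (forall x, x \in X -> ~ (al <= x <= be)) ->
    finite_set [set l | [/\ al <= l, l <= be & is_eigenvalue T l]] /\
    (forall l, al <= l -> l <= be -> finite_multiplicity T l)].
Proof.
have [K [c [lH lB K0 c0 [bH bB jHB]]]] := jH.
have lT := conj_by_lin lH; have sT := conj_by_sym sH; have bT := conj_by_bound bH.
have lB' := conj_by_lin lB; have sB' := conj_by_sym sB; have bB' := conj_by_bound bB.
have hP := spectral_theorem cW lT sT bT.
have fam : conjugate_family dW T (conj_by B) (fun t => conj_by (U t)) (fun t => conj_by (U' t)) c.
  split=> // t ht; have [l1 l2 k1 k2 iU] := hU ht; split; split; rewrite ?/conj_by.
  - exact: conj_by_lin.
  - exact: conj_by_lin.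
  - by move=> u; rewrite JJ' k1.
  - by move=> u; rewrite JJ' k2.
  - by move=> u v; rewrite !rJ !JJ'.
  - by move=> u; rewrite -isoJ !JB JZ !JJ' -isoJ; have [] := jHB _ ht (J u).
  - by move=> u; rewrite -isoJ !JB !JJ' -isoJ; have [] := jHB _ ht (J u).
have dense' v e : 0 < e -> exists2 f, D (J f) & hnorm dW (v - f) <= e.
  move=> e0; have [f Df hf] := denseD (J v) e0; exists (J' f); first by rewrite JJ'.
  by rewrite -isoJ JB JJ'.
have lip' : lipschitz_orbits dW (fun f => D (J f)) (fun t => conj_by (U' t)).
  move=> f /lipD[ell [l0 hf]]; exists ell; split=> // t ht.
  by rewrite -isoJ JB JJ'; exact: hf.
have mX al be : al <= be -> (forall x, x \in X -> ~ (al <= x <= be)) ->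
    mourre_on dW T (fun u => reform dW (conj_by B u) u) al be \/
    mourre_on dW T (fun u => - reform dW (conj_by B u) u) al be.
  have eB : (fun u => reform dW (conj_by B u) u) = (fun u => reform dV (B (J u)) (J u)).
    by apply/funext => u; rewrite rJ JJ'.
  have eB' : (fun u => - reform dW (conj_by B u) u) = (fun u => - reform dV (B (J u)) (J u)).
    by apply/funext => u; rewrite rJ JJ'.
  by move=> ab hX; rewrite eB eB'; case: (mourreX ab hX) => /conj_by_mourre; [left|right].
split.
- by exists K.
- exact: rsym_selfadjoint.
- apply/seteqP; split=> l.
    move=> hl; apply: contrapT => /outside[al [be [h1 h2 /conj_by_mourre hm]]].
    exact: (discrete_of_mourre lT sT cW bT hm h1 h2 hl).
  move=> Sl; apply: (weyl_criterion lT sT hP) => e s e0.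
  have [u [Nu hu hs]] := weylS (map J s) Sl e0; exists (J' u); rewrite NJ' conj_by_shift !JJ'; split=> // p ps.
  have := hs (J p) (map_f J ps); rewrite [dV u _]dotE [dW _ _]dotE !rJ JJ' JZ.
  by [].
- apply: spectrum_on_trivial => // u [h1 [N [mN N0 h2]]].
  apply: (mourre_no_singular cW lT sT bT K0 dense' hP lB' sB' bB' K0 fam lip' mX h1).
  by exists N.
- by exact: (mourre_eigenvalues lT sT dense' lB' bB' K0 fam lip' mX).
Qed.

End Conclusions.
End Transport.

Lemma real_isometry (R : realType) d1 d2 (T1 : measurableType d1) (T2 : measurableType d2)
    (m1 : {measure set T1 -> \bar R}) (m2 : {measure set T2 -> \bar R}) (F : (T2 -> R) -> T1 -> R) :
  (forall f : T2 -> R, measT f -> measT (F f)) ->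
  (forall f : T2 -> R, measT f -> (\int[m1]_x (F f x ^+ 2)%:E = \int[m2]_x (f x ^+ 2)%:E)%E) ->
  (forall a (f g : T2 -> R), F (fun y => a * f y + g y) = fun x => a * F f x + F g x) -> real_op m1 m2 1 F.
Proof.
move=> mF sF lF; split=> // f [mf f2].
  split; first exact: mF.
  apply: L1_ltP => [|x|]; [by apply: measurable_funX; exact: mF|by []|].
  by rewrite sF// rintE// ltry.
by rewrite /sqint /Rintegral sF// expr1n mul1r.
Qed.

(** * The unitary onto the logarithmic variable *)

Section LogUnitary.
Variable R : realType.
Local Notation T := (measurableTypeR R).
Local Notation mu := (@lebesgue_measure R).
Local Notation half := (@lebesgue_halfline R).
Local Notation VL := (cL2 mu).
Local Notation NL := (hnorm (@cL2_dot _ _ _ mu)).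
Local Notation NH := (hnorm (@cL2_dot _ _ _ half)).
Implicit Types (f g : R -> R) (s x : R).

(** The factor [exp (s / 2)] is the square root of the Jacobian of [x = exp s]. The inverse is exact
    for functions on the line, but on the half-line only for [x > 0], so almost everywhere. *)
Definition tolog f s : R := expR (s / 2) * f (expR s).
Definition fromlog g x : R := Num.sqrt (loginv x) * g (ln x).

Lemma fromlogK g : tolog (fromlog g) = g.
Proof.
apply/funext => s; rewrite /tolog /fromlog expRK /loginv ger0_norm// -expRN mulrA.
rewrite (_ : expR (- s) = expR (- s / 2) ^+ 2); last by rewrite -expRM_natl; congr expR; field.
by rewrite sqrtr_sqr ger0_norm// -expRD (_ : _ + _ = 0) ?expR0; field.
Qed.

Lemma tologK f x : 0 < x -> fromlog (tolog f) x = f x.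
Proof.
move=> x0; rewrite /tolog /fromlog lnK// mulrA.
have e : expR (ln x / 2) = Num.sqrt x.
  rewrite -[in RHS](lnK (x0 : x \is Num.pos)) (_ : expR (ln x) = expR (ln x / 2) ^+ 2).
    by rewrite sqrtr_sqr ger0_norm.
  by rewrite -expRM_natl; congr expR; field.
by rewrite e -sqrtrM /loginv ger0_norm// mulVf// sqrtr1 mul1r.
Qed.

Let mexp : measT (@expR R : T -> T). Proof. by []. Qed.
Let mln : measT (@ln R : T -> T). Proof. by []. Qed.

Let measurable_tolog f : measT (f : T -> R) -> measT (tolog f : T -> R).
Proof.
move=> mf; apply: measurable_funM; last exact: (measurableT_comp mf mexp).
by apply: (measurableT_comp mexp); exact: measurable_funM.
Qed.

Let measurable_fromlog g : measT (g : T -> R) -> measT (fromlog g : T -> R).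
Proof.
move=> mg; apply: measurable_funM; last exact: (measurableT_comp mg mln).
exact: (measurableT_comp (continuous_measurable_fun (@sqrt_continuous R)) (@measurable_loginv R)).
Qed.

Let fromlog_sqr g : measT (g : T -> R) ->
  (\int[half]_x (fromlog g x ^+ 2)%:E = \int[mu]_s (g s ^+ 2)%:E)%E.
Proof.
move=> mg; rewrite -(ge0_change_of_variables mln (@measurable_loginv R) (@loginv_ge0 R) (@log_itv R)).
- by apply: eq_integral => x _; rewrite exprMn sqr_sqrtr ?loginv_ge0.
- by apply/measurable_EFinP; exact: measurable_funX.
- by move=> x; rewrite lee_fin.
Qed.

Let tolog_sqr f : measT (f : T -> R) ->
  (\int[mu]_s (tolog f s ^+ 2)%:E = \int[half]_x (f x ^+ 2)%:E)%E.
Proof.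
move=> mf; rewrite -fromlog_sqr; last exact: measurable_tolog.
apply: ae_eq_integral => //.
- by apply/measurable_EFinP; apply: measurable_funX; exact: measurable_fromlog (measurable_tolog mf).
- by apply/measurable_EFinP; exact: measurable_funX.
- by apply/halfline_ae; apply: aeW => x /=; rewrite in_itv andbT => x0; rewrite tologK.
Qed.

Lemma tolog_op : real_op mu half 1 tolog.
Proof.
apply: real_isometry => [f|f|a f g]; [exact: measurable_tolog|exact: tolog_sqr|].
by apply/funext => s; rewrite /tolog; ring.
Qed.

Lemma fromlog_op : real_op half mu 1 fromlog.
Proof.
apply: real_isometry => [f|f|a f g]; [exact: measurable_fromlog|exact: fromlog_sqr|].
by apply/funext => s; rewrite /fromlog; ring.
Qed.

Definition Jlog : L2_halfline R -> VL := lift mu half tolog.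
Definition Jexp : VL -> L2_halfline R := lift half mu fromlog.

Lemma JexpK : cancel Jexp Jlog.
Proof.
move=> u; rewrite /Jlog (lift_comp u tolog_op fromlog_op) -[RHS]classof_repr.
by congr (classof mu _); apply/funext => s; apply: complex_eq; rewrite /= fromlogK.
Qed.

Lemma JlogK : cancel Jlog Jexp.
Proof.
move=> u; rewrite /Jexp (lift_comp u fromlog_op tolog_op) -[RHS]classof_repr.
have [f cf ->] := classofP u; have c := cLfun_cl2 (repr (classof half f)).
apply: classof_eq => //.
  exact: cl2_complexified (real_op_comp fromlog_op tolog_op) c.
apply/halfline_ae; apply: aeW => x /=; rewrite in_itv andbT => x0.
by apply: complex_eq; rewrite /= tologK.
Qed.

Lemma hnorm_Jlog u : NL (Jlog u) = NH u.
Proof.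
apply/eqP; rewrite eq_le; apply/andP; split; first by rewrite -[leRHS]mul1r; exact: lift_bound tolog_op.
by rewrite -{1}(JlogK u) -[leRHS]mul1r; exact: lift_bound fromlog_op.
Qed.

End LogUnitary.

(** * The hypotheses of the theorem in the logarithmic variable *)

Section LogProfiles.
Variable R : realType.
Implicit Types (f : R -> R) (s t x y : R).

Lemma is_derive_logvar f s : derivable f (expR s) 1 ->
  is_derive s 1 (fun x => f (expR x)) (eulerD f (expR s)).
Proof.
move=> df; rewrite /eulerD derive1E mulrC.
exact: (is_derive1_comp (derivableP df) (is_derive_expR s)).
Qed.

Lemma end_limits_logvar f (f0 finf : R) : f t @[t --> 0^'+] --> f0 -> f t @[t --> +oo] --> finf ->
  end_limits (fun s => f (expR s)) f0 finf.
Proof.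
move=> h0 hinf e e0.
have [d  d0 hd] : \forall t \near 0^'+, `|f0 - f t| <= e by move/cvgrPdist_le : h0; exact.
have [M [_ hM]] : \forall t \near +oo, `|finf - f t| <= e by move/cvgrPdist_le : hinf; exact.
exists (`|M| + d^-1); split=> // s; split => hs.
  rewrite distrC; apply: hM; have := expR_ge1Dx s; have := ler_norm M.
  have : 0 < d^-1 by [].
  lra.
rewrite distrC; apply: hd => //.
rewrite /= sub0r normrN gtr0_norm// -(opprK s) expRN -[ltRHS]invrK ltf_pV2 ?posrE//.
have := expR_ge1Dx (- s); have := normr_ge0 M; lra.
Qed.

Lemma bounded_of_end_limits f (f0 finf : R) : continuous f -> end_limits f f0 finf ->
  exists2 M, 0 <= M & forall s, `|f s| <= M.
Proof.
move=> cf hl; have [A [A0 hA]] := hl 1 ltr01; have AA : - A <= A by lra.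
have [|c _ hc] := @EVT_max R (fun x => `|f x|) (- A) A AA.
  by apply: continuous_subspaceT => x; apply: continuous_comp; [exact: cf|exact: norm_continuous].
exists (1 + `|f0| + `|finf| + `|f c|) => //.
move=> s; have [a1 a2 a3] := And3 (normr_ge0 f0) (normr_ge0 finf) (normr_ge0 (f c)).
have [s1|s1] := leP A s.
  by have := (hA s).1 s1; have := lerB_dist (f s) finf; lra.
have [s2|s2] := leP s (- A).
  by have := (hA s).2 s2; have := lerB_dist (f s) f0; lra.
have hs : s \in `[- A, A] by rewrite in_itv/= !ltW.
by have := hc s hs; lra.
Qed.

(** In [s = ln t] the operator [D] is [d/ds]. The limits at both ends bound the function, and the
    first derivative is then recovered from the second by [derivative_bound]. *)
Lemma profile_logvar f (f0 finf C : R) : C2_halfline f -> f t @[t --> 0^'+] --> f0 -> f t @[t --> +oo] --> finf ->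
  (forall t, 0 < t -> `|eulerD (eulerD f) t| <= C * (bracket (ln t)) ^- 2) ->
  end_limits (fun s => f (expR s)) f0 finf /\
  exists M, profile M C (fun s => f (expR s)) (fun s => eulerD f (expR s)) (fun s => eulerD (eulerD f) (expR s)).
Proof.
move=> c2 h0 hinf hC; have le := end_limits_logvar h0 hinf; split=> //.
have d1 s : is_derive s 1 (fun x => f (expR x)) (eulerD f (expR s)).
  by have [df _ _] := c2 _ (expR_gt0 s); exact: is_derive_logvar.
have d2 s : is_derive s 1 (fun x => eulerD f (expR x)) (eulerD (eulerD f) (expR s)).
  by have [_ df _] := c2 _ (expR_gt0 s); apply: is_derive_logvar;
    apply: derivableM; [exact: derivable_id|].
have [M M0 hM] := bounded_of_end_limits (derive_continuous d1) le.
have b2 s : `|eulerD (eulerD f) (expR s)| <= C / (1 + `|s|) ^+ 2.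
  by have := hC _ (expR_gt0 s); rewrite expRK.
exists M; split=> //; first by have := b2 0; rewrite normr0 addr0 expr1n divr1; exact: le_trans.
by split=> //; exact: derivative_bound d1 d2 hM b2 s.
Qed.

Lemma normc_parts (z : R[i]) : `|Re z| <= normc z /\ `|Im z| <= normc z.
Proof. by case: z => x y ; split; rewrite -sqrtr_sqr ler_wsqrtr ?lerDl ?lerDr. Qed.

Lemma cvg_complex_parts (F : set_system R) (FF : Filter F) (g : R -> R[i]) (z : R[i]) :
  normc (g t - z) @[t --> F] --> (0 : R) -> (Re (g t) @[t --> F] --> Re z) /\ (Im (g t) @[t --> F] --> Im z).
Proof.
move=> /cvgr0Pnorm_le h; split; apply/cvgrPdist_le => e e0; apply: filterS (h e e0) => t;
  have [] := normc_parts (g t - z); rewrite !cpartsE (ger0_norm (normc_ge0 (g t - z))) distrC => h1 h2 h3.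
  exact: le_trans h1 h3.
by rewrite distrC; exact: le_trans h2 h3.
Qed.

End LogProfiles.

(** * Identification with the weighted Hankel operator *)

Section HankelKernel.
Variable R : realType.
Local Notation T := (measurableTypeR R).
Local Notation mu := (@lebesgue_measure R).
Local Notation half := (@lebesgue_halfline R).
Local Notation VL := (cL2 mu).
Implicit Types (s t x y : R) (u : VL).

Section HopKernel.
Variables (beta : R) (beta0 : 0 < beta).
Let dl := beta / 4.
Let d0 : 0 < dl. Proof. by rewrite divr_gt0. Qed.
Variables (M C : R) (a a1 a2 : R -> R) (a0 ainf : R).
Hypotheses (pa : profile M C a a1 a2) (la : end_limits a a0 ainf).
Variables (Mf Cf Mg Cg : R) (f f1 f2 g g1 g2 : R -> R) (f0 finf g0 ginf : R).
Hypotheses (pf : profile Mf Cf f f1 f2) (lf : end_limits f f0 finf).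
Hypotheses (pg : profile Mg Cg g g1 g2) (lg : end_limits g g0 ginf).

Definition Hop_re s t := 1 * weighted beta a f f s t + weighted beta a g g s t.
Definition Hop_im s t := -1 * weighted beta a f g s t + weighted beta a g f s t.

Lemma Hop_kernel : exists E1 E2, [/\ expkernel dl E1 Hop_re, expkernel dl E2 Hop_im &
  forall u, Hop beta a f g u = Op Hop_re u + 'i%C *: Op Hop_im u].
Proof.
have [_ [E1 h1] _ _] := weighted_spec beta0 pa la pf lf pf lf; have [_ [E2 h2] _ _] := weighted_spec beta0 pa la pg lg pg lg.
have [_ [E3 h3] _ _] := weighted_spec beta0 pa la pf lf pg lg; have [_ [E4 h4] _ _] := weighted_spec beta0 pa la pg lg pf lf.
exists (`|1| * E1 + E2), (`|-1| * E3 + E4); split; [exact: expkernel_comb|exact: expkernel_comb|move=> u].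
rewrite (Op_comb d0 1 u h1 h2) (Op_comb d0 (-1) u h3 h4).
by rewrite scale1r rmorphN scaleN1r [in RHS](addrC (- _)).
Qed.

Lemma Jexp_Hop_Jlog h : cl2 half h -> \forall x \ae half, repr (conj_by (@Jlog R) (@Jexp R) (Hop beta a f g) (classof half h)) x =
  fromlog (fun s => \int[mu]_t (Hop_re s t * tolog (fun y => Re (h y)) t - Hop_im s t * tolog (fun y => Im (h y)) t)) x +i*
  fromlog (fun s => \int[mu]_t (Hop_re s t * tolog (fun y => Im (h y)) t + Hop_im s t * tolog (fun y => Re (h y)) t)) x.
Proof.
move=> ch; have [E1 [E2 [hA hB hE]]] := Hop_kernel.
rewrite /conj_by /Jlog /Jexp (lift_classof (tolog_op R) ch) hE Op.unlock.
have ck := cl2_complexified (tolog_op R) ch; have [c1 c2] := ck.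
have oA := kop_op d0 hA; have oB := kop_op d0 hB.
have cA := cl2_complexified oA ck; have cB := cl2_complexified oB ck.
rewrite (lift_classof oA ck) (lift_classof oB ck) addrC -classof_lin//.
have cS := cl2_lin 'i%C cB cA; rewrite (lift_classof (fromlog_op R) cS).
apply: filterS (repr_classof (cl2_complexified (fromlog_op R) cS)) => x ->.
have iA := L1_kop d0 _ hA; have iB := L1_kop d0 _ hB.
apply: complex_eq; congr (fromlog _ x); apply/funext => s; rewrite /=.
  by rewrite rintB; [rewrite /kop; ring|exact: iA c1|exact: iB c2].
by rewrite rintD; [rewrite /kop; ring|exact: iA c2|exact: iB c1].
Qed.

End HopKernel.

Lemma lnsum_ln x y : 0 < x -> 0 < y -> lnsum (ln x) (ln y) = ln (x + y).
Proof.
move=> x0 y0.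
rewrite -[LHS]expRK; congr ln; rewrite expRD lnK ?posrE// mulrDr -!expRD.
rewrite -[in RHS](lnK (x0 : x \is Num.pos)) -[in RHS](lnK (y0 : y \is Num.pos)).
by congr (expR _ + expR _); field.
Qed.

(** As [csh (ln x - ln y) = (x + y) / sqrt (x y)], the power of [x + y] cancels and the exponents of
    [x] and of [y] each add up to zero. The product collects the Jacobians, the kernel and the
    powers hidden in [a] and [omega]. *)
Lemma hankel_factor rho x y v : 0 < x -> 0 < y ->
  Num.sqrt (loginv x) * (loginv y * (kk (rho + 2^-1) (ln x - ln y) * expR (ln y / 2))) *
    ((x + y) `^ (1 + 2 * rho) * v) * (x `^ (- rho) * y `^ (- rho)) = v.
Proof.
move=> x0 y0.
have li z : 0 < z -> loginv z = expR (- ln z).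
  by move=> z0; rewrite /loginv gtr0_norm// expRN lnK.
rewrite !li// /kk /powR !gt_eqF//.
have -> : Num.sqrt (expR (- ln x)) = expR (- ln x / 2).
  rewrite (_ : expR (- ln x) = expR (- ln x / 2) ^+ 2); first by rewrite sqrtr_sqr ger0_norm.
  by rewrite -expRM_natl; congr expR; field.
have eL : ln (csh (ln x - ln y)) = ln (x + y) - (ln x + ln y) / 2 by rewrite -lnsum_ln// /lnsum; ring.
rewrite eL; set e1 := expR _; set e2 := expR _; set e3 := expR _; set e4 := expR _.
set e5 := expR _; set e6 := expR _; set e7 := expR _.
transitivity (v * (e1 * (e2 * (e3 * e4)) * e5 * (e6 * e7))); first by ring.
by rewrite -!expRD [X in expR X](_ : _ = 0) ?expR0; field.
Qed.

(** The change of variables [t = ln y] under the integral, with all Jacobian factors gathered in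
    [Phi]. *)
Lemma fromlog_integral (G : R -> R -> R) x (Phi : R -> R) : 0 < x -> L1 mu (G (ln x)) ->
  (forall y, 0 < y -> Num.sqrt (loginv x) * (loginv y * G (ln x) (ln y)) = Phi y) ->
  fromlog (fun s => \int[mu]_t G s t) x = \int[mu]_(y in `]0, +oo[) Phi y.
Proof.
move=> x0 iG hPhi; have mln : measT (@ln R : T -> T) by [].
have ci := L1_change_of_variables mln (@measurable_loginv R) (@loginv_ge0 R) (@log_itv R) iG.
rewrite /fromlog -(rint_change_of_variables mln (@measurable_loginv R) (@loginv_ge0 R) (@log_itv R) iG) -rintZ// rint_halfline.
  by apply: eq_Rintegral => y; rewrite inE /= in_itv andbT; exact: hPhi.
exact: L1_measurable (L1Z _ ci).
Qed.

Lemma conj_Hop_extends (rho M C Mf Cf Mg Cg a0 ainf f0 finf g0 ginf : R) (w : R -> R[i]) (b a1 a2 f1 f2 g1 g2 : R -> R) :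
  let a t := t `^ (1 + 2 * rho) * b t in let omega t := (t `^ (- rho))%:C * w t in
  - 2^-1 < rho -> profile M C (fun s => a (expR s)) a1 a2 -> end_limits (fun s => a (expR s)) a0 ainf ->
  profile Mf Cf (fun s => Re (omega (expR s))) f1 f2 -> end_limits (fun s => Re (omega (expR s))) f0 finf ->
  profile Mg Cg (fun s => Im (omega (expR s))) g1 g2 -> end_limits (fun s => Im (omega (expR s))) g0 ginf ->
  extends_weighted_hankel w b (conj_by (@Jlog R) (@Jexp R)
    (Hop (rho + 2^-1) (fun s => a (expR s)) (fun s => Re (omega (expR s))) (fun s => Im (omega (expR s))))).
Proof.
move=> a omega hrho pa la pf lf pg lg F _; have beta0 : 0 < rho + 2^-1 by lra.
have cF := cLfun_cl2 F; rewrite -(classof_cLfun F).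
have [E1 [E2 [hA hB _]]] := Hop_kernel beta0 pa la pf lf pg lg.
have d0 : 0 < (rho + 2^-1) / 4 by rewrite divr_gt0.
have [c1 c2] := cl2_complexified (tolog_op R) cF.
have h := Jexp_Hop_Jlog beta0 pa la pf lf pg lg cF.
move/halfline_ae : h => h; apply/halfline_ae; apply: filterS h => x hx Dx; rewrite (hx Dx).
have x0 : 0 < x by move: Dx; rewrite /= in_itv/= andbT.
rewrite /weighted_hankel /cintegral.
have om t : 0 < t -> omega (expR (ln t)) = (t `^ (- rho))%:C * w t by move=> t0; rewrite lnK.
have aE y : 0 < y -> a (expR (lnsum (ln x) (ln y))) = (x + y) `^ (1 + 2 * rho) * b (x + y).
  by move=> y0; rewrite lnsum_ln// lnK ?posrE ?addr_gt0.
have iA := L1_kop d0 (ln x) hA; have iB := L1_kop d0 (ln x) hB.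
congr (_ +i* _); (apply: fromlog_integral => //; [by apply: L1B; [exact: iA c1|exact: iB c2]
  || by apply: L1D; [exact: iA c2|exact: iB c1]|move=> y y0]);
  rewrite /Hop_re /Hop_im /weighted /pker /tolog aE// !om// lnK ?posrE// -[b (x + y) in RHS](@hankel_factor rho x y)//;
  case: (w x) (w y) (F y) => [w1 w2] [v1 v2] [z1 z2] /=; ring.
Qed.

End HankelKernel.

(** * Conclusion *)

Lemma itv_sub_closure (R : realType) (al be : R) : al < be -> `[al, be]%classic `<=` closure `]al, be[%classic.
Proof.
move=> ab x /=; rewrite in_itv/= => /andP[x1 x2] B /nbhs_ballP[e /= e0 hB].
pose l := Num.max al (x - e); pose r := Num.min be (x + e).
have lr : l < r by rewrite gt_max !lt_min; lra.
have [l1 l2] : al <= l /\ x - e <= l by split; rewrite le_max lexx ?orbT.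
have [r1 r2] : r <= be /\ r <= x + e by split; rewrite ge_min lexx ?orbT.
exists ((l + r) / 2); split; first by rewrite /= in_itv/=; lra.
by apply: hB; rewrite /ball /= ltr_norml; lra.
Qed.

(** The degenerate point 0 of the Mourre estimate is thereby excluded for every admissible interval,
    with no extra hypothesis. *)
Lemma scaled_open0 (R : realType) (q p : R) : ~ scaled_open q p 0.
Proof.
by rewrite /scaled_open; case: ifP => _; [|case: ifP => _ //]; rewrite /= in_itv/= ltxx ?andbF.
Qed.

Theorem theorem3p3 (R : realType) (rho : R) (b : R -> R) (w : R -> R[i])
    (a0 ainf : R) (omega0 omegainf : R[i]) (C : R) :
  let a : R -> R := fun t => t `^ (1 + 2 * rho) * b t in
  let omega : R -> R[i] := fun t => (t `^ (- rho))%:C * w t in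
  let q0 : R := a0 * normc omega0 ^+ 2 in
  let qinf : R := ainf * normc omegainf ^+ 2 in
  let pi_rho : R := Gamma (rho + 2^-1) ^+ 2 / Gamma (1 + 2 * rho) in
  - 2^-1 < rho ->
  C2_halfline a ->
  cC2_halfline omega ->
  a t @[t --> 0^'+] --> a0 ->
  normc (omega t - omega0) @[t --> 0^'+] --> (0 : R) ->
  a t @[t --> +oo] --> ainf ->
  normc (omega t - omegainf) @[t --> +oo] --> (0 : R) ->
  (forall t, 0 < t -> `|eulerD (eulerD a) t| <= C * (bracket (ln t)) ^- 2) ->
  (forall t, 0 < t ->
     normc (ceulerD (ceulerD omega) t) <= C * (bracket (ln t)) ^- 2) ->
  exists H : {linear L2_halfline R -> L2_halfline R},
    [/\ extends_weighted_hankel w b H,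
        bounded_operator (L2_halfline_dot R) H,
        selfadjoint (L2_halfline_dot R) H,
        essential_spectrum (L2_halfline_dot R) H =
          scaled_closed q0 pi_rho `|` scaled_closed qinf pi_rho &
        singular_continuous_spectrum (L2_halfline_dot R) H = set0 /\
        forall al be : R, al < be ->
          closure `]al, be[%classic `<=`
            (scaled_open q0 pi_rho `|` scaled_open qinf pi_rho)
              `\` [set q0 * pi_rho; qinf * pi_rho] ->
          [/\ singular_continuous_spectrum (L2_halfline_dot R) H
                `&` `]al, be[%classic = set0,
              finite_set [set l | (l \in `]al, be[) /\ is_eigenvalue H l] &
              forall l, l \in `]al, be[ -> is_eigenvalue H l ->
                finite_multiplicity H l]].
Proof.
move=> a omega q0 qinf pi_rho hrho Ca [Cr Ci] la0 lo0 lainf loinf ba bo.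
have beta0 : 0 < rho + 2^-1 by lra.
have [lr0 li0] := cvg_complex_parts _ lo0; have [lrinf liinf] := cvg_complex_parts _ loinf.
have [ea [M pa]] := profile_logvar Ca la0 lainf ba.
have [ef [Mf pf]] := profile_logvar Cr lr0 lrinf (fun t t0 => le_trans (normc_parts _).1 (bo t t0)).
have [eg [Mg pg]] := profile_logvar Ci li0 liinf (fun t t0 => le_trans (normc_parts _).2 (bo t t0)).
set fa := (fun s => a (expR s)) in ea pa; set ff := (fun s => Re (omega (expR s))) in ef pf.
set fg := (fun s => Im (omega (expR s))) in eg pg.
have n2 z : normc z ^+ 2 = Re z ^+ 2 + Im z ^+ 2.
  by case: z => x y ; rewrite sqr_sqrtr.
have pE : pi_rho = phi (rho + 2^-1) 0.
  have e2 : 2 * (rho + 2^-1) = 1 + 2 * rho by lra.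
  by rewrite (Gamma_beta beta0) e2.
have [B jB] := Hop_jet beta0 pa ea pf ef pg eg.
have sH := Hop_sym beta0 pa ea pf ef pg eg.
(* The conjugate family is the dilations on the line, the dense set is [lipschitz_orbit], and the
   list contains 0 and the two thresholds that a closed interval has to avoid. *)
have := @transport_spectrum R _ _ _ (@cL2_dot _ _ _ (@lebesgue_halfline R)) (@Jlog R) (@Jexp R)
  (lift_lin (tolog_op R)) (lift_lin (fromlog_op R)) (@JexpK R) (@JlogK R) (@hnorm_Jlog R)
  _ B _ _ (@lipschitz_orbit R) [:: 0; q0 * pi_rho; qinf * pi_rho] (scaled_closed q0 pi_rho `|` scaled_closed qinf pi_rho)
  (@cL2_complete _ _ _ _) (@dil_family R) jB sH (jet_sym jB sH).
case.
- exact: tent_dense (@lipschitz_orbit_subspace R) (@tent_orbit R).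
- by [].
- by move=> al be ab hX; apply: (Hop_mourre beta0 pa ea pf ef pg eg jB ab); rewrite -!n2 -pE.
- by rewrite /q0 /qinf !n2 pE; exact: (Hop_mourre_outside beta0 pa ea pf ef pg eg).
- move=> l e s; rewrite /q0 /qinf !n2 pE => hl e0.
  exact: (weyl_of_model beta0 s (@Hop_model R _ beta0 _ _ _ _ _ _ _ pa ea _ _ _ _ _ _ _ _ _ _ _ _ _ _ pf ef pg eg) hl e0).
move=> bT sT essT scT eigT.
pose H := conj_by (@Jlog R) (@Jexp R) (Hop (rho + 2^-1) fa ff fg).
have linH : linear H by exact: (conj_by_lin (lift_lin (tolog_op R)) (lift_lin (fromlog_op R)) (Hop_lin beta0 pa ea pf ef pg eg)).
pose HL : {linear L2_halfline R -> L2_halfline R} := HB.pack H (GRing.isLinear.Build _ _ _ _ H linH).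
exists HL; split=> //; first exact: conj_Hop_extends hrho pa ea pf ef pg eg.
split=> // al be ab hcl; rewrite scT set0I.
(* The eigenvalue statement concerns the closed interval, which the closure hypothesis covers: 0 is
   in no [scaled_open], and the thresholds are removed explicitly. *)
have avoid x : x \in [:: 0; q0 * pi_rho; qinf * pi_rho] -> ~ (al <= x <= be).
  move=> hx h; have /hcl[+ +] : closure `]al, be[%classic x by apply: itv_sub_closure => //=.
  move: hx; rewrite !inE => /or3P[] /eqP ->; [|by move=> _; case; left|by move=> _; case; right].
  by move=> [] /scaled_open0.
have [fin mult] := eigT _ _ (ltW ab) avoid.
split=> //.
- by apply: sub_finite_set fin => l  [+ hl]; rewrite in_itv => /andP[/ltW ? /ltW ?].
- by move=> l; rewrite in_itv => /andP[/ltW l1 /ltW l2] _; exact: mult.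
Qed.
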